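(* Suppose $\Omega\subset\mathbb{R}^d$ is convex and compact, the weighted graph $\mathcal{G}$ is connected and symmetric, and the interpolation function $\theta$ satisfies (A1)–(A7). Let $\lambda_{\mathrm{ref}}\in\mathcal{P}_2(\mathbb{R}^d\times\Delta^{n-1})$ be such that for every $\boldsymbol{\mu}\in\mathcal{P}_2(\mathbb{R}^d\times\mathcal{G})$ there exists a unique optimal transport plan $\Gamma_{\boldsymbol{\mu}}$ for $W_{\mathbb{R}^d\times\Delta^{n-1}}$ between $\lambda_{\mathrm{ref}}$ and the canonical lifting $\lambda_{\boldsymbol{\mu}}$, and this plan is induced by a map $T_{\boldsymbol{\mu}}:\mathbb{R}^d\times\Delta^{n-1}\to\mathbb{R}^d\times\Delta^{n-1}$, i.e. $\Gamma_{\boldsymbol{\mu}}=(\mathrm{Id}\times T_{\boldsymbol{\mu}})_\#\lambda_{\mathrm{ref}}$. Define $$d_{\mathrm{LOT}}(\boldsymbol{\mu},\boldsymbol{\nu}):=\Big(\int_{\mathbb{R}^d\times\Delta^{n-1}}\|T_{\boldsymbol{\mu}}(x,r)-T_{\boldsymbol{\nu}}(x,r)\|^2\,d\lambda_{\mathrm{ref}}(x,r)\Big)^{1/2},$$ where $\|\cdot\|$ is the Euclidean norm on $\mathbb{R}^d\times\mathbb{R}^{n-1}$. Then the metric $d_{\mathrm{LOT}}$ induces the same mode of convergence (of sequences) on $\mathcal{P}_2(\Omega\times\mathcal{G})$ as $W_{2,\mathcal{W}}$, $W_{\Omega\times\mathcal{G}}$ and $D_{\mathbb{R}^d\times\ma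thcal{G}}$.
   Context: Graph. $\mathcal{G}$ is a weighted graph with nodes $\{1,\dots,n\}$ and edge weights $q_{ij}\ge 0$. It is symmetric if $q_{ij}=q_{ji}$ and connected if any two nodes are joined by a finite sequence of edges with strictly positive weights. Interpolation function. Assumptions on $\theta:[0,\infty)\times[0,\infty)\to[0,\infty)$: (A1) $\theta$ is continuous on $[0,\infty)^2$ and $C^\infty$ on $(0,\infty)^2$; (A2) $\theta(t,s)=\theta(s,t)$; (A3) $\theta>0$ on $(0,\infty)^2$; (A4) $\theta(1,1)=1$; (A5) $\theta(r,t)\le\theta(s,t)$ for $t\ge0$, $0\le r\le s$; (A6) $\theta(\lambda t,\lambda s)=\lambda\theta(t,s)$ for $\lambda>0$, $t,s\ge0$; (A7) $\theta$ is concave. Vector valued measures. $\mathcal{M}(\Omega)$ denotes the finite (nonnegative) Borel measures on $\Omega$. $\mathcal{P}(\Omega\times\mathcal{G})$ is the set of $\boldsymbol{\mu}=[\mu_1,\dots,\mu_n]^t$ with $\mu_i\in\mathcal{M}(\Omega)$ and $\sum_i\mu_i(\Omega)=1$, with the topology of componentwise narrow convergence; $\bar\mu:=\sum_i\mu_i$. $\mathcal{P}_2(\Omega\times\mathcal{G})$ is the subset with $\int_\Omega|x|^2d\mu_i<\infty$ for all $i$ (same notation with $\Omega$ replaced by $\mathbb{R}^d$). Measures on $\Omega$ are regarded as measures on $\mathbb{R}^d$ by zero extension, so $\mathcal{P}(\Omega\times\mathcal{G})\subseteq\mathcal{P}(\mathbb{R}^d\times\mathcal{G})$. Vector valued continuity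 equation. $(\boldsymbol{\rho},\mathbf{u},\boldsymbol{v})$ is a solution on $[t_0,t_1]$ if: (i) $\boldsymbol{\rho}\in C([t_0,t_1];\mathcal{P}(\Omega\times\mathcal{G}))$; (ii) $\mathbf{u}=[u_i]_{i=1}^n:\mathbb{R}^d\times[t_0,t_1]\to(\mathbb{R}^d)^n$ is measurable with $\int_{t_0}^{t_1}\int_\Omega|u_{i,t}|\,d\rho_{i,t}\,dt<\infty$ for all $i$; (iii) $\boldsymbol{v}=[v_{ij}]:\mathbb{R}^d\times[t_0,t_1]\to\mathbb{R}^{n\times n}$ is measurable with $\int_{t_0}^{t_1}\int_\Omega|v_{ij,t}|\,\theta(\frac{d\rho_{i,t}}{d\bar\rho_t},\frac{d\rho_{j,t}}{d\bar\rho_t})\,d\bar\rho_t\,dt<\infty$ for all $i,j$; (iv) for all $\eta\in C_c^\infty(\mathbb{R}^d\times(t_0,t_1))$ and all $i$, $$\int_{t_0}^{t_1}\!\!\int\partial_t\eta\,d\rho_{i,t}dt=-\int_{t_0}^{t_1}\!\!\int\nabla\eta\cdot u_{i,t}\,d\rho_{i,t}dt-\frac12\sum_{j=1}^n\int_{t_0}^{t_1}\!\!\int\eta\,\theta\Big(\frac{d\rho_{i,t}}{d\bar\rho_t},\frac{d\rho_{j,t}}{d\bar\rho_t}\Big)(v_{ij,t}-v_{ji,t})q_{ij}\,d\bar\rho_t\,dt .$$ $\mathcal{C}(\boldsymbol{\mu},\boldsymbol{\nu})$ is the set of solutions on $[0,1]$ with $\boldsymbol{\rho}_0=\boldsymbol{\mu}$,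 $\boldsymbol{\rho}_1=\boldsymbol{\nu}$. Dynamic distance. $\|(\mathbf{u},\boldsymbol{v})\|^2_{\boldsymbol{\rho}}:=\sum_i\int_\Omega|u_i|^2d\rho_i+\frac12\sum_{i,j}\int_\Omega|v_{ij}|^2\theta(\frac{d\rho_i}{d\bar\rho},\frac{d\rho_j}{d\bar\rho})q_{ij}\,d\bar\rho$ and $W^2_{\Omega\times\mathcal{G}}(\boldsymbol{\mu},\boldsymbol{\nu}):=\inf\{\int_0^1\|(\mathbf{u}_t,\boldsymbol{v}_t)\|^2_{\boldsymbol{\rho}_t}dt:(\boldsymbol{\rho},\mathbf{u},\boldsymbol{v})\in\mathcal{C}(\boldsymbol{\mu},\boldsymbol{\nu})\}$. Graph Wasserstein metric. $\mathcal{P}(\mathcal{G})=\{p\in\mathbb{R}^n:p_i\ge0,\sum_ip_i=1\}$. A pair $(p,v)$ solves the graph continuity equation on $[0,1]$ if $p:[0,1]\to\mathcal{P}(\mathcal{G})$ is continuous, $v:[0,1]\to\mathbb{R}^{n\times n}$ is measurable, $t\mapsto\theta(p_{i,t},p_{j,t})v_{ij,t}$ is locally integrable on $(0,1)$ for all $i,j$, and $\partial_tp_i=\frac12\sum_j\theta(p_i,p_j)(v_{ij}-v_{ji})q_{ij}$ in the sense of distributions for all $i$. Then $W_\mathcal{G}^2(p_0,p_1)$ is the infimum of $\int_0^1\frac12\sum_{i,j}v_{ij,t}^2\theta(p_{i,t},p_{j,t})q_{ij}\,dt$ over all such $(p,v)$ with endpoints $p_0,p_1$. Lifted space. $\Delta^{n-1}=\{r\in\mathbb{R}^{n-1}:r_i\ge0,\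 \sum_{i}r_i\le1\}$, $\mathbf{p}(r)=[p_j(r)]_{j=1}^n:=[r_1,\dots,r_{n-1},1-\sum_{i=1}^{n-1}r_i]\in\mathcal{P}(\mathcal{G})$, $d_{\Delta^{n-1}}(r,\tilde r):=W_\mathcal{G}(\mathbf{p}(r),\mathbf{p}(\tilde r))$, and $d^2_{\mathbb{R}^d\times\Delta^{n-1}}((x,r),(\tilde x,\tilde r)):=|x-\tilde x|^2+d^2_{\Delta^{n-1}}(r,\tilde r)$. $W_{\mathbb{R}^d\times\Delta^{n-1}}$ is the 2-Wasserstein (Kantorovich) distance on probability measures on $\mathbb{R}^d\times\Delta^{n-1}$ with ground distance $d_{\mathbb{R}^d\times\Delta^{n-1}}$; $\mathcal{P}_2(\mathbb{R}^d\times\Delta^{n-1})$ is the set of probability measures with finite second moment. The projection $\mathfrak{P}:\mathcal{P}(\mathbb{R}^d\times\Delta^{n-1})\to\mathcal{P}(\mathbb{R}^d\times\mathcal{G})$ is given by $\int\eta\,d(\mathfrak{P}\lambda)_j=\int p_j(r)\eta(x)\,d\lambda(x,r)$ for all bounded continuous $\eta$, $j=1,\dots,n$. The canonical lifting of $\boldsymbol{\mu}$ is $\lambda_{\boldsymbol{\mu}}:=\sum_{j=1}^n\mu_j\otimes\delta_{e_j}$, where $e_j$ is the vertex of $\Delta^{n-1}$ for which $\mathbf{p}(e_j)$ is the unit mass at node $j$. Static quantities. $D_{\mathbb{R}^d\times\mathcal{G}}(\boldsymbol{\mu},\boldsymbol{\nu}):=\inf\{W_{\mathbb{R}^d\times\Delta^{n-1}}(\lambda_1,\lambda_2):\mathfrak{P}\lambda_1=\boldsymbol{\mu},\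 \mathfrak{P}\lambda_2=\boldsymbol{\nu}\}$ and $W_{2,\mathcal{W}}(\boldsymbol{\mu},\boldsymbol{\nu}):=W_{\mathbb{R}^d\times\Delta^{n-1}}(\lambda_{\boldsymbol{\mu}},\lambda_{\boldsymbol{\nu}})$. *)

(* Defs.v *)
From HB Require Import structures.
From mathcomp Require Import all_boot all_order all_algebra.
From mathcomp Require Import all_classical all_reals all_analysis.

Set Implicit Arguments.
Unset Strict Implicit.
Unset Printing Implicit Defensive.

Import Order.TTheory GRing.Theory Num.Theory.
Import numFieldNormedType.Exports.

Local Open Scope classical_set_scope.
Local Open Scope ring_scope.

(* The Borel sigma-algebra on matrices, hence on R^d = 'rV[R]_d. *)
HB.instance Definition _ (R : realType) (m n : nat) :=
  Measurable.copy 'M[R]_(m, n) (g_sigma_algebraType (@open 'M[R]_(m, n))).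

(* The norm of the library on matrices is the sup norm. *)
Definition sqnorm (R : realType) (d : nat) (x : 'rV[R]_d) : R :=
  \sum_(k < d) x 0 k ^+ 2.

Definition enorm (R : realType) (d : nat) (x : 'rV[R]_d) : R :=
  Num.sqrt (sqnorm x).

(* Bundled measures carry values on non-measurable sets too, so equality of
   measures is tested on measurable sets only. *)
Definition measure_eq d (T : measurableType d) (R : realType)
    (m1 m2 : set T -> \bar R) : Prop :=
  forall A, measurable A -> m1 A = m2 A.

Section finite_sum_of_measures.
Local Open Scope ereal_scope.
Context d (T : measurableType d) (R : realType) (n : nat).

Definition sum_measure (m : 'I_n -> {measure set T -> \bar R})
  (A : set T) : \bar R := \sum_(i < n) m i A.

Section measure.
Variable m : 'I_n -> {measure set T -> \bar R}.

Let sum_measure0 : sum_measure m set0 = 0.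
Proof. by rewrite /sum_measure big1. Qed.

Let sum_measure_ge0 A : 0 <= sum_measure m A.
Proof. exact: sume_ge0. Qed.

Let sum_measure_sigma_additive : semi_sigma_additive (sum_measure m).
Proof.
move=> F mF tF mUF; rewrite [X in _ --> X](_ : _ =
    lim ((fun n => \sum_(0 <= i < n) sum_measure m (F i)) @ \oo)).
  by apply: is_cvg_ereal_nneg_natsum => k _; exact: sume_ge0.
rewrite nneseries_sum//; apply: eq_bigr => /= i _.
exact: measure_semi_bigcup.
Qed.

HB.instance Definition _ := isMeasure.Build _ _ _ (sum_measure m)
  sum_measure0 sum_measure_ge0 sum_measure_sigma_additive.
End measure.

Section finite.
Variable m : 'I_n -> {finite_measure set T -> \bar R}.

Definition sum_finite_measure : set T -> \bar R := sum_measure m.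

HB.instance Definition _ := Measure.on sum_finite_measure.

Let sum_finite : fin_num_fun sum_finite_measure.
Proof. by move=> A mA; apply/sum_fin_numP => i _ _; exact: fin_num_measure. Qed.

HB.instance Definition _ :=
  @Measure_isFinite.Build _ _ _ sum_finite_measure sum_finite.
End finite.
End finite_sum_of_measures.

Section smooth_functions.
Context (R : realType) (V : normedModType R).

(* For U open: f is C^k on U iff its iterated directional derivatives up to
   order k exist and are continuous on U. *)
Fixpoint Ck_on (k : nat) (U : set V) (f : V -> R) : Prop :=
  {in U, continuous f} /\
  if k is k'.+1 then
    forall v : V, {in U, forall x, derivable f x v} /\ Ck_on k' U ('D_v f)
  else True.

Definition smooth_on (U : set V) (f : V -> R) : Prop := forall k, Ck_on k U f.

Definition test_function (U : set V) (f : V -> R) : Prop :=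
  [/\ smooth_on setT f, compact (closure [set x | f x != 0]) &
      closure [set x | f x != 0] `<=` U].
End smooth_functions.

Section graph.
Context (R : realType) (n : nat).

(* A weighted graph on the nodes 'I_n is the matrix q of its weights. *)
Definition symmetric_graph (q : 'M[R]_n) : Prop := forall i j, q i j = q j i.

Definition connected_graph (q : 'M[R]_n) : Prop :=
  forall i j, connect (fun a b => 0 < q a b) i j.
End graph.

(* theta is a total function of which only the values on [0, +oo)^2 matter. *)
Record interpolation_function (R : realType) (theta : R -> R -> R) : Prop := {
  theta_ge0 : forall s t : R, 0 <= s -> 0 <= t -> 0 <= theta s t ;
  theta_continuous :
    {within [set z : R * R | 0 <= z.1 /\ 0 <= z.2],
       continuous (fun z : R * R => theta z.1 z.2)} ;
  theta_smooth :
    smooth_on [set z : R^o * R^o | 0 < z.1 /\ 0 < z.2]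
      (fun z => theta z.1 z.2) ;
  theta_sym : forall s t : R, 0 <= s -> 0 <= t -> theta t s = theta s t ;
  theta_gt0 : forall s t : R, 0 < s -> 0 < t -> 0 < theta s t ;
  theta11 : theta 1 1 = 1 ;
  theta_mono : forall r s t : R, 0 <= t -> 0 <= r -> r <= s ->
    theta r t <= theta s t ;
  theta_homogeneous : forall a s t : R, 0 < a -> 0 <= s -> 0 <= t ->
    theta (a * t) (a * s) = a * theta t s ;
  theta_concave : forall a s t s' t' : R, 0 <= a -> a <= 1 ->
    0 <= s -> 0 <= t -> 0 <= s' -> 0 <= t' ->
    a * theta s t + (1 - a) * theta s' t' <=
    theta (a * s + (1 - a) * s') (a * t + (1 - a) * t')
}.

Section vector_valued_measures.
Context (R : realType) (d n : nat).

Definition vmeasure := 'I_n -> {finite_measure set 'rV[R]_d -> \bar R}.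

Definition vmeasure_eq (mu nu : vmeasure) : Prop :=
  forall i, measure_eq (mu i) (nu i).

Implicit Types (Omega : set 'rV[R]_d) (mu : vmeasure).
Local Open Scope ereal_scope.

(* P(Omega x G), a measure on Omega being its extension by zero to R^d. *)
Definition vprob Omega : set vmeasure :=
  [set mu | (forall i, mu i (~` Omega) = 0) /\ \sum_(i < n) mu i setT = 1].

Definition vprob2 Omega : set vmeasure :=
  [set mu | vprob Omega mu /\
    forall i, \int[mu i]_(x in Omega) (sqnorm x)%:E < +oo].

(* mu-bar *)
Definition total_measure mu : {finite_measure set 'rV[R]_d -> \bar R} :=
  sum_finite_measure mu.

(* d mu_i / d mu-bar, in its everywhere nonnegative version *)
Definition density mu (i : 'I_n) (x : 'rV[R]_d) : R :=
  fine (Radon_Nikodym_SigmaFinite.f (mu i) (total_measure mu) x).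

(* continuity on [t0, t1] for the topology of componentwise narrow
   convergence of measures on Omega *)
Definition narrowly_continuous Omega (t0 t1 : R) (rho : R -> vmeasure) : Prop :=
  forall (i : 'I_n) (f : 'rV[R]_d -> R),
    {within Omega, continuous f} -> bounded_fun (f \_ Omega)%R ->
    {within `[t0, t1],
       continuous (fun t => (\int[rho t i]_(x in Omega) f x)%R : R)}.
End vector_valued_measures.

Section dynamic_distance.
Context (R : realType) (d n : nat).
Variables (Omega : set 'rV[R]_d) (q : 'M[R]_n) (theta : R -> R -> R).
Local Notation leb := (@lebesgue_measure R).
Local Open Scope ereal_scope.

Definition theta_density (mu : vmeasure R d n) (i j : 'I_n) (x : 'rV[R]_d) : R :=
  theta (density mu i x) (density mu j x).

Definition dspace (eta : 'rV[R]_d * R -> R) (k : 'I_d) (z : 'rV[R]_d * R) : R :=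
  'D_(delta_mx 0%R k : 'rV[R]_d, 0%R : R) (eta : _ -> R^o) z.

Definition dtime (eta : 'rV[R]_d * R -> R) (z : 'rV[R]_d * R) : R :=
  'D_(0%R : 'rV[R]_d, 1%R : R) (eta : _ -> R^o) z.

Record continuity_equation (t0 t1 : R) (rho : R -> vmeasure R d n)
    (u : 'I_n -> 'rV[R]_d * R -> 'rV[R]_d)
    (v : 'I_n -> 'I_n -> 'rV[R]_d * R -> R) : Prop := {
  ce_prob : forall t : R, t \in `[t0, t1] -> vprob Omega (rho t) ;
  ce_continuous : narrowly_continuous Omega t0 t1 rho ;
  ce_u_measurable : forall i, measurable_fun (setT `*` `[t0, t1]) (u i) ;
  ce_u_integrable : forall i,
    \int[leb]_(t in `[t0, t1])
      \int[rho t i]_(x in Omega) (enorm (u i (x, t)))%:E < +oo ;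
  ce_v_measurable : forall i j, measurable_fun (setT `*` `[t0, t1]) (v i j) ;
  ce_v_integrable : forall i j,
    \int[leb]_(t in `[t0, t1]) \int[total_measure (rho t)]_(x in Omega)
      (`|v i j (x, t)| * theta_density (rho t) i j x)%:E < +oo ;
  ce_weak : forall (eta : 'rV[R]_d * R -> R) (i : 'I_n),
    @test_function R ('rV[R]_d * R^o)%type (setT `*` `]t0, t1[) eta ->
    \int[leb]_(t in `[t0, t1]) \int[rho t i]_x (dtime eta (x, t))%:E =
    - (\int[leb]_(t in `[t0, t1]) \int[rho t i]_x
        (\sum_(k < d) dspace eta k (x, t) * u i (x, t) 0%R k)%:E)
    - (2^-1)%:E * \sum_(j < n)
        \int[leb]_(t in `[t0, t1]) \int[total_measure (rho t)]_x
          (eta (x, t) * theta_density (rho t) i j x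
            * (v i j (x, t) - v j i (x, t)) * q i j)%:E
}.

Definition tangent_sqnorm (rho : vmeasure R d n)
    (u : 'I_n -> 'rV[R]_d -> 'rV[R]_d) (v : 'I_n -> 'I_n -> 'rV[R]_d -> R)
    : \bar R :=
  \sum_(i < n) \int[rho i]_(x in Omega) (sqnorm (u i x))%:E +
  (2^-1)%:E * \sum_(i < n) \sum_(j < n) \int[total_measure rho]_(x in Omega)
    (`|v i j x| ^+ 2 * theta_density rho i j x * q i j)%:E.

Definition W_dynamic (mu nu : vmeasure R d n) : \bar R :=
  sqrte (ereal_inf [set w | exists rho u v,
    [/\ continuity_equation 0%R 1%R rho u v,
        vmeasure_eq (rho 0%R) mu, vmeasure_eq (rho 1%R) nu &
        w = \int[leb]_(t in `[0%R, 1%R])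
              tangent_sqnorm (rho t) (fun i x => u i (x, t))
                             (fun i j x => v i j (x, t))]]).
End dynamic_distance.

Section graph_wasserstein.
Context (R : realType) (n : nat).
Variables (q : 'M[R]_n) (theta : R -> R -> R).
Local Notation leb := (@lebesgue_measure R).
Local Open Scope ereal_scope.

Definition graph_prob : set 'rV[R]_n :=
  [set p | (forall i, (0 <= p 0 i)%R) /\ (\sum_(i < n) p 0 i = 1)%R].

Record graph_continuity_equation (p : R -> 'rV[R]_n) (v : R -> 'M[R]_n)
    : Prop := {
  gce_prob : forall t : R, t \in `[0%R, 1%R] -> graph_prob (p t) ;
  gce_continuous : {within `[0%R, 1%R], continuous p} ;
  gce_measurable : measurable_fun (`[0%R, 1%R] : set R) v ;
  gce_integrable : forall i j, locally_integrable `]0%R, 1%R[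
    (fun t => theta (p t 0%R i) (p t 0%R j) * v t i j)%R ;
  gce_weak : forall (phi : R -> R) (i : 'I_n),
    @test_function R R^o `]0%R, 1%R[ phi ->
    \int[leb]_(t in `]0%R, 1%R[) (p t 0%R i * derive1 phi t)%:E =
    - ((2^-1)%:E * \sum_(j < n) \int[leb]_(t in `]0%R, 1%R[)
        (phi t * (theta (p t 0%R i) (p t 0%R j)
                    * (v t i j - v t j i) * q i j))%:E)
}.

Definition W_graph (p0 p1 : 'rV[R]_n) : \bar R :=
  sqrte (ereal_inf [set w | exists p v,
    [/\ graph_continuity_equation p v, p 0%R = p0, p 1%R = p1 &
        w = \int[leb]_(t in `[0%R, 1%R])
              (2^-1 * \sum_(i < n) \sum_(j < n)
                v t i j ^+ 2 * theta (p t 0%R i) (p t 0%R j) * q i j)%:E]]).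
End graph_wasserstein.

(* From here on the graph has n.+1 nodes, so that its simplex lives in R^n. *)
Section simplex.
Context (R : realType) (n : nat).

Definition simplex_set : set 'rV[R]_n :=
  [set r | (forall i, 0 <= r 0 i) /\ \sum_(i < n) r 0 i <= 1].

(* The vertex of node j : 'I_n.+1; the last node is sent to the origin. *)
Definition vertex_row (j : 'I_n.+1) : 'rV[R]_n :=
  \row_k (lift ord_max k == j)%:R.

Lemma vertex_rowP j : vertex_row j \in simplex_set.
Proof.
rewrite inE /=; split=> [i|]; first by rewrite mxE ler0n.
under eq_bigr do rewrite mxE.
case: (unliftP ord_max j) => [k ->|->].
  rewrite (bigD1 k)//= eqxx big1 ?addr0// => i /negPf ik.
  by rewrite (inj_eq lift_inj) ik.
by rewrite big1// => i _; rewrite eq_sym (negPf (neq_lift _ _)).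
Qed.

Definition simplex : Type := set_type simplex_set.

Definition vertex (j : 'I_n.+1) : simplex := SigSub (vertex_rowP j).

Definition coords (r : simplex) : 'rV[R]_n := @set_val _ simplex_set r.

HB.instance Definition _ := Topological.copy simplex (set_type simplex_set).
HB.instance Definition _ := isPointed.Build simplex (vertex ord_max).
HB.instance Definition _ :=
  Measurable.copy simplex (g_sigma_algebraType (@open simplex)).

(* The map p from the simplex to P(G); under lift ord_max the first n nodes
   keep their index. *)
Definition node_weights (r : simplex) : 'rV[R]_n.+1 :=
  \row_j if unlift ord_max j is Some k then coords r 0 k
         else 1 - \sum_(k < n) coords r 0 k.
End simplex.

Section lifted_space.
Context (R : realType) (d n : nat).

Definition lifted : Type := ('rV[R]_d * simplex R n)%type.
HB.instance Definition _ := Measurable.on lifted.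

Implicit Types lambda : {measure set lifted -> \bar R}.
Local Open Scope ereal_scope.

(* || z - z' ||^2 for the Euclidean norm on R^d x R^n *)
Definition lifted_sqdist (z z' : lifted) : R :=
  sqnorm (z.1 - z'.1)%R + sqnorm (coords z.2 - coords z'.2)%R.

Definition finite_second_moment lambda : Prop :=
  \int[lambda]_z (sqnorm z.1 + sqnorm (coords z.2))%:E < +oo.

(* P lambda = mu, for the projection P from the lifted space *)
Definition projects_to lambda (mu : vmeasure R d n.+1) : Prop :=
  forall (j : 'I_n.+1) (eta : 'rV[R]_d -> R),
    continuous eta -> bounded_fun eta ->
    \int[mu j]_x (eta x)%:E =
    \int[lambda]_z (node_weights z.2 0%R j * eta z.1)%:E.

Definition canonical_lifting (mu : vmeasure R d n.+1)
    : {measure set lifted -> \bar R} :=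
  sum_measure (fun j => (mu j \x \d_(vertex R j))).

Variables (q : 'M[R]_n.+1) (theta : R -> R -> R).

Definition ground_sqdist (z z' : lifted) : \bar R :=
  (sqnorm (z.1 - z'.1)%R)%:E +
  W_graph q theta (node_weights z.2) (node_weights z'.2) ^+ 2.

Definition coupling lambda1 lambda2 (Gamma : probability (lifted * lifted)%type R)
    : Prop :=
  measure_eq (pushforward Gamma fst) lambda1 /\
  measure_eq (pushforward Gamma snd) lambda2.

Definition transport_cost (Gamma : set (lifted * lifted) -> \bar R) : \bar R :=
  \int[Gamma]_z ground_sqdist z.1 z.2.

Definition W_lifted lambda1 lambda2 : \bar R :=
  sqrte (ereal_inf [set transport_cost Gamma |
                     Gamma in coupling lambda1 lambda2]).

Definition optimal_plan lambda1 lambda2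
    (Gamma : probability (lifted * lifted)%type R) : Prop :=
  coupling lambda1 lambda2 Gamma /\
  forall Gamma', coupling lambda1 lambda2 Gamma' ->
    transport_cost Gamma <= transport_cost Gamma'.

Definition D_static (mu nu : vmeasure R d n.+1) : \bar R :=
  ereal_inf [set w | exists lambda1 lambda2 : probability lifted R,
    [/\ projects_to lambda1 mu, projects_to lambda2 nu &
        w = W_lifted lambda1 lambda2]].

Definition W2W (mu nu : vmeasure R d n.+1) : \bar R :=
  W_lifted (canonical_lifting mu) (canonical_lifting nu).

(* T mu is a transport map inducing the plan Gamma_mu, the unique optimal plan
   from lambda_ref to the canonical lifting of mu. *)
Definition unique_optimal_maps (lambda_ref : probability lifted R)
    (T : vmeasure R d n.+1 -> lifted -> lifted) : Prop :=
  forall mu, vprob2 setT mu ->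
    exists Gamma : probability (lifted * lifted)%type R,
      [/\ optimal_plan lambda_ref (canonical_lifting mu) Gamma,
          forall Gamma', optimal_plan lambda_ref (canonical_lifting mu) Gamma' ->
            measure_eq Gamma' Gamma,
          measurable_fun setT (T mu) &
          measure_eq Gamma (pushforward lambda_ref (fun z => (z, T mu z)))].

Definition d_LOT (lambda_ref : probability lifted R)
    (T : vmeasure R d n.+1 -> lifted -> lifted) (mu nu : vmeasure R d n.+1)
    : \bar R :=
  sqrte (\int[lambda_ref]_z (lifted_sqdist (T mu z) (T nu z))%:E).
End lifted_space.

(* Main.v *)
(* All the distances are compared through the integrals of smooth hat functions
   forming partitions of unity, whose convergence is narrow convergence on the
   compact set [Omega].

   The plan [(T mu, T nu)] couples the canonical liftings, and the ground distance
   is bounded on the simplex, so [d_LOT] dominates [W2W], which dominates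
   [D_static].  Small plans, in the lifted space, and small curves, by Young's
   inequality in the two continuity equations, move the hat integrals little.
   Conversely a coupling of the canonical liftings yields a curve: mass switches
   nodes along a flow of the graph while resting in space, then moves on straight
   segments; the velocity of the curve is a conditional expectation, which does
   not increase the energy.

   It remains to go from narrow convergence to [d_LOT].  Along an ultrafilter the
   joint laws of the reference point and of [T (mu_ k)] have a limit, built by
   taking ultralimits of the conditional weights of dyadic cells.  Gluing
   competitors shows that the limit plan is optimal, hence by uniqueness it is
   carried by the graph of [T mu], and plans carried by graphs that converge to
   such a plan have maps converging in L^2. *)

Require Import Defs.
From HB Require Import structures.
From mathcomp Require Import all_boot all_order all_algebra.
From mathcomp Require Import all_classical all_reals all_analysis.
From mathcomp Require Import measurable_realfun ring lra.
Set Implicit Arguments.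
Unset Strict Implicit.
Unset Printing Implicit Defensive.
Import Order.TTheory GRing.Theory Num.Theory.
Import numFieldNormedType.Exports.
Local Open Scope classical_set_scope.
Local Open Scope ring_scope.

(** The ground cost contains [W_graph], an infimum over curves, whose joint measurability is never
    established, and the inner integrals of a curve need not be measurable in time. Such integrals
    are only compared by inequalities valid for arbitrary nonnegative functions. The exception are
    plans towards a canonical lifting: their targets are vertices, and the cost to a fixed vertex is
    measurable. An interpolation function may vanish on the boundary of the quadrant. The flows are
    therefore built so that the squared flux between two nodes is at most a constant times the
    smaller of their two masses, which theta dominates; all energy estimates rest on this. The
    reference measure lives on an unbounded space and the cost is merely measurable in the reference
    point, so narrow convergence of plans would not let the cost pass to the limit. The ultralimit
    is taken in a stronger sense: integrands need only be measurable in the reference point and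
    Lipschitz in the target. The targets stay in a cube, and the second moment of the reference
    measure gives domination. *)

Local Notation mble := (measurable_fun setT).

(** * Measurability of matrix-valued maps *)

Section matrix_measurability.
Context (R : realType) (m n : nat).

Lemma measurable_coord (i : 'I_m) (j : 'I_n) :
  mble (fun x : 'M[R]_(m, n) => x i j).
Proof.
apply: (measurability _ (RGenOpens.measurableE R)).
move=> _ [_ [a [b ->] <-]]; rewrite setTI; apply: sub_sigma_algebra.
by apply: open_comp; [move=> x _; exact: coord_continuous|exact: interval_open].
Qed.

(** An open set is the union of the countably many sup-norm balls inside it with rational centre and
    radius 1 / (k + 1), and the preimage of one such ball is a finite intersection of coordinate
    conditions. *)
Lemma measurable_fun_mx d (T : measurableType d) (D : set T)
    (f : T -> 'M[R]_(m, n)) :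
  measurable D -> (forall i j, measurable_fun D (fun x => f x i j)) ->
  measurable_fun D f.
Proof.
move=> mD mf.
apply: (@measurability _ _ T 'M[R]_(m, n) D f (@open 'M[R]_(m, n))) => //.
move=> _ [U oU <-].
pose bx (c : 'M[rat]_(m, n) * nat) : set 'M[R]_(m, n) :=
  ball (map_mx ratr c.1 : 'M[R]_(m, n)) c.2.+1%:R^-1.
have -> : D `&` f @^-1` U =
    \bigcup_(c in [set c | bx c `<=` U]) (D `&` f @^-1` (bx c)).
  apply/seteqP; split=> [x [Dx Ux]|x [c cU [Dx fx]]]; last first.
    by split=> //; exact: cU.
  have /nbhs_ballP[e /= e0 eU] : nbhs (f x) U by exact: open_nbhs_nbhs.
  have [k ke] : exists k : nat, k.+1%:R^-1 < e / 2.
    have [k _ hk] := near_infty_natSinv_lt (PosNum (divr_gt0 e0 (ltr0n R 2))).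
    by exists k; exact: (hk k (leqnn k)).
  have /choice[g hg] : forall ij : 'I_m * 'I_n, exists r : rat,
      ball (f x ij.1 ij.2) k.+1%:R^-1 (ratr r : R).
    move=> ij.
    have := @dense_rat R (ball (f x ij.1 ij.2) k.+1%:R^-1).
    move=> []; first by exists (f x ij.1 ij.2); exact: ballxx.
      exact: ball_open.
    by move=> y [hy [r _ rE]]; exists r; rewrite rE.
  exists (\matrix_(i, j) g (i, j), k); last first.
    split=> //; split=> // i j; rewrite !mxE.
    by apply: ball_sym; exact: (hg (i, j)).
  move=> y [_ hy]; apply: eU; split=> // i j.
  have := hy i j; rewrite !mxE => hy'.
  have := ball_triangle (hg (i, j)) hy'.
  by apply: le_ball => /=; rewrite [leRHS](splitr e) lerD// ltW.
rewrite bigcup_mkcond; apply: countable_bigcupT_measurable => [|c].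
  exact: countableP.
case: ifPn => // _.
have -> : D `&` f @^-1` bx c =
    D `&` \bigcap_(ij in [set: 'I_m * 'I_n])
      (D `&` (fun x => f x ij.1 ij.2) @^-1`
         (ball (ratr (c.1 ij.1 ij.2) : R) c.2.+1%:R^-1)).
    apply/seteqP; split=> x [Dx].
      by move=> [_ h]; split=> // -[i j] _ /=; split=> //; have := h i j; rewrite mxE.
    move=> h; split=> //; split=> // i j; rewrite mxE.
    by have [] := h (i, j) I.
  apply: measurableI => //; apply: fin_bigcap_measurable; first exact: finite_finset.
by move=> ij _; apply: mf => //; exact: measurable_ball.
Qed.

End matrix_measurability.

Lemma open_measurable_mx (R : realType) m n (A : set 'M[R]_(m, n)) :
  open A -> measurable A.
Proof. by move=> oA; exact: sub_sigma_algebra. Qed.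

Lemma closed_measurable_mx (R : realType) m n (A : set 'M[R]_(m, n)) :
  closed A -> measurable A.
Proof.
move=> cA; rewrite -[A]setCK; apply: measurableC.
by apply: open_measurable_mx; exact: closed_openC.
Qed.

Lemma continuous_measurable_mx (R : realType) m n (f : 'M[R]_(m, n) -> R) :
  continuous f -> mble f.
Proof.
move=> cf; apply: (measurability _ (RGenOpens.measurableE R)) => _ [_ [a [b ->] <-]].
rewrite setTI; apply: sub_sigma_algebra.
by apply: open_comp; [move=> x _; exact: cf|exact: interval_open].
Qed.

Import HBNNSimple.

(** * Integrals of nonnegative functions that need not be measurable *)

Section lower_integral.
Local Open Scope ereal_scope.
Context d (T : measurableType d) (R : realType).
Variable mu : {measure set T -> \bar R}.
Implicit Types f g h : T -> \bar R.

(* None of the integrands [f] below is assumed measurable: the integral of a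
   nonnegative function is the supremum over the simple functions below it. *)
Lemma integral_nonmeas_le f c :
  (forall x, 0 <= f x) ->
  (forall h : {nnsfun T >-> R}, (forall x, (h x)%:E <= f x) ->
     \int[mu]_x (h x)%:E <= c) ->
  \int[mu]_x f x <= c.
Proof.
move=> f0 hc; rewrite ge0_integralTE//; apply: ge_ereal_sup => _ [h hf <-].
by rewrite -integralT_nnsfun; exact: hc.
Qed.

Lemma le_integral_nonmeas f g : (forall x, 0 <= f x) ->
  (forall x, f x <= g x) -> \int[mu]_x f x <= \int[mu]_x g x.
Proof.
move=> f0 fg; apply: integral_nonmeas_le => // h hf.
rewrite integralT_nnsfun [leRHS]ge0_integralTE; last by move=> x; exact: le_trans (fg x).
by apply: ereal_sup_ubound; exists h => // x; exact: le_trans (fg x).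
Qed.

Lemma le_integral_nonmeas_in (D : set T) f g : (forall x, D x -> 0 <= f x) ->
  (forall x, D x -> f x <= g x) -> \int[mu]_(x in D) f x <= \int[mu]_(x in D) g x.
Proof.
move=> f0 fg; rewrite integral_mkcond [leRHS]integral_mkcond.
apply: le_integral_nonmeas => x; rewrite !patchE; case: ifPn => // /set_mem Dx.
  exact: f0.
exact: fg.
Qed.

(** A simple function below f is almost everywhere below g, and both of these are measurable; f
    itself enters only through such simple functions. *)
Lemma integral_nonmeas_ae_le (D : set T) f g : measurable D -> mu (~` D) = 0 ->
  (forall x, 0 <= f x) -> (forall x, 0 <= g x) -> mble g ->
  (forall x, D x -> f x <= g x) -> \int[mu]_x f x <= \int[mu]_x g x.
Proof.
move=> mD D0 f0 g0 mg fg; apply: integral_nonmeas_le => // h hf.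
apply: ae_ge0_le_integral => //.
- by move=> x _; rewrite lee_fin.
- exact/measurable_EFinP.
- exists (~` D); split=> //; first exact: measurableC.
  by move=> x /= hx Dx; apply: hx => _; exact: le_trans (fg _ Dx).
Qed.

Lemma integral_nonmeas_ae_eq (D : set T) f g : measurable D -> mu (~` D) = 0 ->
  (forall x, 0 <= f x) -> (forall x, 0 <= g x) -> mble g ->
  (forall x, D x -> f x = g x) -> \int[mu]_x f x = \int[mu]_x g x.
Proof.
move=> mD D0 f0 g0 mg fg; apply/eqP; rewrite eq_le; apply/andP; split.
  by apply: (integral_nonmeas_ae_le mD) => // x Dx; rewrite fg.
have -> : \int[mu]_x g x = \int[mu]_x (g \_ D) x.
  apply: ge0_ae_eq_integral => //.
  - by apply/(measurable_restrictT g mD)/measurable_funTS.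
  - by move=> x _; rewrite patchE; case: ifP.
  - exists (~` D); split=> //; first exact: measurableC.
    move=> x /= hx Dx; apply: hx => _; rewrite patchE mem_set//.
apply: le_integral_nonmeas => x; rewrite patchE; case: ifPn => // /set_mem Dx.
by rewrite fg.
Qed.

(** The lower integral is not additive, so a simple s below h is decomposed instead: s' = max (0, (s
    - g) / k) is measurable, lies below f, and satisfies s <= g + k s'. *)
Lemma integral_nonmeas_affine (g : T -> R) (k : R) f h : (0 < k)%R ->
  (forall x, (0 <= g x)%R) -> mble g ->
  (forall x, 0 <= f x) -> (forall x, 0 <= h x) ->
  (forall x, h x <= (g x)%:E + k%:E * f x) ->
  \int[mu]_x h x <= \int[mu]_x (g x)%:E + k%:E * \int[mu]_x f x.
Proof.
move=> k0 g0 mg f0 h0 hgf; apply: integral_nonmeas_le => // s sh.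
pose s' x := Num.max 0%R (k^-1 * (s x - g x))%R.
have ms' : mble s'.
  apply: measurable_maxr => //; apply: measurable_funM => //.
  exact: measurable_funB.
have s'0 x : (0 <= s' x)%R by rewrite /s' le_max lexx.
have ss' x : (s x <= g x + k * s' x)%R.
  rewrite -lerBlDl -ler_pdivrMl//; by rewrite /s' le_max lexx orbT.
have s'f x : (s' x)%:E <= f x.
  have := le_trans (sh x) (hgf x); have := f0 x.
  rewrite /s'; case: (f x) => [r|_ _|//]; last by rewrite leey.
  rewrite -EFinM -EFinD !lee_fin => r0 hr.
  by rewrite ge_max r0 ler_pdivrMl// lerBlDl.
apply: (@le_trans _ _ (\int[mu]_x ((g x)%:E + k%:E * (s' x)%:E))).
  by apply: le_integral_nonmeas => x; rewrite ?lee_fin.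
rewrite ge0_integralD//=; last 4 first.
- by move=> x _; rewrite lee_fin.
- exact/measurable_EFinP.
- by move=> x _; rewrite mule_ge0// lee_fin// ltW.
- by apply/measurable_EFinP/measurable_funM.
rewrite leeD2l// ge0_integralZl//; last 3 first.
- exact/measurable_EFinP.
- by move=> x _; rewrite lee_fin.
- by rewrite lee_fin ltW.
apply: lee_wpmul2l; first by rewrite lee_fin ltW.
by apply: le_integral_nonmeas => // x; rewrite lee_fin.
Qed.

(** The integral is the difference of the lower integrals of the positive and negative parts, both
    of which lie between 0 and the integral of h. *)
Lemma abse_integral_le (D : set T) f h :
  (forall x, D x -> `|f x| <= h x) ->
  `|\int[mu]_(x in D) f x| <= \int[mu]_(x in D) h x.
Proof.
move=> fh; rewrite integralE.
set a := \int[mu]_(x in D) _; set b := \int[mu]_(x in D) _.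
have a0 : 0 <= a by apply: integral_ge0 => x _; exact: funepos_ge0.
have b0 : 0 <= b by apply: integral_ge0 => x _; exact: funeneg_ge0.
have ah : a <= \int[mu]_(x in D) h x.
  apply: le_integral_nonmeas_in => x Dx; first exact: funepos_ge0.
  apply: le_trans (fh x Dx); rewrite funeposE; case: (leP (f x) 0) => h0.
    exact: abse_ge0.
  by rewrite gee0_abs// ltW.
have bh : b <= \int[mu]_(x in D) h x.
  apply: le_integral_nonmeas_in => x Dx; first exact: funeneg_ge0.
  apply: le_trans (fh x Dx); rewrite funenegE; case: (leP (- f x) 0) => h0.
    exact: abse_ge0.
  by rewrite lee0_abs// -oppe_ge0 ltW.
clearbody a b; move: a b (\int[mu]_(x in D) h x) a0 b0 ah bh => [a| |] [b| |] [c| |]//=;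
  rewrite ?lee_fin ?leey// => a0 b0 ac bc.
by rewrite ler_norml; apply/andP; split; lra.
Qed.

End lower_integral.

(** * Image of a measure with a density *)

Section weighted_pushforward.
Local Open Scope ereal_scope.
Context d d' (Z : measurableType d) (Y : measurableType d') (R : realType).
Variables (m : {measure set Z -> \bar R}) (w : Z -> R) (phi : Z -> Y).
Hypotheses (w0 : forall z, (0 <= w z)%R) (mw : mble w).
Hypothesis mphi : mble phi.

(** The hypotheses are arguments of the function, so that the measure structure declared below can
    be inferred from the term alone. *)
Definition wpush of (forall z, (0 <= w z)%R) & mble w &
    mble phi := fun A : set Y =>
  \int[m]_(z in phi @^-1` A) (w z)%:E.

Local Notation W := (wpush w0 mw mphi).

Let wpush_0 : W set0 = 0.
Proof. by rewrite /wpush preimage_set0 integral_set0. Qed.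

Let wpush_ge0 A : 0 <= W A.
Proof. by apply: integral_ge0 => x _; rewrite lee_fin. Qed.

Let wpush_sigma_additive : semi_sigma_additive W.
Proof.
move=> F mF tF mUF; rewrite /wpush preimage_bigcup ge0_integral_bigcup//.
- by apply: is_cvg_nneseries => k _ _; exact: wpush_ge0.
- by move=> k; rewrite -[X in measurable X]setTI; exact: mphi.
- by apply/measurable_EFinP/measurable_funTS.
- by move=> x _; rewrite lee_fin.
- by move=> i j _ _ [z [zi zj]]; apply: tF => //; exists (phi z).
Qed.

HB.instance Definition _ := isMeasure.Build _ _ _ W
  wpush_0 wpush_ge0 wpush_sigma_additive.

Lemma ge0_integral_wpush (f : Y -> \bar R) : mble f ->
  (forall y, 0 <= f y) ->
  \int[W]_y f y = \int[m]_z ((w z)%:E * f (phi z)).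
Proof.
move=> mf f0; pose h := nnsfun_approx measurableT mf.
have mwE : mble (EFin \o w) by exact/measurable_EFinP.
transitivity (lim (\int[W]_y (EFin \o h n) y @[n --> \oo])).
  have fE y : f y = lim ((EFin \o h n) y @[n --> \oo]).
    by apply/esym/cvg_lim => //; exact: cvg_nnsfun_approx.
  under eq_integral => y _ do rewrite fE.
  apply: monotone_convergence => //.
  - by move=> n; exact/measurable_EFinP.
  - by move=> n x Ex //=; rewrite lee_fin.
  - by move=> x Ex a b ab; rewrite lee_fin; exact/lefP/nd_nnsfun_approx.
transitivity (lim (\int[m]_z ((w z)%:E * (h n (phi z))%:E) @[n --> \oo])); last first.
  have fE z : (w z)%:E * f (phi z) = lim (((w z)%:E * (h n (phi z))%:E) @[n --> \oo]).
    apply/esym/cvg_lim => //; apply: cvgeZl => //.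
    exact: (@cvg_nnsfun_approx _ _ _ _ measurableT _ mf).
  under [RHS]eq_integral => z _ do rewrite fE.
  apply/esym; apply: monotone_convergence => //.
  - move=> n; apply: emeasurable_funM => //; apply/measurable_EFinP.
    exact: measurableT_comp.
  - by move=> n x Ex //=; rewrite -EFinM lee_fin mulr_ge0.
  - move=> x Ex a b ab; rewrite lee_fin ler_wpM2l//.
    exact/lefP/nd_nnsfun_approx.
congr (limn _); apply/funext => n.
rewrite integralT_nnsfun sintegralE.
under [RHS]eq_integral => z _.
  rewrite fimfunE -fsumEFin// ge0_mule_fsumr; last first.
    by move=> y; exact: nnfun_muleindic_ge0.
  over.
rewrite ge0_integral_fsum//; last 2 first.
- move=> y; apply: emeasurable_funM => //; apply/measurable_EFinP.
  apply: measurable_funM => //; apply: measurableT_comp => //.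
- move=> y z _; rewrite mule_ge0// ?lee_fin//.
  by have := nnfun_muleindic_ge0 (h n) y (phi z); rewrite -EFinM lee_fin.
apply: eq_fsbigr => y; rewrite inE => -[t _ <-].
under [RHS]eq_integral => z _ do rewrite EFinM muleCA.
rewrite ge0_integralZl//; last 3 first.
- apply: emeasurable_funM => //; apply/measurable_EFinP.
  by apply: measurableT_comp => //.
- by move=> z _; rewrite mule_ge0 ?lee_fin.
- by rewrite lee_fin.
congr (_ * _); rewrite /wpush [LHS]integral_mkcond; apply: eq_integral => z _.
rewrite patchE indicE; case: ifPn => hz.
  by rewrite mem_set ?mule1//; move/set_mem : hz.
rewrite [_ \in _](_ : _ = false) ?mule0//; apply/negbTE; move: hz.
by apply: contra => /set_mem hz; apply/mem_set.
Qed.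

Lemma wpushT : W setT = \int[m]_z (w z)%:E.
Proof. by rewrite /wpush preimage_setT. Qed.

Lemma integral_wpush (f : Y -> \bar R) : mble f ->
  \int[W]_y f y = \int[m]_z ((w z)%:E * f (phi z)).
Proof.
move=> mf; rewrite [LHS]integralE [RHS]integralE.
rewrite !ge0_integral_wpush//; last 2 first.
- exact: measurable_funeneg.
- exact: measurable_funepos.
congr (_ - _); apply: eq_integral => z _.
  by rewrite !funeposE maxe_pMr ?lee_fin// mule0.
by rewrite !funenegE maxe_pMr ?lee_fin// muleN mule0.
Qed.

End weighted_pushforward.

Section bundled_measures.
Context d (T : measurableType d) (R : realType).

Lemma mk_finite_measure (m : {measure set T -> \bar R}) : (m setT < +oo)%E ->
  exists M : {finite_measure set T -> \bar R}, forall A, M A = m A.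
Proof.
move=> mT; exists (mfrestr measurableT mT).
by move=> A /=; rewrite /mfrestr /mrestr setIT.
Qed.

(** Normalizing by the total mass, here 1, leaves all values unchanged and produces the bundled
    structure. *)
Lemma mk_probability (m : {measure set T -> \bar R}) : m setT = 1%E ->
  exists P : probability T R, forall A, P A = m A.
Proof.
move=> mT; exists (mnormalize m point).
by move=> A /=; rewrite /mnormalize mT/= onee_eq0/= invr1 mule1.
Qed.

Lemma ge0_integral_eq_measure (m1 m2 : {measure set T -> \bar R})
    (f : T -> \bar R) : measure_eq m1 m2 ->
  (\int[m1]_x f x = \int[m2]_x f x)%E.
Proof. by move=> m12; apply: eq_measure_integral => A mA _; exact: m12. Qed.

End bundled_measures.

Section sum_of_measures.
Local Open Scope ereal_scope.
Context d (T : measurableType d) (R : realType) (n : nat).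
Variable m : 'I_n -> {measure set T -> \bar R}.

Lemma ge0_integral_sum_measure (f : T -> \bar R) : mble f ->
  (forall x, 0 <= f x) ->
  \int[sum_measure m]_x f x = \sum_(i < n) \int[m i]_x f x.
Proof.
(* [msum] takes a sequence indexed by the natural numbers, so the family is continued by the zero
   measure. *)
move=> mf f0; pose m' (k : nat) : {measure set T -> \bar R} :=
  if insub k is Some i then m i else mzero.
transitivity (\int[msum m' n]_x f x).
  apply: eq_measure_integral => A _ _; apply: eq_bigr => i _.
  by rewrite /m' insubT//= => h; congr (m _ A); exact: val_inj.
rewrite ge0_integral_measure_sum//; apply: eq_bigr => i _; congr (integral _ _ _).
by rewrite /m' insubT//= => h; congr (m _); exact: val_inj.
Qed.

End sum_of_measures.

Section integral_real.
Local Open Scope ereal_scope.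
Context d (T : measurableType d) (R : realType).
Variable mu : {finite_measure set T -> \bar R}.

Lemma finite_bounded_integrable (f : T -> R) (M : R) : mble f ->
  (forall x, (`|f x| <= M)%R) -> mu.-integrable setT (EFin \o f).
Proof.
move=> mf fM; apply: measurable_bounded_integrable => //.
  by rewrite -ge0_fin_numE// fin_num_measure.
exists M; split; first by rewrite num_real.
by move=> N MN x _ /=; apply: le_trans (fM x) _; exact: ltW.
Qed.

End integral_real.

Lemma mble_preimage d1 d2 (X : measurableType d1) (Y : measurableType d2) (f : X -> Y) A :
  mble f -> measurable A -> measurable (f @^-1` A).
Proof. by move=> mf mA; rewrite -[X in measurable X]setTI; exact: mf. Qed.

(* Decomposes a function along arithmetic, pairs and compositions; the database
   holds the measurability of the named functions. *)
Create HintDb mble_db.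
#[local] Hint Resolve measurable_fst measurable_snd measurable_coord : mble_db.

Ltac mea_leaf := first [ assumption | exact: measurable_fst | exact: measurable_snd | solve [auto 2 with mble_db nocore] ].

Ltac mea := intros; cbv beta; first [ mea_leaf | lazymatch goal with
  | |- measurable_fun _ (fun x => x) => exact: measurable_id
  | |- measurable_fun _ (fun _ => ?c) => exact: measurable_cst
  | |- measurable_fun _ (EFin \o _) => apply/measurable_EFinP; mea
  | |- measurable_fun _ (fun x => EFin _) => apply/measurable_EFinP; mea
  | |- measurable_fun _ (fun x => GRing.add _ (GRing.opp _)) => apply: measurable_funB; mea
  | |- measurable_fun _ (fun x => GRing.add _ _) => apply: measurable_funD; mea
  | |- measurable_fun _ (fun x => GRing.mul _ _) => apply: measurable_funM; mea
  | |- measurable_fun _ (fun x => GRing.exp _ _) => apply: measurable_funX; mea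
  | |- measurable_fun _ (fun x => @bigop.body _ _ _ _ _) => apply: measurable_sum; mea
  | |- measurable_fun _ (fun x => (_, _)) => apply: measurable_fun_pair; mea
  | |- measurable_fun _ (indic _) => apply: measurable_indic; mea
  | |- measurable_fun _ (fun x => indic ?A (@?g x)) =>
      apply: (measurableT_comp (_ : measurable_fun setT (indic A))); [apply: measurable_indic; mea | mea]
  | |- measurable_fun _ (fun x => fun_of_matrix (@?g x) ?i ?j) =>
      apply: (measurableT_comp (measurable_coord i j)); mea
  | |- measurable_fun setT (fun x => ?f (@?g x)) =>
      apply: (@measurableT_comp _ _ _ _ _ _ f _ g); mea
  | |- measurable_fun setT (_ \o _) => apply: measurableT_comp; mea
  | |- measurable_fun setT _ => fail
  | |- measurable_fun _ _ => apply: measurable_funTS; mea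
  | |- measurable (_ @^-1` _) => apply: mble_preimage; mea
  | |- measurable (_ `&` _) => apply: measurableI; mea
  | |- measurable (_ `|` _) => apply: measurableU; mea
  | |- measurable (~` _) => apply: measurableC; mea
  end ].

Ltac nonneg := intros; cbv beta; first [ done | lazymatch goal with
  | |- is_true (Order.le _ (EFin _)) => rewrite lee_fin; nonneg
  | |- is_true (Order.le _ (integral _ _ _)) => apply: integral_ge0; nonneg
  | |- is_true (Order.le _ (bigop.body _ _ _)) => first [apply: sume_ge0 | apply: sumr_ge0]; nonneg
  | |- is_true (Order.le _ (GRing.mul _ _)) => apply: mulr_ge0; nonneg
  | |- is_true (Order.le _ (GRing.add _ _)) => apply: addr_ge0; nonneg
  | |- is_true (Order.le _ (GRing.exp _ _)) => first [exact: sqr_ge0 | apply: exprn_ge0; nonneg]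
  | |- is_true (Order.le _ (GRing.inv _)) => rewrite invr_ge0; nonneg
  | |- is_true (Order.le _ _) => first [ exact: ltW | solve [auto with mble_db] ]
  end ].

(** * Smooth functions *)

Section Ck_calculus.
Context (R : realType) (V : normedModType R).
Local Notation Ck k f := (@Ck_on R V k setT f).
Implicit Types f g : V -> R.

Lemma in_setT_continuous f : {in setT, continuous f} <-> continuous f.
Proof. by split=> cf x; [apply: cf; rewrite inE|move=> _; exact: cf]. Qed.

(** To gain one order it suffices to name the directional derivatives; the rules below are then
    inductions on k whose derivative formulas stay within the same class. *)
Lemma Ck_succ k f (df : V -> V -> R) : continuous f ->
  (forall x v, is_derive x v f (df v x)) -> (forall v, Ck k (df v)) ->
  Ck k.+1 f.
Proof.
move=> cf f' df'; split; first exact/in_setT_continuous.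
move=> v; split; first by move=> x _; exact: ex_derive.
have -> : 'D_v f = df v by apply/funext => x; exact: derive_val.
exact: df'.
Qed.

Lemma Ck_succE k f : Ck k.+1 f -> [/\ continuous f,
  forall x v, derivable f x v & forall v, Ck k ('D_v f)].
Proof.
move=> [/in_setT_continuous cf h]; split=> // [x v|v]; have [h1 h2] := h v => //.
by apply: h1; rewrite inE.
Qed.

Lemma Ck_pred k f : Ck k.+1 f -> Ck k f.
Proof.
elim: k f => [|k IH] f /Ck_succE[cf f' Cf]; first by split => //; exact/in_setT_continuous.
apply: (@Ck_succ _ _ (fun v => 'D_v f)) => [//|x v|v].
  exact/derivableP.
exact: IH.
Qed.

Lemma Ck_continuous k f : Ck k f -> continuous f.
Proof. by case: k => [|k] [/in_setT_continuous]. Qed.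

Lemma Ck_cst k (c : R) : Ck k (cst c).
Proof.
elim: k c => [|k IH] c; first by split=> //; apply/in_setT_continuous => x; exact: cvg_cst.
apply: (@Ck_succ _ _ (fun v => cst 0)) => // v.
exact: cvg_cst.
Qed.

Lemma Ck_add k f g : Ck k f -> Ck k g -> Ck k (f \+ g).
Proof.
elim: k f g => [|k IH] f g.
  move=> /Ck_continuous cf /Ck_continuous cg; split=> //; apply/in_setT_continuous => x.
  by apply: cvgD; [exact: cf|exact: cg].
move=> /Ck_succE[cf f' Cf] /Ck_succE[cg g' Cg].
apply: (@Ck_succ _ _ (fun v => 'D_v f \+ 'D_v g)) => [x|x v|v].
- by apply: cvgD; [exact: cf|exact: cg].
- by apply: is_deriveD; exact/derivableP.
- exact: IH.
Qed.

Lemma Ck_mul k f g : Ck k f -> Ck k g -> Ck k (f \* g).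
Proof.
elim: k f g => [|k IH] f g.
  move=> /Ck_continuous cf /Ck_continuous cg; split=> //; apply/in_setT_continuous => x.
  by apply: cvgM; [exact: cf|exact: cg].
move=> Sf Sg; have [cf f' Cf] := Ck_succE Sf; have [cg g' Cg] := Ck_succE Sg.
apply: (@Ck_succ _ _ (fun v => (f \* 'D_v g) \+ (g \* 'D_v f))) => [x|x v|v].
- by apply: cvgM; [exact: cf|exact: cg].
- by apply: is_deriveM; exact/derivableP.
- by apply: Ck_add; apply: IH => //; exact: Ck_pred.
Qed.

Lemma Ck_sub k f g : Ck k f -> Ck k g -> Ck k (f \- g).
Proof.
move=> Cf Cg; have -> : f \- g = f \+ (cst (-1) \* g).
  by apply/funext => x /=; rewrite mulN1r.
by apply: Ck_add => //; apply: Ck_mul => //; exact: Ck_cst.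
Qed.

Lemma Ck_inv k f : (forall x, f x != 0) -> Ck k f -> Ck k (fun x => (f x)^-1).
Proof.
move=> f0; elim: k => [|k IH].
  move=> /Ck_continuous cf; split=> //; apply/in_setT_continuous => x.
  by apply: cvgV; [exact: f0|exact: cf].
move=> Sf; have [cf f' Cf] := Ck_succE Sf.
pose J x := (f x)^-1.
apply: (@Ck_succ _ _ (fun v => cst (-1) \* ((J \* J) \* 'D_v f))) => [x|x v|v].
- by apply: cvgV; [exact: f0|exact: cf].
- apply: DeriveDef; first exact: derivableV.
  by rewrite deriveV// /J /= -exprVn expr2 mulN1r scaleNr.
- apply: Ck_mul; first exact: Ck_cst.
  by apply: Ck_mul => //; apply: Ck_mul; apply: IH; exact: Ck_pred.
Qed.

Lemma Ck_linear k (l : {linear V -> R^o}) : continuous (l : V -> R) -> Ck k l.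
Proof.
move=> cl; case: k => [|k]; first by split=> //; exact/in_setT_continuous.
apply: (@Ck_succ _ _ (fun v => cst (l v))) => // [x v|v]; last exact: Ck_cst.
have dl : differentiable (l : V -> R^o) x by exact: linear_differentiable.
apply: DeriveDef; first exact: diff_derivable.
by rewrite deriveE// diff_lin.
Qed.

Lemma Ck_prod k (I : Type) (r : seq I) (F : I -> V -> R) :
  (forall i, Ck k (F i)) -> Ck k (fun x => \prod_(i <- r) F i x).
Proof.
move=> CF; elim: r => [|i r IH].
  have -> : (fun x => \prod_(i <- [::]) F i x) = cst 1.
    by apply/funext => x; rewrite big_nil.
  exact: Ck_cst.
have -> : (fun x => \prod_(j <- i :: r) F j x) = F i \* (fun x => \prod_(j <- r) F j x).
  by apply/funext => x; rewrite big_cons.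
exact: Ck_mul.
Qed.

End Ck_calculus.

(** Restricted to the line h -> x + h v, this is the chain rule for functions of one real
    variable. *)
Lemma is_derive_comp1 (R : realType) (V : normedModType R) (g : R -> R)
    (f : V -> R) (x v : V) (a b : R) :
  is_derive (f x : R^o) 1 g a -> is_derive x v f b ->
  is_derive x v (g \o f) (a * b).
Proof.
move=> g' f'.
pose F (h : R) := f (h *: v + x).
have F0 : F 0 = f x by rewrite /F scale0r add0r.
have dF : is_derive (0 : R^o) 1 F b.
  have [df <-] := f'.
  have cvF : (fun h : R => h^-1 *: (F (h *: (1 : R^o) + 0) - F 0)) =
             (fun h : R => h^-1 *: ((f \o shift x) (h *: v) - f x)).
    by apply/funext => h; rewrite F0 /F /= addr0 /shift /= [h *: 1]mulr1.
  apply: DeriveDef.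
    by rewrite /derivable /= cvF.
  by rewrite /derive /= cvF.
rewrite -F0 in g'.
have [dGF GFE] := is_derive1_comp g' dF.
have E : (fun h : R => h^-1 *: (((g \o f) \o shift x) (h *: v) - (g \o f) x)) =
         (fun h : R => h^-1 *: ((g \o F) (h *: (1 : R^o) + 0) - (g \o F) 0)).
  by apply/funext => h; rewrite /= F0 /F /= addr0 /shift /= [h *: 1]mulr1.
apply: DeriveDef.
  by rewrite /derivable /= E.
by rewrite /derive /= E.
Qed.

Lemma Ck_comp (R : realType) (V : normedModType R) k (g : R -> R) (f : V -> R) :
  @Ck_on R R^o k setT g -> @Ck_on R V k setT f -> @Ck_on R V k setT (g \o f).
Proof.
elim: k g => [|k IH] g.
  move=> /Ck_continuous cg /Ck_continuous cf; split=> //; apply/in_setT_continuous => x.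
  by apply: continuous_comp; [exact: cf|exact: cg].
move=> /Ck_succE[cg g' Cg] Sf; have [cf f' Cf] := Ck_succE Sf.
apply: (@Ck_succ _ _ _ _ (fun v => (('D_1 (g : R^o -> R)) \o f) \* 'D_v f)) => [x|x v|v].
- by apply: continuous_comp; [exact: cf|exact: cg].
- by apply: is_derive_comp1; exact/derivableP.
- by apply: Ck_mul => //; apply: IH => //; exact: Ck_pred.
Qed.

Section flat_exponential.
Context (R : realType).
Implicit Types (t : R).

(** The case j = 0 is the classical flat function e^(-1/t); the powers of 1/t make the family closed
    under differentiation. *)
Definition flat_exp (j : nat) t : R :=
  if 0 < t then t^-1 ^+ j * expR (- t^-1) else 0.

Lemma flat_exp_ge0 j t : 0 <= flat_exp j t.
Proof.
by rewrite /flat_exp; case: ifPn => // t0; rewrite mulr_ge0 ?expR_ge0 ?exprn_ge0 ?invr_ge0 ?ltW.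
Qed.

Lemma flat_exp_gt0 t : 0 < t -> 0 < flat_exp 0 t.
Proof. by move=> t0; rewrite /flat_exp t0 expr0 mul1r expR_gt0. Qed.

Lemma flat_exp_le0 j t : t <= 0 -> flat_exp j t = 0.
Proof. by rewrite /flat_exp => t0; rewrite ltNge t0. Qed.

(** From e^u >= u^(j+2) / (j+2)! with u = 1/t. Being quadratic, the bound makes the difference
    quotient at 0 tend to 0. *)
Lemma flat_exp_bound j t : flat_exp j t <= (j.+2)`!%:R * t ^+ 2.
Proof.
rewrite /flat_exp; case: ifPn => [t0|_]; last by rewrite mulr_ge0// sqr_ge0.
set u := t^-1; have u0 : 0 < u by rewrite invr_gt0.
have uE : expR (- u) <= (j.+2)`!%:R / u ^+ j.+2.
  rewrite expRN -[leRHS]invrK lef_pV2 ?posrE ?expR_gt0 ?invr_gt0 ?divr_gt0 ?exprn_gt0//.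
  rewrite invf_div; apply: le_trans (expR_ge1Dxn j.+1 (ltW u0)).
  by rewrite lerDr.
apply: (le_trans (ler_wpM2l _ uE)); first by rewrite exprn_ge0// ltW.
have -> : u ^+ j * ((j.+2)`!%:R / u ^+ j.+2) = (j.+2)`!%:R * t ^+ 2; last by [].
have tn0 : t != 0 by rewrite gt_eqF.
by rewrite /u !exprVn invrK mulrCA -[j.+2]addn2 exprD mulKf ?expf_neq0.
Qed.

Lemma is_derive_flat_exp j t :
  is_derive (t : R^o) 1 (flat_exp j) (flat_exp j.+2 t - j%:R * flat_exp j.+1 t).
Proof.
have [t0|t0|->] := ltgtP t 0.
- rewrite !flat_exp_le0 ?(ltW t0)// mulr0 subr0.
  apply: (@near_eq_is_derive _ R^o R^o (cst 0)).
  by near=> s; rewrite /= flat_exp_le0// ltW//; near: s; exact: lt_nbhsl.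
- have tn0 : t != 0 by rewrite gt_eqF.
  have dI : is_derive (t : R^o) 1 (fun s : R => s^-1) (- t ^- 2 *: 1).
    exact: is_deriveV.
  have dX := is_deriveX j dI.
  have dN : is_derive (t : R^o) 1 (fun s : R => - s^-1) (- (- t ^- 2 *: 1)).
    exact: is_deriveN dI.
  have dE := @is_derive1_comp R expR _ t _ _ (is_derive_expR (- t^-1)) dN.
  have dM := is_deriveM dX dE.
  apply: (near_eq_is_derive _ (is_derive_eq dM _)).
    near=> s; rewrite /flat_exp; have -> : 0 < s by near: s; exact: lt_nbhsr.
    by rewrite [LHS]/GRing.mul/= exprfctE.
  rewrite /flat_exp t0 exprfctE /= /GRing.scale /= !mulr1 opprK.
  rewrite -!exprVn; move: (t^-1) (expR _) => u E.
  by case: j {dX dM} => [|j]; rewrite /= !exprS expr0; ring.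
- rewrite !flat_exp_le0// mulr0 subr0.
  have cv0 : (fun h : R => h^-1 *: ((flat_exp j \o shift (0 : R)) (h *: (1 : R^o))
       - flat_exp j 0)) @ 0^' --> (0 : R).
    apply/cvgrPdist_lt => e e0; near=> h.
    have h0 : h != 0 by near: h; exact: nbhs_dnbhs_neq.
    rewrite sub0r normrN [X in _ - X]flat_exp_le0// subr0 /= addr0 [h *: 1]mulr1.
    rewrite normrM normfV (ger0_norm (flat_exp_ge0 _ _)).
    have hp : 0 < `|h| by rewrite normr_gt0.
    rewrite mulrC ltr_pdivrMr//; apply: le_lt_trans (flat_exp_bound _ _) _.
    rewrite -real_normK ?num_real// expr2 mulrA ltr_pM2r//.
    rewrite -ltr_pdivlMl//.
    near: h; apply: dnbhs0_lt.
    by rewrite mulr_gt0// invr_gt0 ltr0n fact_gt0.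
  apply: DeriveDef; first by apply/cvg_ex; exists 0.
  exact/cvg_lim.
Unshelve. all: by end_near. Qed.

Lemma Ck_flat_exp k j : @Ck_on R R^o k setT (flat_exp j).
Proof.
have cj i : continuous (flat_exp i).
  move=> t; apply: (@differentiable_continuous _ R^o R^o); apply/derivable1_diffP.
  by have [] := is_derive_flat_exp i t.
elim: k j => [|k IH] j; first by split=> //; exact/(@in_setT_continuous R R^o).
apply: (@Ck_succ _ R^o _ _ (fun v => cst v \*
    (flat_exp j.+2 \- (cst j%:R \* flat_exp j.+1)))) => [//|x v|v].
  have [d dE] := is_derive_flat_exp j x.
  have df : differentiable (flat_exp j : R^o -> R^o) x by exact/derivable1_diffP.
  apply: DeriveDef; first exact: diff_derivable.
  rewrite deriveE//; have -> : v = v *: (1 : R^o) by rewrite /GRing.scale /= mulr1.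
  by rewrite linearZ -deriveE// dE /= /GRing.scale /= mulr1.
apply: Ck_mul; first exact: Ck_cst.
by apply: Ck_sub => //; apply: Ck_mul => //; exact: Ck_cst.
Qed.

End flat_exponential.

Section smooth_step.
Context (R : realType).
Implicit Types (s t : R).

Lemma Ck_affine k (a b : R) : @Ck_on R R^o k setT (fun t => a * t + b).
Proof.
have -> : (fun t => a * t + b) = (cst a \* id) \+ cst b by [].
apply: Ck_add; last exact: Ck_cst.
apply: Ck_mul; first exact: Ck_cst.
by apply: (@Ck_linear _ R^o _ idfun) => x; exact: cvg_id.
Qed.

Definition smooth_step t : R :=
  flat_exp 0 t / (flat_exp 0 t + flat_exp 0 (1 - t)).

Let den_gt0 t : 0 < flat_exp 0 t + flat_exp 0 (1 - t).
Proof.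
have [t0|t0] := ltP 0 t; first by rewrite ltr_pwDl ?flat_exp_gt0 ?flat_exp_ge0.
by rewrite ltr_wpDl ?flat_exp_ge0 ?flat_exp_gt0// subr_gt0 (le_lt_trans t0).
Qed.

Lemma Ck_smooth_step k : @Ck_on R R^o k setT smooth_step.
Proof.
have C1 : @Ck_on R R^o k setT (fun t => flat_exp 0 (1 - t)).
  have -> : (fun t => flat_exp 0 (1 - t)) = flat_exp 0 \o (fun t => (-1) * t + 1).
    by apply/funext => t /=; rewrite mulN1r addrC.
  by apply: Ck_comp; [exact: Ck_flat_exp|exact: Ck_affine].
apply: Ck_mul; first exact: Ck_flat_exp.
apply: Ck_inv => [t|]; first by rewrite gt_eqF.
by apply: Ck_add => //; exact: Ck_flat_exp.
Qed.

Lemma smooth_step0 t : t <= 0 -> smooth_step t = 0.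
Proof. by move=> t0; rewrite /smooth_step flat_exp_le0// mul0r. Qed.

Lemma smooth_step1 t : 1 <= t -> smooth_step t = 1.
Proof.
move=> t1; rewrite /smooth_step [flat_exp 0 (1 - t)]flat_exp_le0 ?subr_le0//.
by rewrite addr0 divff// gt_eqF// flat_exp_gt0// (lt_le_trans _ t1).
Qed.

Lemma smooth_step_ge0 t : 0 <= smooth_step t.
Proof. by rewrite divr_ge0 ?flat_exp_ge0// ltW. Qed.

Lemma smooth_step_le1 t : smooth_step t <= 1.
Proof. by rewrite ler_pdivrMr// mul1r lerDl flat_exp_ge0. Qed.

(** The derivative is continuous, hence bounded on [0, 1], and the step is constant on either
    side. *)
Lemma smooth_step_derive_bound : exists2 L, 0 < L &
  forall t, is_derive (t : R^o) 1 smooth_step ('D_1 (smooth_step : R^o -> R^o) t) /\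
    `|'D_1 (smooth_step : R^o -> R^o) t| <= L.
Proof.
have /Ck_succE[_ dS CS] := Ck_smooth_step 1.
pose D := 'D_1 (smooth_step : R^o -> R^o).
have cD : continuous D by exact: (Ck_continuous (CS 1)).
have cnD : {within `[0, 1], continuous (fun t => `|D t|)}.
  by apply: continuous_subspaceT => t; apply: cvg_norm; exact: cD.
have [c _ cmax] := EVT_max (@ler01 R) cnD.
exists (`|D c| + 1) => [|t]; first by rewrite ltr_wpDl.
split; first by apply/derivableP; exact: dS.
rewrite -/D; have [t0|t0] := ltP t 0.
  rewrite /D (near_eq_derive (g := cst (0 : R^o))) ?derive_cst ?normr0//.
  near=> s; rewrite smooth_step0// ltW//; near: s; exact: lt_nbhsl.
have [t1|t1] := ltP 1 t.
  rewrite /D (near_eq_derive (g := cst (1 : R^o))) ?derive_cst ?normr0//.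
  near=> s; rewrite smooth_step1// ltW//; near: s; exact: lt_nbhsr.
by rewrite ler_wpDr//; apply: cmax; rewrite in_itv/= t0 t1.
Unshelve. all: by end_near. Qed.

Lemma smooth_step_lipschitz : exists2 L, 0 < L &
  forall s t, `|smooth_step s - smooth_step t| <= L * `|s - t|.
Proof.
have [L L0 hL] := smooth_step_derive_bound; exists L => //.
have h s t : s <= t -> `|smooth_step t - smooth_step s| <= L * `|t - s|.
  move=> st; have [||c _ ->] := @MVT_segment R smooth_step ('D_1 (smooth_step : R^o -> R^o)) s t st.
  - by move=> x _; exact: (hL x).1.
  - apply: continuous_subspaceT; exact: (Ck_continuous (Ck_smooth_step 0)).
  - by rewrite normrM ler_wpM2r// (hL c).2.
move=> s t; have [st|st] := leP s t; last exact/h/ltW.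
by rewrite distrC [`|s - t|]distrC h.
Qed.

(* differences of consecutive translates of the step: a partition of unity *)
Definition smooth_hat t : R := smooth_step (t + 1) - smooth_step t.

Lemma Ck_smooth_hat k : @Ck_on R R^o k setT smooth_hat.
Proof.
apply: Ck_sub; last exact: Ck_smooth_step.
have -> : (fun t => smooth_step (t + 1)) = smooth_step \o (fun t => 1 * t + 1).
  by apply/funext => t /=; rewrite mul1r.
by apply: Ck_comp; [exact: Ck_smooth_step|exact: Ck_affine].
Qed.

Lemma smooth_hat_ge0 t : 0 <= smooth_hat t.
Proof.
rewrite /smooth_hat; have [t0|t0] := leP t 0.
  by rewrite [smooth_step t]smooth_step0// subr0 smooth_step_ge0.
by rewrite [smooth_step (t + 1)]smooth_step1 ?subr_ge0 ?smooth_step_le1// lerDr ltW.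
Qed.

Lemma smooth_hat_le1 t : smooth_hat t <= 1.
Proof.
by rewrite lerBlDr (le_trans (smooth_step_le1 _))// lerDl smooth_step_ge0.
Qed.

Lemma smooth_hat_supp t : smooth_hat t != 0 -> `|t| < 1.
Proof.
apply: contraNT; rewrite -leNgt ler_normr => /orP[t1|t1].
  by rewrite /smooth_hat !smooth_step1 ?subrr// (le_trans t1)// lerDl ler01.
by rewrite /smooth_hat !smooth_step0//; lra.
Qed.

(** The sum telescopes to [smooth_step (t + 1) - smooth_step (t - K%:R)], which is 1 - 0 for t in
    this range. *)
Lemma smooth_hat_sum (K : nat) t : 0 <= t -> t <= K%:R ->
  \sum_(a < K.+1) smooth_hat (t - a%:R) = 1.
Proof.
move=> t0 tK.
have -> : \sum_(a < K.+1) smooth_hat (t - a%:R) =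
    \sum_(0 <= a < K.+1) (smooth_step (t - a%:R + 1) - smooth_step (t - a.+1%:R + 1)).
  rewrite big_mkord; apply: eq_bigr => a _; rewrite /smooth_hat -natr1.
  by congr (_ - smooth_step _); ring.
have -> : \sum_(0 <= a < K.+1) (smooth_step (t - a%:R + 1) - smooth_step (t - a.+1%:R + 1))
  = - \sum_(0 <= a < K.+1) (smooth_step (t - a.+1%:R + 1) - smooth_step (t - a%:R + 1)).
  by rewrite -sumrN; apply: eq_bigr => a _; rewrite opprB.
rewrite telescope_sumr// opprB smooth_step1; last by rewrite subr0 lerDr.
by rewrite smooth_step0 ?subr0// -natr1; lra.
Qed.

Lemma smooth_hat_lipschitz : exists2 L, 0 < L &
  forall s t, `|smooth_hat s - smooth_hat t| <= L * `|s - t|.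
Proof.
have [L L0 hL] := smooth_step_lipschitz; exists (L + L) => [|s t].
  by rewrite addr_gt0.
have h1 := hL (s + 1) (t + 1).
rewrite (_ : s + 1 - (t + 1) = s - t) in h1; last by ring.
rewrite /smooth_hat (_ : _ - _ - _ = (smooth_step (s + 1) - smooth_step (t + 1))
  - (smooth_step s - smooth_step t)); last by ring.
by rewrite mulrDl (le_trans (ler_normB _ _))// lerD.
Qed.

End smooth_step.

(** * Calculus on the unit interval and cutoffs in time *)

Section unit_interval_calculus.
Context (R : realType).
Local Notation leb := (@lebesgue_measure R).

Lemma within_continuousM (T : topologicalType) (A : set T) (f g : T -> R) :
  {within A, continuous f} -> {within A, continuous g} ->
  {within A, continuous (fun x => f x * g x)}.
Proof. by move=> cf cg x; apply: cvgM; [exact: cf|exact: cg]. Qed.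

Lemma FTC_is_derive (F f : R -> R) (a b : R) : a < b ->
  (forall t, is_derive (t : R^o) 1 F (f t)) -> {within `[a, b], continuous f} ->
  (\int[leb]_(x in `[a, b]) (f x)%:E = (F b)%:E - (F a)%:E)%E.
Proof.
move=> ab dF cf.
have cF : continuous F.
  move=> t; apply: (@differentiable_continuous _ R^o R^o); apply/derivable1_diffP.
  by have [] := dF t.
apply: continuous_FTC2 => //.
- split; first by move=> x _.
  + by apply: cvg_at_right_filter; exact: cF.
  + by apply: cvg_at_left_filter; exact: cF.
- by move=> x _; rewrite derive1E; have [_ ->] := dF x.
Qed.

Lemma is_derive_affine (a b t : R) : is_derive (t : R^o) 1 (fun t => a * t + b) a.
Proof.
have h := is_deriveD (is_deriveM (is_derive_cst (a : R^o) (t : R^o) 1)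
  (is_derive_id (t : R^o) 1)) (is_derive_cst (b : R^o) (t : R^o) 1).
apply: (is_derive_eq (f := fun t : R^o => a * t + b) h).
by rewrite /GRing.scale/= mulr0 !addr0 mulr1.
Qed.

Lemma lebesgue_itv01 : (leb `[0%R, 1%R]%classic = 1)%E.
Proof. by rewrite lebesgue_measure_itv/= lte_fin ltr01 sube0. Qed.

Lemma itv01_integrable (f : R -> R) (a b : R) : {within `[a, b], continuous f} ->
  leb.-integrable `[a, b] (EFin \o f).
Proof. by move=> cf; apply: continuous_compact_integrable => //; exact: segment_compact. Qed.

End unit_interval_calculus.

Section cutoff.
Context (R : realType).
Local Notation leb := (@lebesgue_measure R).
Implicit Types (e t : R).

(** The first factor rises from 0 to 1 on [e, 2 e], the second falls from 1 to 0 on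
    [1 - 2 e, 1 - e]. *)
Definition cutoff e t : R :=
  smooth_step (e^-1 * t + -1) * smooth_step ((- e^-1) * t + (e^-1 - 1)).

Lemma Ck_cutoff k e : @Ck_on R R^o k setT (cutoff e).
Proof.
apply: Ck_mul.
  exact: (@Ck_comp R R^o k _ _ (Ck_smooth_step R k) (Ck_affine k e^-1 (-1))).
exact: (@Ck_comp R R^o k _ _ (Ck_smooth_step R k) (Ck_affine k (- e^-1) (e^-1 - 1))).
Qed.

Lemma cutoff_ge0 e t : 0 <= cutoff e t.
Proof. by rewrite mulr_ge0 ?smooth_step_ge0. Qed.

Lemma cutoff_le1 e t : cutoff e t <= 1.
Proof.
by rewrite -[leRHS]mulr1 ler_pM ?smooth_step_ge0 ?smooth_step_le1.
Qed.

Lemma cutoff_supp e t : 0 < e -> cutoff e t != 0 -> e < t < 1 - e.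
Proof.
move=> e0; apply: contraNT; rewrite negb_and -!leNgt => /orP[te|te].
  rewrite /cutoff smooth_step0 ?mul0r// -lerBrDr opprK add0r mulrC ler_pdivrMr// mul1r//.
rewrite /cutoff [X in _ * X]smooth_step0 ?mulr0//.
have -> : - e^-1 * t + (e^-1 - 1) = (1 - e - t) / e by field; rewrite gt_eqF.
by rewrite pmulr_lle0 ?invr_gt0// subr_le0.
Qed.

Lemma cutoff_one e t : 0 < e -> 2 * e <= t -> t <= 1 - 2 * e -> cutoff e t = 1.
Proof.
move=> e0 h1 h2; rewrite /cutoff !smooth_step1 ?mulr1//.
  have -> : - e^-1 * t + (e^-1 - 1) = (1 - e - t) / e by field; rewrite gt_eqF.
  by rewrite ler_pdivlMr// mul1r; lra.
have -> : e^-1 * t + -1 = (t - e) / e by field; rewrite gt_eqF.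
by rewrite ler_pdivlMr// mul1r; lra.
Qed.

Lemma test_function_cutoff e : 0 < e -> @test_function R R^o `]0, 1[ (cutoff e).
Proof.
move=> e0.
have sub : closure [set t | cutoff e t != 0] `<=` `[e, 1 - e].
  have /closure_id -> : closed `[e, 1 - e]%classic by exact: interval_closed.
  apply: closure_subset => t /= /(cutoff_supp e0) /andP[h1 h2].
  by rewrite in_itv/= !ltW.
split=> [k||]; first exact: Ck_cutoff.
- apply: subclosed_compact sub; first exact: closed_closure.
  exact: segment_compact.
- move=> t /sub /=; rewrite !in_itv/= => /andP[h1 h2].
  by rewrite (lt_le_trans e0 h1)/= (le_lt_trans h2)// gtrBl.
Qed.

Lemma is_derive_cutoff e t : is_derive (t : R^o) 1 (cutoff e) (derive1 (cutoff e) t).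
Proof.
rewrite derive1E; apply/derivableP.
by have /Ck_succE[_ + _] := Ck_cutoff 1 e; exact.
Qed.

Lemma cutoff_derive_continuous e : continuous (derive1 (cutoff e)).
Proof.
have /Ck_succE[_ _ CD] := Ck_cutoff 1 e.
rewrite (_ : derive1 (cutoff e) = 'D_1 (cutoff e : R^o -> R^o)).
  exact: Ck_continuous (CD 1).
by apply/funext => t; rewrite derive1E.
Qed.

Lemma cutoff_derive_bound : exists2 L, 0 < L & forall e t, 0 < e ->
  `|derive1 (cutoff e) t| <= L / e.
Proof.
have [L L0 hL] := smooth_step_derive_bound R; exists (L + L) => [|e t e0].
  by rewrite addr_gt0.
pose D := 'D_1 (@smooth_step R : R^o -> R^o).
have d1 := @is_derive1_comp R (@smooth_step R) _ t _ _ (hL (e^-1 * t + -1)).1 (is_derive_affine e^-1 (-1) t).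
have d2 := @is_derive1_comp R (@smooth_step R) _ t _ _
  (hL (- e^-1 * t + (e^-1 - 1))).1 (is_derive_affine (- e^-1) (e^-1 - 1) t).
have d3 := is_deriveM d1 d2.
rewrite derive1E (_ : cutoff e = (@smooth_step R \o (fun t => e^-1 * t + -1)) *
  (@smooth_step R \o (fun t => - e^-1 * t + (e^-1 - 1)))); last by [].
have [_ ->] := d3; rewrite /GRing.scale /=.
have ei0 : 0 < e^-1 by rewrite invr_gt0.
apply: (le_trans (ler_normD _ _)); rewrite !(normrM (smooth_step _) _).
have hD s : `|D s| <= L := (hL s).2.
rewrite -/D !(normrM (D _)) normrN (gtr0_norm ei0).
rewrite !(ger0_norm (smooth_step_ge0 _)) mulrDl; apply: lerD.
- rewrite -[leRHS]mul1r; apply: ler_pM; rewrite ?smooth_step_ge0 ?smooth_step_le1//.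
    by rewrite mulr_ge0 ?(ltW ei0).
  by rewrite ler_wpM2r ?(ltW ei0)// hD.
- rewrite -[leRHS]mul1r; apply: ler_pM; rewrite ?smooth_step_ge0 ?smooth_step_le1//.
    by rewrite mulr_ge0 ?(ltW ei0).
  by rewrite ler_wpM2r ?(ltW ei0)// hD.
Qed.

Lemma cutoff_derive_out e t : 0 < e -> e < 4^-1 -> 2 * e < t -> t < 1 - 2 * e ->
  derive1 (cutoff e) t = 0.
Proof.
move=> e0 e4 h1 h2; rewrite derive1E (near_eq_derive (g := cst (1 : R^o))) ?derive_cst//.
near=> s; apply: cutoff_one => //; apply: ltW; near: s.
  exact: lt_nbhsr.
exact: lt_nbhsl.
Unshelve. all: by end_near. Qed.

(* Integrating by parts against the affine function [l] with the same endpoint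
   values as [m] leaves [m - l], which is small where the cutoff varies. *)
Lemma endpoint_difference_le (m : R -> R) (kappa : R) :
  {within `[0, 1], continuous m} ->
  (forall e, 0 < e -> e < 4^-1 ->
    (`|\int[leb]_(t in `[0%R, 1%R]) (m t * derive1 (cutoff e) t)%:E| <= kappa%:E)%E) ->
  `|m 1 - m 0| <= kappa.
Proof.
move=> cm hk; apply/ler_addgt0Pr => r r0.
have [L L0 hL] := cutoff_derive_bound.
pose M : R := `|m 1 - m 0|.
(* The derivative of the cutoff is at most L / e and lives on a set of measure at most 4 e, so a
   factor bounded by [dl] contributes at most 4 L dl, which is below r / 2. *)
pose dl := r / (8 * L + 1) / 2.
have L8 : 0 < 8 * L + 1 by rewrite ltr_wpDl// mulr_ge0// ltW.
have dl0 : 0 < dl by rewrite !divr_gt0.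
pose l (t : R) := (m 1 - m 0) * t + m 0.
have cl : continuous l.
  by move=> t; apply: cvgD; [apply: cvgM; [exact: cvg_cst|exact: cvg_id]|exact: cvg_cst].
pose g t := m t - l t.
have cg : {within `[0, 1], continuous g}.
  move=> x; apply: cvgB; first exact: cm.
  by apply: (continuous_subspaceT cl).
have g0 : g 0 = 0 by rewrite /g /l mulr0 add0r subrr.
have g1 : g 1 = 0 by rewrite /g /l; ring.
have [_ gr gl] := (continuous_within_itvP g (@ltr01 R)).1 cg.
have [e1 e10 he1] : exists2 e1, 0 < e1 & forall t, 0 <= t -> t < e1 -> `|g t| <= dl.
  move/cvgrPdist_le : gr => /(_ _ dl0) [e1 /= e10 he1]; exists e1 => // t t0 te.
  move: t0; rewrite le_eqVlt => /orP[/eqP <-|t0]; first by rewrite g0 normr0 ltW.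
  have := he1 t; rewrite g0 sub0r normrN; apply=> //.
  by rewrite /= sub0r normrN gtr0_norm.
have [e2 e20 he2] : exists2 e2, 0 < e2 & forall t, t <= 1 -> 1 - t < e2 -> `|g t| <= dl.
  move/cvgrPdist_le : gl => /(_ _ dl0) [e2 /= e20 he2]; exists e2 => // t t1 te.
  move: t1; rewrite le_eqVlt => /orP[/eqP ->|t1]; first by rewrite g1 normr0 ltW.
  have := he2 t; rewrite g1 sub0r normrN; apply=> //.
  by rewrite /= gtr0_norm// subr_gt0.
(* With e at most e1 / 4 and e2 / 4, the difference g is at most [dl] on the transition zones
   [0, 2 e] and [1 - 2 e, 1]; the last bound makes |m 1 - m 0| * 4 e at most r / 2. *)
pose e := Num.min (Num.min (e1 / 4) (e2 / 4)) (Num.min 8^-1 (r / (M + 1) / 8)).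
have M1 : 0 < M + 1 by rewrite ltr_wpDl// normr_ge0.
have e0 : 0 < e.
  by rewrite /e !lt_min; do 2![apply/andP; split]; rewrite// !divr_gt0.
have [ee1 ee2 ee3 ee4] : [/\ e <= e1 / 4, e <= e2 / 4, e <= 8^-1 & e <= r / (M + 1) / 8].
  by rewrite !ge_min !lexx !orbT.
have {ee3} e4 : e < 4^-1 by lra.
clearbody e.
have := hk e e0 e4.
set phi := cutoff e; set dphi := derive1 phi.
have cphi : {within `[0, 1], continuous phi}.
  by apply: continuous_subspaceT; exact: (Ck_continuous (Ck_cutoff 0 e)).
have cdphi : {within `[0, 1], continuous dphi}.
  by apply: continuous_subspaceT; exact: cutoff_derive_continuous.
have clw : {within `[0, 1], continuous l} by exact: continuous_subspaceT.
have imd := itv01_integrable (within_continuousM cm cdphi).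
have ild := itv01_integrable (within_continuousM clw cdphi).
have igd := itv01_integrable (within_continuousM cg cdphi).
have ip := itv01_integrable cphi.
rewrite -EFin_normr_Rintegral// lee_fin => hK.
pose A : set R := `[0, 2 * e] `|` `[1 - 2 * e, 1].
have mA : measurable A by apply: measurableU; exact: measurable_itv.
have lebA : (leb A <= (4 * e)%:E)%E.
  apply: (@le_trans _ _ (leb `[0%R, (2 * e)%R]%classic + leb `[(1 - 2 * e)%R, 1%R]%classic)%E).
    by apply: measureU2; exact: measurable_itv.
  rewrite !lebesgue_measure_itv/= !lte_fin.
  rewrite mulr_gt0// ltrBlDr ltrDl mulr_gt0// -!EFinB -EFinD lee_fin; lra.
have AI : A `<=` `[0, 1].
  have e2' : 2 * e <= 1 by lra.
  have e2'' : 0 <= 1 - 2 * e by lra.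
  move=> t [] /=; rewrite !in_itv/= => /andP[h1 h2].
    by rewrite h1 (le_trans h2).
  by rewrite h2 (le_trans _ h1).
have intA c : 0 <= c -> (\int[leb]_(t in `[0%R, 1%R]) (c * \1_A t)%:E <= (c * (4 * e))%:E)%E.
  move=> c0; under eq_integral do rewrite EFinM.
  rewrite ge0_integralZl//; do ?[mea|by move=> x _; rewrite lee_fin].
  rewrite integral_indic// (EFinM c) lee_wpmul2l//.
  by rewrite (setIidl AI).
have notA t : t \in `[0, 1] -> t \notin A -> 2 * e < t /\ t < 1 - 2 * e.
  rewrite in_itv/= => /andP[t0 t1]; rewrite notin_setE /A /= !in_itv/= t0 t1 andbT /=.
  by move=> /not_orP[/negP + /negP]; rewrite -!ltNge.
have le01A (f : R -> R) c : 0 <= c -> {within `[0, 1], continuous f} ->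
    (forall t, t \in `[0, 1] -> `|f t| <= c * \1_A t) ->
    `|\int[leb]_(t in `[0, 1]) f t| <= c * (4 * e).
  move=> c0 cf fc; rewrite -lee_fin EFin_normr_Rintegral//; last exact: itv01_integrable.
  apply: le_trans (intA c c0); apply: abse_integral_le => t t01.
  by rewrite abse_EFin lee_fin fc.
have h1 : `|\int[leb]_(t in `[0, 1]) (g t * dphi t)| <= dl * (L / e) * (4 * e).
  apply: le01A; [by rewrite mulr_ge0 ?divr_ge0 ?ltW|exact: within_continuousM|].
  move=> t t01; rewrite indicE; have [tA|tA] := boolP (t \in A); last first.
    have [k1 k2] := notA t t01 tA.
    by rewrite /dphi cutoff_derive_out// mulr0 normr0 mulr0.
  rewrite mulr1 normrM ler_pM ?hL//.
  have /andP[t0 t1] : 0 <= t <= 1 by [].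
  move/set_mem : tA => [] /=; rewrite in_itv/= => /andP[k1 k2].
    by apply: he1 => //; lra.
  by apply: he2 => //; lra.
have h2 : `|\int[leb]_(t in `[0, 1]) (1 - phi t)| <= 1 * (4 * e).
  apply: le01A => //.
    by move=> x; apply: cvgB; [exact: cvg_cst|exact: cphi].
  move=> t t01; rewrite indicE; have [tA|tA] := boolP (t \in A); last first.
    have [k1 k2] := notA t t01 tA.
    by rewrite /phi cutoff_one ?(ltW k1) ?(ltW k2)// subrr normr0 mulr0.
  by rewrite mulr1 ger0_norm ?subr_ge0 ?cutoff_le1// gerBl cutoff_ge0.
have h2' : \int[leb]_(t in `[0, 1]) (1 - phi t) = 1 - \int[leb]_(t in `[0, 1]) phi t.
  rewrite RintegralB//; last by apply: itv01_integrable => x; exact: cvg_cst.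
  rewrite Rintegral_cst// mul1r; congr (_ - _).
  by transitivity (fine (leb `[0, 1]%classic)) => //; rewrite lebesgue_itv01.
(* Integration by parts for the affine part: [l t * phi t] vanishes at both ends. *)
have h3 : \int[leb]_(t in `[0, 1]) (l t * dphi t) +
    (m 1 - m 0) * \int[leb]_(t in `[0, 1]) phi t = 0.
  rewrite -RintegralZl// -RintegralD//; last exact: (integrableZl _ (m 1 - m 0) ip).
  have dl1 t : is_derive (t : R^o) 1 l (m 1 - m 0) by exact: is_derive_affine.
  have dF t : is_derive (t : R^o) 1 (fun t => l t * phi t)
      (l t * dphi t + (m 1 - m 0) * phi t).
    apply: is_derive_eq (is_deriveM (dl1 t) (is_derive_cutoff e t)) _.
    by rewrite /GRing.scale/= [phi t * _]mulrC.
  rewrite /Rintegral (@FTC_is_derive _ (fun t => l t * phi t) _ _ _ (@ltr01 R) dF).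
  - rewrite /phi; have -> : cutoff e 1 = 0.
      by apply/eqP/negPn/negP => /(cutoff_supp e0) /andP[k1 k2]; lra.
    have -> : cutoff e 0 = 0.
      by apply/eqP/negPn/negP => /(cutoff_supp e0) /andP[k1 k2]; lra.
    by rewrite !mulr0 subee.
  - move=> x; apply: cvgD; first exact: within_continuousM.
    by apply: cvgM; [exact: cvg_cst|exact: cphi].
have h4 : \int[leb]_(t in `[0, 1]) (m t * dphi t) =
   \int[leb]_(t in `[0, 1]) (g t * dphi t) + \int[leb]_(t in `[0, 1]) (l t * dphi t).
  rewrite -RintegralD//; congr (fine _); apply: eq_integral => t _; congr EFin.
  by rewrite /g; ring.
move: hK h1 h2; rewrite h4 h2' mul1r.
move: (\int[leb]_(t in `[0, 1]) (g t * dphi t)) (\int[leb]_(t in `[0, 1]) (l t * dphi t))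
  (\int[leb]_(t in `[0, 1]) phi t) h3 => G Lx I h3 hK hG hI.
have e_M : M * (4 * e) <= r / 2.
  have : (M + 1) * (4 * e) <= r / 2.
    rewrite -ler_pdivlMl//; move: ee4; rewrite [(M + 1)^-1 * _]mulrC.
    rewrite (_ : r / 2 / (M + 1) = 4 * (r / (M + 1) / 8)); last by field; rewrite gt_eqF.
    by rewrite ler_pM2l.
  by apply: le_trans; rewrite ler_wpM2r ?lerDl// mulr_ge0// ltW.
have hG' : `|G| <= r / 2.
  apply: (le_trans hG); rewrite (_ : dl * (L / e) * (4 * e) = (4 * L) * dl); last first.
    by field; rewrite gt_eqF.
  rewrite /dl mulrA ler_pM2r// mulrA ler_pdivrMr// mulrC ler_pM2l//.
  by rewrite ler_wpDr//; nra.
have hm : `|(m 1 - m 0) * (1 - I)| <= r / 2.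
  by rewrite normrM; apply: le_trans e_M; rewrite ler_wpM2l.
(* G + Lx is the tested integral of m, bounded by kappa; 1 - I and G are the two errors, each worth
   at most r / 2. *)
have -> : m 1 - m 0 = (m 1 - m 0) * (1 - I) - (G + Lx) + G.
  have -> : Lx = - ((m 1 - m 0) * I) by apply/eqP; rewrite -addr_eq0 h3.
  ring.
apply: (le_trans (ler_normD _ _)); rewrite [r in leRHS]splitr addrA lerD//.
by apply: (le_trans (ler_normB _ _)); rewrite addrC lerD.
Qed.

End cutoff.

Lemma Ck_coordinate_like (R : realType) (V : normedModType R) k (f : V -> R) :
  continuous f -> (forall h v x, f (h *: v + x) = h * f v + f x) ->
  @Ck_on R V k setT f.
Proof.
move=> cf lf; case: k => [|k]; first by split=> //; exact/in_setT_continuous.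
apply: (@Ck_succ _ _ _ _ (fun v => cst (f v))) => [//|x v|v]; last exact: Ck_cst.
have cv : (fun h : R => h^-1 *: ((f \o shift x) (h *: v) - f x)) @ 0^' --> f v.
  apply: (@cvg_trans _ ((cst (f v) : R -> R) @ 0^')); last exact: cvg_cst.
  apply: near_eq_cvg; near=> h.
  have h0 : h != 0 by near: h; exact: nbhs_dnbhs_neq.
  by rewrite /= /shift /= lf addrK /GRing.scale/= mulKf.
by apply: DeriveDef; [apply/cvg_ex; exists (f v)|exact/cvg_lim].
Unshelve. all: by end_near. Qed.

(** * Smooth partitions of unity in space *)

Section hat_products.
Context (R : realType) (d : nat).
Implicit Types (N : R) (b : 'I_d -> R) (x : 'rV[R]_d).

(** A bump around the point - b / N, of half-width 1 / N in every coordinate. Integer translates of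
    b give a partition of unity at scale N. *)
Definition hat_prod N b x : R := \prod_(k < d) smooth_hat (N * x 0 k + b k).

Lemma Ck_hat_prod k N b : @Ck_on R 'rV[R]_d k setT (hat_prod N b).
Proof.
apply: Ck_prod => i.
apply: (@Ck_comp _ _ _ (@smooth_hat R)); first exact: Ck_smooth_hat.
apply: Ck_add; last exact: Ck_cst.
apply: Ck_mul; first exact: Ck_cst.
apply: Ck_coordinate_like; first exact: coord_continuous.
by move=> h v x; rewrite !mxE.
Qed.

Lemma hat_prod_continuous N b : continuous (hat_prod N b).
Proof. exact: Ck_continuous (Ck_hat_prod 0 N b). Qed.

Lemma hat_prod_ge0 N b x : 0 <= hat_prod N b x.
Proof. by apply: prodr_ge0 => k _; exact: smooth_hat_ge0. Qed.

Lemma hat_prod_le1 N b x : hat_prod N b x <= 1.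
Proof. by apply: prodr_ile1 => k _; rewrite smooth_hat_ge0 smooth_hat_le1. Qed.

Lemma hat_prod_supp N b x : hat_prod N b x != 0 -> forall k, `|N * x 0 k + b k| < 1.
Proof.
by move=> h k; apply: smooth_hat_supp; move/prodf_neq0 : h; exact.
Qed.

(** A product of numbers in [0, 1] changes by at most the sum of the changes of its factors, so the
    constant is that of a single hat times the scale, whatever b is. *)
Lemma hat_prod_lipschitz : exists2 L, 0 < L & forall N b x y, 0 < N ->
  `|hat_prod N b x - hat_prod N b y| <= L * N * \sum_(k < d) `|x 0 k - y 0 k|.
Proof.
have [L L0 hL] := smooth_hat_lipschitz R; exists L => // N b x y N0.
have key (r : seq 'I_d) (f g : 'I_d -> R) : (forall i, 0 <= f i <= 1) ->
    (forall i, 0 <= g i <= 1) ->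
    `|\prod_(i <- r) f i - \prod_(i <- r) g i| <= \sum_(i <- r) `|f i - g i|.
  move=> f01 g01; elim: r => [|i r IH]; first by rewrite !big_nil subrr normr0.
  rewrite !big_cons.
  have -> : f i * \prod_(j <- r) f j - g i * \prod_(j <- r) g j =
    (f i - g i) * \prod_(j <- r) f j + g i * (\prod_(j <- r) f j - \prod_(j <- r) g j).
    by ring.
  apply: (le_trans (ler_normD _ _)); rewrite !normrM; apply: lerD.
    rewrite ler_piMr// ger0_norm; last by apply: prodr_ge0 => j _; have /andP[] := f01 j.
    by apply: prodr_ile1 => j _; exact: f01.
  apply: le_trans IH; rewrite ler_piMl// ger0_norm; by have /andP[] := g01 i.
apply: (le_trans (key _ _ _ _ _)).
- by move=> i; rewrite smooth_hat_ge0 smooth_hat_le1.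
- by move=> i; rewrite smooth_hat_ge0 smooth_hat_le1.
rewrite mulr_sumr; apply: ler_sum => k _; apply: (le_trans (hL _ _)).
rewrite (_ : _ - _ = N * (x 0 k - y 0 k)); last by ring.
by rewrite normrM (gtr0_norm N0) mulrA.
Qed.

Lemma test_function_hat_cutoff N b (e : R) : 0 < N -> 0 < e ->
  @test_function R ('rV[R]_d * R^o)%type (setT `*` `]0, 1[)
    (fun z => hat_prod N b z.1 * cutoff e z.2).
Proof.
move=> N0 e0.
pose C : set ('rV[R]_d * R^o) :=
  [set x : 'rV[R]_d | forall k, x 0 k \in `[(- 1 - b k) / N, (1 - b k) / N]] `*` `[e, 1 - e].
have cC : compact C.
  apply: compact_setX; last exact: segment_compact.
  apply: (@rV_compact R d (fun k => `[(- 1 - b k) / N, (1 - b k) / N]%classic)) => k.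
  exact: segment_compact.
have clC : closed C by apply: compact_closed => //; exact: norm_hausdorff.
have sub : closure [set z | hat_prod N b z.1 * cutoff e z.2 != 0] `<=` C.
  have /closure_id -> := clC.
  apply: closure_subset => -[x t] /=; rewrite mulf_eq0 negb_or => /andP[hx ht].
  split=> [k|] /=; last first.
    by have /andP[h1 h2] := cutoff_supp e0 ht; rewrite in_itv/= !ltW.
  have := hat_prod_supp hx k; rewrite ltr_norml in_itv/= => /andP[h1 h2].
  by rewrite ler_pdivrMr// ler_pdivlMr// [_ * N]mulrC; apply/andP; split; lra.
split=> [k||].
- apply: Ck_mul.
    apply: Ck_prod => i.
    apply: (@Ck_comp _ _ _ (@smooth_hat R)); first exact: Ck_smooth_hat.
    apply: Ck_add; last exact: Ck_cst.
    apply: Ck_mul; first exact: Ck_cst.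
    apply: Ck_coordinate_like; last by move=> h v x; rewrite !mxE.
    move=> z; apply: (@continuous_comp _ _ _ fst (fun x : 'rV[R]_d => x 0 i)).
      exact: cvg_fst.
    exact: coord_continuous.
  apply: (@Ck_comp _ _ _ (cutoff e)); first exact: Ck_cutoff.
  by apply: Ck_coordinate_like => // z; exact: cvg_snd.
- by apply: subclosed_compact sub => //; exact: closed_closure.
- move=> [x t] /sub [_ /=]; rewrite in_itv/= => /andP[h1 h2]; split=> //=.
  by rewrite in_itv/= (lt_le_trans e0 h1)/= (le_lt_trans h2)// gtrBl.
Qed.

Lemma dtime_hat_cutoff N b (e : R) x t :
  dtime (fun z => hat_prod N b z.1 * cutoff e z.2) (x, t) =
  hat_prod N b x * derive1 (cutoff e) t.
Proof.
have [_ <-] : is_derive (t : R^o) 1 (fun t => hat_prod N b x * cutoff e t)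
    (hat_prod N b x * derive1 (cutoff e) t).
  have := is_deriveM (is_derive_cst (hat_prod N b x : R^o) (t : R^o) 1)
    (is_derive_cutoff e t).
  by move=> h; apply: (is_derive_eq h); rewrite /GRing.scale/= mulr0 addr0.
have E : (fun h : R => h^-1 *: (((fun z : 'rV[R]_d * R^o => hat_prod N b z.1 * cutoff e z.2)
      \o shift (x, t)) (h *: (0, 1)) - hat_prod N b x * cutoff e t)) =
    (fun h : R => h^-1 *: (((fun t : R^o => hat_prod N b x * cutoff e t)
      \o shift t) (h *: 1) - hat_prod N b x * cutoff e t)).
  by apply/funext => h /=; rewrite scaler0 !add0r.
by rewrite /dtime /derive /= E.
Qed.

Lemma dspace_hat_cutoff N b (e : R) x t k :
  dspace (fun z => hat_prod N b z.1 * cutoff e z.2) k (x, t) =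
  'D_(delta_mx 0 k) (hat_prod N b) x * cutoff e t.
Proof.
have [_ dh _] := Ck_succE (Ck_hat_prod 1 N b).
have dh' : is_derive x (delta_mx 0 k) (hat_prod N b) ('D_(delta_mx 0 k) (hat_prod N b) x).
  exact/derivableP.
have [_ <-] : is_derive x (delta_mx 0 k : 'rV[R]_d) (fun y => hat_prod N b y * cutoff e t)
    ('D_(delta_mx 0 k) (hat_prod N b) x * cutoff e t).
  have := is_deriveM dh' (is_derive_cst (cutoff e t : R^o) x (delta_mx 0 k)).
  by move=> h; apply: (is_derive_eq h); rewrite /GRing.scale/= mulr0 add0r mulrC.
have E : (fun h : R => h^-1 *: (((fun z : 'rV[R]_d * R^o => hat_prod N b z.1 * cutoff e z.2)
      \o shift (x, t)) (h *: (delta_mx 0 k, 0)) - hat_prod N b x * cutoff e t)) =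
    (fun h : R => h^-1 *: (((fun y : 'rV[R]_d => hat_prod N b y * cutoff e t)
      \o shift x) (h *: delta_mx 0 k) - hat_prod N b x * cutoff e t)).
  by apply/funext => h /=; rewrite scaler0 !add0r.
by rewrite /dspace /derive /= E.
Qed.

Lemma hat_prod_derive_bound N b (K : set 'rV[R]_d) : compact K ->
  exists2 C, 0 < C & forall k x, K x -> `|'D_(delta_mx 0 k) (hat_prod N b) x| <= C.
Proof.
move=> cK; have [_ _ Ch] := Ck_succE (Ck_hat_prod 1 N b).
have /choice[C hC] (k : 'I_d) : exists C, 0 < C /\
    forall x, K x -> `|'D_(delta_mx 0 k) (hat_prod N b) x| <= C.
  have cD := Ck_continuous (Ch (delta_mx 0 k)).
  have : compact (('D_(delta_mx 0 k) (hat_prod N b)) @` K).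
    by apply: continuous_compact => //; exact: continuous_subspaceT.
  move/compact_bounded => [M [_ hM]].
  exists (`|M| + 1); split; first by rewrite ltr_wpDl.
  move=> x Kx; apply: hM; last by exists x.
  by rewrite (le_lt_trans (ler_norm M))// ltrDl.
exists (1 + \sum_(k < d) C k) => [|k x Kx].
  by rewrite ltr_wpDr// sumr_ge0// => k _; have [/ltW] := hC k.
have [C0 /(_ x Kx) h] := hC k; apply: (le_trans h).
rewrite ler_wpDl// (bigD1 k)//= lerDl sumr_ge0// => j _.
by have [/ltW] := hC j.
Qed.

(** Expanding the product over the coordinates of one-dimensional partitions of unity. K exceeds 2 N
    M, so the translates reach over the whole range of N (x_k + M). *)
Lemma hat_prod_sum (M : R) (N : nat) : 0 <= M -> exists (K : nat) ,
  forall x, (forall k, `|x 0 k| <= M) ->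
  \sum_(a : {ffun 'I_d -> 'I_K.+1})
    hat_prod N%:R (fun k => N%:R * M - (a k)%:R) x = 1.
Proof.
move=> M0; pose K := Num.bound (N%:R * (M + M)); exists K => x xM.
under eq_bigr do rewrite /hat_prod.
rewrite -(bigA_distr_bigA (fun k (a : 'I_K.+1) =>
  smooth_hat (N%:R * x 0 k + (N%:R * M - a%:R)))) big1// => k _.
under eq_bigr do rewrite addrA.
apply: smooth_hat_sum.
  by rewrite -mulrDr mulr_ge0// -lerBlDr sub0r; have := xM k; rewrite ler_norml => /andP[].
have : N%:R * (M + M) < K%:R :> R.
  by apply: archi_boundP; rewrite mulr_ge0 ?addr_ge0.
move=> /ltW; apply: le_trans.
rewrite -mulrDr ler_wpM2l// lerD2r; have := xM k; by rewrite ler_norml => /andP[].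
Qed.

End hat_products.

(** * Flows on a connected graph *)

Section ramp.
Context (R : realType).
Implicit Types (t : R).

Definition ramp t : R := Num.max 0 t.

Lemma ramp_ge0 t : 0 <= ramp t. Proof. by rewrite /ramp le_max lexx. Qed.

Lemma ramp_le0 t : t <= 0 -> ramp t = 0.
Proof. by move=> t0; apply/max_idPl. Qed.

Lemma rampE t : ramp t = (t + `|t|) / 2.
Proof.
rewrite /ramp; case: (leP 0 t) => t0; first by rewrite ger0_norm//; lra.
by rewrite ltr0_norm//; lra.
Qed.

Lemma ramp_continuous : continuous ramp.
Proof.
move=> t; have -> : ramp = (fun t => (t + `|t|) / 2) by apply/funext => s; exact: rampE.
by apply: cvgM; [apply: cvgD; [exact: cvg_id|exact: cvg_norm]|exact: cvg_cst].
Qed.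

Lemma is_derive_ramp2 t : is_derive (t : R^o) 1 (fun t => ramp t ^+ 2) (2 * ramp t).
Proof.
have [t0|t0|->] := ltgtP t 0.
- rewrite ramp_le0 ?ltW// mulr0.
  apply: (@near_eq_is_derive _ R^o R^o (cst 0)).
  near=> s; rewrite /= ramp_le0 ?expr0n// ltW//; near: s; exact: lt_nbhsl.
- have d2 := is_deriveX 2 (is_derive_id (t : R^o) 1).
  apply: (near_eq_is_derive _ (is_derive_eq d2 _)).
    near=> s; rewrite exprfctE/= /ramp; congr (_ ^+ 2); apply/esym/max_idPr/ltW.
    by near: s; exact: lt_nbhsr.
  by rewrite /ramp (max_idPr (ltW t0)) /GRing.scale/= expr1 mulr1.
- rewrite ramp_le0// mulr0.
  have cv0 : (fun h : R => h^-1 *: (((fun t => ramp t ^+ 2) \o shift (0 : R)) (h *: (1 : R^o))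
       - ramp 0 ^+ 2)) @ 0^' --> (0 : R).
    apply/cvgrPdist_le => e e0; near=> h.
    have h0 : h != 0 by near: h; exact: nbhs_dnbhs_neq.
    rewrite sub0r normrN ramp_le0// expr0n subr0 /= addr0 [h *: 1]mulr1.
    have hp : 0 < `|h| by rewrite normr_gt0.
    rewrite normrM normfV mulrC ler_pdivrMr// ger0_norm ?sqr_ge0//.
    apply: (@le_trans _ _ (`|h| ^+ 2)).
      rewrite ler_sqr ?nnegrE ?ramp_ge0// /ramp ge_max normr_ge0 ler_norm//.
    rewrite expr2 ler_pM2r//.
    by near: h; exact: dnbhs0_le.
  apply: DeriveDef; first by apply/cvg_ex; exists 0.
  exact/cvg_lim.
Unshelve. all: by end_near. Qed.

(** A C^1 profile falling from 1 at time 0 to 0 at time 1/2. Being a square, it controls the square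
    of its own derivative. *)
Definition fading t : R := ramp (1 + - 2 * t) ^+ 2.

Lemma is_derive_fading t : is_derive (t : R^o) 1 fading (- 4 * ramp (1 + - 2 * t)).
Proof.
have h := @is_derive1_comp R (fun t => ramp t ^+ 2) (fun t => - 2 * t + 1) t _ _
  (is_derive_ramp2 (- 2 * t + 1)) (is_derive_affine (- 2) 1 t).
have -> : fading = (fun t => ramp t ^+ 2) \o (fun t => - 2 * t + 1).
  by apply/funext => s; rewrite /fading /= addrC.
by apply: (is_derive_eq h); rewrite [_ + 1]addrC; ring.
Qed.

Lemma fading0 : fading 0 = 1.
Proof. by rewrite /fading mulr0 addr0 /ramp (max_idPr ler01) expr1n. Qed.

Lemma fading_half t : 2^-1 <= t -> ramp (1 + - 2 * t) = 0.
Proof. by move=> t2; apply: ramp_le0; lra. Qed.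

Lemma fading_itv t : 0 <= t -> 0 <= ramp (1 + - 2 * t) <= 1.
Proof. by move=> t0; rewrite ramp_ge0/= /ramp ge_max ler01/=; lra. Qed.

(* Start, end and middle weights of the transfer along a flow; both derivatives
   are controlled by the square root of the middle weight. *)
Definition wstart t := fading t * (1 + fading t - fading t ^+ 2).
Definition wend t := (1 - fading t) ^+ 3.
Definition wmid t := 2 * fading t * (1 - fading t) ^+ 2.
Definition dwstart t :=
  (1 - fading t) * (1 + 3 * fading t) * (- 4 * ramp (1 + - 2 * t)).
Definition dwend t := - 3 * (1 - fading t) ^+ 2 * (- 4 * ramp (1 + - 2 * t)).

Lemma weights_sum t : wstart t + wend t + wmid t = 1.
Proof. by rewrite /wstart /wend /wmid; ring. Qed.

Lemma wmidE t : wmid t = 1 - wstart t - wend t.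
Proof. by rewrite -(weights_sum t); ring. Qed.

Lemma is_derive_wstart t : is_derive (t : R^o) 1 wstart (dwstart t).
Proof.
have df := is_derive_fading t.
have h := is_deriveM df (is_deriveB (is_deriveD (is_derive_cst (1 : R^o) (t : R^o) 1) df)
  (is_deriveX 2 df)).
have -> : wstart = fading * (cst 1 + fading - fading ^+ 2).
  by apply/funext => s; rewrite [RHS]/GRing.mul/= exprfctE.
apply: (is_derive_eq h).
have -> : (cst 1 + fading - fading ^+ 2) t = 1 + fading t - fading t ^+ 2 by [].
by rewrite /dwstart /GRing.scale/= expr1; ring.
Qed.

Lemma is_derive_wend t : is_derive (t : R^o) 1 wend (dwend t).
Proof.
have df := is_derive_fading t.
have h := is_deriveX 3 (is_deriveB (is_derive_cst (1 : R^o) (t : R^o) 1) df).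
have -> : wend = (cst 1 - fading) ^+ 3.
  by apply/funext => s; rewrite exprfctE.
apply: (is_derive_eq h).
have -> : (cst 1 - fading) t = 1 - fading t by [].
by rewrite /dwend /GRing.scale/=; ring.
Qed.

Let fading01 t : 0 <= t -> 0 <= fading t <= 1.
Proof.
move=> /fading_itv /andP[h0 h1]; rewrite /fading exprn_ge0//=.
by rewrite -[leRHS](expr1n _ 2) ler_sqr ?nnegrE.
Qed.

Lemma wstart_ge0 t : 0 <= t -> 0 <= wstart t.
Proof.
move=> /fading01 /andP[h0 h1]; rewrite /wstart mulr_ge0//.
have : fading t ^+ 2 <= 1 by rewrite -[leRHS](expr1n _ 2) ler_sqr ?nnegrE.
lra.
Qed.

Lemma wend_ge0 t : 0 <= t -> 0 <= wend t.
Proof. by move=> /fading01 /andP[h0 h1]; rewrite exprn_ge0// subr_ge0. Qed.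

Lemma wmid_ge0 t : 0 <= t -> 0 <= wmid t.
Proof. by move=> /fading01 /andP[h0 h1]; apply: mulr_ge0; [exact: mulr_ge0|exact: sqr_ge0]. Qed.

(** [fading] is the square of the ramp, so the squared derivative contains the factor f (1 - f)^2 of
    the middle weight; the remaining 16 (1 + 3 f)^2 is at most 256. *)
Lemma dwstart_bound t : 0 <= t -> dwstart t ^+ 2 <= 128 * wmid t.
Proof.
move=> t0; have /andP[f0 f1] := fading01 t0.
have -> : dwstart t ^+ 2 = (fading t * (1 - fading t) ^+ 2) * (16 * (1 + 3 * fading t) ^+ 2).
  rewrite /dwstart /fading; ring.
have -> : 128 * wmid t = (fading t * (1 - fading t) ^+ 2) * 256 by rewrite /wmid; ring.
apply: ler_wpM2l; first nonneg.
have : (1 + 3 * fading t) ^+ 2 <= 4 ^+ 2 by rewrite ler_sqr ?nnegrE; lra.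
lra.
Qed.

Lemma dwend_bound t : 0 <= t -> dwend t ^+ 2 <= 72 * wmid t.
Proof.
move=> t0; have /andP[f0 f1] := fading01 t0.
have -> : dwend t ^+ 2 = (fading t * (1 - fading t) ^+ 2) * (144 * (1 - fading t) ^+ 2).
  rewrite /dwend /fading; ring.
have -> : 72 * wmid t = (fading t * (1 - fading t) ^+ 2) * 144 by rewrite /wmid; ring.
apply: ler_wpM2l; first nonneg.
have : (1 - fading t) ^+ 2 <= 1 ^+ 2 by rewrite ler_sqr ?nnegrE; lra.
lra.
Qed.

Lemma fading_continuous : continuous fading.
Proof.
move=> t; have [/derivable1_diffP h _] := is_derive_fading t.
exact: (@differentiable_continuous _ R^o R^o).
Qed.

Lemma ramp_affine_continuous : continuous (fun t => ramp (1 + - 2 * t)).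
Proof.
move=> t; apply: (@continuous_comp _ _ _ (fun t => 1 + - 2 * t) ramp); last exact: ramp_continuous.
by apply: cvgD; [exact: cvg_cst|apply: cvgM; [exact: cvg_cst|exact: cvg_id]].
Qed.

Lemma dwstart_continuous : continuous dwstart.
Proof.
move=> t; have cf := @fading_continuous t; have cr := @ramp_affine_continuous t.
apply: cvgM; last by apply: cvgM => //; exact: cvg_cst.
apply: cvgM; first by apply: cvgB => //; exact: cvg_cst.
by apply: cvgD; [exact: cvg_cst|apply: cvgM => //; exact: cvg_cst].
Qed.

Lemma dwend_continuous : continuous dwend.
Proof.
move=> t; have cf := @fading_continuous t; have cr := @ramp_affine_continuous t.
apply: cvgM; last by apply: cvgM => //; exact: cvg_cst.
apply: cvgM; first exact: cvg_cst.
have -> : (fun t => (1 - fading t) ^+ 2) = (fun t => (1 - fading t) * (1 - fading t)) by [].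
by apply: cvgM; apply: cvgB => //; exact: cvg_cst.
Qed.

End ramp.

Section elementary_flows.
Context (R : realType) (n : nat) (q : 'M[R]_n).
Hypotheses (q_connected : connected_graph q) (q_symmetric : symmetric_graph q).

Definition is_flow (F : 'I_n -> 'I_n -> R) := (forall a b, F a b = - F b a) /\
  (forall a b, q a b <= 0 -> F a b = 0).

(** One unit is pushed along a path from i to j. An edge of the path contributes +1 and -1 to its
    two orientations, and the divergences telescope. *)
Lemma unit_flow i j : exists F, is_flow F /\
  forall a, \sum_b F a b = (a == j)%:R - (a == i)%:R.
Proof.
have /connectP[p + ->] := q_connected i j.
elim: p i => [|x p IH] i /= => [_|/andP[qix /IH[F [[F1 F2] F3]]]].
  exists (fun _ _ => 0); split=> [|a]; first by split=> // a b; rewrite oppr0.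
  by rewrite big1// subrr.
pose E a b : R := ((a == x) && (b == i))%:R - ((a == i) && (b == x))%:R.
exists (fun a b => E a b + F a b); split; first split.
- by move=> a b; rewrite opprD -F1 /E opprB [(b == x) && _]andbC [(b == i) && _]andbC.
- move=> a b qab; rewrite F2// addr0 /E.
  case: (altP (a =P x)) (altP (b =P i)) (altP (a =P i)) (altP (b =P x)) => [ax|_] [bi|_] [ai|_] [bx|_];
    rewrite /= ?subrr//; subst; move: qab; rewrite ?[q x i]q_symmetric leNgt qix//.
- move=> a; rewrite big_split/= F3 /E sumrB.
  have s (c e : 'I_n) : \sum_b ((a == c) && (b == e))%:R = (a == c)%:R :> R.
    rewrite (bigD1 e)//= eqxx andbT big1 ?addr0// => b /negPf ->.
    by rewrite andbF.
  by rewrite !s; ring.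
Qed.

(** P i j is a curve of weights from node i to node j and J i j the flux driving it, both at rest
    after time 1/2. [fs_bound] makes the energy finite for every interpolation function, since theta
    is at least the minimum; [fs_diag] makes mass that keeps its node free of charge. *)
Record flow_system (C : R) (P : 'I_n -> 'I_n -> R -> 'I_n -> R)
    (J : 'I_n -> 'I_n -> R -> 'I_n -> 'I_n -> R) : Prop := {
  fs_ge0 : forall i j t a, 0 <= t -> 0 <= P i j t a ;
  fs_sum : forall i j t, \sum_a P i j t a = 1 ;
  fs_start : forall i j a, P i j 0 a = (a == i)%:R ;
  fs_end : forall i j t a, 2^-1 <= t -> P i j t a = (a == j)%:R ;
  fs_derive : forall i j a t,
    is_derive (t : R^o) 1 (fun t => P i j t a) (\sum_b J i j t a b) ;
  fs_continuous : forall i j a b, continuous (fun t => J i j t a b) ;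
  fs_anti : forall i j t a b, J i j t a b = - J i j t b a ;
  fs_supp : forall i j t a b, q a b <= 0 -> J i j t a b = 0 ;
  fs_bound : forall i j t a b, 0 <= t ->
    J i j t a b ^+ 2 <= C * Num.min (P i j t a) (P i j t b) ;
  fs_diag : forall i t a b, J i i t a b = 0 ;
  fs_stop : forall i j t a b, 2^-1 <= t -> J i j t a b = 0
}.

(** The averaged flow [Fs] spreads the mass of i over all nodes and [Fe] collects it at j. On the
    way every node holds at least [wmid t / N], which dominates the squares of the derivatives of
    the weights and hence of the flux. *)
Lemma flow_systemP : exists C P J, 0 <= C /\ flow_system C P J.
Proof.
have [F0 hF0] := choice (fun ij : 'I_n * 'I_n => unit_flow ij.1 ij.2).
pose N : R := n%:R.
pose Fs i a b := N^-1 * \sum_l F0 (i, l) a b.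
pose Fe j a b := N^-1 * \sum_l F0 (l, j) a b.
(* The start, end and uniform distributions, mixed with the three time weights. Equal nodes are
   treated apart so that nothing flows between them. *)
pose P (i j : 'I_n) (t : R) (a : 'I_n) : R := if i == j then (a == i)%:R
  else wstart t * (a == i)%:R + wend t * (a == j)%:R + wmid t * N^-1.
pose J (i j : 'I_n) (t : R) (a b : 'I_n) : R := if i == j then 0 else - dwstart t * Fs i a b + dwend t * Fe j a b.
pose C0 : R := \sum_i \sum_a \sum_b (Fs i a b ^+ 2 + Fe i a b ^+ 2).
have C0P i a b : Fs i a b ^+ 2 + Fe i a b ^+ 2 <= C0.
  have le_term (I : finType) (f : I -> R) k : (forall l, 0 <= f l) -> f k <= \sum_l f l.
    by move=> f0; rewrite (bigD1 k)//= lerDl sumr_ge0.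
  have t0 k c e : 0 <= Fs k c e ^+ 2 + Fe k c e ^+ 2 by nonneg.
  apply: (le_trans (le_term _ (fun e => Fs i a e ^+ 2 + Fe i a e ^+ 2) b _)) => //.
  apply: (le_trans (le_term _ (fun c => \sum_e (Fs i c e ^+ 2 + Fe i c e ^+ 2)) a _)).
    nonneg.
  apply: (le_term _ (fun k => \sum_c \sum_e (Fs k c e ^+ 2 + Fe k c e ^+ 2))) => k.
  nonneg.
have C00 : 0 <= C0.
  by do ?[apply: sumr_ge0 => ? _]; nonneg.
have N0 (i : 'I_n) : 0 < N by rewrite ltr0n (leq_ltn_trans _ (ltn_ord i)).
have sd a : \sum_(l < n) (a == l)%:R = 1 :> R.
  by rewrite (bigD1 a)//= eqxx big1 ?addr0// => l /negPf; rewrite eq_sym => ->.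
have dFs i a : \sum_b Fs i a b = N^-1 - (a == i)%:R.
  rewrite -mulr_sumr exchange_big/=.
  under eq_bigr do rewrite (hF0 (i, _)).2 /=.
  rewrite sumrB sd sumr_const card_ord mulrBr mulr1 -[(_ == i)%:R *+ n]mulr_natl mulKf//.
  by rewrite gt_eqF// (N0 i).
have dFe j a : \sum_b Fe j a b = (a == j)%:R - N^-1.
  rewrite -mulr_sumr exchange_big/=.
  under eq_bigr do rewrite (hF0 (_, j)).2 /=.
  rewrite sumrB sd sumr_const card_ord mulrBr mulr1 -[(_ == j)%:R *+ n]mulr_natl mulKf//.
  by rewrite gt_eqF// (N0 j).
have aFs i a b : Fs i a b = - Fs i b a.
  by rewrite /Fs -mulrN -sumrN; congr (_ * _); apply: eq_bigr => l _; exact: (hF0 _).1.1.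
have aFe i a b : Fe i a b = - Fe i b a.
  by rewrite /Fe -mulrN -sumrN; congr (_ * _); apply: eq_bigr => l _; exact: (hF0 _).1.1.
have sFs i a b : q a b <= 0 -> Fs i a b = 0.
  by move=> qab; rewrite /Fs big1 ?mulr0// => l _; exact: (hF0 _).1.2.
have sFe i a b : q a b <= 0 -> Fe i a b = 0.
  by move=> qab; rewrite /Fe big1 ?mulr0// => l _; exact: (hF0 _).1.2.
have P0 i j t a : 0 <= t -> 0 <= P i j t a.
  move=> t0; rewrite /P; case: ifPn => // _.
  by rewrite !addr_ge0// mulr_ge0 ?invr_ge0 ?wstart_ge0 ?wend_ge0 ?wmid_ge0.
(* 400 = (128 + 72) * 2: the two derivative bounds, times the bound 2 C0 for the squares of the two
   flows. The factor N converts [wmid t] into the share [wmid t / N] of a single node. *)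
exists (400 * C0 * N), P, J; split.
  by apply: mulr_ge0; [apply: mulr_ge0; [exact: ler0n|exact: C00]|exact: ler0n].
split => //.
- move=> i j t; have s c : \sum_a (a == c :> 'I_n)%:R = 1 :> R.
    by rewrite (bigD1 c)//= eqxx big1 ?addr0// => a /negPf ->.
  have [ij|ij] := boolP (i == j); first by rewrite /P ij; exact: s.
  rewrite /P (negPf ij).
  rewrite !big_split/= -!mulr_sumr !s sumr_const card_ord !mulr1 -[N^-1 *+ n]mulr_natl.
  by rewrite divff ?gt_eqF// ?(N0 i)// mulr1 weights_sum.
- move=> i j a; rewrite /P; case: ifPn => // _.
  by rewrite /wstart /wend /wmid fading0; ring.
- move=> i j t a t2; rewrite /P; case: ifPn => [/eqP -> //|_].
  by rewrite /wstart /wend /wmid /fading fading_half//; ring.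
- move=> i j a t; have [ij|ij] := boolP (i == j); rewrite /P /J ?ij ?(negPf ij).
    rewrite big1//; exact: is_derive_cst.
  have -> : \sum_b (- dwstart t * Fs i a b + dwend t * Fe j a b) =
      - dwstart t * (N^-1 - (a == i)%:R) + dwend t * ((a == j)%:R - N^-1).
    by rewrite -dFs -dFe big_split/= [in RHS]mulr_sumr [in RHS]mulr_sumr.
  have d1 := is_deriveM (is_derive_wstart t) (is_derive_cst ((a == i)%:R : R^o) (t : R^o) 1).
  have d2 := is_deriveM (is_derive_wend t) (is_derive_cst ((a == j)%:R : R^o) (t : R^o) 1).
  have d3 := is_derive_cst (N^-1 : R^o) (t : R^o) 1.
  have d4 := is_deriveD (is_deriveD d1 d2) (is_deriveM (is_deriveB (is_deriveB
    (is_derive_cst (1 : R^o) (t : R^o) 1) (is_derive_wstart t)) (is_derive_wend t)) d3).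
  have -> : (fun t => wstart t * (a == i)%:R + wend t * (a == j)%:R + wmid t / N) =
    (@wstart R * cst (a == i)%:R + @wend R * cst (a == j)%:R +
      (cst 1 - @wstart R - @wend R) * cst N^-1).
    apply/funext => s.
    by rewrite wmidE.
  apply: (is_derive_eq d4).
  by rewrite /GRing.scale/=; ring.
- move=> i j a b t; have [ij|ij] := boolP (i == j); rewrite /J ?ij ?(negPf ij).
    exact: cvg_cst.
  apply: cvgD; apply: cvgM; do ?exact: cvg_cst.
    by apply: cvgN; exact: dwstart_continuous.
  exact: dwend_continuous.
- move=> i j t a b; rewrite /J; case: ifPn => _; first by rewrite oppr0.
  by rewrite aFs aFe; ring.
- by move=> i j t a b qab; rewrite /J sFs// sFe// !mulr0 addr0 if_same.
- move=> i j t a b t0; rewrite /J; have [_|ij] := ifPn.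
    by rewrite expr0n mulr_ge0 ?mulr_ge0 ?ler0n// le_min !P0.
  apply: (@le_trans _ _ (400 * C0 * wmid t)).
    have h (x y u v : R) : (- x * u + y * v) ^+ 2 <= (x ^+ 2 + y ^+ 2) * (u ^+ 2 + v ^+ 2).
      rewrite -subr_ge0 (_ : _ - _ = (x * v + y * u) ^+ 2) ?sqr_ge0//; ring.
    apply: (le_trans (h _ _ _ _)).
    have h1 := dwstart_bound t0; have h2 := dwend_bound t0.
    have h3 : Fs i a b ^+ 2 + Fe j a b ^+ 2 <= 2 * C0.
      clear N0; have := C0P i a b; have := C0P j a b.
      have := sqr_ge0 (Fe i a b); have := sqr_ge0 (Fs j a b); lra.
    apply: (@le_trans _ _ ((200 * wmid t) * (2 * C0))).
      by clear N0; apply: ler_pM => //; rewrite ?addr_ge0 ?sqr_ge0//; lra.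
    by rewrite le_eqVlt; apply/orP; left; apply/eqP; ring.
  rewrite -[leRHS]mulrA; apply: ler_wpM2l.
    by apply: mulr_ge0; [exact: ler0n|exact: C00].
  have hP c : wmid t * N^-1 <= P i j t c.
    rewrite /P (negPf ij) lerDr.
    by rewrite addr_ge0// mulr_ge0 ?wstart_ge0 ?wend_ge0.
  by rewrite -ler_pdivrMl ?(N0 i)// mulrC le_min !hP.
- by move=> i t a b; rewrite /J eqxx.
- move=> i j t a b t2; rewrite /J /dwstart /dwend fading_half// !mulr0 oppr0 !mul0r addr0.
  by rewrite if_same.
Qed.

End elementary_flows.

(** * The graph Wasserstein distance *)

Lemma measurable_invr (R : realType) d (T : measurableType d) (D : set T) (f : T -> R) :
  measurable D -> measurable_fun D f -> measurable_fun D (fun x => (f x)^-1).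
Proof.
move=> mD mf; apply: (@measurableT_comp _ _ _ _ _ _ (fun x : R => x^-1)) => //.
have -> : [set: R] = [set 0] `|` [set~ 0] by rewrite setUv.
apply/measurable_funU => //; first exact: measurableC.
split; first exact: measurable_fun_set1.
apply: open_continuous_measurable_fun => [|x].
  by apply: closed_openC; exact: closed_eq.
by rewrite inE => /eqP x0; exact: inv_continuous.
Qed.

Section weighted_sums.
Context (R : realType) (I : finType).

(** The weighted variance around c is nonnegative; take c to be the weighted mean X / S, the case S
    = 0 being trivial. *)
Lemma weighted_cauchy_schwarz (s x : I -> R) (A : pred I) : (forall i, 0 <= s i) ->
  (\sum_(i | A i) s i * x i) ^+ 2 <=
  (\sum_(i | A i) s i) * (\sum_(i | A i) s i * x i ^+ 2).
Proof.
move=> s0.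
set S := \sum_(i | A i) s i; set X := \sum_(i | A i) s i * x i.
set Q := \sum_(i | A i) s i * x i ^+ 2.
have S0 : 0 <= S by exact: sumr_ge0.
have key c : 0 <= Q - 2 * c * X + c ^+ 2 * S.
  have -> : Q - 2 * c * X + c ^+ 2 * S = \sum_(i | A i) s i * (x i - c) ^+ 2.
    rewrite !mulr_sumr -sumrN -!big_split/=; apply: eq_bigr => i _; ring.
  nonneg.
have [S0'|S0'] := eqVneq S 0.
  have si i : A i -> s i = 0.
    move=> Ai; apply/eqP; rewrite eq_le s0 andbT -S0'.
    by rewrite /S (bigD1 i)//= lerDl sumr_ge0.
  have -> : X = 0 by rewrite /X big1// => i /si ->; rewrite mul0r.
  by rewrite S0' expr0n mul0r.
have Sp : 0 < S by rewrite lt_neqAle eq_sym S0'.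
have := key (X / S).
rewrite (_ : _ + _ = Q - X ^+ 2 / S); last by field.
by rewrite subr_ge0 ler_pdivrMr// mulrC.
Qed.

End weighted_sums.

Section interpolation.
Context (R : realType) (theta : R -> R -> R).
Hypothesis theta_interp : interpolation_function theta.

Lemma theta00 : theta 0 0 = 0.
Proof.
have := theta_homogeneous theta_interp (ltr0n R 2) (lexx 0) (lexx 0).
by rewrite mulr0; lra.
Qed.

Lemma theta_diag s : 0 <= s -> theta s s = s.
Proof.
rewrite le_eqVlt => /orP[/eqP <-|s0]; first exact: theta00.
have := theta_homogeneous theta_interp s0 (ler01) (ler01).
by rewrite !mulr1 (theta11 theta_interp) mulr1.
Qed.

Lemma theta_mono2 a b a' b' : 0 <= a -> 0 <= b -> a <= a' -> b <= b' ->
  theta a b <= theta a' b'.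
Proof.
move=> a0 b0 aa bb.
apply: (le_trans (theta_mono theta_interp b0 a0 aa)).
have a'0 := le_trans a0 aa; have b'0 := le_trans b0 bb.
rewrite (theta_sym theta_interp b0 a'0) (theta_sym theta_interp b'0 a'0).
exact: (theta_mono theta_interp).
Qed.

(** By monotonicity theta is at least its value at (m, m), m the minimum, and on the diagonal
    homogeneity with theta 1 1 = 1 gives theta m m = m. *)
Lemma theta_ge_min a b : 0 <= a -> 0 <= b -> Num.min a b <= theta a b.
Proof.
move=> a0 b0; rewrite -[leLHS]theta_diag ?le_min ?a0//.
by apply: theta_mono2; rewrite ?le_min ?a0 ?ge_min ?lexx ?orbT.
Qed.

Lemma theta_le_add a b : 0 <= a -> 0 <= b -> theta a b <= a + b.
Proof.
move=> a0 b0; rewrite -[leRHS]theta_diag ?addr_ge0//.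
by apply: theta_mono2; rewrite ?lerDl ?lerDr.
Qed.

(** Homogeneity turns theta (f, g) into g * theta (f / g, 1), where the second factor is a monotone
    function of one variable; at points with g = 0 it is f * theta (1, 0). *)
Lemma measurable_theta d (T : measurableType d) (D : set T) (f g : T -> R) :
  measurable D -> measurable_fun D f -> measurable_fun D g ->
  (forall x, D x -> 0 <= f x) -> (forall x, D x -> 0 <= g x) ->
  measurable_fun D (fun x => theta (f x) (g x)).
Proof.
move=> mD mf mg f0 g0.
pose h (a : R) := theta (Num.max 0 a) 1.
have mh : mble h.
  apply: nondecreasing_measurable => // x y xy.
  apply: theta_mono2 => //; first by rewrite le_max lexx.
  by rewrite ge_max !le_max lexx xy orbT.
have E : {in D, (fun x => if 0 < g x then g x * h (f x / g x) else f x * theta 1 0)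
    =1 (fun x => theta (f x) (g x))}.
  move=> x /set_mem Dx; case: ifPn => gx.
    rewrite /h (max_idPr _) ?divr_ge0 ?f0 ?g0//.
    rewrite -(theta_homogeneous theta_interp gx) ?divr_ge0 ?f0 ?g0//.
    by rewrite mulr1 mulrC divfK// gt_eqF.
  have -> : g x = 0 by apply/eqP; rewrite eq_le g0// leNgt gx.
  have := f0 x Dx; rewrite le_eqVlt => /orP[/eqP <-|fx]; first by rewrite mul0r theta00.
  by rewrite -(theta_homogeneous theta_interp fx)// mulr1 mulr0.
apply: eq_measurable_fun E _.
apply: measurable_fun_if => //.
- exact: measurable_fun_ltr.
- apply: measurable_funM; first by apply: measurable_funS mg => //; exact: subIsetl.
  apply: measurableT_comp => //; apply: measurable_funM.
    by apply: measurable_funS mf => //; exact: subIsetl.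
  apply: measurable_invr; last by apply: measurable_funS mg => //; exact: subIsetl.
  exact: (measurable_fun_ltr (@measurable_cst _ _ _ _ D (0 : R)) mg).
- apply: measurable_funM => //; apply: measurable_funS mf => //; exact: subIsetl.
Qed.

End interpolation.

Section velocity.
Context (R : realType).
Implicit Types (x th c K m : R).

(** Here x is a flux, th a value of theta and c the weight of an edge. Where th or c vanishes, the
    hypotheses force x = 0, so that the convention [x / 0 = 0] does no harm. *)
Lemma velocity_flux x th c K m : 0 <= K -> 0 <= m -> m <= th -> 0 <= c ->
  x ^+ 2 <= K * m -> (c <= 0 -> x = 0) -> th * (x / (th * c)) * c = x.
Proof.
move=> K0 m0 mth c0 xK cx.
have [c0'|cn0] := eqVneq c 0; first by rewrite c0' mulr0 cx// c0'.
have [th0|thn0] := eqVneq th 0; last by field; rewrite cn0 thn0.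
have m00 : m = 0 by apply/eqP; rewrite eq_le m0 andbT -th0.
have : x ^+ 2 <= 0 by rewrite (le_trans xK)// m00 mulr0.
rewrite le_eqVlt ltNge sqr_ge0 orbF sqrf_eq0 => /eqP ->.
by rewrite !mul0r mulr0 mul0r.
Qed.

(** The energy equals x^2 / (th c) where th and c are positive, and x^2 <= K m <= K th. Elsewhere it
    is 0 by the convention [x / 0 = 0]. *)
Lemma velocity_energy x th c K m : 0 <= K -> 0 <= m -> m <= th -> 0 <= c ->
  x ^+ 2 <= K * m -> (x / (th * c)) ^+ 2 * th * c <= K * c^-1.
Proof.
move=> K0 m0 mth c0 xK.
have [c0'|cn0] := eqVneq c 0; first by rewrite c0' invr0 !mulr0.
have [th0|thn0] := eqVneq th 0; first by rewrite th0 mulr0 mul0r mulr_ge0 ?invr_ge0.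
have thp : 0 < th by rewrite lt_neqAle eq_sym thn0 (le_trans m0).
rewrite (_ : _ * th * c = x ^+ 2 / th / c); last by field; rewrite cn0 thn0.
rewrite ler_wpM2r ?invr_ge0// ler_pdivrMr//; apply: (le_trans xK).
by rewrite ler_wpM2l.
Qed.

End velocity.

Lemma integral_cst01 (R : realType) (c : R) :
  (\int[@lebesgue_measure R]_(t in `[0%R, 1%R]) c%:E = c%:E)%E.
Proof.
rewrite integral_cst// -[RHS]mule1; congr (_ * _)%E; exact: lebesgue_itv01.
Qed.

Lemma integral_affine01 (R : realType) (c k : R) (f : R -> R) : 0 <= c -> 0 <= k ->
  measurable_fun (`[0, 1] : set R) f -> (forall t, t \in `[0, 1] -> 0 <= f t) ->
  (\int[@lebesgue_measure R]_(t in `[0%R, 1%R]) (c + k * f t)%:E =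
   c%:E + k%:E * \int[@lebesgue_measure R]_(t in `[0%R, 1%R]) (f t)%:E)%E.
Proof.
move=> c0 k0 mf f0; under eq_integral do rewrite EFinD EFinM.
have f0' t : `[0, 1]%classic t -> (0 <= (f t)%:E)%E by nonneg.
rewrite ge0_integralD//=; last 2 first.
- by move=> t t01; rewrite mule_ge0// f0'.
- by apply/measurable_EFinP/measurable_funM.
rewrite integral_cst01 ge0_integralZl//; mea.
Qed.

Lemma cvg_mx_coord (R : realType) (T : Type) (F : set_system T) (FF : Filter F)
    m n (f : T -> 'M[R]_(m, n)) (l : 'M[R]_(m, n)) :
  (forall i j, f x i j @[x --> F] --> l i j) -> f x @[x --> F] --> l.
Proof.
move=> fl; apply/cvg_ballP => e e0.
have := @filter_forall T ('I_m * 'I_n)%type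
  (fun ij x => ball (l ij.1 ij.2) e (f x ij.1 ij.2)) F FF.
move=> /(_ _) h; apply: filterS (h _) => [x hx|[i j]].
  by split=> // i j; exact: (hx (i, j)).
by have /cvg_ballP := fl i j; exact.
Qed.

Section flow_mixture.
Context (R : realType) (n : nat) (q : 'M[R]_n).
Variables (C : R) (P : 'I_n -> 'I_n -> R -> 'I_n -> R)
  (J : 'I_n -> 'I_n -> R -> 'I_n -> 'I_n -> R).
Hypotheses (C0 : 0 <= C) (fs : flow_system q C P J).
Local Notation pair := ('I_n * 'I_n)%type.
Implicit Types (s : pair -> R) (t : R).

Definition mix_dens s t a : R := \sum_(ij : pair) s ij * P ij.1 ij.2 t a.
Definition mix_flux s t a b : R := \sum_(ij : pair) s ij * J ij.1 ij.2 t a b.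
(** Pairs on the diagonal carry no flux by [fs_diag], so only this mass enters the energy. *)
Definition off_diag s : R := \sum_(ij : pair | ij.1 != ij.2) s ij.

Lemma off_diag_ge0 s : (forall ij, 0 <= s ij) -> 0 <= off_diag s.
Proof. by move=> s0; exact: sumr_ge0. Qed.

Lemma mix_dens_ge0 s t a : (forall ij, 0 <= s ij) -> 0 <= t -> 0 <= mix_dens s t a.
Proof. by move=> s0 t0; apply: sumr_ge0 => ij _; rewrite mulr_ge0// (fs_ge0 fs). Qed.

Lemma mix_dens_sum s t : \sum_a mix_dens s t a = \sum_ij s ij.
Proof.
rewrite exchange_big/=; apply: eq_bigr => ij _.
by rewrite -mulr_sumr (fs_sum fs) mulr1.
Qed.

Lemma mix_flux_anti s t a b : mix_flux s t a b = - mix_flux s t b a.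
Proof.
by rewrite -sumrN; apply: eq_bigr => ij _; rewrite (fs_anti fs) mulrN.
Qed.

Lemma mix_flux_supp s t a b : q a b <= 0 -> mix_flux s t a b = 0.
Proof. by move=> qab; rewrite /mix_flux big1// => ij _; rewrite (fs_supp fs)// mulr0. Qed.

Lemma mix_flux_stop s t a b : 2^-1 <= t -> mix_flux s t a b = 0.
Proof. by move=> t2; rewrite /mix_flux big1// => ij _; rewrite (fs_stop fs)// mulr0. Qed.

Lemma is_derive_mix_dens s t a :
  is_derive (t : R^o) 1 (fun t => mix_dens s t a) (\sum_b mix_flux s t a b).
Proof.
rewrite exchange_big/=.
rewrite /mix_dens; elim: (index_enum _) => [|ij r IH].
  rewrite big_nil; have -> : (fun t => \sum_(ij <- [::]) s ij * P ij.1 ij.2 t a) = cst 0.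
    by apply/funext => u; rewrite big_nil.
  exact: is_derive_cst.
rewrite big_cons; have -> : (fun t => \sum_(ij <- ij :: r) s ij * P ij.1 ij.2 t a) =
  (cst (s ij) * (fun t => P ij.1 ij.2 t a)) + (fun t => \sum_(ij <- r) s ij * P ij.1 ij.2 t a).
  by apply/funext => u; rewrite big_cons.
have h := is_deriveD (is_deriveM (is_derive_cst (s ij : R^o) (t : R^o) 1)
  (fs_derive fs ij.1 ij.2 a t)) IH.
apply: (is_derive_eq h); rewrite /GRing.scale/= mulr0 addr0.
by rewrite mulr_sumr.
Qed.

Lemma mix_flux_continuous s a b : continuous (fun t => mix_flux s t a b).
Proof.
rewrite /mix_flux => t; elim: (index_enum _) => [|ij r IH].
  under [X in continuous_at _ X]eq_fun do rewrite big_nil.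
  exact: cvg_cst.
under [X in continuous_at _ X]eq_fun do rewrite big_cons.
apply: cvgD => //; apply: cvgM; first exact: cvg_cst.
exact: (fs_continuous fs).
Qed.

Lemma mix_dens_continuous s a : continuous (fun t => mix_dens s t a).
Proof.
move=> t; apply: (@differentiable_continuous _ R^o R^o); apply/derivable1_diffP.
by have [] := is_derive_mix_dens s t a.
Qed.

(** Cauchy-Schwarz over the pairs off the diagonal; the restriction to these pairs produces the
    factor [off_diag s], which makes the energy proportional to the mass that changes node. *)
Lemma mix_flux_bound s t a b : (forall ij, 0 <= s ij) -> 0 <= t ->
  mix_flux s t a b ^+ 2 <=
  (C * off_diag s) * Num.min (mix_dens s t a) (mix_dens s t b).
Proof.
move=> s0 t0.
have -> : mix_flux s t a b = \sum_(ij : pair | ij.1 != ij.2) s ij * J ij.1 ij.2 t a b.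
  rewrite /mix_flux [LHS](bigID (fun ij : pair => ij.1 == ij.2))/= big1 ?add0r//.
  by move=> [i j] /= /eqP <-; rewrite (fs_diag fs) mulr0.
apply: (le_trans (weighted_cauchy_schwarz _ _ s0)).
rewrite -/(off_diag s) [C * _]mulrC -mulrA; apply: ler_wpM2l; first exact: off_diag_ge0.
have h c : (forall ij, J ij.1 ij.2 t a b ^+ 2 <= C * P ij.1 ij.2 t c) ->
    \sum_(ij : pair | ij.1 != ij.2) s ij * J ij.1 ij.2 t a b ^+ 2 <= C * mix_dens s t c.
  move=> hJ; rewrite /mix_dens mulr_sumr [leRHS](bigID (fun ij : pair => ij.1 != ij.2))/=.
  rewrite ler_wpDr//; last first.
    by apply: ler_sum => ij _; rewrite [leRHS]mulrCA; apply: ler_wpM2l.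
  by apply: sumr_ge0 => ij _; rewrite !mulr_ge0// (fs_ge0 fs).
rewrite /Num.min; case: ifP => _; apply: h => ij;
  apply: (le_trans (fs_bound fs _ _ _ _ t0)); apply: ler_wpM2l => //;
  by rewrite ge_min lexx ?orbT.
Qed.

End flow_mixture.

Section graph_cost.
Context (R : realType) (n : nat) (q : 'M[R]_n) (theta : R -> R -> R).
Hypotheses (q_ge0 : forall i j, 0 <= q i j) (theta_interp : interpolation_function theta).
Local Notation leb := (@lebesgue_measure R).

Definition graph_integrand (p : R -> 'rV[R]_n) (v : R -> 'M[R]_n) (t : R) : R :=
  2^-1 * \sum_(i < n) \sum_(j < n) v t i j ^+ 2 * theta (p t 0 i) (p t 0 j) * q i j.

Definition graph_cost p v : \bar R :=
  (\int[leb]_(t in `[0%R, 1%R]) (graph_integrand p v t)%:E)%E.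

Lemma graph_integrand_ge0 p v t : graph_prob (p t) -> 0 <= graph_integrand p v t.
Proof.
move=> [p0 _]; apply: mulr_ge0; rewrite//.
apply: sumr_ge0 => i _; apply: sumr_ge0 => j _; apply: mulr_ge0 => //.
by apply: mulr_ge0; [exact: sqr_ge0|exact: (theta_ge0 theta_interp)].
Qed.

Lemma graph_cost_ge0 p v : graph_continuity_equation q theta p v ->
  (0 <= graph_cost p v)%E.
Proof.
move=> gce; apply: integral_ge0 => t t01; rewrite lee_fin graph_integrand_ge0//.
exact: gce_prob gce _ t01.
Qed.

Definition graph_costs (p0 p1 : 'rV[R]_n) : set \bar R :=
  [set w | exists p v, [/\ graph_continuity_equation q theta p v, p 0 = p0, p 1 = p1 &
    w = graph_cost p v]].

Lemma W_graph_sq p0 p1 : (W_graph q theta p0 p1 ^+ 2)%E = ereal_inf (graph_costs p0 p1).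
Proof.
rewrite /W_graph sqr_sqrte//; apply: le_ereal_inf_tmp => _ [p [v [gce _ _ ->]]].
exact: graph_cost_ge0.
Qed.

Lemma W_graph_sq_ge0 p0 p1 : (0 <= W_graph q theta p0 p1 ^+ 2)%E.
Proof.
rewrite W_graph_sq; apply: le_ereal_inf_tmp => _ [p [v [gce _ _ ->]]].
exact: graph_cost_ge0.
Qed.

Lemma gce_coord_continuous p v i : graph_continuity_equation q theta p v ->
  {within `[0, 1], continuous (fun t => p t 0 i)}.
Proof.
move=> gce t; apply: (@continuous_comp _ _ _ (p : subspace `[0, 1] -> _)
  (fun x : 'rV[R]_n => x 0 i)); first exact: (gce_continuous gce).
exact: coord_continuous.
Qed.

Lemma gce_coord_measurable p v i : graph_continuity_equation q theta p v ->
  measurable_fun (`[0, 1] : set R) (fun t => p t 0 i).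
Proof.
move=> gce; apply: subspace_continuous_measurable_fun => //.
exact: gce_coord_continuous gce.
Qed.

Lemma gce_theta_measurable p v i j : graph_continuity_equation q theta p v ->
  measurable_fun (`[0, 1] : set R) (fun t => theta (p t 0 i) (p t 0 j)).
Proof.
move=> gce; apply: (measurable_theta theta_interp) => //;
  do ?[exact: gce_coord_measurable gce];
  by move=> t t01; have [+ _] := gce_prob gce t01; exact.
Qed.

Lemma gce_v_measurable p v i j : graph_continuity_equation q theta p v ->
  measurable_fun (`[0, 1] : set R) (fun t => v t i j).
Proof.
move=> gce; apply: (measurableT_comp (measurable_coord i j)).
exact: gce_measurable gce.
Qed.

Lemma graph_integrand_measurable p v : graph_continuity_equation q theta p v ->
  measurable_fun (`[0, 1] : set R) (graph_integrand p v).
Proof.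
move=> gce; apply: measurable_funM => //.
apply: measurable_sum => i; apply: measurable_sum => j.
apply: measurable_funM => //; apply: measurable_funM; last exact: gce_theta_measurable gce.
by apply: measurable_funX; exact: gce_v_measurable gce.
Qed.

End graph_cost.

Section graph_upper_bound.
Context (R : realType) (n : nat) (q : 'M[R]_n) (theta : R -> R -> R).
Hypotheses (q_ge0 : forall i j, 0 <= q i j) (q_symmetric : symmetric_graph q) (theta_interp : interpolation_function theta).
Variables (C : R) (P : 'I_n -> 'I_n -> R -> 'I_n -> R)
  (J : 'I_n -> 'I_n -> R -> 'I_n -> 'I_n -> R).
Hypotheses (C0 : 0 <= C) (fs : flow_system q C P J).
Local Notation pair := ('I_n * 'I_n)%type.
Local Notation leb := (@lebesgue_measure R).

(** Absent edges contribute nothing, because [0^-1 = 0]. *)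
Definition inverse_weights : R := \sum_(a < n) \sum_(b < n) (q a b)^-1.

Lemma inverse_weights_ge0 : 0 <= inverse_weights.
Proof. by apply: sumr_ge0 => a _; apply: sumr_ge0 => b _; rewrite invr_ge0. Qed.

Definition mix_curve (s : pair -> R) (t : R) : 'rV[R]_n := \row_a mix_dens P s t a.

Definition mix_velocity (s : pair -> R) (t : R) : 'M[R]_n :=
  \matrix_(a, b) (mix_flux J s t a b /
    (theta (mix_dens P s t a) (mix_dens P s t b) * q a b)).

Variable s : pair -> R.
Hypotheses (s0 : forall ij, 0 <= s ij) (s1 : \sum_ij s ij = 1).

Let dens0 t a : 0 <= t -> 0 <= mix_dens P s t a.
Proof. exact: mix_dens_ge0 fs _ _ _ s0. Qed.

Let min0 t a b : 0 <= t -> 0 <= Num.min (mix_dens P s t a) (mix_dens P s t b).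
Proof. by move=> t0; rewrite le_min !dens0. Qed.

Let CO : 0 <= C * off_diag s.
Proof. by rewrite mulr_ge0 ?off_diag_ge0. Qed.

Let q_le0 a b : q a b <= 0 -> q b a <= 0.
Proof. by rewrite q_symmetric. Qed.

Lemma mix_velocity_flux t a b : 0 <= t ->
  theta (mix_dens P s t a) (mix_dens P s t b) * mix_velocity s t a b * q a b =
  mix_flux J s t a b.
Proof.
move=> t0; rewrite mxE; apply: (velocity_flux CO (min0 a b t0)) => //.
- exact: theta_ge_min (dens0 _ t0) (dens0 _ t0).
- exact: mix_flux_bound C0 fs _ _ _ _ s0 t0.
- exact: mix_flux_supp fs _ _ _ _.
Qed.

Lemma mix_velocity_energy t a b : 0 <= t ->
  mix_velocity s t a b ^+ 2 * theta (mix_dens P s t a) (mix_dens P s t b) * q a b <=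
  C * off_diag s * (q a b)^-1.
Proof.
move=> t0; rewrite mxE; apply: (velocity_energy CO (min0 a b t0)) => //.
- exact: theta_ge_min (dens0 _ t0) (dens0 _ t0).
- exact: mix_flux_bound C0 fs _ _ _ _ s0 t0.
Qed.

Lemma mix_graph_prob t : 0 <= t -> graph_prob (mix_curve s t).
Proof.
move=> t0; split=> [i|]; first by rewrite mxE dens0.
under eq_bigr do rewrite mxE.
by rewrite (mix_dens_sum fs).
Qed.

Lemma mix_gce : graph_continuity_equation q theta (mix_curve s) (mix_velocity s).
Proof.
have d_cont a : continuous (fun t => mix_dens P s t a) by exact: mix_dens_continuous fs _ _.
have f_cont a b : continuous (fun t => mix_flux J s t a b) by exact: mix_flux_continuous fs _ _ _.
have md (D : set R) a : measurable D -> measurable_fun D (fun t => mix_dens P s t a).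
  by move=> mD; apply: measurable_funTS; exact: continuous_measurable_fun.
have mf (D : set R) a b : measurable D -> measurable_fun D (fun t => mix_flux J s t a b).
  by move=> mD; apply: measurable_funTS; exact: continuous_measurable_fun.
have flux_theta t a b : 0 <= t ->
    theta (mix_curve s t 0 a) (mix_curve s t 0 b) * mix_velocity s t a b =
    mix_flux J s t a b / q a b.
  move=> t0; rewrite !mxE.
  have [qab|qab] := eqVneq (q a b) 0; first by rewrite qab invr0 mulr0 invr0 !mulr0.
  by have := mix_velocity_flux a b t0; rewrite mxE => h; rewrite -[in RHS]h mulfK.
split.
- by move=> t; rewrite in_itv/= => /andP[t0 _]; exact: mix_graph_prob.
- apply: continuous_subspaceT => t; apply: cvg_mx_coord => i j.
  rewrite mxE; under eq_fun do rewrite mxE.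
  exact: d_cont.
- apply: measurable_fun_mx => // a b.
  have -> : (fun t => mix_velocity s t a b) = (fun t => mix_flux J s t a b /
      (theta (mix_dens P s t a) (mix_dens P s t b) * q a b)).
    by apply/funext => t; rewrite mxE.
  apply: measurable_funM; first exact: mf.
  apply: measurable_invr => //; apply: measurable_funM => //.
  apply: (measurable_theta theta_interp) => //; do ?exact: md;
    by move=> t /=; rewrite in_itv/= => /andP[t0 _]; exact: dens0.
- move=> a b; have E : {in `]0 : R, 1 : R[%classic, (fun t => mix_flux J s t a b / q a b) =1
      (fun t => theta (mix_curve s t 0 a) (mix_curve s t 0 b) * mix_velocity s t a b)}.
    by move=> t; rewrite inE/= in_itv/= => /andP[/ltW t0 _]; rewrite flux_theta.
  split.
  + by apply: eq_measurable_fun E _; apply: measurable_funM => //; exact: mf.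
  + exact: interval_open.
  + move=> K KD cK.
    have -> : (\int[leb]_(t in K) `|theta (mix_curve s t 0%R a) (mix_curve s t 0%R b) *
        mix_velocity s t a b|%:E = \int[leb]_(t in K) `|mix_flux J s t a b / q a b|%:E)%E.
      by apply: eq_integral => t /set_mem Kt; rewrite -E// inE; exact: KD.
    have /integrableP[_] : leb.-integrable K (EFin \o (fun t => mix_flux J s t a b / q a b)).
      apply: continuous_compact_integrable => //; apply: continuous_subspaceT => t.
      by apply: cvgM; [exact: f_cont|exact: cvg_cst].
    by [].
- move=> phi i [sphi cphi supphi].
  have phi_out t : ~ (`]0, 1[%classic t) -> phi t = 0.
    move=> t01; apply/eqP/negPn/negP => pt; apply: t01; apply: supphi.
    exact: subset_closure.
  have phi0 : phi 0 = 0 by apply: phi_out; rewrite /= in_itv/= ltxx.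
  have phi1 : phi 1 = 0 by apply: phi_out; rewrite /= in_itv/= ltxx andbF.
  have /Ck_succE[cphi' dphi Cphi] := sphi 1.
  have Dphi t : is_derive (t : R^o) 1 phi (derive1 phi t).
    by rewrite derive1E; exact/derivableP.
  have cdphi : continuous (derive1 phi).
    rewrite (_ : derive1 phi = 'D_1 (phi : R^o -> R^o)); last by apply/funext => t; rewrite derive1E.
    exact: Ck_continuous (Cphi 1).
  pose fl t := \sum_b mix_flux J s t i b.
  have cfl : continuous fl.
    move=> t; rewrite /fl; elim: (index_enum _) => [|b r IH].
      under [X in continuous_at _ X]eq_fun do rewrite big_nil.
      exact: cvg_cst.
    under [X in continuous_at _ X]eq_fun do rewrite big_cons.
    by apply: cvgD => //; exact: f_cont.
  have mT (f : R -> R) (D : set R) : continuous f -> measurable D -> measurable_fun D (EFin \o f).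
    by move=> cf mD; apply/measurable_EFinP; apply: measurable_funTS; exact: continuous_measurable_fun.
  have cM (f g : R -> R) : continuous f -> continuous g -> continuous (fun t => f t * g t).
    by move=> cf cg t; apply: cvgM; [exact: cf|exact: cg].
  have i01 (f : R -> R) : continuous f ->
      (\int[leb]_(t in `]0%R, 1%R[) (f t)%:E = \int[leb]_(t in `[0%R, 1%R]) (f t)%:E)%E.
    by move=> cf; rewrite [RHS]integral_itv_bndoo//; apply: mT.
  have int01 (f : R -> R) : continuous f -> leb.-integrable `[0, 1] (EFin \o f).
    by move=> cf; apply: itv01_integrable; exact: continuous_subspaceT.
  transitivity (\int[leb]_(t in `[0%R, 1%R]) (mix_dens P s t i * derive1 phi t)%:E)%E.
    by under eq_integral do rewrite mxE; rewrite i01//; exact: cM.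
  have -> : ((2^-1)%:E * \sum_(j < n) \int[leb]_(t in `]0%R, 1%R[)
       (phi t * (theta (mix_curve s t 0%R i) (mix_curve s t 0%R j) *
          (mix_velocity s t i j - mix_velocity s t j i) * q i j))%:E =
     \int[leb]_(t in `[0%R, 1%R]) (phi t * fl t)%:E)%E.
    (* The flux is antisymmetric while theta and q are symmetric, so the difference v_ij - v_ji
       doubles the flux; the factor 1/2 undoes this. *)
    transitivity ((2^-1)%:E * \sum_(j < n) \int[leb]_(t in `[0%R, 1%R])
        (2 * (phi t * mix_flux J s t i j))%:E)%E.
      congr (_ * _)%E; apply: eq_bigr => j _.
      rewrite -i01; last by apply: (cM); [move=> t; exact: cvg_cst|exact: cM].
      apply: eq_integral => t; rewrite inE/= in_itv/= => /andP[/ltW t0 _]; congr EFin.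
      rewrite [RHS]mulrCA; congr (_ * _).
      rewrite mulrBr mulrBl [X in X * _ - _]flux_theta//.
      have -> : theta (mix_curve s t 0 i) (mix_curve s t 0 j) =
                theta (mix_curve s t 0 j) (mix_curve s t 0 i).
        by rewrite (theta_sym theta_interp)//; rewrite mxE dens0.
      rewrite flux_theta// [q j i]q_symmetric -mulrBl.
      have -> : mix_flux J s t j i = - mix_flux J s t i j by exact: mix_flux_anti fs _ _ _ _.
      have [qij|qij] := eqVneq (q i j) 0; last by field.
      by rewrite qij mulr0 (mix_flux_supp fs) ?qij// mulr0.
    rewrite -integral_sum//; last first.
      by move=> j; apply: int01; apply: (cM); [move=> t; exact: cvg_cst|exact: cM].
    rewrite -integralZl//; last first.
      by apply: integrable_sum => //= j _; apply: int01; apply: (cM); [move=> t; exact: cvg_cst|exact: cM].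
    apply: eq_integral => t _; rewrite sumEFin -EFinM; congr EFin.
    by rewrite -mulr_sumr mulKf// /fl mulr_sumr.
  (* The integral of this derivative over [0, 1] vanishes, since phi is 0 at both ends: this is the
     weak equation. *)
  have Dd t : is_derive (t : R^o) 1 (fun t => mix_dens P s t i * phi t)
      (mix_dens P s t i * derive1 phi t + phi t * fl t).
    have h := is_deriveM (is_derive_mix_dens fs s t i) (Dphi t).
    have -> : (fun t => mix_dens P s t i * phi t) = (mix_dens P s)^~ i * phi by [].
    by apply: (is_derive_eq h); rewrite /GRing.scale.
  have := FTC_is_derive ltr01 Dd.
  rewrite phi0 phi1 !mulr0 -EFinB subrr => /(_ _)/wrap[].
    by apply: continuous_subspaceT => t; apply: cvgD; exact: cM.
  move=> h; rewrite -[RHS]add0e -[0%E in RHS]h.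
  under [in RHS]eq_integral do rewrite EFinD.
  rewrite integralD//; [|by apply: int01; exact: cM..].
  rewrite addeK//; apply: integrable_fin_num => //; apply: int01; exact: cM.
Qed.

(** With s a coupling of two probability vectors, the mixed elementary flows start at its first
    marginal and end at its second. *)
Lemma W_graph_mix : (W_graph q theta
    (\row_a \sum_(ij : pair | ij.1 == a) s ij)%R (\row_a \sum_(ij : pair | ij.2 == a) s ij)%R ^+ 2
    <= (2^-1 * (C * off_diag s * inverse_weights))%:E)%E.
Proof.
rewrite W_graph_sq//.
have E0 : mix_curve s 0 = \row_a \sum_(ij : pair | ij.1 == a) s ij.
  apply/rowP => a; rewrite !mxE big_mkcond; apply: eq_bigr => ij _.
  by rewrite (fs_start fs); case: eqVneq => _; rewrite ?mulr1 ?mulr0.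
have E1 : mix_curve s 1 = \row_a \sum_(ij : pair | ij.2 == a) s ij.
  apply/rowP => a; rewrite !mxE big_mkcond; apply: eq_bigr => ij _.
  by rewrite (fs_end fs) ?invf_le1 ?ler1n//; case: eqVneq => _; rewrite ?mulr1 ?mulr0.
apply: (@le_trans _ _ (graph_cost q theta (mix_curve s) (mix_velocity s))).
  by apply: ereal_inf_lbound; exists (mix_curve s), (mix_velocity s); split=> //; exact: mix_gce.
rewrite /graph_cost -[leRHS]integral_cst01; apply: le_integral_nonmeas_in => t;
    rewrite /= in_itv/= => /andP[t0 _]; rewrite lee_fin.
  by apply: graph_integrand_ge0 => //; exact: mix_graph_prob.
rewrite /graph_integrand; apply: ler_wpM2l; first nonneg.
rewrite /inverse_weights mulr_sumr; apply: ler_sum => a _.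
rewrite mulr_sumr; apply: ler_sum => b _.
by have := mix_velocity_energy a b t0; rewrite !mxE.
Qed.

End graph_upper_bound.

Section graph_bounds.
Context (R : realType) (n : nat) (q : 'M[R]_n) (theta : R -> R -> R).
Hypotheses (q_ge0 : forall i j, 0 <= q i j) (q_symmetric : symmetric_graph q) (q_connected : connected_graph q) (theta_interp : interpolation_function theta).
Local Notation leb := (@lebesgue_measure R).

Definition node_mass (j : 'I_n) : 'rV[R]_n := \row_a (a == j)%:R.

(** Any two probability vectors are joined by the flows mixed according to their product coupling,
    whose off-diagonal mass is at most 1. *)
Lemma W_graph_bounded : exists2 C, 0 <= C & forall p p', graph_prob p -> graph_prob p' ->
  (W_graph q theta p p' ^+ 2 <= C%:E)%E.
Proof.
have [C [P [J [C0 fs]]]] := flow_systemP q_connected q_symmetric.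
exists (2^-1 * (C * inverse_weights q)).
  by rewrite !mulr_ge0//// inverse_weights_ge0.
move=> p p' [p0 p1] [p0' p1'].
pose s (ij : 'I_n * 'I_n) := p 0 ij.1 * p' 0 ij.2.
have s0 ij : 0 <= s ij by rewrite mulr_ge0.
have s1 : \sum_ij s ij = 1.
  by rewrite -(pair_bigA _ (fun i j => p 0 i * p' 0 j))/= -big_distrlr/= p1 p1' mulr1.
have off1 : off_diag s <= 1.
  rewrite -s1 /off_diag [leRHS](bigID (fun ij : 'I_n * 'I_n => ij.1 != ij.2))/=.
  by rewrite lerDl sumr_ge0.
have := W_graph_mix q_ge0 q_symmetric theta_interp C0 fs s0 s1.
have -> : \row_a \sum_(ij : 'I_n * 'I_n | ij.1 == a) s ij = p.
  apply/rowP => a; rewrite mxE /s.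
  rewrite (eq_bigl (fun ij => pred1 a ij.1 && xpredT ij.2)); last by move=> [? ?]; rewrite /= andbT.
  rewrite -(pair_big (pred1 a) xpredT (fun i j => p 0 i * p' 0 j))/= big_pred1_eq.
  by rewrite -mulr_sumr p1' mulr1.
have -> : \row_a \sum_(ij : 'I_n * 'I_n | ij.2 == a) s ij = p'.
  apply/rowP => a; rewrite mxE /s.
  rewrite -(pair_big xpredT (pred1 a) (fun i j => p 0 i * p' 0 j))/=.
  under eq_bigr do rewrite big_pred1_eq.
  by rewrite -mulr_suml p1 mul1r.
move=> h; apply: (le_trans h); rewrite lee_fin.
apply: ler_wpM2l; first nonneg.
apply: ler_wpM2r; first exact: inverse_weights_ge0.
by rewrite ler_piMr.
Qed.

Lemma node_mass_prob j : graph_prob (node_mass j).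
Proof.
split=> [i|]; first by rewrite mxE ler0n.
under eq_bigr do rewrite mxE.
by rewrite (bigD1 j)//= eqxx big1 ?addr0// => i /negPf ->.
Qed.

Lemma W_graph_refl j : (W_graph q theta (node_mass j) (node_mass j) ^+ 2 = 0)%E.
Proof.
have [C [P [J [C0 fs]]]] := flow_systemP q_connected q_symmetric.
pose s (ij : 'I_n * 'I_n) : R := (ij == (j, j))%:R.
have s0 ij : 0 <= s ij by [].
have s1 : \sum_ij s ij = 1.
  by rewrite (bigD1 (j, j))//= /s eqxx big1 ?addr0// => i /negPf ->.
have := W_graph_mix q_ge0 q_symmetric theta_interp C0 fs s0 s1.
have h (f : 'I_n * 'I_n -> 'I_n) : f (j, j) = j ->
    \row_a \sum_(ij : 'I_n * 'I_n | f ij == a) s ij = node_mass j.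
  move=> fj; apply/rowP => a; rewrite !mxE.
  have [->|aj] := eqVneq a j.
    rewrite (bigD1 (j, j))/=; last by rewrite fj.
    by rewrite /s eqxx big1 ?addr0// => i /andP[_ /negPf ->].
  rewrite big1// => ij /eqP fij; rewrite /s; case: eqVneq => // e.
  by move: aj; rewrite -fij e fj eqxx.
rewrite (h fst)// (h snd)// /off_diag big1; last first.
  by move=> ij ne; rewrite /s; case: eqVneq => // e; rewrite e eqxx in ne.
rewrite mulr0 mul0r mulr0 => h0; apply/eqP; rewrite eq_le h0.
exact: W_graph_sq_ge0.
Qed.

(* Testing the equation with a cutoff in time; by Young's inequality the flux
   [theta |v| q] is at most [delta q + theta v^2 q / delta]. *)
Lemma young_flux (x delta th c : R) : 0 < delta -> 0 <= th -> th <= 1 -> 0 <= c ->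
  th * `|x| * c <= 2^-1 * (delta * c + delta^-1 * (x ^+ 2 * th * c)).
Proof.
move=> d0 th0 th1 c0.
have h : 2 * `|x| <= delta + delta^-1 * x ^+ 2.
  rewrite -subr_ge0 (_ : _ - _ = delta^-1 * (delta - `|x|) ^+ 2).
    nonneg.
  by rewrite -(normr_id x) -[x ^+ 2]real_normK ?num_real// normr_id; field; rewrite gt_eqF.
rewrite ler_pdivlMl//.
have th' : th * (2 * `|x|) * c <= th * (delta + delta^-1 * x ^+ 2) * c.
  by rewrite ler_wpM2r// ler_wpM2l.
have dc : th * (delta * c) <= delta * c by rewrite ler_piMl// mulr_ge0// ltW.
rewrite (_ : 2 * _ = th * (2 * `|x|) * c); last by ring.
apply: (le_trans th'); rewrite (_ : _ * c = th * (delta * c) + delta^-1 * (x ^+ 2 * th * c)).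
  by rewrite lerD2r.
by ring.
Qed.

Lemma flux_young (p : 'rV[R]_n) (v : 'M[R]_n) (phi : R) i delta :
  (forall i, 0 <= p 0 i) -> \sum_(i < n) p 0 i = 1 -> 0 <= phi -> phi <= 1 -> 0 < delta ->
  2^-1 * (\sum_(j < n) `|phi * (theta (p 0 i) (p 0 j) * (v i j - v j i) * q i j)|) <=
  delta * (\sum_(a < n) \sum_(b < n) q a b) +
  delta^-1 * (2^-1 * \sum_(a < n) \sum_(b < n) v a b ^+ 2 * theta (p 0 a) (p 0 b) * q a b).
Proof.
move=> p0 p1 phi0 phi1 d0.
have th0 a b : 0 <= theta (p 0 a) (p 0 b) by exact: (theta_ge0 theta_interp).
have ple a : p 0 a <= 1 by rewrite -p1 (bigD1 a)//= lerDl sumr_ge0.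
have th1 a b : theta (p 0 a) (p 0 b) <= 1.
  by rewrite -[leRHS](theta11 theta_interp); apply: (theta_mono2 theta_interp).
pose g a b := theta (p 0 a) (p 0 b) * `|v a b| * q a b.
have g0 a b : 0 <= g a b by rewrite !mulr_ge0.
have hj j : `|phi * (theta (p 0 i) (p 0 j) * (v i j - v j i) * q i j)| <= g i j + g j i.
  rewrite normrM (ger0_norm phi0) !normrM (ger0_norm (th0 _ _)) (ger0_norm (q_ge0 _ _)).
  apply: (@le_trans _ _ (theta (p 0 i) (p 0 j) * `|v i j - v j i| * q i j)).
    by rewrite ler_piMl// !mulr_ge0.
  rewrite /g (theta_sym theta_interp (p0 i) (p0 j)) (q_symmetric j i) -mulrDl -mulrDr.
  by rewrite ler_wpM2r// ler_wpM2l// ler_normB.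
have row f : (forall a b, 0 <= f a b) -> \sum_(j < n) f i j <= \sum_(a < n) \sum_(b < n) f a b :> R.
  by move=> f0; rewrite [leRHS](bigD1 i)//= lerDl sumr_ge0// => a _; nonneg.
have S : \sum_(j < n) `|phi * (theta (p 0 i) (p 0 j) * (v i j - v j i) * q i j)| <=
    2 * \sum_(a < n) \sum_(b < n) g a b.
  apply: (@le_trans _ _ (\sum_(j < n) (g i j + g j i))); first by apply: ler_sum => j _; exact: hj.
  rewrite big_split/= mulr_natl mulr2n lerD ?row//.
  by rewrite [leRHS]exchange_big/=; exact: (row (fun a b => g b a)).
rewrite ler_pdivrMl//; apply: (le_trans S); rewrite ler_pM2l//.
apply: (@le_trans _ _ (\sum_(a < n) \sum_(b < n) 2^-1 * (delta * q a b +
    delta^-1 * (v a b ^+ 2 * theta (p 0 a) (p 0 b) * q a b)))).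
  by apply: ler_sum => a _; apply: ler_sum => b _; exact: young_flux.
under eq_bigr do rewrite -mulr_sumr big_split/= -!mulr_sumr.
rewrite -mulr_sumr big_split/= -!mulr_sumr mulrDr lerD//; last by rewrite mulrCA.
rewrite ler_piMl ?invf_le1 ?ler1n//; apply: mulr_ge0; first exact: ltW.
nonneg.
Qed.

(** The tested integral is bounded by delta Q + cost / delta for every cutoff, so
    [endpoint_difference_le] applies to t -> p_i(t). The parameter delta stays free and is chosen
    where the bound is used. *)
Lemma gce_lower p v i delta : graph_continuity_equation q theta p v -> 0 < delta ->
  ((delta * (`|p 1 0 i - p 0 0 i| - delta * \sum_(a < n) \sum_(b < n) q a b))%:E <=
   graph_cost q theta p v)%E.
Proof.
move=> gce d0.
have := graph_cost_ge0 q_ge0 theta_interp gce.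
case E : (graph_cost q theta p v) => [c| |] // c0; last by rewrite leey.
rewrite lee_fin mulrC -ler_pdivlMr// lerBlDr.
set Q := \sum_(a < n) _.
apply: (endpoint_difference_le (m := fun t => p t 0 i)) => [|e e0 e4].
  exact: gce_coord_continuous gce.
have mp j := gce_coord_measurable j gce.
have mth a b := gce_theta_measurable theta_interp a b gce.
have mv a b := gce_v_measurable a b gce.
have mcut : measurable_fun (`[0, 1] : set R) (cutoff e).
  apply: measurable_funTS; apply: continuous_measurable_fun.
  exact: Ck_continuous (Ck_cutoff 0 e).
have mdcut : measurable_fun (`[0, 1] : set R) (derive1 (cutoff e)).
  by apply: measurable_funTS; apply: continuous_measurable_fun; exact: cutoff_derive_continuous.
pose f j t := cutoff e t * (theta (p t 0 i) (p t 0 j) * (v t i j - v t j i) * q i j).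
have mf j : measurable_fun (`[0, 1] : set R) (f j).
  apply: measurable_funM => //; apply: measurable_funM => //; apply: measurable_funM => //.
  mea.
have itv_ends (g : R -> R) : measurable_fun (`[0, 1] : set R) g ->
    (\int[leb]_(t in `]0%R, 1%R[) (g t)%:E = \int[leb]_(t in `[0%R, 1%R]) (g t)%:E)%E.
  move=> mg; rewrite [RHS]integral_itv_bndoo//; apply/measurable_EFinP.
  by apply: measurable_funS mg => //; apply: subset_itv; rewrite bnd_simp.
rewrite -itv_ends; last mea.
rewrite (gce_weak gce) ?abseN; last exact: test_function_cutoff.
rewrite abseM gee0_abs//.
apply: (@le_trans _ _ ((2^-1)%:E * \sum_(j < n) \int[leb]_(t in `[0%R, 1%R]) `|f j t|%:E)%E).
  apply: lee_wpmul2l; first nonneg.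
  apply: (le_trans (lee_abs_sum _ _ _)); apply: lee_sum => j _.
  rewrite (itv_ends (f j))//; exact: abse_integral_le.
have maf j : measurable_fun (`[0, 1] : set R) (fun t => `|f j t|) by exact: measurableT_comp.
rewrite -ge0_integral_sum//; last first.
  by move=> j; apply/measurable_EFinP; exact: maf.
rewrite -ge0_integralZl//; last 2 first.
- by apply: emeasurable_sum => j; apply/measurable_EFinP; exact: maf.
- nonneg.
have Q0 : 0 <= Q by apply: sumr_ge0 => a _; exact: sumr_ge0.
have g0 t : t \in `[0, 1] -> 0 <= graph_integrand q theta p v t.
  by move=> t01; apply: graph_integrand_ge0 => //; exact: gce_prob gce _ t01.
apply: (@le_trans _ _ (\int[leb]_(t in `[0%R, 1%R])
    (delta * Q + delta^-1 * graph_integrand q theta p v t)%:E)%E); last first.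
  rewrite integral_affine01//; last 3 first.
  - nonneg.
  - nonneg.
  - exact: graph_integrand_measurable.
  rewrite -/(graph_cost q theta p v) E -EFinM -EFinD lee_fin.
  by rewrite addrC [c / _]mulrC.
apply: le_integral_nonmeas_in => t t01.
  apply: mule_ge0; rewrite//.
  nonneg.
rewrite sumEFin -EFinM lee_fin.
have [p0 p1] := gce_prob gce t01.
by apply: flux_young => //; [exact: cutoff_ge0|exact: cutoff_le1].
Qed.

Lemma W_graph_lower (p p' : 'rV[R]_n) i delta : 0 < delta ->
  ((delta * (`|p' 0 i - p 0 i| - delta * \sum_(a < n) \sum_(b < n) q a b))%:E <=
   W_graph q theta p p' ^+ 2)%E.
Proof.
move=> d0; rewrite W_graph_sq//; apply: le_ereal_inf_tmp => _ [P [v [gce <- <- ->]]].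
exact: gce_lower.
Qed.

End graph_bounds.

Lemma integral_lincomb d (T : measurableType d) (R : realType)
    (mu : {measure set T -> \bar R}) (D : set T) (mD : measurable D) (f g : T -> R) (a b : R) :
  mu.-integrable D (EFin \o f) -> mu.-integrable D (EFin \o g) ->
  (\int[mu]_(x in D) (a * f x + b * g x)%:E =
   (a * fine (\int[mu]_(x in D) (f x)%:E) + b * fine (\int[mu]_(x in D) (g x)%:E))%:E)%E.
Proof.
move=> If Ig; rewrite EFinD !EFinM !fineK; do ?[exact: integrable_fin_num].
rewrite -!integralZl// -integralD//; do ?exact: integrableZl.
Qed.

Lemma lebesgue_lincomb (R : realType) (D : set R) (f g : R -> R) (a b : R) :
  let leb := @lebesgue_measure R in
  measurable D -> leb.-integrable D (EFin \o f) -> leb.-integrable D (EFin \o g) ->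
  (\int[leb]_(x in D) (a * f x + b * g x)%:E =
   (a * fine (\int[leb]_(x in D) (f x)%:E) + b * fine (\int[leb]_(x in D) (g x)%:E))%:E)%E.
Proof. by move=> leb mD If Ig; apply: integral_lincomb. Qed.

(** * Convexity of the squared graph distance *)

Section mixing_curves.
Context (R : realType) (n : nat) (q : 'M[R]_n) (theta : R -> R -> R).
Hypotheses (q_ge0 : forall i j, 0 <= q i j) (theta_interp : interpolation_function theta).
Local Notation leb := (@lebesgue_measure R).
Variables (a b : R).
Hypotheses (a0 : 0 <= a) (b0 : 0 <= b) (ab1 : a + b = 1).

Lemma theta_concave_sum s t s' t' : 0 <= s -> 0 <= t -> 0 <= s' -> 0 <= t' ->
  a * theta s t + b * theta s' t' <= theta (a * s + b * s') (a * t + b * t').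
Proof.
move=> s0 t0 s0' t0'; have -> : b = 1 - a by rewrite -ab1 addrC addKr.
by apply: (theta_concave theta_interp) => //; rewrite -ab1 lerDl.
Qed.

(** The fluxes are averaged, not the velocities, because the continuity equation is linear in the
    flux; Th stands for theta of the mixed masses. *)
Definition mixed_velocity (x y th th' Th : R) : R := (a * (th * x) + b * (th' * y)) / Th.

Lemma mixed_velocity_flux x y th th' Th : 0 <= th -> 0 <= th' ->
  a * th + b * th' <= Th -> Th * mixed_velocity x y th th' Th = a * (th * x) + b * (th' * y).
Proof.
move=> th0 th0' le; rewrite /mixed_velocity.
have [T0|T0] := eqVneq Th 0; last by field.
have ath : 0 <= a * th by nonneg.
have bth : 0 <= b * th' by nonneg.
have : a * th = 0 by lra.
have : b * th' = 0 by lra.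
by rewrite T0 mul0r !mulrA => -> ->; rewrite !mul0r addr0.
Qed.

(** Joint convexity of flux^2 / theta, followed by the concavity of theta in the form of the last
    hypothesis. The defect in the convexity is a th * b th' * (x - y)^2. *)
Lemma mixed_velocity_energy x y th th' Th : 0 <= th -> 0 <= th' ->
  a * th + b * th' <= Th ->
  mixed_velocity x y th th' Th ^+ 2 * Th <= a * (x ^+ 2 * th) + b * (y ^+ 2 * th').
Proof.
move=> th0 th0' le; rewrite /mixed_velocity.
have ath : 0 <= a * th by nonneg.
have bth : 0 <= b * th' by nonneg.
have rhs0 : 0 <= a * (x ^+ 2 * th) + b * (y ^+ 2 * th').
  nonneg.
have [T0|T0] := eqVneq Th 0; first by rewrite T0 mulr0.
have Tp : 0 < Th by lra.
rewrite (_ : _ * Th = (a * (th * x) + b * (th' * y)) ^+ 2 / Th); last by field.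
rewrite ler_pdivrMr//.
apply: (@le_trans _ _ ((a * (x ^+ 2 * th) + b * (y ^+ 2 * th')) * (a * th + b * th'))); last first.
  by rewrite ler_wpM2l.
rewrite -subr_ge0 (_ : _ - _ = (a * th) * (b * th') * (x - y) ^+ 2); last by ring.
nonneg.
Qed.

Variables (p p' : R -> 'rV[R]_n) (v v' : R -> 'M[R]_n).
Hypotheses (gce : graph_continuity_equation q theta p v)
  (gce' : graph_continuity_equation q theta p' v').

Definition mixed_curve t : 'rV[R]_n := a *: p t + b *: p' t.

Definition mixed_field t : 'M[R]_n := \matrix_(i, j)
  mixed_velocity (v t i j) (v' t i j) (theta (p t 0 i) (p t 0 j))
    (theta (p' t 0 i) (p' t 0 j)) (theta (mixed_curve t 0 i) (mixed_curve t 0 j)).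

Let th0 t i j : t \in `[0, 1] -> 0 <= theta (p t 0 i) (p t 0 j).
Proof.
by move=> t01; have [p0 _] := gce_prob gce t01; exact: (theta_ge0 theta_interp).
Qed.

Let th0' t i j : t \in `[0, 1] -> 0 <= theta (p' t 0 i) (p' t 0 j).
Proof.
by move=> t01; have [p0 _] := gce_prob gce' t01; exact: (theta_ge0 theta_interp).
Qed.

Let thle t i j : t \in `[0, 1] -> a * theta (p t 0 i) (p t 0 j) +
  b * theta (p' t 0 i) (p' t 0 j) <= theta (mixed_curve t 0 i) (mixed_curve t 0 j).
Proof.
move=> t01; have [p0 _] := gce_prob gce t01; have [p0' _] := gce_prob gce' t01.
by rewrite !mxE; exact: theta_concave_sum.
Qed.

Lemma mixed_flux t i j : t \in `[0, 1] ->
  theta (mixed_curve t 0 i) (mixed_curve t 0 j) * mixed_field t i j =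
  a * (theta (p t 0 i) (p t 0 j) * v t i j) + b * (theta (p' t 0 i) (p' t 0 j) * v' t i j).
Proof.
move=> t01; rewrite [mixed_field _ _ _]mxE mixed_velocity_flux//.
- exact: th0.
- exact: th0'.
- exact: thle.
Qed.

Let sub01 : `]0 : R, 1 : R[%classic `<=` `[0 : R, 1 : R]%classic.
Proof. by apply: subset_itv; rewrite bnd_simp. Qed.

Lemma locally_integrableZ (k : R) (D : set R) (f : R -> R) :
  locally_integrable D f -> locally_integrable D (fun t => k * f t).
Proof.
move=> [mf oD hK]; split=> // [|K KD cK]; first mea.
have mD : measurable D by exact: open_measurable.
have mK : measurable K.
  by apply: closed_measurable; apply: compact_closed => //; exact: Rhausdorff.
under eq_integral do rewrite normrM EFinM.
rewrite ge0_integralZl//; last first.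
  by apply/measurable_EFinP; apply: measurableT_comp => //; exact: measurable_funS mf.
have := hK K KD cK.
have : (0 <= \int[leb]_(x in K) `|f x|%:E)%E by nonneg.
by case: (\int[leb]_(x in K) _)%E => // r _ _; rewrite -EFinM ltry.
Qed.

Lemma gce_test_integrable pp vv (phi : R -> R) i j :
  graph_continuity_equation q theta pp vv -> @test_function R R^o `]0, 1[ phi ->
  leb.-integrable `]0, 1[
    (EFin \o (fun t => phi t * (theta (pp t 0 i) (pp t 0 j) * vv t i j))).
Proof.
move=> G [sphi cphi supphi].
pose K := closure [set x | phi x != 0].
have cont : continuous phi by exact: Ck_continuous (sphi 0).
have [mf oD hK] := gce_integrable G i j.
have mphi D : measurable D -> measurable_fun D phi.
  by move=> mD; apply: measurable_funTS; exact: continuous_measurable_fun.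
have mg : measurable_fun (`]0, 1[ : set R)
    (fun t => phi t * (theta (pp t 0 i) (pp t 0 j) * vv t i j)).
  by apply: measurable_funM => //; exact: mphi.
apply/integrableP; split; first mea.
have [M [Mr hM]] := compact_bounded (continuous_compact (continuous_subspaceT cont) cphi).
have M1 : `|M| + 1 > M by rewrite (le_lt_trans (ler_norm _))// ltrDl.
have phiM t : K t -> `|phi t| <= `|M| + 1.
  by move=> Kt; apply: (hM _ M1); exists t.
have -> : (\int[leb]_(t in `]0%R, 1%R[)
    `|(EFin \o (fun t => phi t * (theta (pp t 0 i) (pp t 0 j) * vv t i j))%R) t| =
    \int[leb]_(t in K) `|phi t * (theta (pp t 0 i) (pp t 0 j) * vv t i j)|%:E)%E.
  rewrite integral_mkcond [RHS]integral_mkcond; apply: eq_integral => t _; rewrite !patchE.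
  case: ifPn => t01.
    case: ifPn => // /negP tK; have pt0 : phi t = 0.
      by apply/eqP/negPn/negP => pt; apply: tK; apply/mem_set/subset_closure.
    by rewrite /= pt0 mul0r normr0.
  case: ifPn => // /set_mem /supphi tt; by case/negP: t01; exact/mem_set.
apply: le_lt_trans (_ : (\int[leb]_(t in K) ((`|M| + 1) *
    `|theta (pp t 0 i) (pp t 0 j) * vv t i j|)%:E < +oo)%E).
  apply: le_integral_nonmeas_in => t Kt; rewrite ?lee_fin// normrM.
  by rewrite ler_wpM2r// phiM.
have [_ _ /(_ K supphi cphi)] := locally_integrableZ (`|M| + 1) (gce_integrable G i j).
by under eq_integral do rewrite normrM (ger0_norm (addr_ge0 (normr_ge0 _) ler01)).
Qed.

Lemma mixed_gce : graph_continuity_equation q theta mixed_curve mixed_field.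
Proof.
have P t : t \in `[0, 1] -> graph_prob (mixed_curve t).
  move=> t01; have [p0 p1] := gce_prob gce t01; have [p0' p1'] := gce_prob gce' t01.
  split=> [i|]; first by rewrite !mxE addr_ge0 ?mulr_ge0.
  under eq_bigr do rewrite !mxE.
  by rewrite big_split/= -!mulr_sumr p1 p1' !mulr1.
have mcoord i : measurable_fun (`[0, 1] : set R) (fun t => mixed_curve t 0 i).
  have -> : (fun t => mixed_curve t 0 i) = (fun t => a * p t 0 i + b * p' t 0 i).
    by apply/funext => t; rewrite !mxE.
  apply: measurable_funD; apply: measurable_funM => //.
    exact: gce_coord_measurable gce.
  exact: gce_coord_measurable gce'.
have E i j : {in `]0 : R, 1 : R[%classic,
    (fun t => a * (theta (p t 0 i) (p t 0 j) * v t i j) +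
      b * (theta (p' t 0 i) (p' t 0 j) * v' t i j)) =1
    (fun t => theta (mixed_curve t 0 i) (mixed_curve t 0 j) * mixed_field t i j)}.
  by move=> t /set_mem t01; rewrite mixed_flux//; exact: sub01.
split=> //.
- have cZ (k : R) (f : R -> 'rV[R]_n) : {within `[0, 1], continuous f} ->
      {within `[0, 1], continuous (fun t => k *: f t)}.
    move=> cf t; apply: (@continuous_comp _ _ _ (f : subspace `[0, 1] -> _)
      (fun x : 'rV[R]_n => k *: x)); [exact: cf|exact: scaler_continuous].
  have ca := cZ a _ (gce_continuous gce); have cb := cZ b _ (gce_continuous gce').
  by move=> t; exact: (@continuousD _ _ _ _ _ t (ca t) (cb t)).
- apply: measurable_fun_mx => // i j.
  have -> : (fun t => mixed_field t i j) = (fun t =>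
      (a * (theta (p t 0 i) (p t 0 j) * v t i j) +
      b * (theta (p' t 0 i) (p' t 0 j) * v' t i j)) /
      theta (mixed_curve t 0 i) (mixed_curve t 0 j)).
    by apply/funext => t; rewrite mxE.
  apply: measurable_funM.
    apply: measurable_funD; apply: measurable_funM => //; apply: measurable_funM.
    + exact: gce_theta_measurable gce.
    + exact: gce_v_measurable gce.
    + exact: gce_theta_measurable gce'.
    + exact: gce_v_measurable gce'.
  apply: measurable_invr => //; apply: (measurable_theta theta_interp) => // t t01;
    by have [+ _] := P t t01; exact.
- move=> i j.
  have := locally_integrableD (locally_integrableZ a (gce_integrable gce i j))
    (locally_integrableZ b (gce_integrable gce' i j)).
  move=> [mf oD hK]; split=> // [|K KD cK]; first exact: eq_measurable_fun (E i j) mf.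
  apply: le_lt_trans (hK K KD cK); rewrite [leLHS](_ : _ = (\int[leb]_(x in K)
      `|(fun t => a * (theta (p t 0 i) (p t 0 j) * v t i j)) x +
        (fun t => b * (theta (p' t 0 i) (p' t 0 j) * v' t i j)) x|%:E)%E)//.
  by apply: eq_integral => t /set_mem Kt; rewrite -E//; apply/mem_set/KD.
- move=> phi i tphi; have [sphi _ _] := tphi.
  have /Ck_succE[_ _ Cphi] := sphi 1.
  have cdphi : continuous (derive1 phi).
    rewrite (_ : derive1 phi = 'D_1 (phi : R^o -> R^o)); last by apply/funext => t; rewrite derive1E.
    exact: Ck_continuous (Cphi 1).
  have [D DE mD] : exists2 D : set R, D = `]0 : R, 1 : R[%classic & measurable D.
    by exists `]0 : R, 1 : R[%classic.
  have D01 : D `<=` `[0 : R, 1 : R]%classic by rewrite DE; exact: sub01.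
  have It pp vv (G : graph_continuity_equation q theta pp vv) j k :=
    gce_test_integrable j k G tphi.
  have GW pp vv (G : graph_continuity_equation q theta pp vv) := gce_weak G i tphi.
  rewrite -DE in It GW *.
  have Iw pp vv : graph_continuity_equation q theta pp vv -> forall j : 'I_n,
      leb.-integrable D (EFin \o (fun t => phi t * (theta (pp t 0 i) (pp t 0 j) *
        (vv t i j - vv t j i) * q i j))).
    move=> G j.
    have I1 : leb.-integrable D (fun t =>
       ((q i j)%:E * (phi t * (theta (pp t 0%R i) (pp t 0%R j) * vv t i j))%:E -
       (q i j)%:E * (phi t * (theta (pp t 0%R j) (pp t 0%R i) * vv t j i))%:E)%E).
      by apply: integrableB => //; apply: integrableZl => //; exact: It.
    apply: eq_integrable I1 => // t /set_mem /D01 t01; have [pp0 _] := gce_prob G t01.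
    rewrite (theta_sym theta_interp (pp0 i) (pp0 j)) -!EFinM -EFinB; congr EFin => /=; ring.
  have Ip pp vv : graph_continuity_equation q theta pp vv ->
      leb.-integrable D (EFin \o (fun t => pp t 0 i * derive1 phi t)).
    move=> G; apply: (@integrableS _ _ _ leb _ D _ _ _ D01) => //.
    apply: itv01_integrable; apply: within_continuousM; first exact: gce_coord_continuous G.
    exact: continuous_subspaceT.
  have Ifin (f : R -> R) : leb.-integrable D (EFin \o f) ->
      (\int[leb]_(t in D) (f t)%:E = (fine (\int[leb]_(t in D) (f t)%:E))%:E)%E.
    by move=> If; rewrite fineK//; exact: integrable_fin_num.
  have Wk pp vv (G : graph_continuity_equation q theta pp vv) :
      fine (\int[leb]_(t in D) (pp t 0%R i * derive1 phi t)%:E)%E =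
      - (2^-1 * \sum_(j < n) fine (\int[leb]_(t in D)
        (phi t * (theta (pp t 0%R i) (pp t 0%R j) * (vv t i j - vv t j i) * q i j))%:E)%E).
    rewrite (GW _ _ G); under eq_bigr do rewrite (Ifin _ (Iw _ _ G _)).
    by rewrite sumEFin -EFinM.
  transitivity ((\int[leb]_(t in D) (a * (p t 0%R i * derive1 phi t) +
      b * (p' t 0%R i * derive1 phi t))%:E)%E).
    by apply: eq_integral => t _; rewrite !mxE; congr EFin; ring.
  rewrite (lebesgue_lincomb _ _ mD (Ip _ _ gce) (Ip _ _ gce')) (Wk _ _ gce) (Wk _ _ gce').
  rewrite (eq_bigr (fun j => (a * fine (\int[leb]_(t in D)
        (phi t * (theta (p t 0%R i) (p t 0%R j) * (v t i j - v t j i) * q i j))%:E)%E +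
      b * fine (\int[leb]_(t in D)
        (phi t * (theta (p' t 0%R i) (p' t 0%R j) * (v' t i j - v' t j i) * q i j))%:E)%E)%:E)).
    rewrite sumEFin -EFinM big_split/= -!mulr_sumr; congr EFin; ring.
  move=> j _; rewrite -(lebesgue_lincomb _ _ mD (Iw _ _ gce j) (Iw _ _ gce' j)).
  apply: eq_integral => t /set_mem /D01 t01; congr EFin.
  have [P0 _] := P t t01; have [p0 _] := gce_prob gce t01; have [p0' _] := gce_prob gce' t01.
  rewrite mulrBr mixed_flux//.
  rewrite [in X in _ * ((_ - X) * _)](theta_sym theta_interp (P0 j) (P0 i)) mixed_flux//.
  rewrite (theta_sym theta_interp (p0 i) (p0 j)) (theta_sym theta_interp (p0' i) (p0' j)).
  ring.
Qed.

Lemma mixed_cost : (graph_cost q theta mixed_curve mixed_field <=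
  a%:E * graph_cost q theta p v + b%:E * graph_cost q theta p' v')%E.
Proof.
have g0 pp vv : graph_continuity_equation q theta pp vv -> forall t, `[0, 1]%classic t ->
    (0 <= (graph_integrand q theta pp vv t)%:E)%E.
  move=> G t t01; rewrite lee_fin; apply: graph_integrand_ge0 => //; exact: gce_prob G _ t01.
have mg pp vv : graph_continuity_equation q theta pp vv ->
    measurable_fun `[0 : R, 1 : R]%classic (fun t => (graph_integrand q theta pp vv t)%:E).
  by move=> G; apply/measurable_EFinP; exact: graph_integrand_measurable.
rewrite /graph_cost -ge0_integralZl//; [|exact: mg|exact: g0].
rewrite -ge0_integralZl//; [|exact: mg|exact: g0].
rewrite -ge0_integralD//; last 4 first.
- by move=> t t01; rewrite mule_ge0// (g0 _ _ gce).
- by apply: measurable_funeM; exact: mg.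
- by move=> t t01; rewrite mule_ge0// (g0 _ _ gce').
- by apply: measurable_funeM; exact: mg.
apply: le_integral_nonmeas_in => t t01; first exact: g0 mixed_gce t t01.
rewrite -!EFinM -EFinD lee_fin /graph_integrand.
rewrite ![_ * (2^-1 * _)]mulrCA -mulrDr ler_wpM2l//.
rewrite !mulr_sumr -big_split/=; apply: ler_sum => i _.
rewrite !mulr_sumr -big_split/=; apply: ler_sum => j _.
rewrite ![_ * (_ * q i j)]mulrA -mulrDl ler_wpM2r// [mixed_field _ _ _]mxE.
apply: mixed_velocity_energy; [exact: th0|exact: th0'|exact: thle].
Qed.

End mixing_curves.

Section graph_convexity.
Context (R : realType) (n : nat) (q : 'M[R]_n) (theta : R -> R -> R).
Hypotheses (q_ge0 : forall i j, 0 <= q i j) (theta_interp : interpolation_function theta).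

(** The infima need not be attained, so curves within e of them are mixed. *)
Lemma W_graph_convex (a b : R) (p0 p1 p0' p1' : 'rV[R]_n) : 0 <= a -> 0 <= b -> a + b = 1 ->
  (W_graph q theta p0 p1 ^+ 2 < +oo)%E -> (W_graph q theta p0' p1' ^+ 2 < +oo)%E ->
  (W_graph q theta (a *: p0 + b *: p0') (a *: p1 + b *: p1') ^+ 2 <=
   a%:E * W_graph q theta p0 p1 ^+ 2 + b%:E * W_graph q theta p0' p1' ^+ 2)%E.
Proof.
move=> a0 b0 ab; rewrite !W_graph_sq// => f f'.
have h pp qq : (0 <= ereal_inf (graph_costs q theta pp qq))%E.
  by rewrite -W_graph_sq//; exact: W_graph_sq_ge0.
have fin pp qq : (ereal_inf (graph_costs q theta pp qq) < +oo)%E ->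
    ereal_inf (graph_costs q theta pp qq) \is a fin_num.
  by move=> F; rewrite ge0_fin_numE.
apply/lee_addgt0Pr => e e0.
have [_ [p [v [gce P0 P1 ->]]] lt] := lb_ereal_inf_adherent e0 (fin _ _ f).
have [_ [p' [v' [gce' P0' P1' ->]]] lt'] := lb_ereal_inf_adherent e0 (fin _ _ f').
have cf : (graph_cost q theta p v < +oo)%E by apply: lt_trans lt _; apply: lte_add_pinfty; rewrite ?ltry.
have cf' : (graph_cost q theta p' v' < +oo)%E by apply: lt_trans lt' _; apply: lte_add_pinfty; rewrite ?ltry.
apply: (@le_trans _ _ (graph_cost q theta (mixed_curve a b p p') (mixed_field theta a b p p' v v'))).
  apply: ereal_inf_lbound; exists (mixed_curve a b p p'), (mixed_field theta a b p p' v v').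
  split=> //; [exact: mixed_gce|by rewrite /mixed_curve P0 P0'|by rewrite /mixed_curve P1 P1'].
apply: (le_trans (mixed_cost q_ge0 theta_interp a0 b0 ab gce gce')) => {cf cf'}.
have [a' ha] : exists r, ereal_inf (graph_costs q theta p0 p1) = r%:E.
  by exists (fine (ereal_inf (graph_costs q theta p0 p1))); rewrite fineK// fin.
have [b' hb] : exists r, ereal_inf (graph_costs q theta p0' p1') = r%:E.
  by exists (fine (ereal_inf (graph_costs q theta p0' p1'))); rewrite fineK// fin.
move: lt lt'; rewrite ha hb => /ltW lt /ltW lt'.
apply: (le_trans (leeD (lee_wpmul2l _ lt) (lee_wpmul2l _ lt'))); rewrite ?lee_fin//.
rewrite [leLHS](_ : _ = a * a' + b * b' + (a + b) * e); last by ring.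
by rewrite ab mul1r.
Qed.

End graph_convexity.

(** * Points of the simplex and the cost of reaching a vertex *)

Section simplex_weights.
Context (R : realType) (n : nat).
Implicit Types r : simplex R n.

Lemma node_weights_prob r : graph_prob (node_weights r).
Proof.
have [r0 r1] : simplex_set (coords r) by exact: set_valP.
split=> [i|].
  by rewrite mxE; case: unlift => [k|]; rewrite// subr_ge0.
rewrite big_ord_recr/= [X in _ + X]mxE unlift_none.
rewrite addrC (eq_bigr (fun k => coords r 0 k)) ?subrK// => k _.
rewrite mxE (_ : widen_ord _ k = lift ord_max k) ?liftK//.
by apply: val_inj => /=; rewrite /bump leqNgt ltn_ord.
Qed.

Lemma node_weights_vertex j : node_weights (vertex R j) = @node_mass R n.+1 j.
Proof.
have cE : coords (vertex R j) = vertex_row R j by [].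
apply/rowP => a; rewrite !mxE cE; case: (unliftP ord_max a) => [k ->|->].
  by rewrite mxE.
under eq_bigr do rewrite mxE.
case: (unliftP ord_max j) => [k ->|->].
  rewrite (bigD1 k)//= eqxx big1 ?addr0 ?subrr ?(negPf (neq_lift _ _))// => i /negPf ik.
  by rewrite (inj_eq lift_inj) ik.
by rewrite big1 ?subr0 ?eqxx// => i _; rewrite eq_sym (negPf (neq_lift _ _)).
Qed.

Lemma coords_continuous : continuous (@coords R n : simplex R n -> 'rV[R]_n).
Proof. exact: (@initial_continuous _ _ (@set_val _ (simplex_set (R:=R) (n:=n)))). Qed.

Lemma node_weights_continuous j : continuous (fun r => node_weights r 0 j).
Proof.
have cc k : continuous (fun r => coords r 0 k).
  move=> r; apply: (@continuous_comp _ _ _ (@coords R n : simplex R n -> _)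
    (fun x : 'rV[R]_n => x 0 k)); [exact: coords_continuous|exact: coord_continuous].
case: (unliftP ord_max j) => [k ->|->].
  rewrite (_ : (fun r => _) = fun r => coords r 0 k)//.
  by apply/funext => r; rewrite mxE liftK.
rewrite (_ : (fun r => _) = fun r => 1 - \sum_(k < n) coords r 0 k); last first.
  by apply/funext => r; rewrite mxE unlift_none.
have cS (s : seq 'I_n) : continuous (fun r => \sum_(k <- s) coords r 0 k).
  elim: s => [|k s IH].
    rewrite (_ : (fun r => _) = cst 0); first by move=> r; exact: cst_continuous.
    by apply/funext => r; rewrite big_nil.
  rewrite (_ : (fun r => _) = (fun r => coords r 0 k + \sum_(k <- s) coords r 0 k)).
    by move=> r; exact: (continuousD (cc k r) (IH r)).
  by apply/funext => r; rewrite big_cons.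
move=> r; apply: (@continuous_comp _ _ _ (fun r => \sum_(k < n) coords r 0 k) (fun x => 1 - x)).
  exact: cS.
by apply: cvgB; [exact: cvg_cst|exact: cvg_id].
Qed.

Lemma continuous_measurable_simplex (f : simplex R n -> R) : continuous f ->
  mble f.
Proof.
move=> cf; apply: (measurability _ (RGenOpens.measurableE R)).
move=> _ [_ [a [b ->] <-]]; rewrite setTI.
by apply: sub_sigma_algebra; apply: open_comp => //; exact: interval_open.
Qed.

Lemma measurable_coords : mble (@coords R n).
Proof.
apply: measurable_fun_mx => // i j; apply: continuous_measurable_simplex => r.
apply: (@continuous_comp _ _ _ (@coords R n : simplex R n -> _)
  (fun x : 'rV[R]_n => x i j)); [exact: coords_continuous|exact: coord_continuous].
Qed.

Lemma measurable_node_weights j : mble (fun r => node_weights r 0 j).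
Proof. exact: continuous_measurable_simplex (@node_weights_continuous j). Qed.

(* [s] is the point with [p' = (1 - eps) p + eps s]. *)
Lemma graph_prob_extend m (p p' : 'rV[R]_m) (eps : R) : graph_prob p -> graph_prob p' ->
  0 < eps -> (forall i, (1 - eps) * p 0 i <= p' 0 i) ->
  exists2 s, graph_prob s & p' = (1 - eps) *: p + eps *: s.
Proof.
move=> [p0 p1] [p0' p1'] e0 h; exists (eps^-1 *: (p' - (1 - eps) *: p)).
  split=> [i|].
    by rewrite !mxE mulr_ge0 ?invr_ge0 ?(ltW e0)// subr_ge0.
  under eq_bigr do rewrite !mxE.
  rewrite -mulr_sumr big_split/= sumrN -mulr_sumr p1 p1' mulr1 opprB addrC subrK.
  by rewrite mulVf// gt_eqF.
by rewrite scalerA divff ?gt_eqF// scale1r addrC subrK.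
Qed.

End simplex_weights.

Section ground_cost.
Context (R : realType) (n : nat) (q : 'M[R]_n.+1) (theta : R -> R -> R).
Hypotheses (q_ge0 : forall i j, 0 <= q i j) (q_symmetric : symmetric_graph q) (q_connected : connected_graph q) (theta_interp : interpolation_function theta).

(** Plans towards a canonical lifting have their targets at vertices, so measurability is needed in
    the first argument only, for finitely many second arguments. *)
Definition node_cost (j : 'I_n.+1) (r : simplex R n) : R :=
  fine (W_graph q theta (node_weights r) (node_mass R j) ^+ 2)%E.

Lemma node_costE j r :
  ((node_cost j r)%:E = W_graph q theta (node_weights r) (node_mass R j) ^+ 2)%E.
Proof.
have [C C0 hC] := W_graph_bounded q_ge0 q_symmetric q_connected theta_interp.
rewrite /node_cost fineK// ge0_fin_numE; last exact: W_graph_sq_ge0.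
apply: le_lt_trans (ltry C); apply: hC; [exact: node_weights_prob|exact: node_mass_prob].
Qed.

Lemma node_cost_ge0 j r : 0 <= node_cost j r.
Proof. by rewrite -lee_fin node_costE; exact: W_graph_sq_ge0. Qed.

Lemma node_cost_bounded : exists2 C, 0 <= C & forall j r, node_cost j r <= C.
Proof.
have [C C0 hC] := W_graph_bounded q_ge0 q_symmetric q_connected theta_interp.
exists C => // j r; rewrite -lee_fin node_costE.
by apply: hC; [exact: node_weights_prob|exact: node_mass_prob].
Qed.

(* [W_graph ^+ 2] is convex and bounded, hence upper semicontinuous on the
   simplex; this provides its measurability. *)
Lemma node_cost_open j c : open [set r | node_cost j r < c].
Proof.
have [C C0 hC] := W_graph_bounded q_ge0 q_symmetric q_connected theta_interp.
rewrite openE => r /= rc; rewrite /interior/=.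
pose gap := c - node_cost j r.
have gap0 : 0 < gap by rewrite subr_gt0.
(* A fraction eps of the mass can then be moved anywhere at cost at most C each, since eps * C stays
   below the gap. *)
pose eps := Num.min 2^-1 (gap / (2 * (C + 1))).
have C1 : 0 < C + 1 by rewrite ltr_wpDl.
have eps0 : 0 < eps by rewrite lt_min invr_gt0 ltr0n divr_gt0// mulr_gt0.
have eps1 : eps <= 2^-1 by rewrite ge_min lexx.
have epsC : eps * C < gap.
  apply: (@le_lt_trans _ _ (gap / (2 * (C + 1)) * C)).
    by rewrite ler_wpM2r// ge_min lexx orbT.
  rewrite -mulrA gtr_pMr// mulrC ltr_pdivrMr//; lra.
(* For s near r the vector s - (1 - eps) r is nonnegative, so s mixes r with some point of the
   simplex. At nodes where r has weight 0 the inequality is free. *)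
have near_r : \forall s \near r, forall i : 'I_n.+1,
    (1 - eps) * node_weights r 0 i <= node_weights s 0 i.
  apply: (@filter_forall _ _ _ (nbhs r)) => i.
  have [r0 _] := node_weights_prob r.
  have := r0 i; rewrite le_eqVlt => /orP[/eqP <-|ri].
    apply: filterE => s; rewrite mulr0; by have [+ _] := node_weights_prob s; exact.
  have lt : (1 - eps) * node_weights r 0 i < node_weights r 0 i.
    by rewrite gtr_pMl// ltrBlDr ltrDl.
  have := @node_weights_continuous R n i r.
  move=> /(_ _ (lt_nbhsr lt)).
  by move=> h; apply: (@filterS _ (nbhs r) _ _ _ _ h) => s /ltW.
near=> s => /=.
have h_rs : forall i, (1 - eps) * node_weights r 0 i <= node_weights s 0 i by near: s.
have [t tp Es] := graph_prob_extend (node_weights_prob r) (node_weights_prob s) eps0 h_rs.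
have mp := @node_mass_prob R n.+1 j.
have fin p : graph_prob p -> (W_graph q theta p (node_mass R j) ^+ 2 < +oo)%E.
  by move=> pp; apply: le_lt_trans (ltry C); exact: hC.
have := W_graph_convex q_ge0 theta_interp (a := 1 - eps) (b := eps) _ _ _
  (fin _ (node_weights_prob r)) (fin _ tp).
rewrite -scalerDl subrK scale1r -Es -!node_costE => /(_ _ _ erefl) h.
have {}h : ((node_cost j s)%:E <= ((1 - eps) * node_cost j r + eps * C)%:E)%E.
  apply: (le_trans (h _ _)); [lra|exact: ltW|].
  rewrite (EFinD (_ * _)) (EFinM (1 - eps)) (EFinM eps); apply: leeD => //; apply: lee_wpmul2l; first nonneg.
  exact: hC.
rewrite lee_fin in h; apply: (le_lt_trans h).
have : eps * node_cost j r >= 0 by rewrite mulr_ge0 ?(ltW eps0)// node_cost_ge0.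
move: epsC; rewrite /gap; lra.
Unshelve. all: end_near.
Qed.

Lemma measurable_node_cost j : mble (node_cost j).
Proof.
apply: (measurability _ (RGenInftyO.measurableE R)).
move=> _ [_ [c ->] <-]; rewrite setTI.
apply: sub_sigma_algebra; rewrite (_ : _ @^-1` _ = [set r | node_cost j r < c]).
  exact: node_cost_open.
by apply/seteqP; split=> r; rewrite /= in_itv.
Qed.

End ground_cost.

(** * Static distances and narrow convergence *)

Section convergence_to_zero.
Context (R : realType).
Local Open Scope ereal_scope.

Lemma cvg0P (x : nat -> \bar R) : (forall k, 0 <= x k) ->
  (x k @[k --> \oo] --> 0 <->
   forall e : R, (0 < e)%R -> \forall k \near \oo, x k <= e%:E).
Proof.
move=> x0; split=> [x_cvg e e0|h].
  have /fine_cvgP[xf xe] := x_cvg.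
  have /cvgrPdist_le/(_ _ e0) := xe.
  apply: filterS2 xf => k xk; rewrite /= sub0r normrN ger0_norm ?fine_ge0//.
  by move=> he; rewrite -(fineK xk) lee_fin.
have xf : \forall k \near \oo, x k \is a fin_num.
  apply: filterS (h _ ltr01) => k xk; rewrite ge0_fin_numE//.
  exact: le_lt_trans xk (ltry _).
apply/fine_cvgP; split=> //; apply/cvgrPdist_le => e e0.
apply: filterS2 xf (h _ e0) => k xk.
by rewrite /= sub0r normrN ger0_norm ?fine_ge0// -{1}(fineK xk) lee_fin.
Qed.

Lemma sqrte_cvg0P (x : nat -> \bar R) : (forall k, 0 <= x k) ->
  (sqrte (x k) @[k --> \oo] --> 0 <->
   forall e : R, (0 < e)%R -> \forall k \near \oo, x k <= e%:E).
Proof.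
move=> x0; rewrite cvg0P; last by move=> k; exact: sqrte_ge0.
split=> h e e0.
  have s0 : (0 < Num.sqrt e)%R by rewrite sqrtr_gt0.
  apply: filterS (h _ s0) => k hk.
  rewrite -(sqr_sqrte (x0 k)) -(sqr_sqrtr (ltW e0)) EFin_expe.
  by rewrite lee_sqr ?sqrte_ge0// lee_fin sqrtr_ge0.
have e2 : (0 < e ^+ 2)%R by rewrite exprn_gt0.
apply: filterS (h _ e2) => k hk.
rewrite -(ger0_norm (ltW e0)) -sqrtr_sqr.
by rewrite -[leRHS]/(sqrte (e ^+ 2)%:E) lee_sqrt// lee_fin sqr_ge0.
Qed.

End convergence_to_zero.

Section canonical_lifting_facts.
Context (R : realType) (d n : nat).
Local Open Scope ereal_scope.
Implicit Types mu : vmeasure R d n.+1.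

Lemma measurable_pair_vertex j :
  mble (fun x : 'rV[R]_d => (x, vertex R j) : lifted R d n).
Proof. by apply: measurable_fun_pair. Qed.

Lemma ge0_integral_canonical mu (f : lifted R d n -> \bar R) :
  mble f -> (forall z, 0 <= f z) ->
  \int[canonical_lifting mu]_z f z = \sum_(j < n.+1) \int[mu j]_x f (x, vertex R j).
Proof.
move=> mf f0; rewrite /canonical_lifting ge0_integral_sum_measure//.
apply: eq_bigr => j _; rewrite fubini_tonelli1//; apply: eq_integral => x _.
rewrite /fubini_F integral_dirac ?diracT ?mul1e//.
mea.
Qed.

Lemma integral_canonical mu (f : lifted R d n -> \bar R) :
  mble f ->
  (forall j, (mu j).-integrable setT (fun x => f (x, vertex R j))) ->
  \int[canonical_lifting mu]_z f z = \sum_(j < n.+1) \int[mu j]_x f (x, vertex R j).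
Proof.
move=> mf fi; rewrite [LHS]integralE !ge0_integral_canonical//; last 2 first.
- exact: measurable_funeneg.
- exact: measurable_funepos.
have Ep i : \int[mu i]_x f^\+ (x, vertex R i) = \int[mu i]_x (fun x => f (x, vertex R i))^\+ x.
  by apply: eq_integral => x _; rewrite !funeposE.
have En i : \int[mu i]_x f^\- (x, vertex R i) = \int[mu i]_x (fun x => f (x, vertex R i))^\- x.
  by apply: eq_integral => x _; rewrite !funenegE.
under eq_bigr do rewrite Ep; under [X in _ - X]eq_bigr do rewrite En.
rewrite -fin_num_sumeN; last by move=> i _; apply: integrable_neg_fin_num => //; exact: fi.
by rewrite -big_split/=; apply: eq_bigr => i _; rewrite [RHS]integralE.
Qed.

Lemma canonical_liftingE mu A : measurable A ->
  canonical_lifting mu A = \sum_(j < n.+1) mu j [set x | A (x, vertex R j)].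
Proof.
move=> mA; rewrite -[in LHS](setIT A) -(integral_indic _ measurableT)//.
rewrite ge0_integral_canonical//; last first.
- mea.
apply: eq_bigr => j _; have mB : measurable [set x | A (x, vertex R j)].
  exact: mble_preimage.
rewrite -[in RHS](setIT [set x | _]) -integral_indic//; apply: eq_integral => x _.

Qed.

Lemma canonical_prob Omega mu : vprob Omega mu -> canonical_lifting mu setT = 1.
Proof. by move=> [_ <-]; rewrite canonical_liftingE. Qed.

Lemma node_weights_vertexE (i j : 'I_n.+1) : node_weights (vertex R i) 0%R j = (j == i)%:R.
Proof. by rewrite node_weights_vertex mxE. Qed.

Lemma canonical_projects mu : projects_to (canonical_lifting mu) mu.
Proof.
move=> j eta ceta [M [Mr hM]].
have meta := continuous_measurable_mx ceta.
have bound x : (`|eta x| <= `|M| + 1)%R.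
  by apply: (hM (`|M| + 1)%R) => //; rewrite (le_lt_trans (ler_norm _))// ltrDl.
have mw : mble (fun z : lifted R d n => node_weights z.2 0%R j).
  by apply: (measurableT_comp (measurable_node_weights j)).
rewrite integral_canonical; last 2 first.
- mea.
- move=> i; apply: (@finite_bounded_integrable _ _ _ _ _ (`|M| + 1)%R).
    by apply: measurable_funM => //; exact: (measurableT_comp mw (measurable_pair_vertex i)).
  move=> x; rewrite normrM node_weights_vertexE; case: (j == i); last first.
    by rewrite normr0 mul0r addr_ge0.
  by rewrite normr1 mul1r.
rewrite (bigD1 j)//= big1 ?adde0; last first.
  move=> i ij; rewrite integral0_eq// => x _.
  by rewrite node_weights_vertexE eq_sym (negPf ij) mul0r.
by apply: eq_integral => x _; rewrite node_weights_vertexE eqxx mul1r.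
Qed.

End canonical_lifting_facts.

Section static_distances.
Context (R : realType) (d n : nat) (q : 'M[R]_n.+1) (theta : R -> R -> R).
Hypotheses (q_ge0 : forall i j, 0 <= q i j) (q_symmetric : symmetric_graph q) (q_connected : connected_graph q) (theta_interp : interpolation_function theta).
Local Open Scope ereal_scope.
Local Notation L := (lifted R d n).
Implicit Types mu nu : vmeasure R d n.+1.

Lemma sqnorm_ge0 m (x : 'rV[R]_m) : (0 <= sqnorm x)%R.
Proof. by apply: sumr_ge0 => k _; exact: sqr_ge0. Qed.

Lemma ground_sqdist_ge0 (z z' : L) : 0 <= ground_sqdist q theta z z'.
Proof. by rewrite adde_ge0 ?lee_fin ?sqnorm_ge0//; exact: W_graph_sq_ge0. Qed.

Lemma transport_cost_ge0 (G : {measure set (L * L) -> \bar R}) :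
  0 <= transport_cost q theta G.
Proof. by apply: integral_ge0 => z _; exact: ground_sqdist_ge0. Qed.

Definition coupling_costs (l1 l2 : {measure set L -> \bar R}) : set \bar R :=
  [set transport_cost q theta G | G in coupling l1 l2].

Lemma coupling_costs_ge0 l1 l2 : 0 <= ereal_inf (coupling_costs l1 l2).
Proof. by apply: le_ereal_inf_tmp => _ [G _ <-]; exact: transport_cost_ge0. Qed.

Lemma D_static_ge0 mu nu : 0 <= D_static q theta mu nu.
Proof.
by apply: le_ereal_inf_tmp => _ [l1 [l2 [_ _ ->]]]; exact: sqrte_ge0.
Qed.

Definition at_vertex (z : L) : Prop := exists j, z.2 = vertex R j.

Lemma vertex_weights (r : simplex R n) j : node_weights r 0%R j = 1%R -> r = vertex R j.
Proof.
move=> rj; have [w0 w1] := node_weights_prob r.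
have wE i : node_weights r 0%R i = (i == j)%:R.
  have [->//|ij] := eqVneq i j; apply/eqP; rewrite eq_le w0 andbT.
  have : (\sum_(a < n.+1) node_weights r 0%R a >= node_weights r 0%R j + node_weights r 0%R i)%R.
    rewrite (bigD1 j)//= lerD2l (bigD1 i)//= lerDl; exact: sumr_ge0.
  by rewrite w1 rj gerDl.
apply: val_inj; apply/rowP => k; have := wE (lift ord_max k).
by rewrite !mxE liftK /= => ->.
Qed.

Lemma measurable_at_vertex : measurable [set z : L | at_vertex z].
Proof.
have -> : [set z : L | at_vertex z] = \bigcup_(j in [set: 'I_n.+1])
    [set z | node_weights z.2 0%R j = 1%R].
  apply/seteqP; split=> [z [j zj]|z [j _ /= /vertex_weights zj]]; last by exists j.
  by exists j => //=; rewrite zj node_weights_vertexE eqxx.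
apply: fin_bigcup_measurable => // j _.
rewrite (_ : [set _ | _] = (fun z : L => node_weights z.2 0%R j) @^-1` [set 1%R])//.
rewrite -[X in measurable X]setTI.
by apply: (measurableT_comp (measurable_node_weights j)).
Qed.

Lemma measurable_in_fst (A : set 'rV[R]_d) : measurable A -> measurable [set z : L | A z.1].
Proof.
move=> mA; rewrite (_ : [set z : L | A z.1] = fst @^-1` A)//.
mea.
Qed.

Lemma canonical_support (Omega : set 'rV[R]_d) mu : measurable Omega -> vprob Omega mu ->
  canonical_lifting mu (~` [set z : L | at_vertex z /\ Omega z.1]) = 0.
Proof.
move=> mO [mu0 _]; rewrite canonical_liftingE; last first.
  apply: measurableC; rewrite -/(_ `&` _); apply: measurableI.
    exact: measurable_at_vertex.
  exact: measurable_in_fst.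
rewrite big1// => j _; rewrite -[RHS](mu0 j); congr (mu j _).
apply/seteqP; split=> x /=; first by move=> h Ox; apply: h; split=> //; exists j.
by move=> h [_].
Qed.

(** Distinct vertices are at Euclidean distance at least 1 while the graph distance is bounded; at a
    common vertex both node terms vanish. *)
Lemma ground_le_lifted : exists2 C : R, (0 <= C)%R & forall z z' : L,
  at_vertex z -> at_vertex z' ->
  ground_sqdist q theta z z' <= (C * lifted_sqdist z z')%:E.
Proof.
have [C C0 hC] := W_graph_bounded q_ge0 q_symmetric q_connected theta_interp.
exists (1 + C)%R; first nonneg.
move=> z z' [i zi] [j zj]; rewrite /ground_sqdist /lifted_sqdist zi zj !node_weights_vertex.
set s := sqnorm (z.1 - z'.1); have s0 : (0 <= s)%R by exact: sqnorm_ge0.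
have [->|ij] := eqVneq i j.
  rewrite W_graph_refl// adde0 lee_fin subrr.
  have -> : sqnorm (0 : 'rV[R]_n) = 0%R by rewrite /sqnorm big1// => k _; rewrite mxE expr0n.
  by rewrite addr0 ler_peMl// lerDl.
have c1 : (1 <= sqnorm (coords (vertex R i) - coords (vertex R j)))%R.
  (* The last node sits at the origin, so of two distinct vertices at least one has a coordinate 1
     where the other has 0. *)
  have key (a b : 'I_n.+1) k : a != b -> a = lift ord_max k ->
      (1 <= sqnorm (vertex_row R a - vertex_row R b))%R.
    move=> ab ak; rewrite /sqnorm (bigD1 k)//= !mxE -ak eqxx (negPf ab) subr0 expr1n.
    by rewrite lerDl sumr_ge0// => l _; exact: sqr_ge0.
  have [k ik|ik] := unliftP ord_max i; first exact: (key _ _ _ ij ik).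
  have [k jk|jk] := unliftP ord_max j; last by rewrite ik jk eqxx in ij.
  rewrite eq_sym in ij; apply: (le_trans (key _ _ _ ij jk)).
  by rewrite le_eqVlt; apply/orP; left; apply/eqP; apply: eq_bigr => l _;
    rewrite !mxE -sqrrN opprB.
apply: (@le_trans _ _ (s%:E + C%:E)).
  by apply: leeD2l; apply: hC; exact: node_mass_prob.
rewrite -EFinD lee_fin mulrDr; apply: lerD; first by rewrite ler_peMl// lerDl.
apply: (@le_trans _ _ (1 + C)%R); first by rewrite lerDr.
by rewrite ler_peMr// addr_ge0.
Qed.

Lemma coupling_fst_null (l1 l2 : {measure set L -> \bar R}) (G : probability (L * L)%type R)
    (D : set L) : measurable D ->
  coupling l1 l2 G -> l1 (~` D) = 0 -> G (~` (fst @^-1` D)) = 0.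
Proof.
move=> mD [h1 _] l0; rewrite -[RHS]l0 -[RHS]h1//; mea.
Qed.

Lemma coupling_snd_null (l1 l2 : {measure set L -> \bar R}) (G : probability (L * L)%type R)
    (D : set L) : measurable D ->
  coupling l1 l2 G -> l2 (~` D) = 0 -> G (~` (snd @^-1` D)) = 0.
Proof.
move=> mD [_ h2] l0; rewrite -[RHS]l0 -[RHS]h2//; mea.
Qed.

Lemma measure_setCI_null d' (T : measurableType d') (m : {measure set T -> \bar R})
  (A B : set T) : measurable A -> measurable B -> m (~` A) = 0 -> m (~` B) = 0 ->
  m (~` (A `&` B)) = 0.
Proof.
move=> mA mB A0 B0; rewrite setCI; apply/eqP; rewrite -measure_le0.
apply: (le_trans (measureU2 m (measurableC mA) (measurableC mB))).
by rewrite [X in X + _]A0 [X in _ + X]B0 adde0.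
Qed.

Lemma measurable_sqnorm m : mble (@sqnorm R m).
Proof.
apply: measurable_sum => k; apply: measurable_funX.
mea.
Qed.

Lemma measurable_mx_sub d' (T : measurableType d') m (f g : T -> 'rV[R]_m) :
  mble f -> mble g -> mble (fun x => f x - g x)%R.
Proof.
move=> mf mg; apply: measurable_fun_mx => // i j.
have -> : (fun x => (f x - g x)%R i j) = (fun x => f x i j - g x i j)%R.
  by apply/funext => x; rewrite !mxE.
mea.
Qed.

Lemma measurable_lifted_sqdist d' (T : measurableType d') (f g : T -> L) :
  mble f -> mble g ->
  mble (fun x => lifted_sqdist (f x) (g x)).
Proof.
move=> mf mg; apply: measurable_funD; apply: (measurableT_comp (@measurable_sqnorm _)).
  by apply: measurable_mx_sub; mea.
apply: measurable_mx_sub; apply: (measurableT_comp (@measurable_coords R n));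
  mea.
Qed.

(* The pushforward of a non-measurable integrand is only estimated. *)
Lemma pushforward_integral_le d1 d2 (X : measurableType d1) (Y : measurableType d2)
    (m : {measure set X -> \bar R}) (P : probability Y R) (phi : X -> Y) (D : set Y)
    (f g : Y -> \bar R) : mble phi ->
  measure_eq P (pushforward m phi) -> measurable D -> m (~` (phi @^-1` D)) = 0 ->
  (forall y, 0 <= f y) -> (forall y, 0 <= g y) -> mble g ->
  (forall y, D y -> f y <= g y) ->
  \int[P]_y f y <= \int[m]_x g (phi x).
Proof.
move=> mphi PE mD mD0 f0 g0 mg fg.
apply: (@le_trans _ _ (\int[P]_y g y)).
  apply: (integral_nonmeas_ae_le mD) => //.
  by rewrite [LHS]PE//; mea.
pose W := wpush m (fun=> ler01) (@measurable_cst _ _ _ _ setT (1%R : R)) mphi.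
rewrite (_ : \int[P]_y g y = \int[W]_y g y); last first.
  apply: eq_measure_integral => A mA _.
  rewrite [LHS]PE//; have mB : measurable (phi @^-1` A).
    mea.
  by rewrite -[RHS]/(\int[m]_(z in phi @^-1` A) (1%R)%:E) integral_cst ?mul1e.
by rewrite ge0_integral_wpush//; under eq_integral do rewrite mul1e.
Qed.

Lemma W2W_le_LOT (Omega : set 'rV[R]_d) (lambda_ref : probability L R)
    (T : vmeasure R d n.+1 -> L -> L) : measurable Omega ->
  unique_optimal_maps q theta lambda_ref T ->
  exists2 C : R, (0 <= C)%R & forall mu nu, vprob2 setT mu -> vprob2 setT nu ->
    vprob Omega mu -> vprob Omega nu ->
  ereal_inf (coupling_costs (canonical_lifting mu) (canonical_lifting nu)) <=
  C%:E * \int[lambda_ref]_z (lifted_sqdist (T mu z) (T nu z))%:E.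
Proof.
move=> mO opt; have [C C0 hC] := ground_le_lifted; exists C => // mu nu mu2 nu2 muO nuO.
have [Gm [[cm _] _ mTm GmE]] := opt _ mu2; have [Gn [[cn _] _ mTn GnE]] := opt _ nu2.
pose phi z := (T mu z, T nu z).
have mphi : mble phi by exact: measurable_fun_pair.
have [G GE] := @mk_probability _ _ _ (pushforward lambda_ref phi) (probability_setT lambda_ref).
have snd_eq (m : vmeasure R d n.+1) (Gam : probability (L * L)%type R) (S : L -> L) : mble S ->
    coupling lambda_ref (canonical_lifting m) Gam ->
    measure_eq Gam (pushforward lambda_ref (fun z => (z, S z))) ->
    forall A, measurable A -> lambda_ref (S @^-1` A) = canonical_lifting m A.
  move=> mS [_ h2] GamE A mA; rewrite -h2// [RHS]GamE//.
  mea.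
have Em := snd_eq _ _ _ mTm cm GmE; have En := snd_eq _ _ _ mTn cn GnE.
have cG : coupling (canonical_lifting mu) (canonical_lifting nu) G.
  by split=> A mA; rewrite /pushforward GE -?Em// -?En.
pose D := [set z : L | at_vertex z /\ Omega z.1].
have mD : measurable D by apply: measurableI; [exact: measurable_at_vertex|exact: measurable_in_fst].
apply: (@le_trans _ _ (transport_cost q theta G)).
  by apply: ereal_inf_lbound; exists G.
have mg : mble (fun z : L * L => (C * lifted_sqdist z.1 z.2)%:E).
  apply/measurable_EFinP; apply: measurable_funM => //.
  by apply: measurable_lifted_sqdist; [mea|mea].
have l0 (z z' : L) : (0 <= lifted_sqdist z z')%R by rewrite addr_ge0// sqnorm_ge0.
rewrite -ge0_integralZl//; last 2 first.
- by apply/measurable_EFinP; exact: measurable_lifted_sqdist.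
- nonneg.
under [leRHS]eq_integral do rewrite -EFinM.
have mD1 : measurable (fst @^-1` D : set (L * L)) by mea.
have mD2 : measurable (snd @^-1` D : set (L * L)) by mea.
have GP : measure_eq G (pushforward lambda_ref phi) by [].
have l0' : lambda_ref (~` (phi @^-1` ((fst @^-1` D) `&` (snd @^-1` D)))) = 0.
  rewrite -/(T mu @^-1` D `&` T nu @^-1` D); apply: measure_setCI_null.
  - exact: mble_preimage.
  - exact: mble_preimage.
  - rewrite -[LHS]/(lambda_ref (T mu @^-1` (~` D))) Em; last mea.
    exact: canonical_support.
  - rewrite -[LHS]/(lambda_ref (T nu @^-1` (~` D))) En; last mea.
    exact: canonical_support.
apply: (pushforward_integral_le mphi GP (measurableI _ _ mD1 mD2) l0'
  (g := fun z => (C * lifted_sqdist z.1 z.2)%:E)) => //.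
- by move=> z; exact: ground_sqdist_ge0.
- nonneg.
- by move=> z [[v1 _] [v2 _]]; exact: hC.
Qed.

End static_distances.

Section weak_convergence.
Context (R : realType) (d n : nat) (q : 'M[R]_n.+1) (theta : R -> R -> R).
Hypotheses (q_ge0 : forall i j, 0 <= q i j) (q_symmetric : symmetric_graph q) (q_connected : connected_graph q) (theta_interp : interpolation_function theta).
Local Open Scope ereal_scope.
Local Notation L := (lifted R d n).
Implicit Types mu nu : vmeasure R d n.+1.

Definition hat_mass mu (j : 'I_n.+1) (N : R) (b : 'I_d -> R) : R :=
  fine (\int[mu j]_x (hat_prod N b x)%:E).

(** Each hat is treated separately, at every scale; uniformity over the finitely many hats that
    cover a cube is recovered where it is needed. *)
Definition hat_converge (mu_ : nat -> vmeasure R d n.+1) mu : Prop :=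
  forall j N b, (0 < N)%R -> forall e : R, (0 < e)%R ->
    \forall k \near \oo, (`|hat_mass (mu_ k) j N b - hat_mass mu j N b| <= e)%R.

Lemma measurable_hat_prod (N : R) b : mble (@hat_prod R d N b).
Proof. exact: (continuous_measurable_mx (@hat_prod_continuous _ _ N b)). Qed.

Lemma hat_integrable (m : {finite_measure set 'rV[R]_d -> \bar R}) N b :
  m.-integrable setT (fun x => (hat_prod N b x)%:E).
Proof.
apply: (@finite_bounded_integrable _ _ _ _ _ 1%R); first exact: measurable_hat_prod.
by move=> x; rewrite ger0_norm ?hat_prod_ge0// hat_prod_le1.
Qed.

Lemma hat_massE mu j N b : (hat_mass mu j N b)%:E = \int[mu j]_x (hat_prod N b x)%:E.
Proof. by rewrite fineK//; apply: integrable_fin_num => //; exact: hat_integrable. Qed.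

(* [a / delta] is the Young bound of [sqrt a] *)
Lemma young_le (x a delta : R) : (0 < delta)%R -> (x ^+ 2 <= a)%R ->
  (`|x| <= delta + delta^-1 * a)%R.
Proof.
move=> d0 xa; apply: (@le_trans _ _ (delta + delta^-1 * x ^+ 2)%R); last first.
  by rewrite lerD2l ler_wpM2l// invr_ge0 ltW.
rewrite -subr_ge0 -[(x ^+ 2)%R]real_normK ?num_real//.
have a0 := normr_ge0 x; move: (`|x|%R) a0 => y y0.
rewrite (_ : _ - _ = delta^-1 * ((delta - y) ^+ 2 + delta * y))%R; last by field; rewrite gt_eqF.
nonneg.
Qed.

(** The node weight varies by at most delta Q + W^2 / delta, and the hat by its Lipschitz bound with
    Young's inequality in each coordinate. A bound affine in the cost, with a constant first term,
    is what can be integrated against a non-measurable cost. *)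
Lemma hat_gap_pointwise N b j : (0 < N)%R -> exists2 K : R, (0 < K)%R &
  forall (delta : R) (z z' : L), (0 < delta)%R ->
  (`|node_weights z.2 0%R j * hat_prod N b z.1 -
     node_weights z'.2 0%R j * hat_prod N b z'.1|)%:E <=
  (K * delta)%:E + (K / delta)%:E * ground_sqdist q theta z z'.
Proof.
move=> N0; have [Lh L0 hL] := hat_prod_lipschitz R d.
have [C C0 hC] := W_graph_bounded q_ge0 q_symmetric q_connected theta_interp.
pose Q := (\sum_(a < n.+1) \sum_(b < n.+1) q a b)%R.
have Q0 : (0 <= Q)%R by apply: sumr_ge0 => a _; exact: sumr_ge0.
exists (Lh * N * d%:R + Q + 1)%R.
  apply: ltr_wpDl => //; apply: addr_ge0 => //; apply: mulr_ge0 => //.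
  nonneg.
move=> delta z z' d0; set s := sqnorm (z.1 - z'.1).
have s0 : (0 <= s)%R by exact: sqnorm_ge0.
pose w := fine (W_graph q theta (node_weights z.2) (node_weights z'.2) ^+ 2).
have wE : W_graph q theta (node_weights z.2) (node_weights z'.2) ^+ 2 = w%:E.
  rewrite /w fineK// ge0_fin_numE; last exact: W_graph_sq_ge0.
  by apply: le_lt_trans (ltry C); apply: hC; exact: node_weights_prob.
have w0 : (0 <= w)%R by rewrite -lee_fin -wE; exact: W_graph_sq_ge0.
have := W_graph_lower q_ge0 q_symmetric theta_interp (node_weights z.2)
  (node_weights z'.2) j d0.
rewrite -/Q wE lee_fin -ler_pdivlMl// lerBlDr distrC => hW.
rewrite /ground_sqdist wE -/s.
rewrite [leRHS](_ : _ = ((Lh * N * d%:R + Q + 1) * delta +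
  (Lh * N * d%:R + Q + 1) / delta * (s + w))%:E)%E; last by rewrite EFinD (EFinM (_ / _)).
rewrite lee_fin.
have [p0 p1] := node_weights_prob z.2.
have ple (r : simplex R n) i : (node_weights r 0%R i <= 1)%R.
  by have [r0 <-] := node_weights_prob r; rewrite (bigD1 i)//= lerDl sumr_ge0.
have hx : (`|hat_prod N b z.1 - hat_prod N b z'.1| <=
    Lh * N * (d%:R * (delta + delta^-1 * s)))%R.
  apply: (le_trans (hL _ _ _ _ N0)); apply: ler_wpM2l; first nonneg.
  apply: (@le_trans _ _ (\sum_(k < d) (delta + delta^-1 * s))%R).
    apply: ler_sum => k _; apply: young_le => //.
    by rewrite /s /sqnorm (bigD1 k)//= !mxE lerDl sumr_ge0// => l _; exact: sqr_ge0.
  by rewrite sumr_const card_ord mulr_natl.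
rewrite (_ : _ - _ = node_weights z.2 0 j * (hat_prod N b z.1 - hat_prod N b z'.1) +
  (node_weights z.2 0 j - node_weights z'.2 0 j) * hat_prod N b z'.1)%R; last by ring.
apply: (le_trans (ler_normD _ _)); rewrite !normrM.
rewrite (ger0_norm (p0 j)) (ger0_norm (hat_prod_ge0 _ _ _)).
apply: (@le_trans _ _ (`|hat_prod N b z.1 - hat_prod N b z'.1| +
    `|node_weights z.2 0 j - node_weights z'.2 0 j|)%R).
  by apply: lerD; [rewrite ler_piMl|rewrite ler_piMr// hat_prod_le1].
apply: (le_trans (lerD hx hW)).
have di : (0 <= delta^-1)%R by nonneg.
set A := (Lh * N)%R in hx *; have A0 : (0 <= A)%R by rewrite mulr_ge0// ltW.
have e1 : (0 <= delta^-1 * w * (A * d%:R + Q))%R.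
  nonneg.
have e2 : (0 <= delta^-1 * s * (Q + 1))%R.
  nonneg.
rewrite -subr_ge0.
rewrite (_ : _ - _ = delta + delta^-1 * w * (A * d%:R + Q) + delta^-1 * s * (Q + 1))%R.
  nonneg.
by rewrite /A; ring.
Qed.

Lemma hat_gap_coupling N b j : (0 < N)%R -> exists2 K : R, (0 < K)%R &
  forall (delta : R) mu nu (l1 l2 : probability L R) (G : probability (L * L)%type R),
  (0 < delta)%R -> projects_to l1 mu -> projects_to l2 nu -> coupling l1 l2 G ->
  (`|hat_mass mu j N b - hat_mass nu j N b|)%:E <=
  (K * delta)%:E + (K / delta)%:E * transport_cost q theta G.
Proof.
move=> N0; have [K K0 hK] := hat_gap_pointwise b j N0; exists K => //.
move=> delta mu nu l1 l2 G d0 pm pn [c1 c2].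
pose f (z : L) := (node_weights z.2 0%R j * hat_prod N b z.1)%R.
have mf : mble f.
  apply: measurable_funM; first exact: (measurableT_comp (measurable_node_weights j)).
  by apply: (measurableT_comp (measurable_hat_prod N b)).
have f1 z : (`|f z| <= 1)%R.
  have [p0 p1] := node_weights_prob z.2; rewrite ger0_norm ?mulr_ge0 ?hat_prod_ge0//.
  apply: (@le_trans _ _ (1 * 1)%R); last by rewrite mulr1.
  by apply: ler_pM => //; rewrite ?hat_prod_ge0 ?hat_prod_le1// -p1 (bigD1 j)//= lerDl sumr_ge0.
have bh : bounded_fun (@hat_prod R d N b).
  exists 1%R; split; first exact: real1.
  by move=> M M1 x _ /=; rewrite ger0_norm ?hat_prod_ge0// (le_trans (hat_prod_le1 _ _ _))// ltW.
have E (l : probability L R) (m : vmeasure R d n.+1) (pr : L * L -> L) :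
    mble pr -> projects_to l m -> measure_eq (pushforward G pr) l ->
    (hat_mass m j N b)%:E = \int[G]_z (f (pr z))%:E.
  move=> mpr pl cl; rewrite hat_massE pl//; last exact: hat_prod_continuous.
  rewrite -(ge0_integral_eq_measure _ cl) integral_pushforward//.
  - mea.
  - apply: (@finite_bounded_integrable _ _ _ _ (f \o pr) 1%R) => [|z]; last exact: f1.
    mea.
have i1 (pr : L * L -> L) : mble pr -> G.-integrable setT (fun z => (f (pr z))%:E).
  move=> mpr; apply: (@finite_bounded_integrable _ _ _ _ (f \o pr) 1%R) => [|z]; last exact: f1.
  mea.
have := E _ _ _ measurable_fst pm c1; have := E _ _ _ measurable_snd pn c2.
move=> E2 E1; rewrite -abse_EFin EFinB E1 E2 -integralB//; [|exact: i1..].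
apply: (@le_trans _ _ (\int[G]_z (`|f z.1 - f z.2|)%:E)).
  by apply: abse_integral_le => z _; rewrite -EFinB.
have kd : (0 < K / delta)%R by rewrite divr_gt0.
have := @integral_nonmeas_affine _ _ _ G (fun=> K * delta)%R (K / delta)%R
  (fun z => ground_sqdist q theta z.1 z.2) (fun z => (`|f z.1 - f z.2|)%:E) kd.
rewrite integral_cst// [X in _ * X + _]probability_setT mule1; apply => //.
- nonneg.
- by move=> z; exact: ground_sqdist_ge0.
- by move=> z; exact: hK.
Qed.

(* For [delta] with [K delta <= e / 2], the cost bound [e / 2 * (delta / K)] suffices. *)
Lemma D_static_hat_converge (mu_ : nat -> vmeasure R d n.+1) mu :
  D_static q theta (mu_ k) mu @[k --> \oo] --> 0 -> hat_converge mu_ mu.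
Proof.
move=> D0 j N b N0 e e0; have [K K0 hK] := hat_gap_coupling b j N0.
have /cvg0P h := D0; pose delta := (e / (2 * K))%R.
have K2 : (0 < 2 * K)%R by rewrite mulr_gt0.
have d0 : (0 < delta)%R by rewrite divr_gt0.
pose c := (e / 2 * (delta / K))%R.
have c0 : (0 < c)%R by rewrite mulr_gt0 ?divr_gt0.
have s0 : (0 < Num.sqrt c / 2)%R by rewrite divr_gt0// sqrtr_gt0.
have D_ge0 k := D_static_ge0 q theta (mu_ k) mu.
apply: filterS (h D_ge0 _ s0) => k hk.
have : D_static q theta (mu_ k) mu < (Num.sqrt c)%:E.
  apply: (le_lt_trans hk); rewrite lte_fin ltr_pdivrMr// ltr_pMr//; lra.
move=> /ereal_inf_lt[_ [l1 [l2 [p1 p2 ->]]]].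
rewrite -[(Num.sqrt c)%:E]/(sqrte c%:E) => hW.
have : ereal_inf (coupling_costs q theta l1 l2) < c%:E.
  by rewrite ltNge -lee_sqrt ?coupling_costs_ge0// -ltNge.
move=> /ereal_inf_lt[_ [G cG <-]] hc.
have := hK _ _ _ _ _ _ d0 p1 p2 cG; rewrite -lee_fin => /le_trans; apply.
have : (K / delta)%:E * transport_cost q theta G <= (K / delta)%:E * c%:E.
  by apply: lee_wpmul2l; [rewrite lee_fin divr_ge0// ltW|exact: ltW].
move=> /(leeD2l (K * delta)%:E) /le_trans; apply.
rewrite -EFinM -EFinD lee_fin /c /delta le_eqVlt; apply/orP; left; apply/eqP.
by field; rewrite !gt_eqF.
Qed.

Lemma D_static_le_W2W (Omega : set 'rV[R]_d) mu nu : vprob Omega mu -> vprob Omega nu ->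
  D_static q theta mu nu <= W2W q theta mu nu.
Proof.
move=> /canonical_prob m1 /canonical_prob n1.
have [l1 l1E] := mk_probability m1; have [l2 l2E] := mk_probability n1.
apply: ereal_inf_lbound; exists l1, l2; split.
- move=> j eta ceta beta; rewrite (canonical_projects mu)//.
  by apply: ge0_integral_eq_measure => A _; apply/esym/l1E.
- move=> j eta ceta beta; rewrite (canonical_projects nu)//.
  by apply: ge0_integral_eq_measure => A _; apply/esym/l2E.
rewrite /W2W /W_lifted; congr (sqrte (ereal_inf _)).
apply/seteqP; split=> _ [G [c1 c2] <-]; exists G => //; split=> A mA.
- by rewrite c1//; apply/esym/l1E.
- by rewrite c2//; apply/esym/l2E.
- by rewrite c1//; exact: l1E.
- by rewrite c2//; exact: l2E.
Qed.

End weak_convergence.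

#[local] Hint Resolve measurable_sqnorm measurable_mx_sub measurable_lifted_sqdist measurable_node_weights measurable_coords
  measurable_at_vertex measurable_in_fst measurable_hat_prod : mble_db.
#[local] Hint Extern 0 (is_true _) => first [exact: sqnorm_ge0 | exact: ground_sqdist_ge0 | exact: hat_prod_ge0] : mble_db.

(** * Gluing of plans *)

(* The common mass [min a b] stays in place. *)
Lemma finite_coupling (R : realType) (I : finType) (a b : I -> R) :
  (forall i, 0 <= a i) -> (forall i, 0 <= b i) -> \sum_i a i = \sum_i b i ->
  exists k : I -> I -> R, [/\ forall i j, 0 <= k i j, forall i, \sum_j k i j = a i,
    forall j, \sum_i k i j = b j & forall i, a i - k i i <= `|a i - b i|].
Proof.
move=> a0 b0 ab; pose m i := Num.min (a i) (b i).
pose r := \sum_i (a i - m i).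
have am i : 0 <= a i - m i by rewrite subr_ge0 ge_min lexx.
have bm i : 0 <= b i - m i by rewrite subr_ge0 ge_min lexx orbT.
have r0 : 0 <= r by exact: sumr_ge0.
have rE : r = \sum_i (b i - m i) by rewrite /r !sumrB ab.
have ai0 i : r = 0 -> a i - m i = 0.
  by move=> /eqP; rewrite /r psumr_eq0// => /allP/(_ i); rewrite mem_index_enum => /(_ isT)/eqP.
have bi0 i : r = 0 -> b i - m i = 0.
  by rewrite rE => /eqP; rewrite psumr_eq0// => /allP/(_ i); rewrite mem_index_enum => /(_ isT)/eqP.
(* The excesses over the common mass are coupled independently, both having total mass r. If r = 0
   they all vanish, and so does the quotient. *)
exists (fun i j => m i * (i == j)%:R + (a i - m i) * (b j - m j) / r).
have diag (f : I -> R) i : \sum_j f j * (i == j)%:R = f i.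
  rewrite (bigD1 i)//= eqxx mulr1 big1 ?addr0// => j /negPf.
  by rewrite eq_sym => ->; rewrite mulr0.
split.
- move=> i j; apply: addr_ge0; first by rewrite mulr_ge0// le_min a0 b0.
  nonneg.
- move=> i; rewrite big_split/= -mulr_suml -mulr_sumr -rE.
  rewrite (eq_bigr (fun j => m j * (i == j)%:R)) ?diag; last first.
    by move=> j _; case: eqVneq => [->//|_]; rewrite !mulr0.
  have [r0'|rn0] := eqVneq r 0; last by rewrite mulfK// addrC subrK.
  by rewrite r0' mulr0 mul0r addr0; have := ai0 i r0'; lra.
- move=> j; rewrite big_split/= -mulr_suml -mulr_suml -/r.
  rewrite (eq_bigr (fun i => m i * (j == i)%:R)) ?diag; last by move=> i _; rewrite eq_sym.
  have [r0'|rn0] := eqVneq r 0; last by rewrite mulrAC divff// mul1r addrC subrK.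
  by rewrite r0' !mul0r addr0; have := bi0 j r0'; lra.
- move=> i; rewrite eqxx mulr1.
  have p0 : 0 <= (a i - m i) * (b i - m i) / r.
    nonneg.
  apply: (@le_trans _ _ (a i - m i)); first by move: p0; lra.
  rewrite /m /Num.min; case: ifPn => _; first by rewrite subrr.
  exact: ler_norm.
Qed.

Lemma tonelli_sum d1 d2 (X : measurableType d1) (Y : measurableType d2) (R : realType)
    (m1 : {finite_measure set X -> \bar R}) (m2 : {finite_measure set Y -> \bar R})
    (I : finType) (F : I -> X -> R) (G : I -> Y -> R) :
  (forall i, mble (F i)) -> (forall i, mble (G i)) ->
  (forall i x, 0 <= F i x) -> (forall i y, 0 <= G i y) ->
  (\int[m1 \x m2]_z (\sum_i F i z.1 * G i z.2)%:E =
   \sum_i (\int[m1]_x (F i x)%:E) * (\int[m2]_y (G i y)%:E))%E.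
Proof.
move=> mF mG F0 G0; under eq_integral do rewrite -sumEFin.
rewrite ge0_integral_sum//; last 2 first.
- mea.
- nonneg.
apply: eq_bigr => i _; rewrite fubini_tonelli1//; last 2 first.
- mea.
- nonneg.
rewrite /fubini_F/=.
under eq_integral => x _.
  under eq_integral do rewrite EFinM.
  rewrite ge0_integralZl//; [|mea|nonneg|nonneg].
  over.
rewrite ge0_integralZr//; [mea|nonneg|].
nonneg.
Qed.

Section vertex_cost.
Context (R : realType) (d n : nat) (q : 'M[R]_n.+1) (theta : R -> R -> R).
Hypotheses (q_ge0 : forall i j, 0 <= q i j) (q_symmetric : symmetric_graph q) (q_connected : connected_graph q) (theta_interp : interpolation_function theta).
Local Notation L := (lifted R d n).

(* A measurable function that agrees with the ground cost when [y] sits at a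
   vertex of the simplex. *)
Definition vertex_cost (z y : L) : R :=
  sqnorm (z.1 - y.1) + \sum_j node_weights y.2 0 j * node_cost q theta j z.2.

Lemma vertex_costE z x j : vertex_cost z (x, vertex R j) =
  sqnorm (z.1 - x) + node_cost q theta j z.2.
Proof.
rewrite /vertex_cost/=; congr (_ + _); rewrite (bigD1 j)//= node_weights_vertexE eqxx mul1r.
by rewrite big1 ?addr0// => i /negPf ij; rewrite node_weights_vertexE ij mul0r.
Qed.

Lemma vertex_cost_ground z y : at_vertex y ->
  ((vertex_cost z y)%:E = ground_sqdist q theta z y)%E.
Proof.
case: y => x _ [j /= ->]; rewrite vertex_costE /ground_sqdist EFinD node_costE//.
by rewrite node_weights_vertex.
Qed.

Lemma vertex_cost_ge0 z y : 0 <= vertex_cost z y.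
Proof.
apply: addr_ge0; first exact: sqnorm_ge0.
apply: sumr_ge0 => j _; have [p0 _] := node_weights_prob y.2.
by rewrite mulr_ge0// node_cost_ge0.
Qed.

Lemma measurable_vertex_cost d' (T : measurableType d') (f g : T -> L) :
  mble f -> mble g ->
  mble (fun x => vertex_cost (f x) (g x)).
Proof.
move=> mf mg; apply: measurable_funD.
  apply: (measurableT_comp (@measurable_sqnorm _ _)).
  by apply: measurable_mx_sub; mea.
apply: measurable_sum => j; apply: measurable_funM.
  apply: (measurableT_comp (measurable_node_weights j)).
  mea.
apply: (measurableT_comp (measurable_node_cost q_ge0 q_symmetric q_connected theta_interp j)).
mea.
Qed.

Lemma transport_costE (l1 : {measure set L -> \bar R}) nu (Omega : set 'rV[R]_d)
    (G : probability (L * L)%type R) : measurable Omega -> vprob Omega nu ->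
  coupling l1 (canonical_lifting nu) G ->
  (transport_cost q theta G = \int[G]_z (vertex_cost z.1 z.2)%:E)%E.
Proof.
move=> mO nuO cG; have mV := @measurable_at_vertex R d n.
have mD := measurableI _ _ mV (measurable_in_fst (n := n) mO).
have G0 := coupling_snd_null mD cG (canonical_support mO nuO).
apply: (integral_nonmeas_ae_eq _ G0) => //.
- mea.
- nonneg.
- by move=> z; rewrite lee_fin vertex_cost_ge0.
- apply/measurable_EFinP.
  by apply: measurable_vertex_cost; [mea|mea].
- by move=> z [v _]; rewrite vertex_cost_ground.
Qed.

End vertex_cost.

(** * Gluing a transport map with a coupling of cells *)

Section gluing.
Context (R : realType) (d n : nat) (q : 'M[R]_n.+1) (theta : R -> R -> R).
Hypotheses (q_ge0 : forall i j, 0 <= q i j) (q_symmetric : symmetric_graph q) (q_connected : connected_graph q) (theta_interp : interpolation_function theta).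
Local Notation L := (lifted R d n).
Variables (Omega : set 'rV[R]_d) (M C : R).
Hypotheses (mO : measurable Omega) (M0 : 0 <= M)
  (OM : forall x, Omega x -> forall k, `|x 0 k| <= M).
Hypotheses (C0 : 0 <= C) (hC : forall j r, node_cost q theta j r <= C).
Variables (I : finType) (chi : I -> 'rV[R]_d -> R) (eps : R).
Hypotheses (eps0 : 0 <= eps) (mchi : forall c, mble (chi c))
  (chi0 : forall c x, 0 <= chi c x) (chi1 : forall c x, chi c x <= 1)
  (chi_sum : forall x, Omega x -> \sum_c chi c x = 1)
  (chi_near : forall c x y, chi c x != 0 -> chi c y != 0 ->
    forall k, `|x 0 k - y 0 k| <= eps).
Variables (lambda : probability L R) (S : L -> L) (mS : mble S).
Hypothesis S_Omega : (lambda (~` [set z | Omega (S z).1]) = 0)%E.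
Variables (mu nu : vmeasure R d n.+1).
Hypotheses (muO : vprob Omega mu) (nuO : vprob Omega nu).
Local Notation node := 'I_n.+1.
Local Notation cell := (I * 'I_n.+1)%type.

(** A cell is a hat together with a node. Cells overlap: z is distributed over the cells of its
    image S z, with weights that sum to 1 when the image lies over Omega. *)
Definition cell_weight (l : cell) (z : L) : R :=
  node_weights (S z).2 0 l.2 * chi l.1 (S z).1.
Definition cell_mass (m : vmeasure R d n.+1) (l : cell) : R :=
  fine (\int[m l.2]_x (chi l.1 x)%:E)%E.

Hypothesis S_mu : forall l, (\int[lambda]_z (cell_weight l z)%:E = (cell_mass mu l)%:E)%E.

Lemma cell_weight_ge0 l z : 0 <= cell_weight l z.
Proof. by have [p0 _] := node_weights_prob (S z).2; rewrite mulr_ge0. Qed.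

Lemma measurable_cell_weight l : mble (cell_weight l).
Proof.
apply: measurable_funM.
  apply: (measurableT_comp (measurable_node_weights l.2)).
  mea.
mea.
Qed.

Lemma cell_weight_sum z : Omega (S z).1 -> \sum_l cell_weight l z = 1.
Proof.
move=> Oz; rewrite -(pair_bigA _ (fun c j => node_weights (S z).2 0 j * chi c (S z).1))/=.
have [_ p1] := node_weights_prob (S z).2.
by under eq_bigr do rewrite -mulr_suml p1 mul1r; exact: chi_sum.
Qed.

Lemma chi_integrable (m : {finite_measure set 'rV[R]_d -> \bar R}) c :
  m.-integrable setT (fun x => (chi c x)%:E).
Proof.
apply: (@finite_bounded_integrable _ _ _ _ _ 1%R); first exact: mchi.
by move=> x; rewrite ger0_norm.
Qed.

Lemma cell_massE m l : ((cell_mass m l)%:E = \int[m l.2]_x (chi l.1 x)%:E)%E.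
Proof. by rewrite fineK//; apply: integrable_fin_num => //; exact: chi_integrable. Qed.

Lemma cell_mass_ge0 m l : 0 <= cell_mass m l.
Proof. by rewrite -lee_fin cell_massE; apply: integral_ge0 => x _; rewrite lee_fin. Qed.

Lemma cell_mass_sum m : vprob Omega m -> \sum_l cell_mass m l = 1.
Proof.
move=> [m0 m1]; apply/eqP; rewrite -eqe -sumEFin -m1; apply/eqP.
under eq_bigr do rewrite cell_massE.
rewrite -(pair_bigA _ (fun c j => (\int[m j]_x (chi c x)%:E)%E))/= exchange_big/=.
apply: eq_bigr => j _; rewrite -ge0_integral_sum//; last 2 first.
- mea.
- nonneg.
rewrite -[RHS]mul1e -integral_cst//; apply: (integral_nonmeas_ae_eq mO (m0 j)) => //.
  nonneg.
by move=> x Ox; rewrite sumEFin chi_sum.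
Qed.

Let a := cell_mass mu.
Let b := cell_mass nu.
Variable k : cell -> cell -> R.
Hypotheses (k0 : forall l l', 0 <= k l l') (ka : forall l, \sum_l' k l l' = a l)
  (kb : forall l', \sum_l k l l' = b l') (kd : forall l, a l - k l l <= `|a l - b l|).

Let c l l' := k l l' / (a l * b l').

Let c0 l l' : 0 <= c l l'.
Proof. by rewrite divr_ge0// mulr_ge0// cell_mass_ge0. Qed.

Let k_le_a l l' : k l l' <= a l.
Proof. by rewrite -ka (bigD1 l')//= lerDl sumr_ge0. Qed.

Let k_le_b l l' : k l l' <= b l'.
Proof. by rewrite -kb (bigD1 l)//= lerDl sumr_ge0. Qed.

(** If one of the masses vanishes then so does k, so the cancellation survives the convention
    [x / 0 = 0]. *)
Let cb l l' : c l l' * b l' = k l l' / a l.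
Proof.
rewrite /c; have [b0|b0] := eqVneq (b l') 0; last first.
  have [a0|a0] := eqVneq (a l) 0; last by field; rewrite a0 b0.
  by rewrite a0 mul0r !invr0 !mulr0 mul0r.
have -> : k l l' = 0 by apply/eqP; rewrite eq_le k0 -b0 k_le_b.
by rewrite !mul0r.
Qed.

Let ca l l' : c l l' * a l = k l l' / b l'.
Proof.
rewrite /c; have [a0|a0] := eqVneq (a l) 0; last first.
  have [b0|b0] := eqVneq (b l') 0; last by field; rewrite a0 b0.
  by rewrite b0 mulr0 !invr0 !mulr0 mul0r.
have -> : k l l' = 0 by apply/eqP; rewrite eq_le k0 -a0 k_le_a.
by rewrite !mul0r.
Qed.

(** Density of the glued plan against [lambda \x nu j']: a point z in the cell l, with weight
    [cell_weight l z], goes to the cell l' with probability k l l' / a l, and is spread there like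
    nu, normalized by b l'. *)
Definition glue_weight (j' : node) (zx : L * 'rV[R]_d) : R :=
  \sum_(p : cell * I) c p.1 (p.2, j') * cell_weight p.1 zx.1 * chi p.2 zx.2.

Lemma glue_weight_ge0 j' zx : 0 <= glue_weight j' zx.
Proof.
apply: sumr_ge0 => p _; apply: mulr_ge0 => //; apply: mulr_ge0 => //.
exact: cell_weight_ge0.
Qed.

Lemma measurable_glue_weight j' : mble (glue_weight j').
Proof.
apply: measurable_sum => p; apply: measurable_funM.
  apply: measurable_funM => //.
  by apply: (measurableT_comp (measurable_cell_weight p.1)); mea.
mea.
Qed.

Definition glue_map (j' : node) (zx : L * 'rV[R]_d) : L * L := (zx.1, (zx.2, vertex R j')).

Lemma measurable_glue_map j' : mble (glue_map j').
Proof.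
apply: measurable_fun_pair; first mea.
mea.
Qed.

Definition glue_measure : {measure set (L * L) -> \bar R} :=
  sum_measure (fun j' => wpush (lambda \x nu j')%E (glue_weight_ge0 j')
    (measurable_glue_weight j') (measurable_glue_map j') : {measure set (L * L) -> \bar R}).

Lemma ge0_integral_glue (f : L * L -> R) : mble f -> (forall z, 0 <= f z) ->
  (\int[glue_measure]_z (f z)%:E =
   \sum_(j' < n.+1) \int[lambda \x nu j']_zx (glue_weight j' zx * f (glue_map j' zx))%:E)%E.
Proof.
move=> mf f0; have mfE : mble (fun z => (f z)%:E) by exact/measurable_EFinP.
rewrite /glue_measure ge0_integral_sum_measure//; apply: eq_bigr => j' _.
by rewrite ge0_integral_wpush.
Qed.

(** For product integrands Tonelli separates z from x. An indicator on one side and the constant 1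
    on the other then give the two marginals. *)
Lemma glue_separated (f : L -> R) (g : L -> R) :
  mble f -> (forall z, 0 <= f z) ->
  mble g -> (forall z, 0 <= g z) ->
  (\int[glue_measure]_z (f z.1 * g z.2)%:E =
   \sum_(l : cell) \sum_(l' : cell) (c l l')%:E *
     ((\int[lambda]_z (f z * cell_weight l z)%:E) *
      (\int[nu l'.2]_x (g (x, vertex R l'.2) * chi l'.1 x)%:E)))%E.
Proof.
move=> mf f0 mg g0; rewrite ge0_integral_glue; last 2 first.
- mea.
- nonneg.
transitivity (\sum_(j' < n.+1) \sum_(p : cell * I) (c p.1 (p.2, j'))%:E *
     ((\int[lambda]_z (f z * cell_weight p.1 z)%:E) *
      (\int[nu j']_x (g (x, vertex R j') * chi p.2 x)%:E)))%E.
  apply: eq_bigr => j' _.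
  transitivity (\int[lambda \x nu j']_zx (\sum_(p : cell * I)
     (c p.1 (p.2, j') * (f zx.1 * cell_weight p.1 zx.1)) *
     (g (zx.2, vertex R j') * chi p.2 zx.2))%:E)%E.
    apply: eq_integral => zx _; rewrite /glue_weight mulr_suml; congr EFin.
    by apply: eq_bigr => p _; rewrite /glue_map/=; ring.
  rewrite (tonelli_sum _ _ (F := fun (p : cell * I) z => c p.1 (p.2, j') * (f z * cell_weight p.1 z))
     (G := fun p x => g (x, vertex R j') * chi p.2 x)).
  - apply: eq_bigr => p _; rewrite muleA; congr (_ * _)%E.
    under eq_integral do rewrite EFinM.
    rewrite ge0_integralZl//.
    + by apply/measurable_EFinP; apply: measurable_funM => //; exact: measurable_cell_weight.
    + by move=> z _; rewrite lee_fin mulr_ge0// cell_weight_ge0.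
    + nonneg.
  - by move=> p; apply: measurable_funM => //; apply: measurable_funM => //; exact: measurable_cell_weight.
  - mea.
  - by move=> p z; apply: mulr_ge0 => //; apply: mulr_ge0 => //; exact: cell_weight_ge0.
  - nonneg.
under eq_bigr do rewrite -(pair_bigA _ (fun l c' => ((c l (c', _))%:E *
     ((\int[lambda]_z (f z * cell_weight l z)%:E) *
      (\int[nu _]_x (g (x, vertex R _) * chi c' x)%:E)))%E)) /=.
rewrite exchange_big/=; apply: eq_bigr => l _; rewrite exchange_big/=.
rewrite (pair_bigA _ (fun c' j' => ((c l (c', j'))%:E *
     ((\int[lambda]_z (f z * cell_weight l z)%:E) *
      (\int[nu j']_x (g (x, vertex R j') * chi c' x)%:E)))%E))/=.
by apply: eq_bigr => -[c' j'] _.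
Qed.

Lemma glue_fst A : measurable A -> glue_measure (fst @^-1` A) = lambda A.
Proof.
move=> mA.
have mB : measurable (fst @^-1` A : set (L * L)) by mea.
have mw l : mble (fun z => \1_A z * cell_weight l z).
  by apply: measurable_funM => //; exact: measurable_cell_weight.
have w0 l z : 0 <= \1_A z * cell_weight l z by rewrite mulr_ge0// cell_weight_ge0.
rewrite -[in LHS](setIT (_ @^-1` _)) -(integral_indic _ measurableT)//.
transitivity (\int[glue_measure]_z (\1_A z.1 * (cst 1 : L -> R) z.2)%:E)%E.
  by apply: eq_integral => z _; rewrite mulr1 !indicE.
rewrite glue_separated//.
have X l : exists2 x : R, (\int[lambda]_z (\1_A z * cell_weight l z)%:E = x%:E)%E & 0 <= x <= a l.
  have le : (\int[lambda]_z (\1_A z * cell_weight l z)%:E <= (a l)%:E)%E.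
    rewrite -S_mu; apply: le_integral_nonmeas => z; rewrite lee_fin//.
    by rewrite indicE ler_piMl ?cell_weight_ge0// lern1 leq_b1.
  have ge : (0 <= \int[lambda]_z (\1_A z * cell_weight l z)%:E)%E.
    nonneg.
  case: (\int[lambda]_z _)%E le ge => // x xa x0; exists x => //.
  by rewrite -!lee_fin x0.
transitivity (\sum_(l : cell) \int[lambda]_z (\1_A z * cell_weight l z)%:E)%E.
  apply: eq_bigr => l _; have [x -> /andP[x0 xa]] := X l.
  transitivity ((\sum_l' x * (k l l' / a l))%:E).
    rewrite -sumEFin; apply: eq_bigr => l' _.
    under [in LHS]eq_integral do rewrite mul1r.
    rewrite -cell_massE -!EFinM -/(b l') -cb; congr EFin; ring.
  rewrite -mulr_sumr -mulr_suml ka; congr EFin.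
  have [al|al] := eqVneq (a l) 0; last by rewrite divff// mulr1.
  by rewrite al mul0r mulr0; apply/eqP; rewrite eq_le x0 -al xa.
rewrite -ge0_integral_sum//; last 2 first.
- mea.
- nonneg.
rewrite -[in RHS](setIT A) -(integral_indic _ measurableT)//.
have mOS : measurable [set z | Omega (S z).1].
  rewrite -[X in measurable X]setTI.
  by apply: (measurableT_comp (f := fun z => (S z).1)) => //; mea.
apply: (integral_nonmeas_ae_eq mOS S_Omega) => //.
- nonneg.
- mea.
- by move=> z Oz; rewrite sumEFin -mulr_sumr cell_weight_sum// mulr1.
Qed.

Lemma glue_snd B : measurable B -> glue_measure (snd @^-1` B) = canonical_lifting nu B.
Proof.
move=> mB; have mg : mble (\1_B : L -> R) by exact: measurable_indic.
have mB' : measurable (snd @^-1` B : set (L * L)) by mea.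
have mw (l : cell) : mble (fun x => \1_B (x, vertex R l.2) * chi l.1 x).
  by apply: measurable_funM => //; apply: (measurableT_comp mg); mea.
have w0 (l : cell) x : 0 <= \1_B (x, vertex R l.2) * chi l.1 x by nonneg.
rewrite -[in LHS](setIT (_ @^-1` _)) -(integral_indic _ measurableT)//.
transitivity (\int[glue_measure]_z ((cst 1 : L -> R) z.1 * \1_B z.2)%:E)%E.
  by apply: eq_integral => z _; rewrite mul1r !indicE.
rewrite glue_separated// exchange_big/=.
have X l : exists2 x : R, (\int[nu l.2]_z (\1_B (z, vertex R l.2) * chi l.1 z)%:E = x%:E)%E &
    0 <= x <= b l.
  have le : (\int[nu l.2]_z (\1_B (z, vertex R l.2) * chi l.1 z)%:E <= (b l)%:E)%E.
    rewrite cell_massE; apply: le_integral_nonmeas => z; rewrite lee_fin//.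
    by rewrite indicE ler_piMl// lern1 leq_b1.
  have ge : (0 <= \int[nu l.2]_z (\1_B (z, vertex R l.2) * chi l.1 z)%:E)%E.
    nonneg.
  case: (\int[nu l.2]_z _)%E le ge => // x xa x0; exists x => //.
  by rewrite -!lee_fin x0.
transitivity (\sum_(l : cell) \int[nu l.2]_z (\1_B (z, vertex R l.2) * chi l.1 z)%:E)%E.
  apply: eq_bigr => l' _; have [x -> /andP[x0 xb]] := X l'.
  transitivity ((\sum_l x * (k l l' / b l'))%:E).
    rewrite -sumEFin; apply: eq_bigr => l _.
    under [in LHS]eq_integral do rewrite mul1r.
    rewrite S_mu -!EFinM -/(a l) -ca; congr EFin; ring.
  rewrite -mulr_sumr -mulr_suml kb; congr EFin.
  have [bl|bl] := eqVneq (b l') 0; last by rewrite divff// mulr1.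
  by rewrite bl mul0r mulr0; apply/eqP; rewrite eq_le x0 -bl xb.
rewrite -(pair_bigA _ (fun c j => (\int[nu j]_z (\1_B (z, vertex R j) * chi c z)%:E)%E))/=.
rewrite exchange_big/= -[in RHS](setIT B) -(integral_indic _ measurableT)//.
rewrite ge0_integral_canonical//; last first.
- mea.
apply: eq_bigr => j _; rewrite -ge0_integral_sum//; last 2 first.
- by move=> c'; apply/measurable_EFinP; exact: (mw (c', j)).
- nonneg.
apply: (integral_nonmeas_ae_eq mO (nuO.1 j)) => //.
- nonneg.
- by apply/measurable_EFinP; apply: (measurableT_comp mg); mea.
- by move=> z Oz; rewrite sumEFin -mulr_sumr chi_sum// mulr1.
Qed.

Lemma glue_total : glue_measure setT = 1%E.
Proof. by rewrite -(preimage_setT fst) glue_fst// probability_setT. Qed.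

(** It dominates two quantities at once: the cost from z to any vertex over the cube, at most 2
    |z|^2 + 2 d M^2 + C, and the rate |z|^2 + d (1 + 2 M) at which |z - x|^2 varies with x in the
    cube. *)
Definition moment_bound (z : L) : R :=
  2 * sqnorm z.1 + (2 * (d%:R * M ^+ 2) + C + d%:R * (1 + 2 * M)).

Lemma sqnorm_shift (y x x' : 'rV[R]_d) :
  (forall k, `|x 0 k| <= M) -> (forall k, `|x' 0 k| <= M) -> (forall k, `|x 0 k - x' 0 k| <= eps) ->
  sqnorm (y - x) <= sqnorm (y - x') + eps * (sqnorm y + d%:R * (1 + 2 * M)).
Proof.
move=> xM xM' xx; have -> : d%:R * (1 + 2 * M) = \sum_(k < d) (1 + 2 * M).
  by rewrite sumr_const card_ord mulr_natl.
rewrite /sqnorm -big_split/= mulr_sumr -big_split/=; apply: ler_sum => k' _; rewrite !mxE.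
have := xM k'; have := xM' k'; have := xx k'.
move: (y 0 k') (x 0 k') (x' 0 k') => u v w.
move=> vw wM vM.
have : (u - v) ^+ 2 - (u - w) ^+ 2 = (w - v) * (2 * u - v - w) by ring.
have : (w - v) * (2 * u - v - w) <= eps * (2 * `|u| + 2 * M).
  apply: (le_trans (ler_norm _)); rewrite normrM distrC; apply: ler_pM => //.
  rewrite -addrA -opprD; apply: (le_trans (ler_normB _ _)); rewrite normrM ger0_norm//.
  rewrite lerD2l; apply: (le_trans (ler_normD _ _)); lra.
have : eps * (2 * `|u| + 2 * M) <= eps * (u ^+ 2 + (1 + 2 * M)).
  rewrite ler_wpM2l// addrA lerD2r.
  rewrite -[u ^+ 2]real_normK ?num_real//.
  by have := sqr_ge0 (`|u| - 1); lra.
lra.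
Qed.

Lemma sqnorm_sub_le (y x : 'rV[R]_d) : (forall k, `|x 0 k| <= M) ->
  sqnorm (y - x) <= 2 * sqnorm y + 2 * (d%:R * M ^+ 2).
Proof.
move=> xM; have -> : d%:R * M ^+ 2 = \sum_(k < d) M ^+ 2.
  by rewrite sumr_const card_ord mulr_natl.
rewrite /sqnorm !mulr_sumr -big_split/=; apply: ler_sum => k' _; rewrite !mxE.
have := xM k'; move: (y 0 k') (x 0 k') => u v vM.
have : v ^+ 2 <= M ^+ 2 by rewrite -[v ^+ 2]real_normK ?num_real// ler_pXn2r// nnegrE.
by have := sqr_ge0 (u + v); lra.
Qed.

Lemma moment_bound_ge0 z : 0 <= moment_bound z.
Proof.
apply: addr_ge0; first nonneg.
apply: addr_ge0; first nonneg.
nonneg.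
Qed.

Lemma measurable_moment_bound : mble moment_bound.
Proof.
apply: measurable_funD => //; apply: measurable_funM => //.
mea.
Qed.

Definition cell_cost (l : cell) (z : L) : R :=
  sqnorm (z.1 - (S z).1) + node_cost q theta l.2 z.2.

Lemma cell_cost_ge0 l z : 0 <= cell_cost l z.
Proof. by rewrite addr_ge0 ?sqnorm_ge0// node_cost_ge0. Qed.

Lemma measurable_cell_cost l : mble (cell_cost l).
Proof.
apply: measurable_funD.
  apply: (measurableT_comp (@measurable_sqnorm _ _)); apply: measurable_mx_sub.
    mea.
  mea.
apply: (measurableT_comp (measurable_node_cost q_ge0 q_symmetric q_connected theta_interp l.2)).
mea.
Qed.

(** Mass that stays in its cell pays the cost of S up to an error proportional to eps; for mass that
    changes cell only the crude bound is available. *)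
Definition cell_bound (l l' : cell) (z : L) : R :=
  if l == l' then cell_cost l z + eps * moment_bound z else moment_bound z.

Lemma cell_bound_ge0 l l' z : 0 <= cell_bound l l' z.
Proof.
rewrite /cell_bound; case: ifP => _; last exact: moment_bound_ge0.
by rewrite addr_ge0 ?cell_cost_ge0// mulr_ge0// moment_bound_ge0.
Qed.

Lemma measurable_cell_bound l l' : mble (cell_bound l l').
Proof.
case E : (l == l'); rewrite /cell_bound E; last exact: measurable_moment_bound.
apply: measurable_funD; first exact: measurable_cell_cost.
by apply: measurable_funM => //; exact: measurable_moment_bound.
Qed.

Lemma glue_pointwise j' z x : Omega x -> Omega (S z).1 ->
  glue_weight j' (z, x) * vertex_cost q theta z (x, vertex R j') <=
  \sum_(p : cell * I) (c p.1 (p.2, j') * (cell_weight p.1 z * cell_bound p.1 (p.2, j') z)) *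
    chi p.2 x.
Proof.
move=> Ox Oz; rewrite /glue_weight mulr_suml; apply: ler_sum => p _ /=.
have [pz|pz] := eqVneq (cell_weight p.1 z) 0; first by rewrite pz !(mulr0, mul0r).
have [px|px] := eqVneq (chi p.2 x) 0; first by rewrite px !(mulr0, mul0r).
rewrite [leLHS](_ : _ = (c p.1 (p.2, j') * (cell_weight p.1 z *
  vertex_cost q theta z (x, vertex R j'))) * chi p.2 x); last by ring.
apply: ler_wpM2r => //; apply: ler_wpM2l => //; apply: ler_wpM2l; first exact: cell_weight_ge0.
rewrite vertex_costE /cell_bound /moment_bound.
have nc := hC j' z.2.
have d0 : 0 <= d%:R * (1 + 2 * M) by nonneg.
have dM : 0 <= 2 * (d%:R * M ^+ 2) by nonneg.
have s0 := sqnorm_ge0 z.1.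
case: eqP => [pE|_]; last first.
  have := sqnorm_sub_le z.1 (OM Ox); lra.
have czS : chi p.2 (S z).1 != 0.
  by move: pz; rewrite /cell_weight pE/= mulf_eq0 negb_or => /andP[].
have := sqnorm_shift z.1 (OM Ox) (OM Oz) (chi_near px czS).
rewrite /cell_cost pE/=; set u := d%:R * (1 + 2 * M) in d0 *; set w := 2 * (d%:R * M ^+ 2) in dM *; clearbody u w.
have h : eps * (sqnorm z.1 + u) <= eps * (2 * sqnorm z.1 + (w + C + u)).
  apply: ler_wpM2l => //.
  rewrite [leRHS](_ : _ = sqnorm z.1 + u + (sqnorm z.1 + w + C)); last by ring.
  by rewrite lerDl !addr_ge0.
lra.
Qed.

(** Staying mass contributes the cost of S and eps times the moment; moving mass contributes the
    moment times the fraction of each cell that leaves it. *)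
Lemma glue_cost : (\int[glue_measure]_z (vertex_cost q theta z.1 z.2)%:E <=
  \int[lambda]_z (vertex_cost q theta z (S z))%:E +
  (eps + \sum_l `|a l - b l| / a l)%:E * \int[lambda]_z (moment_bound z)%:E)%E.
Proof.
have vc0 := vertex_cost_ge0 q_ge0 q_symmetric q_connected theta_interp (d := d).
have mcb l l' : mble (fun z => cell_weight l z * cell_bound l l' z).
  by apply: measurable_funM; [exact: measurable_cell_weight|exact: measurable_cell_bound].
have cb0 l l' z : 0 <= cell_weight l z * cell_bound l l' z.
  by rewrite mulr_ge0 ?cell_weight_ge0 ?cell_bound_ge0.
have mOS : measurable [set z | Omega (S z).1].
  rewrite -[X in measurable X]setTI.
  by apply: (measurableT_comp (f := fun z => (S z).1)) => //; mea.
rewrite ge0_integral_glue; last 2 first.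
- by apply: measurable_vertex_cost.
- by move=> z; exact: vc0.
have step1 j' : (\int[lambda \x nu j']_zx (glue_weight j' zx *
      vertex_cost q theta (glue_map j' zx).1 (glue_map j' zx).2)%:E <=
    \sum_(l : cell) \sum_(c' : I) (k l (c', j') / a l)%:E *
      \int[lambda]_z (cell_weight l z * cell_bound l (c', j') z)%:E)%E.
  pose D := (fst @^-1` [set z | Omega (S z).1] : set (L * 'rV[R]_d)) `&` (snd @^-1` Omega).
  have mD1 : measurable (fst @^-1` [set z | Omega (S z).1] : set (L * 'rV[R]_d)) by mea.
  have mD2 : measurable (snd @^-1` Omega : set (L * 'rV[R]_d)) by mea.
  have D0 : (lambda \x nu j')%E (~` D) = 0%E.
    apply: measure_setCI_null => //.
      rewrite (_ : ~` _ = (~` [set z | Omega (S z).1]) `*` setT); last first.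
        by apply/seteqP; split=> [[z x] h|[z x] [h _]].
      apply: (eq_trans (product_measure1E _ _ (measurableC mOS) measurableT)).
      by rewrite [X in (X * _)%E]S_Omega mul0e.
    rewrite (_ : ~` _ = setT `*` (~` Omega)); last first.
      by apply/seteqP; split=> [[z x] h|[z x] [_ h]].
    apply: (eq_trans (product_measure1E _ _ measurableT (measurableC mO))).
    by rewrite [X in (_ * X)%E](nuO.1 j') mule0.
  apply: (@le_trans _ _ (\int[lambda \x nu j']_zx (\sum_(p : cell * I)
     (c p.1 (p.2, j') * (cell_weight p.1 zx.1 * cell_bound p.1 (p.2, j') zx.1)) *
     chi p.2 zx.2)%:E)%E).
    apply: (integral_nonmeas_ae_le (measurableI _ _ mD1 mD2) D0).
    - by move=> zx; rewrite lee_fin mulr_ge0// glue_weight_ge0.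
    - nonneg.
    - apply/measurable_EFinP; apply: measurable_sum => p; apply: measurable_funM.
        apply: measurable_funM => //; apply: (measurableT_comp (mcb _ _)); mea.
      mea.
    - by move=> [z x] [Oz Ox]; rewrite lee_fin; exact: glue_pointwise.
  rewrite (tonelli_sum _ _
    (F := fun (p : cell * I) z => c p.1 (p.2, j') * (cell_weight p.1 z * cell_bound p.1 (p.2, j') z))
    (G := fun p x => chi p.2 x)) => //; last 2 first.
  - mea.
  - nonneg.
  rewrite -(pair_bigA _ (fun l c' => ((\int[lambda]_z (c l (c', j') *
    (cell_weight l z * cell_bound l (c', j') z))%:E) * \int[nu j']_x (chi c' x)%:E)%E))/=.
  rewrite le_eqVlt; apply/orP; left; apply/eqP.
  apply: eq_bigr => l _; apply: eq_bigr => c' _.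
  rewrite -cb EFinM -(cell_massE nu (c', j')) -/b.
  under eq_integral do rewrite EFinM.
  rewrite ge0_integralZl//; [by rewrite muleAC| |nonneg|nonneg].
  mea.
apply: (le_trans (lee_sum _ (fun j' _ => step1 j'))).
have -> : (\sum_(j' < n.+1) \sum_(l : cell) \sum_(c' : I) (k l (c', j') / a l)%:E *
      \int[lambda]_z (cell_weight l z * cell_bound l (c', j') z)%:E =
    \sum_(l : cell) \sum_(l' : cell) (k l l' / a l)%:E *
      \int[lambda]_z (cell_weight l z * cell_bound l l' z)%:E)%E.
  rewrite exchange_big/=; apply: eq_bigr => l _; rewrite exchange_big/=.
  rewrite (pair_bigA _ (fun c' j' => ((k l (c', j') / a l)%:E *
      \int[lambda]_z (cell_weight l z * cell_bound l (c', j') z)%:E)%E))/=.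
  by apply: eq_bigr => -[c' j'] _.
set IH := (\int[lambda]_z (moment_bound z)%:E)%E.
have IH0 : (0 <= IH)%E by apply: integral_ge0 => z _; rewrite lee_fin moment_bound_ge0.
have int0 l l' : (0 <= \int[lambda]_z (cell_weight l z * cell_bound l l' z)%:E)%E.
  nonneg.
have ka0 l l' : 0 <= k l l' / a l by rewrite divr_ge0// cell_mass_ge0.
(* The diagonal term is kept; the mass leaving l is a l - k l l, which the choice of the coupling
   bounds by |a l - b l|. *)
have step2 l : (\sum_(l' : cell) (k l l' / a l)%:E *
      \int[lambda]_z (cell_weight l z * cell_bound l l' z)%:E <=
    \int[lambda]_z (cell_weight l z * cell_bound l l z)%:E + (`|a l - b l| / a l)%:E * IH)%E.
  rewrite (bigD1 l)//=; apply: leeD.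
    rewrite -[leRHS]mul1e; apply: lee_wpmul2r => //; rewrite lee_fin.
    have [al|al] := eqVneq (a l) 0; first by rewrite al invr0 mulr0.
    by rewrite ler_pdivrMr ?mul1r// lt_neqAle eq_sym al cell_mass_ge0.
  apply: (@le_trans _ _ (\sum_(l' | l' != l) (k l l' / a l)%:E * IH)%E).
    apply: lee_sum => l' ll'; apply: lee_wpmul2l; first nonneg.
    apply: le_integral_nonmeas => z; rewrite lee_fin//.
    rewrite /cell_bound eq_sym (negPf ll') ler_piMl ?moment_bound_ge0//.
    have [p0 p1] := node_weights_prob (S z).2.
    apply: (@le_trans _ _ (1 * 1)); last by rewrite mulr1.
    by apply: ler_pM => //; rewrite -p1 (bigD1 l.2)//= lerDl sumr_ge0.
  rewrite -ge0_sume_distrl; last by move=> l' _; rewrite lee_fin.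
  apply: lee_wpmul2r => //; rewrite sumEFin lee_fin -mulr_suml.
  apply: ler_wpM2r; first by rewrite invr_ge0 cell_mass_ge0.
  by have := kd l; rewrite -[X in X - _]ka (bigD1 l)//= addrAC subrr add0r.
apply: (le_trans (lee_sum _ (fun l _ => step2 l))).
rewrite big_split/= -ge0_sume_distrl; last first.
  by move=> l _; rewrite lee_fin divr_ge0// cell_mass_ge0.
rewrite sumEFin EFinD ge0_muleDl//; last first.
  by apply: sumr_ge0 => l _; rewrite divr_ge0// cell_mass_ge0.
rewrite addeA; apply: leeD => //.
rewrite -ge0_integral_sum//; last 2 first.
- mea.
- nonneg.
have mvS : mble (fun z => vertex_cost q theta z (S z)).
  by apply: measurable_vertex_cost => //; mea.
have mH := measurable_moment_bound.
rewrite -ge0_integralZl//; [|mea|by move=> z _; rewrite lee_fin moment_bound_ge0].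
rewrite -ge0_integralD//; last 4 first.
- nonneg.
- mea.
- by move=> z _; rewrite mule_ge0// lee_fin moment_bound_ge0.
- by apply: measurable_funeM; mea.
apply: (integral_nonmeas_ae_le mOS S_Omega).
- nonneg.
- by move=> z; apply: adde_ge0; [rewrite lee_fin|apply: mule_ge0; rewrite lee_fin ?moment_bound_ge0].
- apply: emeasurable_funD; first mea.
  by apply: measurable_funeM; mea.
move=> z Oz; rewrite sumEFin -EFinM -EFinD lee_fin.
under eq_bigr do rewrite /cell_bound eqxx mulrDr.
rewrite big_split/= -mulr_suml cell_weight_sum// mul1r lerD2r.
rewrite /cell_cost; under eq_bigr do rewrite mulrDr.
rewrite big_split/= -mulr_suml cell_weight_sum// mul1r /vertex_cost lerD2l.
rewrite le_eqVlt; apply/orP; left; apply/eqP.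
rewrite -(pair_bigA _ (fun c' j => cell_weight (c', j) z * node_cost q theta j z.2))/=.
rewrite exchange_big/=; apply: eq_bigr => j _; rewrite -mulr_suml; congr (_ * _).
by rewrite /cell_weight/= -mulr_sumr chi_sum// mulr1.
Qed.

End gluing.

Section recovery.
Context (R : realType) (d n : nat) (q : 'M[R]_n.+1) (theta : R -> R -> R).
Hypotheses (q_ge0 : forall i j, 0 <= q i j) (q_symmetric : symmetric_graph q) (q_connected : connected_graph q) (theta_interp : interpolation_function theta).
Local Notation L := (lifted R d n).
Variables (Omega : set 'rV[R]_d) (M : R).
Hypotheses (mO : measurable Omega) (M0 : 0 <= M)
  (OM : forall x, Omega x -> forall k, `|x 0 k| <= M).

Lemma moment_bound_integral (lambda : probability L R) C : 0 <= C -> finite_second_moment lambda ->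
  exists2 h : R, 0 <= h & (\int[lambda]_z (moment_bound M C z)%:E = h%:E)%E.
Proof.
move=> C0 fm; have mb0 := moment_bound_ge0 M0 C0.
pose c := 2 * (d%:R * M ^+ 2) + C + d%:R * (1 + 2 * M).
have c0 : 0 <= c.
  apply: addr_ge0; first nonneg.
  nonneg.
have ge : (0 <= \int[lambda]_z (moment_bound M C z)%:E)%E.
  nonneg.
suff lt : (\int[lambda]_z (moment_bound M C z)%:E < +oo)%E.
  exists (fine (\int[lambda]_z (moment_bound M C z)%:E)%E); first exact: fine_ge0.
  by rewrite fineK// ge0_fin_numE.
have kp : 0 < 2 :> R by [].
have := @integral_nonmeas_affine _ _ _ lambda (fun=> c) 2
  (fun z => (sqnorm z.1 + sqnorm (coords z.2))%:E)%E (fun z => (moment_bound M C z)%:E) kp.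
have s0 z : (0 <= (sqnorm z.1 + sqnorm (coords (z : L).2))%:E)%E.
  nonneg.
move=> h; apply: (le_lt_trans (h _ _ s0 _ _)) => //.
- nonneg.
- move=> z; rewrite [leRHS](_ : _ = (c + 2 * (sqnorm z.1 + sqnorm (coords z.2)))%:E)%E.
    by rewrite lee_fin /moment_bound -/c addrC lerD2l ler_pM2l// lerDl sqnorm_ge0.
  by rewrite EFinD EFinM.
- rewrite integral_cst// [X in (_ * X)%E]probability_setT mule1.
  by rewrite lte_add_pinfty ?ltry//; apply: lte_mul_pinfty.
Qed.

(** A competitor for [mu_ k] of almost the cost of S: the cells are taken so fine, then k so large,
    that each of the two errors of [glue_cost] is below e / 2. Optimality of S is not involved; its
    hat integrals have to be those of mu. *)
Lemma recovery_plan (lambda : probability L R) (S : L -> L) (mu : vmeasure R d n.+1)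
    (mu_ : nat -> vmeasure R d n.+1) :
  finite_second_moment lambda -> mble S ->
  (lambda (~` [set z | Omega (S z).1]) = 0)%E ->
  (forall j N b, 0 < N ->
    (\int[lambda]_z (node_weights (S z).2 0%R j * hat_prod N b (S z).1)%:E =
     \int[mu j]_x (hat_prod N b x)%:E)%E) ->
  vprob Omega mu -> (forall k, vprob Omega (mu_ k)) -> hat_converge mu_ mu ->
  forall e, 0 < e -> \forall k \near \oo, exists2 G : probability (L * L)%type R,
    coupling lambda (canonical_lifting (mu_ k)) G &
    (transport_cost q theta G <= \int[lambda]_z (vertex_cost q theta z (S z))%:E + e%:E)%E.
Proof.
move=> fm mS SO hproj muO mukO hc e e0.
have [C C0 hC] := node_cost_bounded q_ge0 q_symmetric q_connected theta_interp.
have [h h0 hE] := moment_bound_integral C0 fm.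
have e20 : 0 < e / 2 by rewrite divr_gt0.
(* Hats of scale N have support of width 2 / N, and 2 / N times the moment h is at most e / 2. *)
pose N := (Num.bound (2 * h / (e / 2))).+1.
have N0 : 0 < N%:R :> R by [].
have hN : 2 / N%:R * h <= e / 2.
  rewrite mulrAC ler_pdivrMr// -ler_pdivrMl// mulrC.
  apply: (@le_trans _ _ (Num.bound (2 * h / (e / 2)))%:R); last by rewrite /N ler_nat.
  by apply/ltW/archi_boundP; rewrite divr_ge0 ?(ltW e20)// mulr_ge0.
have [K hK] := hat_prod_sum d N M0.
pose I : finType := {ffun 'I_d -> 'I_K.+1}.
pose b_ (c : I) k := N%:R * M - (c k)%:R.
pose chi (c : I) := hat_prod N%:R (b_ c).
have eps0 : 0 <= 2 / N%:R :> R by [].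
have mchi c : mble (chi c) by exact: measurable_hat_prod.
have chi0 c x : 0 <= chi c x by nonneg.
have chi1 c x : chi c x <= 1 by exact: hat_prod_le1.
have chi_sum x : Omega x -> \sum_c chi c x = 1 by move=> Ox; apply: hK; exact: OM.
have chi_near c x y : chi c x != 0 -> chi c y != 0 -> forall k, `|x 0 k - y 0 k| <= 2 / N%:R.
  move=> /hat_prod_supp hx /hat_prod_supp hy k.
  rewrite ler_pdivlMr// -[X in _ * X](gtr0_norm N0) -normrM mulrBl.
  rewrite (_ : _ - _ = (N%:R * x 0 k + b_ c k) - (N%:R * y 0 k + b_ c k)); last by ring.
  by apply: (le_trans (ler_normB _ _)); have := hx k; have := hy k; lra.
have Smu l : (\int[lambda]_z (cell_weight chi S l z)%:E = (cell_mass chi mu l)%:E)%E.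
  by rewrite cell_massE//; exact: hproj.
pose a := cell_mass chi mu.
have a0 l : 0 <= a l by exact: cell_mass_ge0.
pose A := \sum_l (a l)^-1.
have A0 : 0 <= A by apply: sumr_ge0 => l _; rewrite invr_ge0.
(* When all cell masses agree within eta, the relative defects add up to at most eta * A, and eta *
   A * h is at most e / 2. *)
pose eta := e / 2 / ((A + 1) * (h + 1)).
have eta0 : 0 < eta by rewrite divr_gt0// mulr_gt0// ltr_wpDl.
have near_l : \forall k \near \oo, forall l, `|a l - cell_mass chi (mu_ k) l| <= eta.
  apply: (@filter_forall _ _ _ (nbhs \oo)) => l.
  by apply: filterS (hc l.2 N%:R (b_ l.1) N0 eta eta0) => k; rewrite distrC.
apply: filterS near_l => k hk.
pose b := cell_mass chi (mu_ k).
have ab : \sum_l a l = \sum_l b l.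
  rewrite /a /b (cell_mass_sum mO mchi chi0 chi1 chi_sum muO).
  by rewrite (cell_mass_sum mO mchi chi0 chi1 chi_sum (mukO k)).
have [c [c0 ca cb cd]] := finite_coupling a0 (fun l => cell_mass_ge0 mchi chi0 chi1 (mu_ k) l) ab.
pose Gm := glue_measure mchi chi0 chi1 lambda mS mu (mu_ k) c0.
have [G GE] := mk_probability (glue_total mO mchi chi0 chi1 chi_sum mS SO Smu c0 ca cb).
have cG : coupling lambda (canonical_lifting (mu_ k)) G.
  split=> B mB; rewrite /pushforward GE.
    exact: (glue_fst mO mchi chi0 chi1 chi_sum mS SO Smu c0 ca cb).
  exact: (glue_snd mO mchi chi0 chi1 chi_sum mS (mukO k) Smu c0 ca cb).
exists G => //.
rewrite (transport_costE q_ge0 q_symmetric q_connected theta_interp mO (mukO k) cG).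
rewrite (_ : (\int[G]_z _)%E = (\int[Gm]_z (vertex_cost q theta z.1 z.2)%:E)%E); last first.
  by apply: ge0_integral_eq_measure => B mB; exact: GE.
have := glue_cost q_ge0 q_symmetric q_connected theta_interp mO M0 OM C0 hC eps0 mchi chi0 chi1
  chi_sum chi_near mS SO (mukO k) c0 ca cb cd.
move=> /le_trans; apply; apply: leeD => //; rewrite hE -EFinM lee_fin mulrDl.
rewrite (splitr e); apply: lerD => //.
apply: (@le_trans _ _ (eta * A * h)).
  apply: ler_wpM2r => //; rewrite /A mulr_sumr; apply: ler_sum => l _.
  by apply: ler_wpM2r; [rewrite invr_ge0|exact: hk].
have AH : 0 < (A + 1) * (h + 1) by rewrite mulr_gt0// ltr_wpDl.
have -> : e / 2 = eta * ((A + 1) * (h + 1)) by rewrite /eta divfK// gt_eqF.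
rewrite -mulrA; apply: ler_wpM2l; first exact: ltW.
by apply: ler_pM => //; rewrite lerDl.
Qed.

(** [W_graph_lower] at node i, whose mass drops from 1 to 0, with delta so small that delta * Q <=
    1/2. Its use is to bound the probability of a change of node by the transport cost. *)
Lemma ground_vertex_lower : exists2 c : R, 0 < c & forall (z y : L) i j,
  z.2 = vertex R i -> y.2 = vertex R j -> i != j -> (c%:E <= ground_sqdist q theta z y)%E.
Proof.
pose Q := \sum_(a < n.+1) \sum_(b < n.+1) q a b.
have Q0 : 0 <= Q by apply: sumr_ge0 => a _; exact: sumr_ge0.
pose delta := (2 * (Q + 1))^-1.
have Q2 : 0 < 2 * (Q + 1) by rewrite mulr_gt0// ltr_wpDl.
have d0 : 0 < delta by rewrite invr_gt0.
have dQ : delta * Q <= 2^-1.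
  rewrite /delta mulrC ler_pdivrMr// mulrA mulVf// mul1r; lra.
exists (delta / 2); first by rewrite divr_gt0.
move=> z y i j zi yj ij; rewrite /ground_sqdist zi yj !node_weights_vertex.
apply: (@le_trans _ _ (W_graph q theta (node_mass R i) (node_mass R j) ^+ 2)%E).
  have := W_graph_lower q_ge0 q_symmetric theta_interp (node_mass R i) (node_mass R j) i d0.
  apply: le_trans; rewrite lee_fin -/Q !mxE eqxx (negPf ij) sub0r normrN normr1.
  by apply: ler_wpM2l; [exact: ltW|lra].
by rewrite leeDr ?lee_fin ?sqnorm_ge0.
Qed.

End recovery.

(** * Ultralimits of maps *)

Lemma cvg_sum_seq (R : realType) (T I : Type) (F : set_system T) (FF : Filter F)
    (s : seq I) (f : I -> T -> R) (l : I -> R) : (forall i, f i x @[x --> F] --> l i) ->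
  \sum_(i <- s) f i x @[x --> F] --> \sum_(i <- s) l i.
Proof.
move=> fl; elim: s => [|i s IH].
  rewrite big_nil (_ : (fun x => _) = cst 0); first exact: cvg_cst.
  by apply/funext => x; rewrite big_nil.
rewrite big_cons (_ : (fun x => _) = (fun x => f i x + \sum_(i <- s) f i x)).
  exact: cvgD.
by apply/funext => x; rewrite big_cons.
Qed.

Section ultrafilter_limits.
Context (R : realType) (U : set_system nat) (UU : UltraFilter U).

Lemma ultra_bounded_cvg (r : nat -> R) (a b : R) : (forall k, a <= r k <= b) ->
  r k @[k --> U] --> lim (r k @[k --> U]).
Proof.
move=> rab.
have UK : (r k @[k --> U]) `[a, b]%classic.
  suff: U (r @^-1` `[a, b]%classic) by [].
  by rewrite (_ : r @^-1` _ = setT); [exact: filterT|apply/seteqP; split=> // k _; rewrite /= in_itv/= rab].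
have [p [_ clp]] := @segment_compact R a b (r k @[k --> U]) _ UK.
apply/cvg_ex; exists p => V Vp; have [//|UV] := in_ultra_setVsetC (r @^-1` V) UU.
have UV' : (r k @[k --> U]) (~` V) by [].
by have [x []] := clp _ _ UV' Vp.
Qed.

End ultrafilter_limits.

Import HBNNSimple.

Section setwise_convergence.
Context d (Z : measurableType d) (R : realType).
Variable lambda : {finite_measure set Z -> \bar R}.
Implicit Types m : {measure set Z -> \bar R}.

Definition setwise_le m := forall A, measurable A -> (m A <= lambda A)%E.

Lemma setwise_le_integral m (f : Z -> \bar R) : setwise_le m -> mble f ->
  (forall x, 0 <= f x)%E -> (\int[m]_x f x <= \int[lambda]_x f x)%E.
Proof.
move=> ml mf f0; apply: integral_nonmeas_le => // h hf.
apply: (@le_trans _ _ (\int[lambda]_x (h x)%:E)%E); last first.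
  by apply: le_integral_nonmeas => // x; rewrite lee_fin.
rewrite !integralT_nnsfun !sintegralE; apply: lee_fsum => //= y [x _ <-].
by apply: lee_wpmul2l; rewrite ?lee_fin//; exact: ml.
Qed.

(** Domination by [lambda] makes the error of replacing f by a simple function below it uniform in
    k; for simple functions the claim is a finite sum. *)
Lemma setwise_integral_cvg (I : Type) (U : set_system I) (PU : ProperFilter U)
    (m_ : I -> {measure set Z -> \bar R}) m (f : Z -> R) :
  (forall k, setwise_le (m_ k)) -> setwise_le m ->
  (forall A, measurable A -> fine (m_ k A) @[k --> U] --> fine (m A)) ->
  (forall x, 0 <= f x) -> lambda.-integrable setT (EFin \o f) ->
  fine (\int[m_ k]_x (f x)%:E)%E @[k --> U] --> fine (\int[m]_x (f x)%:E)%E.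
Proof.
move=> m_l ml mm f0 fi; have mf : mble f.
  by apply/measurable_EFinP; exact: measurable_int fi.
have mfE : mble (EFin \o f) by exact/measurable_EFinP.
have fin m' (g : Z -> R) : setwise_le m' -> mble g -> (forall x, 0 <= g x <= f x) ->
    (\int[m']_x (g x)%:E)%E \is a fin_num.
  move=> ml' mg g0f; rewrite ge0_fin_numE; last first.
    by apply: integral_ge0 => x _; rewrite lee_fin; have /andP[] := g0f x.
  apply: (@le_lt_trans _ _ (\int[lambda]_x (f x)%:E)%E).
    apply: (@le_trans _ _ (\int[m']_x (f x)%:E)%E).
      by apply: le_integral_nonmeas => x; rewrite lee_fin; have /andP[] := g0f x.
    by apply: setwise_le_integral => // x; rewrite lee_fin.
  have /integrableP[_] := fi.
  by under eq_integral do rewrite /= ger0_norm//.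
have ll : setwise_le lambda by [].
apply/cvgrPdist_le => e e0.
have e3 : 0 < e / 3 by rewrite divr_gt0.
have [g gf hg] : exists2 g : {nnsfun Z >-> R}, (forall x, g x <= f x) &
    (\int[lambda]_x (f x)%:E <= \int[lambda]_x (g x)%:E + (e / 3)%:E)%E.
  have := @ge0_integralTE _ _ _ lambda (EFin \o f) (fun x => f0 x).
  have ff : (\int[lambda]_x (f x)%:E)%E \is a fin_num by apply: fin => // x; rewrite f0 lexx.
  move=> E; have Ff : ereal_sup [set sintegral lambda h | h in
      [set h : {nnsfun Z >-> R} | forall x, ((h x)%:E <= (EFin \o f) x)%E]] \is a fin_num.
    by rewrite -E.
  have [_ [g gf <-] lt] := ub_ereal_sup_adherent e3 Ff.
  exists g => [x|]; first by have := gf x; nonneg.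
  by rewrite E integralT_nnsfun addeC -leeBlDl// ltW.
have gap m' : setwise_le m' ->
    0 <= fine (\int[m']_x (f x)%:E)%E - fine (\int[m']_x (g x)%:E)%E <= e / 3.
  move=> ml'; have Fg : (\int[m']_x (g x)%:E)%E \is a fin_num by apply: fin => // x; rewrite gf andbT.
  have Ff : (\int[m']_x (f x)%:E)%E \is a fin_num by apply: fin => // x; rewrite f0 lexx.
  have D m'' : setwise_le m'' -> (\int[m'']_x (f x)%:E =
      \int[m'']_x (g x)%:E + \int[m'']_x (f x - g x)%:E)%E.
    move=> ml''; rewrite -ge0_integralD//; last 4 first.
    - nonneg.
    - exact/measurable_EFinP.
    - by move=> x _; rewrite lee_fin subr_ge0.
    - by apply/measurable_EFinP; exact: measurable_funB.
    by apply: eq_integral => x _; rewrite -EFinD addrC subrK.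
  have mfg : mble (fun x => (f x - g x)%:E).
    by apply/measurable_EFinP; exact: measurable_funB.
  have Fd m'' : setwise_le m'' -> (\int[m'']_x (f x - g x)%:E)%E \is a fin_num.
    move=> ml''; apply: fin => //; first exact: measurable_funB.
    by move=> x; rewrite subr_ge0 gf/= lerBlDr lerDl.
  rewrite (D _ ml') fineD ?(Fd _ ml')// addrC addKr fine_ge0/=; last first.
    by apply: integral_ge0 => x _; rewrite lee_fin subr_ge0.
  rewrite -lee_fin fineK ?Fd//.
  apply: (@le_trans _ _ (\int[lambda]_x (f x - g x)%:E)%E).
    by apply: setwise_le_integral => // x; rewrite lee_fin subr_ge0.
  have Fgl : (\int[lambda]_x (g x)%:E)%E \is a fin_num by apply: fin => // x; rewrite gf andbT.
  by move: hg; rewrite (D _ ll) leeD2lE.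
have cg : fine (\int[m_ k]_x (g x)%:E)%E @[k --> U] --> fine (\int[m]_x (g x)%:E)%E.
  have mfin m' A : setwise_le m' -> measurable A -> m' A \is a fin_num.
    move=> ml' mA; rewrite ge0_fin_numE//; apply: (le_lt_trans (ml' _ mA)).
    by rewrite -ge0_fin_numE// fin_num_measure.
  have E m' : setwise_le m' -> fine (\int[m']_x (g x)%:E)%E =
      \sum_(y <- finmap.enum_fset (fset_set (range g))) y * fine (m' (g @^-1` [set y])).
    move=> ml'; rewrite integralT_nnsfun sintegralE fsbig_finite//=.
    rewrite (eq_bigr (fun y => (y * fine (m' (g @^-1` [set y])))%:E)); last first.
      by move=> y _; rewrite EFinM fineK// mfin.
    by rewrite sumEFin.
  rewrite (_ : (fun k => _) = fun k => \sum_(y <- finmap.enum_fset (fset_set (range g))) y *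
      fine (m_ k (g @^-1` [set y]))); last by apply/funext => k; rewrite E.
  rewrite E//; elim: (finmap.enum_fset _) => [|y r IH].
    by under eq_fun do rewrite big_nil; rewrite big_nil; exact: cvg_cst.
  under eq_fun do rewrite big_cons; rewrite big_cons.
  by apply: cvgD => //; apply: cvgM; [exact: cvg_cst|exact: mm].
have /cvgrPdist_le/(_ _ e3) := cg.
apply: filterS => k hk; have /andP[a1 a2] := gap _ ml; have /andP[b1 b2] := gap _ (m_l k).
move: hk a1 a2 b1 b2; rewrite !ler_norml => /andP[h1 h2] a1 a2 b1 b2.
by apply/andP; split; lra.
Qed.

End setwise_convergence.

Section ultralimit_measure.
Context d (Z : measurableType d) (R : realType).
Variable lambda : probability Z R.
Variables (U : set_system nat) (UU : UltraFilter U) (E : nat -> set Z).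
Hypothesis mE : forall k, measurable (E k).

Let r A k : R := fine (lambda (A `&` E k)).

(** The maximum with 0 matters only for non-measurable A, where the limit is not controlled although
    a measure must be nonnegative. *)
Definition ulim of UltraFilter U & (forall k, measurable (E k)) := fun A : set Z =>
  (Num.max 0 (lim (r A k @[k --> U])))%:E.

Let fin A : measurable A -> lambda A \is a fin_num.
Proof. by move=> mA; rewrite fin_num_measure. Qed.

Let r01 A : measurable A -> forall k, 0 <= r A k <= fine (lambda A).
Proof.
move=> mA k; rewrite fine_ge0//= fine_le ?fin//; first mea.
by apply: le_measure; rewrite ?inE//; mea.
Qed.

Lemma ulim_cvg A : measurable A -> r A k @[k --> U] --> fine (ulim UU mE A).
Proof.
move=> mA; have c := ultra_bounded_cvg UU (r01 mA).
rewrite /ulim/= (max_idPr _)//; apply: limr_ge; first by apply/cvg_ex; exists (lim (r A k @[k --> U])).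
by apply: filterS filterT => k _; have /andP[] := r01 mA k.
Qed.

Lemma ulim_le A : measurable A -> (ulim UU mE A <= lambda A)%E.
Proof.
move=> mA; rewrite -(fineK (fin mA)) -[ulim _ _ A]fineK// lee_fin.
have c := ulim_cvg mA; rewrite -(cvg_lim _ c)//.
apply: limr_le; first by apply/cvg_ex; eexists; exact: c.
by apply: filterS filterT => k _; have /andP[] := r01 mA k.
Qed.

Let ulim0 : ulim UU mE set0 = 0%E.
Proof.
apply/eqP; rewrite eq_le; apply/andP; split; last by rewrite lee_fin le_max lexx.
by have := ulim_le measurable0; rewrite measure0.
Qed.

Let ulim_ge0 A : (0 <= ulim UU mE A)%E.
Proof. by rewrite lee_fin le_max lexx. Qed.

(** Finite additivity passes to the ultralimit. The tails of the series are bounded by those of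
    [lambda], uniformly in k, which upgrades it to countable additivity. *)
Let ulim_sigma_additive : semi_sigma_additive (ulim UU mE).
Proof.
move=> F mF tF mUF.
pose T n := \bigcup_(i in [set k | (n <= k)%N]) F i.
have mT n : measurable (T n) by exact: bigcup_measurable.
have rD n : fine (ulim UU mE (\bigcup_i F i)) - \sum_(0 <= i < n) fine (ulim UU mE (F i)) <=
      fine (lambda (\bigcup_i F i)) - \sum_(0 <= i < n) fine (lambda (F i)) /\
    0 <= fine (ulim UU mE (\bigcup_i F i)) - \sum_(0 <= i < n) fine (ulim UU mE (F i)).
  have c : r (\bigcup_i F i) k - \sum_(0 <= i < n) r (F i) k @[k --> U] -->
      fine (ulim UU mE (\bigcup_i F i)) - \sum_(0 <= i < n) fine (ulim UU mE (F i)).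
    apply: cvgB; first exact: ulim_cvg.
    elim: n => [|n IH].
      by under eq_fun do rewrite big_geq//; rewrite big_geq//; exact: cvg_cst.
    under eq_fun do rewrite big_nat_recr//=; rewrite big_nat_recr//=.
    by apply: cvgD => //; exact: ulim_cvg.
  have key B : measurable B -> fine (lambda ((\bigcup_i F i) `&` B)) -
      \sum_(0 <= i < n) fine (lambda (F i `&` B)) = fine (lambda (T n `&` B)).
    move=> mB; apply/eqP; rewrite subr_eq addrC; apply/eqP; elim: n {c} => [|n IH].
      rewrite big_geq// add0r; congr (fine (lambda (_ `&` _))).
      by apply/seteqP; split=> x [i ? Fx]; exists i.
    rewrite IH big_nat_recr//= -addrA; congr (_ + _).
    have -> : T n `&` B = (F n `&` B) `|` (T n.+1 `&` B).
      apply/seteqP; split=> [x [[i /= ni Fx] Bx]|x [[Fx Bx]|[[i /= ni Fx] Bx]]].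
      - have [E0|ni'] := eqVneq i n; first by left; rewrite -E0.
        by right; split=> //; exists i => //=; rewrite ltn_neqAle eq_sym ni'.
      - by split=> //; exists n => /=.
      - by split=> //; exists i => //=; exact: ltnW.
    rewrite measureU//.
    - by rewrite fineD// fin//; apply: measurableI => //; exact: mT.
    - mea.
    - mea.
    apply/seteqP; split=> // x [[Fx _] [[i /= ni Fix] _]].
    have : i = n by apply: tF => //; exists x.
    by move=> E'; rewrite E' ltnn in ni.
  have kT := key setT measurableT; rewrite setIT in kT.
  have bnd k : 0 <= r (\bigcup_i F i) k - \sum_(0 <= i < n) r (F i) k <=
      fine (lambda (\bigcup_i F i)) - \sum_(0 <= i < n) fine (lambda (F i)).
    rewrite [X in 0 <= X <= _](key _ (mE k)).
    under [X in _ <= _ - X]eq_bigr do rewrite -[F _]setIT.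
    rewrite kT setIT; exact: r01.
  split; rewrite -(cvg_lim _ c)//.
    apply: limr_le; first by apply/cvg_ex; eexists; exact: c.
    by apply: filterS filterT => k _; have /andP[] := bnd k.
  apply: limr_ge; first by apply/cvg_ex; eexists; exact: c.
  by apply: filterS filterT => k _; have /andP[] := bnd k.
have sl : (fine (lambda (\bigcup_i F i)) - \sum_(0 <= i < n) fine (lambda (F i))) @[n --> \oo] --> (0 : R).
  rewrite -[X in _ --> X](subrr (fine (lambda (\bigcup_i F i)))); apply: cvgB; first exact: cvg_cst.
  have h := @measure_sigma_additive _ _ _ lambda _ mF tF.
  have {}h : (\sum_(0 <= i < n) lambda (F i))%E @[n --> \oo] --> (fine (lambda (\bigcup_i F i)))%:E.
    by rewrite fineK ?fin//; exact: h.
  apply: cvg_trans (fine_cvg h); apply: near_eq_cvg; apply: nearW => n /=.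
  rewrite (eq_bigr (fun i => (fine (lambda (F i)))%:E)); last by move=> i _; rewrite fineK// fin.
  by rewrite sumEFin.
have ul : (\sum_(0 <= i < n) fine (ulim UU mE (F i))) @[n --> \oo] --> fine (ulim UU mE (\bigcup_i F i)).
  apply/cvgrPdist_le => e e0; have /cvgrPdist_le/(_ _ e0) := sl.
  apply: filterS => n; rewrite sub0r normrN => h; have [h1 h2] := rD n.
  by rewrite ger0_norm//; apply: (le_trans h1); apply: le_trans h; exact: ler_norm.
rewrite -[X in _ --> X]fineK//; apply/fine_cvgP; split.
  by apply: nearW => n; apply/sum_fin_numP => i _ _.
apply: cvg_trans ul; apply: near_eq_cvg; apply: nearW => n /=.
by rewrite sumEFin.
Qed.

HB.instance Definition _ := isMeasure.Build _ _ _ (ulim UU mE)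
  ulim0 ulim_ge0 ulim_sigma_additive.

Lemma ulim_density : exists w : Z -> R, [/\ mble w, forall z, 0 <= w z,
  lambda.-integrable setT (EFin \o w) &
  forall A, measurable A -> (ulim UU mE A = \int[lambda]_(z in A) (w z)%:E)%E].
Proof.
have [nu nuE] := @mk_finite_measure _ _ _ (ulim UU mE : {measure set Z -> \bar R}) (ltry _).
have dom : nu `<< lambda.
  move=> N N0 A mA AN; rewrite nuE; have lA : lambda A = 0%E by exact: N0.
  by apply/eqP; rewrite eq_le measure_ge0 andbT -lA; exact: ulim_le.
pose f := Radon_Nikodym_SigmaFinite.f nu lambda.
have f0 := Radon_Nikodym_SigmaFinite.f_ge0 dom; have ff := Radon_Nikodym_SigmaFinite.f_fin_num dom.
have fi := Radon_Nikodym_SigmaFinite.f_integrable dom.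
have fE : EFin \o (fine \o f) = f by apply/funext => z; rewrite /= fineK.
exists (fine \o f); split.
- by apply/measurable_EFinP; rewrite fE; exact: measurable_int fi.
- by move=> z; exact/fine_ge0/f0.
- by rewrite fE.
- move=> A mA; rewrite -[LHS]nuE (Radon_Nikodym_SigmaFinite.f_integral dom)//.
  by apply: eq_integral => z _; rewrite /= fineK.
Qed.

End ultralimit_measure.

(** * Limits of nested codes *)

Section nested_codes.
Context d (Z : measurableType d) (R : realType).
Variable lambda : probability Z R.
Variables (U : set_system nat) (UU : UltraFilter U).
Variables (K n : nat) (code : nat -> nat -> Z -> nat).
Hypothesis K0 : (0 < K)%N.
Local Notation B m := (n.+1 * K ^ m)%N.
Hypotheses (mcode : forall m k a, measurable [set z | code m k z = a])
  (code_lt : forall m k z, (code m k z < B m)%N)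
  (code_div : forall m k z, (code m k z = code m.+1 k z %/ K)%N).
Local Notation leb := (@lebesgue_measure R).

Lemma uniform_unit_interval : exists P : probability (measurableTypeR R) R, forall F, 0 <= F <= 1 ->
  P [set w | w < F] = F%:E.
Proof.
have mI : measurable (`[0, 1]%classic : set R) by [].
have m1 : (mrestr leb mI) setT = 1%E by rewrite /mrestr setTI; exact: lebesgue_itv01.
have [P PE] := mk_probability m1.
exists P => F /andP[F0 F1]; rewrite PE /= /mrestr.
have -> : [set w | w < F] `&` `[0, 1] = `[0, F[%classic.
  apply/seteqP; split=> w /=; rewrite !in_itv/=; first by move=> [-> /andP[->]].
  by move=> /andP[-> wF]; split=> //=; exact/ltW/(lt_le_trans wF).
rewrite lebesgue_measure_itv/= lte_fin; case: ltgtP F0 => // [F0 _|<- _].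
  by rewrite -EFinB subr0.
by [].
Qed.

(* [w m a z] is the limit conditional probability of the code [a] given [z];
   the consistency relations, which hold almost everywhere, are enforced
   everywhere by changing [w] on a null set. *)
Lemma limit_weights : exists w : nat -> nat -> Z -> R, [/\
  forall m a, mble (w m a), forall m a z, 0 <= w m a z,
  forall m a z, (a < B m)%N -> w m a z = \sum_(i < K) w m.+1 (K * a + i)%N z,
  forall z, \sum_(a < n.+1) w 0%N a z = 1 &
  forall m a A, measurable A -> fine (lambda (A `&` [set z | code m k z = a])) @[k --> U] -->
    fine (\int[lambda]_(z in A) (w m a z)%:E)%E].
Proof.
have /choice[w0 hw0] : forall m, exists w : nat -> Z -> R, forall a, [/\ mble (w a),
    forall z, 0 <= w a z, lambda.-integrable setT (EFin \o w a) &
    forall A, measurable A -> (ulim lambda UU (fun k => mcode m k a) A = \int[lambda]_(z in A) (w a z)%:E)%E].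
  move=> m; have /choice[w hw] := fun a => ulim_density lambda UU (fun k => mcode m k a).
  by exists w.
have wi m a : lambda.-integrable setT (EFin \o w0 m a) by have [] := hw0 m a.
have wE m a A : measurable A ->
    fine (\int[lambda]_(z in A) (w0 m a z)%:E)%E = fine (ulim lambda UU (fun k => mcode m k a) A).
  by move=> mA; have [_ _ _ ->] := hw0 m a.
have wfin m a A : measurable A -> (\int[lambda]_(z in A) (w0 m a z)%:E)%E \is a fin_num.
  by move=> mA; apply: integrable_fin_num => //; apply: integrableS (wi m a).
have fin A : measurable A -> lambda A \is a fin_num by move=> mA; rewrite fin_num_measure.
have sum_cvg I (c : nat -> nat) m (D : nat -> set Z) A : measurable A ->
    injective c -> (forall k z, D k z <-> exists2 i, (i < I)%N & code m k z = c i) ->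
    fine (lambda (A `&` D k)) @[k --> U] --> \sum_(i < I) fine (\int[lambda]_(z in A) (w0 m (c i) z)%:E)%E.
  move=> mA ci DE.
  have -> : (fun k => fine (lambda (A `&` D k))) =
      fun k => \sum_(i < I) fine (lambda (A `&` [set z | code m k z = c i])).
    apply/funext => k.
    have mAi (i : 'I_I) : measurable (A `&` [set z | code m k z = c i]) by exact: measurableI.
    have -> : A `&` D k = \big[setU/set0]_(i < I) (A `&` [set z | code m k z = c i]).
      rewrite -(bigcup_mkord I (fun i => A `&` [set z | code m k z = c i])).
      apply/seteqP; split=> z.
        by move=> [Az /DE[i iI ci']]; exists i.
      by move=> [i iI [Az ci']]; split=> //; apply/DE; exists i.
    rewrite (@measure_semi_additive_ord _ _ _ lambda I (fun i : 'I_I => A `&` [set z | code m k z = c i]))//.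
    - by rewrite -sum_fine// => i _; exact: fin.
    - move=> i j _ _ [z [[_ /= zi] [_ /= zj]]]; apply: val_inj; apply: ci.
      by rewrite -zi -zj.
    - exact: bigsetU_measurable.
  under [X in _ --> X]eq_bigr do rewrite wE//.
  by apply: cvg_sum_seq => i; exact: ulim_cvg.
have wcvg m a A : measurable A -> fine (lambda (A `&` [set z | code m k z = a])) @[k --> U] -->
    fine (\int[lambda]_(z in A) (w0 m a z)%:E)%E.
  by move=> mA; rewrite wE//; exact: ulim_cvg.
have sumE (I : nat) (c : nat -> nat) m A : measurable A ->
    (\sum_(i < I) fine (\int[lambda]_(z in A) (w0 m (c i) z)%:E)%E)%:E =
    (\int[lambda]_(z in A) (\sum_(i < I) w0 m (c i) z)%:E)%E.
  move=> mA; rewrite -sumEFin; under [RHS]eq_integral do rewrite -sumEFin.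
  rewrite ge0_integral_sum//; last 2 first.
  - by move=> i; apply: measurable_funTS; exact: measurable_int (wi _ _).
  - by move=> i z _; rewrite lee_fin; have [_ + _ _] := hw0 m (c i); exact.
  by apply: eq_bigr => i _; rewrite fineK// wfin.
have msum (I : nat) (c : nat -> nat) m : mble (fun z => (\sum_(i < I) w0 m (c i) z)%:E).
  by apply/measurable_EFinP; apply: measurable_sum => i; have [] := hw0 m (c i).
(* At every k the event of the code a is the disjoint union of the events of its K children, so the
   limit weights have equal integrals over all measurable sets. *)
have ae1 : {ae lambda, forall z, forall m a, w0 m a z = \sum_(i < K) w0 m.+1 (K * a + i)%N z}.
  apply: ae_foralln => m; apply: ae_foralln => a.
  have : ae_eq lambda setT (EFin \o w0 m a) (fun z => (\sum_(i < K) w0 m.+1 (K * a + i)%N z)%:E).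
    apply: integral_ae_eq => // A _ mA.
    rewrite -(sumE K (fun i => K * a + i)%N)// -[LHS]fineK ?wfin//; congr EFin.
    have c1 := wcvg m a A mA.
    have c2 := sum_cvg K (fun i => K * a + i)%N m.+1 (fun k => [set z | code m k z = a]) A mA.
    apply: (cvg_unique _ c1 (c2 _ _)) => // [i j /addnI//|k z] /=.
    rewrite code_div; split=> [az|[i iK ->]].
      by exists (code m.+1 k z %% K)%N; [rewrite ltn_mod|rewrite -az mulnC -divn_eq].
    by rewrite mulnC divnMDl// divn_small// addn0.
  by apply: filterS => z /(_ I); case.
have ae2 : {ae lambda, forall z, \sum_(a < n.+1) w0 0%N a z = 1}.
  have : ae_eq lambda setT (fun z => (\sum_(a < n.+1) w0 0%N a z)%:E) (cst 1%E).
    apply: integral_ae_eq => //.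
      under eq_fun do rewrite -sumEFin.
      by apply: (@integrable_sum _ _ _ _ _ _ _ (index_enum 'I_n.+1)) => // i _; exact: wi.
    move=> A _ mA; rewrite -(sumE n.+1 id)// integral_cst// mul1e -[RHS]fineK ?fin//; congr EFin.
    have c2 := sum_cvg n.+1 id 0%N (fun k => setT) A mA.
    apply/esym; apply: (cvg_unique _ _ (c2 _ _)) => // [|k z].
      by under eq_fun do rewrite setIT; exact: cvg_cst.
    by split=> // _; exists (code 0%N k z) => //; rewrite -[n.+1]muln1; exact: code_lt.
  by apply: filterS => z /(_ I); case.
have [N [mN N0 NP]] := filterI ae1 ae2.
(* On the null set all the mass is put on the code 0, which is its own first child; both relations
   hold there too. *)
pose w m a z := w0 m a z * \1_(~` N) z + (a == 0%N)%:R * \1_N z.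
have wN m a z : N z -> w m a z = (a == 0%N)%:R.
  move=> Nz; rewrite /w !indicE (mem_set Nz) mulr1.
  by rewrite (_ : _ \in _ = false) ?mulr0 ?add0r//; apply/negbTE/negP => /set_mem.
have wNN m a z : ~ N z -> w m a z = w0 m a z.
  move=> Nz; rewrite /w !indicE (mem_set (Nz : (~` N) z)) mulr1.
  by rewrite (_ : z \in N = false) ?mulr0 ?addr0//; apply/negbTE/negP => /set_mem.
have mw m a : mble (w m a).
  apply: measurable_funD; apply: measurable_funM => //; first by have [] := hw0 m a.
    mea.
have wge0 m a z : 0 <= w m a z.
  by apply: addr_ge0; apply: mulr_ge0 => //; have [_ + _ _] := hw0 m a; exact.
exists w; split=> //.
- move=> m a z _; have [Nz|Nz] := pselect (N z).
    rewrite wN//; under eq_bigr do rewrite wN// addn_eq0 muln_eq0.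
    rewrite (bigD1 (Ordinal K0))//= big1 ?addr0; last first.
      move=> i i0; have /negPf -> : (i : nat) != 0%N; last by rewrite andbF.
      by apply: contra i0 => /eqP i0; apply/eqP/val_inj.
    by rewrite eqxx andbT (gtn_eqF K0).
  have : ~ (~` [set z | (forall m a, w0 m a z = \sum_(i < K) w0 m.+1 (K * a + i)%N z) /\
     \sum_(a < n.+1) w0 0%N a z = 1]) z by move=> /NP.
  by move=> /contrapT[h _]; rewrite wNN// h; apply: eq_bigr => i _; rewrite wNN.
- move=> z; have [Nz|Nz] := pselect (N z).
    by under eq_bigr do rewrite wN//; rewrite big_ord_recl/= big1 ?addr0.
  have : ~ (~` [set z | (forall m a, w0 m a z = \sum_(i < K) w0 m.+1 (K * a + i)%N z) /\
     \sum_(a < n.+1) w0 0%N a z = 1]) z by move=> /NP.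
  by move=> /contrapT[_ h]; rewrite -[RHS]h; apply: eq_bigr => i _; rewrite wNN.
- move=> m a A mA; rewrite (_ : (\int[lambda]_(z in A) (w m a z)%:E)%E =
    (\int[lambda]_(z in A) (w0 m a z)%:E)%E); first exact: wcvg.
  apply: ge0_ae_eq_integral; first exact: mA.
  - mea.
  - by apply: measurable_funTS; exact: measurable_int (wi _ _).
  - nonneg.
  - by move=> z _; rewrite lee_fin; have [_ + _ _] := hw0 m a; exact.
  - exists N; split=> // z /= h; apply: contrapT => Nz; apply: h => _.
    by rewrite wNN.
Qed.

(* The codes of the limit are read off the conditional distribution functions
   [F m a], the second variable being uniform on the unit interval. *)
Lemma limit_codes : exists (P : probability (measurableTypeR R) R)
    (A : nat -> Z * measurableTypeR R -> nat), [/\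
  forall m a, measurable [set zw | A m zw = a],
  forall m zw, (A m zw < B m)%N,
  forall m zw, (A m zw = A m.+1 zw %/ K)%N &
  forall m a S, measurable S -> (a < B m)%N ->
    fine (lambda (S `&` [set z | code m k z = a])) @[k --> U] -->
    fine ((lambda \x P)%E ((fst @^-1` S) `&` [set zw | A m zw = a]))].
Proof.
have [P PU] := uniform_unit_interval.
have [w [mw w0 wK w1 wcvg]] := limit_weights.
(* The conditional distribution function strictly below a. The children of b are K b, ..., K b + K -
   1, so [F m a] and [F m.+1 (K * a)] agree. *)
pose F m a z := \sum_(b < a) w m b z.
have mF m a : mble (F m a) by apply: measurable_sum => b.
have F_mono m a b z : (a <= b)%N -> F m a z <= F m b z.
  move=> ab; rewrite /F -(subnKC ab) big_split_ord/= lerDl; exact: sumr_ge0.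
have FK m a z : (a <= B m)%N -> F m a z = F m.+1 (K * a)%N z.
  elim: a => [|a IH] aB; first by rewrite muln0 /F !big_ord0.
  rewrite {1}/F big_ord_recr/= -/(F m a z) IH ?(ltnW aB)// wK//.
  rewrite mulnS addnC [in RHS]/F big_split_ord/=.
  by congr (_ + _).
have FB m z : F m (B m) z = 1.
  elim: m => [|m IH]; first by rewrite expn0 muln1; exact: w1.
  by rewrite -[RHS]IH [RHS]FK// expnS mulnCA.
have F0 m z : F m 0%N z = 0 by rewrite /F big_ord0.
have F01 m a z : (a <= B m)%N -> 0 <= F m a z <= 1.
  by move=> aB; rewrite -(F0 m z) -(FB m z) !F_mono.
(* The number of thresholds [F m a z], 1 <= a < B m, that do not exceed w: this is the quantile
   function of the weights at w. *)
pose A m (zw : Z * measurableTypeR R) : nat := (\sum_(1 <= a < B m) (F m a zw.1 <= zw.2 :> R)%R)%N.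
have Bp m : (0 < B m)%N by rewrite muln_gt0/= expn_gt0 K0.
have A_lt m zw : (A m zw < B m)%N.
  apply: (@leq_ltn_trans (\sum_(1 <= a < B m) 1)%N).
    by apply: leq_sum => a _; exact: leq_b1.
  by rewrite sum_nat_const_nat muln1 subn1 prednK.
have A_ltE m a zw : (0 < a)%N -> (a < B m)%N -> (A m zw < a)%N = (zw.2 < F m a zw.1 :> R).
  move=> a0 aB; rewrite /A (@big_cat_nat _ _ _ a)//=; last exact: ltnW.
  case: ltP => h.
    rewrite [X in (_ + X)%N]big1_seq ?addn0.
      apply: (@leq_ltn_trans (\sum_(1 <= b < a) 1)%N); first by apply: leq_sum => b _; exact: leq_b1.
      by rewrite sum_nat_const_nat muln1 subn1 prednK.
    move=> b /andP[_]; rewrite mem_index_iota => /andP[ab _].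
    by rewrite leNgt (lt_le_trans h (F_mono m _ _ zw.1 ab)).
  apply/negbTE; rewrite -leqNgt [X in (_ + X)%N]big_ltn//= h.
  rewrite (eq_big_nat _ _ (F2 := fun=> 1%N)); last first.
    by move=> b /andP[b1 ba]; rewrite (le_trans (F_mono m _ _ zw.1 (ltnW ba)) h).
  by rewrite sum_nat_const_nat muln1 addnA addn1 subn1 prednK// leq_addr.
have mlt m a : measurable [set zw | (A m zw < a)%N].
  have [a0|a0] := posnP a; first by rewrite a0 (_ : [set _ | _] = set0)//; apply/seteqP; split.
  have [aB|aB] := ltnP a (B m); last first.
    rewrite (_ : [set _ | _] = setT)//; apply/seteqP; split=> // zw _ /=.
    exact: leq_trans (A_lt _ _) aB.
  rewrite (_ : [set _ | _] = [set zw : Z * measurableTypeR R | zw.2 < F m a zw.1 :> R]); last first.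
    by apply/seteqP; split=> zw /=; rewrite A_ltE.
  rewrite -[X in measurable X]setTI.
  have mf : mble (fun zw : Z * measurableTypeR R => F m a zw.1) by mea.
  have ms : mble (fun zw : Z * measurableTypeR R => zw.2 : R) by mea.
  exact: (measurable_fun_ltr ms mf measurableT (Y := [set true])).
have AE m a : [set zw | A m zw = a] = [set zw | (A m zw < a.+1)%N] `\` [set zw | (A m zw < a)%N].
  apply/seteqP; split=> zw /=; first by move=> ->; split; rewrite// ltnn.
  by move=> [h1 /negP]; rewrite -leqNgt => h2; apply/eqP; rewrite eqn_leq -ltnS h1 h2.
have mA m a : measurable [set zw | A m zw = a] by rewrite AE; exact: measurableD.
have PF m a z : (a <= B m)%N -> P [set w | (A m (z, w) < a)%N] = (F m a z)%:E.
  move=> aB; have [a0|a0] := posnP a.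
    by rewrite a0 F0 (_ : [set _ | _] = set0) ?measure0//; apply/seteqP; split.
  move: aB; rewrite leq_eqVlt => /orP[/eqP ->|aB].
    by rewrite FB (_ : [set _ | _] = setT) ?probability_setT//; apply/seteqP; split=> // w' _; exact: A_lt.
  rewrite (_ : [set _ | _] = [set w' : R | w' < F m a z]); last first.
    by apply/seteqP; split=> w' /=; rewrite A_ltE.
  by rewrite PU// F01// ltnW.
have mA1 m a z : measurable [set w | A m (z, w) = a].
  rewrite (_ : [set _ | _] = xsection [set zw | A m zw = a] z); first exact: measurable_xsection.
  by apply/seteqP; split=> w' /=; [move=> h; apply/mem_set|move=> /set_mem].
have mlt1 m a z : measurable [set w | (A m (z, w) < a)%N].
  rewrite (_ : [set _ | _] = xsection [set zw | (A m zw < a)%N] z); first exact: measurable_xsection.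
  by apply/seteqP; split=> w' /=; [move=> h; apply/mem_set|move=> /set_mem].
have Pw m a z : (a < B m)%N -> P [set w | A m (z, w) = a] = (w m a z)%:E.
  move=> aB; have := PF m a.+1 z aB.
  rewrite (_ : [set w | (A m (z, w) < a.+1)%N] =
     [set w | (A m (z, w) < a)%N] `|` [set w | A m (z, w) = a]); last first.
    apply/seteqP; split=> w' /=; first by rewrite ltnS leq_eqVlt => /orP[/eqP|]; [right|left].
    by move=> [|->] //; exact: ltnW.
  have -> : P ([set w | (A m (z, w) < a)%N] `|` [set w | A m (z, w) = a]) =
      (P [set w | (A m (z, w) < a)%N] + P [set w | A m (z, w) = a])%E.
    apply: measureU => //.
    by apply/seteqP; split=> // w' [/= h1 h2]; rewrite h2 ltnn in h1.
  rewrite PF ?(ltnW aB)// /F big_ord_recr/= EFinD => /eqP; rewrite eq_sym => /eqP.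
  have Pf : P [set w | A m (z, w) = a] \is a fin_num by exact: fin_num_measure.
  by rewrite -(fineK Pf) -!EFinD => -[] /addrI ->.
exists P, A; split=> //.
(* Both codes are below a exactly when w < F m a z = F m.+1 (K * a) z, for every threshold a, hence
   they coincide. *)
- move=> m zw; have lem a : (0 < a)%N -> (a < B m)%N -> (A m zw < a)%N = (A m.+1 zw %/ K < a)%N.
    move=> a0 aB; rewrite ltn_divLR// mulnC A_ltE// FK ?(ltnW aB)// -A_ltE//.
      by rewrite muln_gt0 K0.
    by rewrite expnS mulnCA ltn_mul2l K0.
  have h2 : (A m.+1 zw %/ K < B m)%N by rewrite ltn_divLR// -mulnA -expnSr; exact: A_lt.
  apply/eqP; rewrite eqn_leq; apply/andP; split.
    rewrite -ltnS; have [e|ne] := ltnP (A m.+1 zw %/ K).+1 (B m); first by rewrite lem// ltnSn.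
    exact: leq_trans (A_lt m zw) ne.
  rewrite -ltnS; have [e|ne] := ltnP (A m zw).+1 (B m); first by rewrite -lem// ltnSn.
  exact: leq_trans h2 ne.
- move=> m a S mS aB.
  rewrite (_ : (lambda \x P)%E _ = (\int[lambda]_(z in S) (w m a z)%:E)%E); first exact: wcvg.
  rewrite /product_measure1/= [RHS]integral_mkcond; apply: eq_integral => z _; rewrite patchE.
  case: ifPn => [/set_mem Sz|/negP Sz].
    rewrite -Pw//; congr (P _); apply/seteqP; split=> w' /=.
      by move=> /set_mem[_ /=].
    by move=> h; apply/mem_set; split.
  rewrite (_ : xsection _ z = set0) ?measure0//; apply/seteqP; split=> w' //= /set_mem[/= Sz' _].
  by apply: Sz; exact/mem_set.
Qed.

End nested_codes.

(** * Dyadic cubes numbered by nested codes *)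

Section dyadic_codes.
Context (R : realType) (d : nat).
Local Notation D := {ffun 'I_d -> bool}.
Local Notation K := #|{: D}|.

(** The position of t inside its dyadic interval of level m, rescaled to [0, 1); comparing it with
    1/2 gives the next binary digit. *)
Fixpoint residue (m : nat) (t : R) : R :=
  if m is m'.+1 then 2 * residue m' t - (2^-1 <= residue m' t)%R%:R else t.

Lemma residue01 m t : 0 <= t < 1 -> 0 <= residue m t < 1.
Proof.
move=> t01; elim: m => [//|m /andP[r0 r1]] /=.
by have [h|h] := leP (2^-1 : R) (residue m t); apply/andP; split=> /=; lra.
Qed.

Lemma measurable_residue m : mble (residue m).
Proof.
elim: m => [|m IH]; first exact: measurable_id.
apply: measurable_funB; first mea.
rewrite (_ : (fun t => _) = \1_[set t | 2^-1 <= residue m t]); last first.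
  apply/funext => t; change ((2^-1 <= residue m t)%R%:R = \1_[set t | 2^-1 <= residue m t] t :> R).
  by rewrite indicE; have [h|/negP h] := boolP (2^-1 <= residue m t); [rewrite mem_set|rewrite memNset].
apply: measurable_indic; rewrite -[X in measurable X]setTI.
by apply: (measurable_fun_ler (@measurable_cst _ _ _ _ setT (2^-1 : R)) IH measurableT (Y := [set true])).
Qed.

(** The default of [nth] is never reached, since the remainder is below the length of the
    enumeration. *)
Definition digit (a : nat) : D := nth [ffun=> false] (enum {: D}) (a %% K).

(** The lower corner of the dyadic cube of side 2^-m that the code a designates. *)
Fixpoint corner (m a : nat) (i : 'I_d) : R :=
  if m is m'.+1 then corner m' (a %/ K) i + (digit a i)%:R * 2^-1 ^+ m else 0.

(** Each level appends one base K symbol holding the d binary digits of that level; the leading part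
    is the node j. Division by K forgets the last level. *)
Fixpoint vcode (m : nat) (t : 'I_d -> R) (j : nat) : nat :=
  if m is m'.+1 then (
    K * vcode m' t j + index [ffun i => (2^-1 <= residue m' (t i))%R] (enum {: D}))%N
  else j.

Lemma corner01 m a i : 0 <= corner m a i <= 1 - 2^-1 ^+ m.
Proof.
elim: m a => [|m IH] a; first by rewrite expr0 subrr lexx.
have p0 : 0 <= 2^-1 ^+ m.+1 :> R by nonneg.
have /andP[h0 h1] := IH (a %/ K)%N; rewrite /=.
have e : 2^-1 ^+ m = 2 * 2^-1 ^+ m.+1 :> R by rewrite exprS mulrA mulfV ?mul1r.
by case: (digit a i); rewrite ?mul1r ?mul0r; apply/andP; split; lra.
Qed.

Fixpoint root (m a : nat) : nat := if m is m'.+1 then root m' (a %/ K) else a.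

Lemma K_gt0 : (0 < K)%N.
Proof. by apply/card_gt0P; exists [ffun=> false]. Qed.

Let index_lt b : (index b (enum {: D}) < K)%N.
Proof. by rewrite cardE index_mem mem_enum. Qed.

Lemma vcode_div m t j : vcode m t j = (vcode m.+1 t j %/ K)%N.
Proof. by rewrite /= mulnC divnMDl ?K_gt0// divn_small// addn0. Qed.

Lemma vcode_lt m t j N : (j < N)%N -> (vcode m t j < N * K ^ m)%N.
Proof.
move=> jN; elim: m => [|m IH]; first by rewrite muln1.
by rewrite expnSr mulnA -ltn_divLR ?K_gt0// -vcode_div.
Qed.

Lemma digit_vcode m t j : digit (vcode m.+1 t j) = [ffun i => 2^-1 <= residue m (t i)].
Proof.
by rewrite /digit /= mulnC modnMDl modn_small// nth_index// mem_enum.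
Qed.

Lemma corner_vcode m t j i : corner m (vcode m t j) i = t i - residue m (t i) * 2^-1 ^+ m.
Proof.
elim: m => [|m IH]; first by rewrite /= expr0 mulr1 subrr.
rewrite [corner _ _ _]/= -/(vcode m.+1 t j) -vcode_div IH digit_vcode ffunE exprS /=.
move: (2^-1 <= residue m (t i))%R => b; move: (residue m (t i)) => r.
by move: (2^-1 ^+ m) (b%:R : R) => p c; field.
Qed.

Lemma root_vcode m t j : root m (vcode m t j) = j.
Proof. by elim: m => // m IH; rewrite [LHS]/= -/(vcode m.+1 t j) -vcode_div. Qed.

Lemma measurable_vcode d' (T : measurableType d') (x : T -> 'I_d -> R) (j : T -> nat) m a :
  (forall i, mble (fun z => x z i)) ->
  (forall a, measurable [set z | j z = a]) -> measurable [set z | vcode m (x z) (j z) = a].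
Proof.
move=> mx mj; elim: m a => [|m IH] a //.
pose b z : D := [ffun i => 2^-1 <= residue m (x z i)].
have mb (c : D) : measurable [set z | b z = c].
  rewrite (_ : [set z | b z = c] = \bigcap_(i in [set: 'I_d]) [set z | (2^-1 <= residue m (x z i)) = c i]).
    apply: fin_bigcap_measurable => // i _; rewrite -[X in measurable X]setTI.
    have mr : mble (fun z => residue m (x z i)).
      exact: (measurableT_comp (measurable_residue m)).
    exact: (measurable_fun_ler (@measurable_cst _ _ _ _ setT (2^-1 : R)) mr measurableT (Y := [set c i])).
  apply/seteqP; split=> z /=; first by move=> <- i _; rewrite /= ffunE.
  by move=> h; apply/ffunP => i; rewrite ffunE; exact: h.
rewrite (_ : [set z | _] = \bigcup_(c in [set: D])
   ([set z | b z = c] `&` [set z | vcode m (x z) (j z) = (a %/ K)%N /\ index c (enum {: D}) = (a %% K)%N])).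
  apply: fin_bigcup_measurable => // c _; apply: measurableI => //.
  have [e|e] := eqVneq (index c (enum {: D})) (a %% K)%N.
    rewrite (_ : [set z | _] = [set z | vcode m (x z) (j z) = (a %/ K)%N])//.
    by apply/seteqP; split=> z //= [].
  rewrite (_ : [set z | _] = set0)//; apply/seteqP; split=> z //= [_ /eqP].
  by rewrite (negPf e).
apply/seteqP; split=> z /=.
  move=> az; exists (b z) => //; split=> //=.
  split; first by rewrite -az; exact: vcode_div.
  by rewrite -az /= mulnC modnMDl modn_small.
move=> [c _ [/= bz [vz ic]]]; rewrite -/(b z) bz vz ic mulnC.
by rewrite -divn_eq.
Qed.

Lemma corner_mono m a i : corner m (a %/ K) i <= corner m.+1 a i.
Proof. by rewrite /= lerDl mulr_ge0// exprn_ge0// invr_ge0. Qed.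

Lemma corner_step m a i : corner m.+1 a i <= corner m (a %/ K) i + 2^-1 ^+ m.+1.
Proof.
rewrite /= lerD2l ler_piMl//.
by case: (digit a i).
Qed.

Section nested.
Variable A : nat -> nat.
Hypothesis A_div : forall m, A m = (A m.+1 %/ K)%N.

Lemma root_nested m : root m (A m) = A 0.
Proof. by elim: m => // m IH; rewrite /= -A_div. Qed.

Lemma corner_nested m p i : corner m (A m) i <= corner (m + p) (A (m + p)) i <=
  corner m (A m) i + 2^-1 ^+ m - 2^-1 ^+ (m + p).
Proof.
elim: p => [|p /andP[IH1 IH2]]; first by rewrite addn0 addrK lexx.
rewrite addnS; have := corner_mono (m + p) (A (m + p).+1) i.
have := corner_step (m + p) (A (m + p).+1) i; rewrite -A_div => h1 h2.
have e : 2^-1 ^+ (m + p) = 2 * 2^-1 ^+ (m + p).+1 :> R by rewrite exprS mulrA mulfV ?mul1r.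
by apply/andP; split; lra.
Qed.

Lemma corner_cvg i : exists2 l : R, corner m (A m) i @[m --> \oo] --> l &
  forall m, corner m (A m) i <= l <= corner m (A m) i + 2^-1 ^+ m.
Proof.
have nd : nondecreasing_seq (fun m => corner m (A m) i).
  move=> m p mp; rewrite -(subnKC mp).
  by have /andP[] := corner_nested m (p - m) i.
have pos m : 0 <= 2^-1 ^+ m :> R by [].
have ub m p : corner p (A p) i <= corner m (A m) i + 2^-1 ^+ m.
  have [mp|pm] := leqP m p.
    rewrite -(subnKC mp); have /andP[_] := corner_nested m (p - m) i.
    by have := pos (m + (p - m))%N; lra.
  by have := nd _ _ (ltnW pm); have := pos m; rewrite /=; lra.
have cv : cvgn (fun m => corner m (A m) i).
  apply: nondecreasing_is_cvgn => //.
  by exists (corner 0 (A 0) i + 2^-1 ^+ 0) => _ [p _ <-]; exact: ub.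
exists (limn (fun m => corner m (A m) i)); first exact: cv.
move=> m; apply/andP; split.
  exact: nondecreasing_cvgn_le.
by apply: limr_le => //; apply: nearW => p; exact: ub.
Qed.

End nested.

End dyadic_codes.

Section integral_gap.
Local Open Scope ereal_scope.
Context d (T : measurableType d) (R : realType).

Lemma fine_integral_gap (m : {measure set T -> \bar R}) (f g l : T -> R) :
  m.-integrable setT (EFin \o f) -> m.-integrable setT (EFin \o g) ->
  m.-integrable setT (EFin \o l) -> (forall x, (`|f x - g x| <= l x)%R) ->
  (`|fine (\int[m]_x (f x)%:E) - fine (\int[m]_x (g x)%:E)| <= fine (\int[m]_x (l x)%:E))%R.
Proof.
move=> fi gi li fgl.
have ff := integrable_fin_num measurableT fi; have gf := integrable_fin_num measurableT gi.
have lf := integrable_fin_num measurableT li.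
rewrite -lee_fin fineK// -abse_EFin EFinB !fineK// -integralB//.
by apply: abse_integral_le => x _; rewrite -EFinB lee_fin.
Qed.

Lemma integral_fst d2 (Y : measurableType d2) (m : {finite_measure set T -> \bar R})
    (P : probability Y R) (f : T -> R) : mble f -> (forall x, (0 <= f x)%R) ->
  \int[m \x P]_z (f z.1)%:E = \int[m]_x (f x)%:E.
Proof.
move=> mf f0; have mF : mble (fun z : T * Y => (f z.1)%:E).
  mea.
have F0 (z : T * Y) : 0 <= (f z.1)%:E by nonneg.
rewrite (fubini_tonelli1 _ mF F0).
apply: eq_integral => x _; rewrite /fubini_F/= integral_cst//.
by rewrite [X in _ * X]probability_setT mule1.
Qed.

End integral_gap.

Lemma dist_third (R : realFieldType) (a a' b b' e : R) : `|a - a'| <= e / 3 ->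
  `|b - b'| <= e / 3 -> `|a' - b'| <= e / 3 -> `|a - b| <= e.
Proof.
rewrite !ler_norml => /andP[h1 h2] /andP[h3 h4] /andP[h5 h6].
by apply/andP; split; lra.
Qed.

(** * Ultralimits of maps into a cube and finitely many nodes *)

Section stability.
Context d' (Z : measurableType d') (R : realType).

Lemma coded_integral d2 (W : measurableType d2) (m : {measure set W -> \bar R})
    (B : nat) (c : W -> nat) (phi : W -> Z) (f : nat -> Z -> R)
    (mc : forall a, measurable [set w | c w = a]) (mphi : mble phi)
    (w0 : forall a w, 0 <= \1_[set w | c w = a] w :> R)
    (mw : forall a, mble (\1_[set w | c w = a] : W -> R)) :
  (forall w, c w < B)%N -> (forall a, mble (f a)) -> (forall a z, 0 <= f a z) ->
  (forall a, (\int[m]_w (f a (phi w))%:E < +oo)%E) ->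
  fine (\int[m]_w (f (c w) (phi w))%:E)%E =
  \sum_(a < B) fine (\int[wpush m (w0 a) (mw a) mphi]_z (f a z)%:E)%E.
Proof.
move=> cB mf f0 fi.
have -> : (\int[m]_w (f (c w) (phi w))%:E)%E =
    (\sum_(a < B) \int[m]_w (\1_[set w | c w = a] w * f a (phi w))%:E)%E.
  rewrite -ge0_integral_sum//.
  - apply: eq_integral => w _; rewrite sumEFin; congr EFin.
    rewrite (bigD1 (Ordinal (cB w)))//= big1 ?addr0.
      by rewrite indicE mem_set// mul1r.
    move=> a /eqP aw; rewrite indicE memNset ?mul0r//= => ca; apply: aw.
    exact/val_inj.
  - mea.
  - nonneg.
have E a : (\int[wpush m (w0 a) (mw a) mphi]_z (f a z)%:E =
    \int[m]_w (\1_[set w | c w = a] w * f a (phi w))%:E)%E.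
  rewrite ge0_integral_wpush//; first mea.
  nonneg.
rewrite -sum_fine; first by apply: eq_bigr => a _; rewrite E.
move=> a _; rewrite ge0_fin_numE; last by apply: integral_ge0 => w _; rewrite lee_fin mulr_ge0.
apply: le_lt_trans (fi a); apply: ge0_le_integral => //.
- nonneg.
- mea.
- mea.
- by move=> w _; rewrite lee_fin ler_piMl// indicE; case: (_ \in _).
Qed.

Variable lambda : probability Z R.
Variables (U : set_system nat) (UU : UltraFilter U).
Variables (d n : nat) (M : R).
Hypothesis M0 : 0 <= M.
Variables (x : nat -> Z -> 'rV[R]_d) (j : nat -> Z -> 'I_n.+1).
Hypotheses (mx : forall k i, mble (fun z => x k z 0 i))
  (mj : forall k a, measurable [set z | j k z = a])
  (xM : forall k z i, `|x k z 0 i| <= M).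

(** The extra 1 keeps (x + M) / s strictly below 1, as the binary expansion requires. *)
Let s : R := 2 * M + 1.
Let s0 : 0 < s. Proof. by rewrite /s ltr_wpDl// mulr_ge0. Qed.
Let t k z (i : 'I_d) : R := (x k z 0 i + M) / s.
Let t01 k z i : 0 <= t k z i < 1.
Proof.
have := xM k z i; rewrite ler_norml => /andP[h1 h2]; apply/andP; split.
  by rewrite divr_ge0 ?(ltW s0)//; lra.
by rewrite /t ltr_pdivrMr// mul1r /s; lra.
Qed.
Let code m k z := vcode m (t k z) (j k z).
Let point m a : 'rV[R]_d := \row_i (s * corner R m a i - M).

Let point_bound m a i : `|point m a 0 i| <= M + 1.
Proof.
have /andP[h0 h1] := corner01 R m a i.
have p0 : 0 <= 2^-1 ^+ m :> R by [].
have c1 : corner R m a i <= 1 by lra.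
have hs : s * corner R m a i <= s by rewrite ler_piMr ?(ltW s0).
have hs0 : 0 <= s * corner R m a i by nonneg.
by rewrite mxE ler_norml; move: hs hs0; rewrite /s => *; apply/andP; split; lra.
Qed.

Let point_code m k z i : `|x k z 0 i - point m (code m k z) 0 i| <= s * 2^-1 ^+ m.
Proof.
rewrite mxE corner_vcode.
have -> : x k z 0 i - (s * (t k z i - residue m (t k z i) * 2^-1 ^+ m) - M) =
    s * (residue m (t k z i) * 2^-1 ^+ m).
  by rewrite mulrBr /t [s * (_ / s)]mulrCA mulfV ?gt_eqF// mulr1; ring.
have /andP[r0 r1] := residue01 m (t01 k z i).
rewrite ger0_norm ?mulr_ge0 ?(ltW s0)// ler_pM2l//.
by rewrite ler_piMl// ltW.
Qed.

(** A Young measure: the joint laws of z, the node and the place converge to that of z, N, G, where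
    an auxiliary variable of law P carries the randomness created in the limit. The integrand is
    Lipschitz in the place but only measurable in z, as the transport cost is. *)
Lemma subsequential_maps : exists (P : probability (measurableTypeR R) R)
    (N : Z * measurableTypeR R -> 'I_n.+1) (G : Z * measurableTypeR R -> 'rV[R]_d),
  [/\ forall a, measurable [set w | N w = a],
      forall i, mble (fun w => G w 0 i),
      forall w i, `|G w 0 i| <= M + 1 &
      forall (h : 'I_n.+1 -> 'rV[R]_d -> Z -> R) (L : Z -> R),
        (forall a y z, 0 <= h a y z) ->
        (forall a, mble (fun w : 'rV[R]_d * Z => h a w.1 w.2)) ->
        (forall a, lambda.-integrable setT (fun z => (h a 0 z)%:E)) ->
        (forall z, 0 <= L z) -> mble L ->
        lambda.-integrable setT (EFin \o L) ->
        (forall a (y y' : 'rV[R]_d) z, (forall i, `|y 0 i| <= M + 1) -> (forall i, `|y' 0 i| <= M + 1) ->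
          `|h a y z - h a y' z| <= L z * \sum_i `|y 0 i - y' 0 i|) ->
        fine (\int[lambda]_z (h (j k z) (x k z) z)%:E)%E @[k --> U] -->
        fine (\int[(lambda \x P)%E]_w (h (N w) (G w) w.1)%:E)%E].
Proof.
pose K := #|{ffun 'I_d -> bool}|.
have K0 : (0 < K)%N := K_gt0 d.
have mt k i : mble (fun z => t k z i).
  by apply: measurable_funM => //; mea.
have mjn k (a : nat) : measurable [set z | (j k z : nat) = a].
  have [an|na] := ltnP a n.+1.
    rewrite (_ : [set z | _] = [set z | j k z = Ordinal an])//.
    by apply/seteqP; split=> z /= [e]; [exact/val_inj|rewrite e].
  rewrite (_ : [set z | _] = set0)//; apply/seteqP; split=> z //= e.
  by have := ltn_ord (j k z); rewrite e ltnNge na.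
have mcode m k a : measurable [set z | code m k z = a].
  by apply: measurable_vcode.
have code_lt m k z : (code m k z < n.+1 * K ^ m)%N by exact/vcode_lt/ltn_ord.
have code_div m k z : (code m k z = code m.+1 k z %/ K)%N by exact: vcode_div.
have [P [A [mA A_lt A_div A_cvg]]] := limit_codes lambda UU K0 mcode code_lt code_div.
pose N w : 'I_n.+1 := inord (A 0 w).
have NE w : (N w : nat) = A 0 w by rewrite inordK// (leq_trans (A_lt 0 w))// muln1.
pose g w (i : 'I_d) : R := limn (fun m => corner R m (A m w) i).
have gP w i : [/\ corner R m (A m w) i @[m --> \oo] --> g w i &
    forall m, corner R m (A m w) i <= g w i <= corner R m (A m w) i + 2^-1 ^+ m].
  have [l lc lb] := @corner_cvg R d (A ^~ w) (A_div ^~ w) i.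
  suff -> : g w i = l by [].
  exact/cvg_lim.
pose G w : 'rV[R]_d := \row_i (s * g w i - M).
have GP m w i : `|G w 0 i - point m (A m w) 0 i| <= s * 2^-1 ^+ m.
  rewrite !mxE (_ : _ - _ = s * (g w i - corner R m (A m w) i)); last by ring.
  have [_ /(_ m) /andP[h1 h2]] := gP w i.
  by rewrite ger0_norm ?mulr_ge0 ?(ltW s0) ?subr_ge0// ler_pM2l// lerBlDl.
have GM w i : `|G w 0 i| <= M + 1.
  have [_ /(_ 0) /andP[h1 h2]] := gP w i; move: h1 h2; rewrite /= expr0 add0r => h1 h2.
  have hs : s * g w i <= s by rewrite ler_piMr ?(ltW s0).
  have hs0 : 0 <= s * g w i by nonneg.
  by rewrite mxE ler_norml; move: hs hs0; rewrite /s => *; apply/andP; split; lra.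
have mcoded d2 (W : measurableType d2) (c : W -> nat) B (F : nat -> W -> R) :
    (forall a, measurable [set w | c w = a]) -> (forall w, c w < B)%N ->
    (forall a, mble (F a)) -> mble (fun w => F (c w) w).
  move=> mc cB mF; rewrite (_ : (fun w => _) = (fun w => \sum_(a < B) F a w * \1_[set w | c w = a] w)).
    mea.
  apply/funext => w; rewrite (bigD1 (Ordinal (cB w)))//= big1 ?addr0.
    by rewrite indicE mem_set// mulr1.
  move=> a /eqP aw; rewrite indicE memNset ?mulr0//= => ca; apply: aw.
  exact/val_inj.
have mg i : mble (g ^~ i).
  apply: (@measurable_fun_cvg _ _ _ setT (fun m w => corner R m (A m w) i)) => //.
    by move=> m; apply: (mcoded _ _ (A m) _ (fun a _ => corner R m a i)).
  by move=> w _; have [] := gP w i.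
have mG i : mble (fun w => G w 0 i).
  rewrite (_ : (fun w => _) = (fun w => s * g w i - M)); last by apply/funext => w; rewrite mxE.
  mea.
have mN a : measurable [set w | N w = a].
  rewrite (_ : [set w | _] = [set w | A 0 w = a]); first exact: mA.
  by apply/seteqP; split=> w /=; [move=> <-|move=> e; apply/val_inj]; rewrite /= NE.
exists P, N, G; split=> // h L h0 mh hi L0 mL Li hL.
(* Freeze the base point at the corner of its cell; the error is uniform in [k]. *)
pose f m a z := h (inord (root d m a)) (point m a) z.
have mcomp d2 (W : measurableType d2) a (Y : W -> 'rV[R]_d) (V : W -> Z) :
    mble Y -> mble V ->
    mble (fun w => h a (Y w) (V w)).
  move=> mY mV.
  exact: (measurableT_comp (mh a) (measurable_fun_pair mY mV)).
have mf m a : mble (f m a) by apply: mcomp; [mea|mea].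
pose D : R := \sum_(i < d) s.
(* An integrable bound for h over the box: the values at 0 plus the Lipschitz rate times the size of
   the box. *)
pose bd z := \sum_a h a 0 z + L z * \sum_(i < d) (M + 1).
have bd_int : lambda.-integrable setT (EFin \o bd).
  rewrite (_ : EFin \o bd = (fun z => \sum_a (h a 0 z)%:E) \+
      (fun z => (\sum_(i < d) (M + 1))%R%:E * (L z)%:E))%E; last first.
    by apply/funext => z; rewrite /= sumEFin -EFinM -EFinD mulrC.
  apply: integrableD => //; first by apply: integrable_sum.
  exact: integrableZl.
have M10 : 0 <= M + 1 by nonneg.
have h_bd a (y : 'rV[R]_d) z : (forall i, `|y 0 i| <= M + 1) -> 0 <= h a y z <= bd z.
  move=> yM; rewrite h0 /bd /=.
  have y0 i : `|(0 : 'rV[R]_d) 0 i| <= M + 1 by rewrite mxE normr0.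
  have := hL a y 0 z yM y0; rewrite (_ : \sum_i _ = \sum_i `|y 0 i|); last first.
    by apply: eq_bigr => i _; rewrite mxE subr0.
  rewrite ler_norml => /andP[_ hle].
  have h1 : L z * \sum_i `|y 0 i| <= L z * \sum_(i < d) (M + 1).
    by rewrite ler_wpM2l//; exact: ler_sum.
  have h2 : h a 0 z <= \sum_a h a 0 z by rewrite (bigD1 a)//= lerDl sumr_ge0.
  by lra.
have bd0 z : 0 <= bd z.
  have y0 i : `|(0 : 'rV[R]_d) 0 i| <= M + 1 by rewrite mxE normr0.
  by have /andP[u v] := h_bd ord0 0 z y0; exact: le_trans u v.
have mbd : mble bd by apply/measurable_EFinP; exact: measurable_int bd_int.
have bd_intP : ((lambda \x P)%E).-integrable setT (fun w => (bd w.1)%:E).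
  apply/integrableP; split.
    mea.
  rewrite (eq_integral (fun w => (bd w.1)%:E)); last first.
    by move=> w _; rewrite /= ger0_norm.
  rewrite integral_fst//.
  have /integrableP[_] := bd_int; congr (_ < _)%E.
  by apply: eq_integral => z _; rewrite /= ger0_norm.
have int_le d2 (W : measurableType d2) (m : {measure set W -> \bar R}) (V : W -> Z) (F : W -> R) :
    m.-integrable setT (fun w => (bd (V w))%:E) -> mble F ->
    (forall w, 0 <= F w <= bd (V w)) -> m.-integrable setT (fun w => (F w)%:E).
  move=> bi mF Fb; apply: (le_integrable measurableT _ _ bi); first mea.
  move=> w _; have /andP[F0 Fw] := Fb w.
  by rewrite /= lee_fin !ger0_norm.
have fin_le d2 (W : measurableType d2) (m : {measure set W -> \bar R}) (F : W -> R) :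
    m.-integrable setT (fun w => (F w)%:E) -> (forall w, 0 <= F w) ->
    (\int[m]_w (F w)%:E < +oo)%E.
  move=> /integrableP[_ +] F0; congr (_ < _)%E.
  by apply: eq_integral => z _; rewrite /= ger0_norm.
have mfst : mble (fst : Z * measurableTypeR R -> Z) by mea.
have mxk k : mble (x k) by apply: (measurable_fun_mx measurableT) => a i; rewrite ord1; exact: mx.
have mGG : mble G by apply: (measurable_fun_mx measurableT) => a i; rewrite ord1; exact: mG.
have jE k z : j k z = inord (j k z : nat) by rewrite inord_val.
have hx_int k : lambda.-integrable setT (fun z => (h (j k z) (x k z) z)%:E).
  apply: (int_le _ _ _ id) => // [|z].
    under eq_fun do rewrite jE.
    apply: (mcoded _ _ (fun z => j k z : nat) n.+1 (fun a z => h (inord a) (x k z) z)) => //.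
    by move=> a; apply: mcomp => //; mea.
  by apply: h_bd => i; apply: le_trans (xM k z i) _; rewrite lerDl.
have hG_int : ((lambda \x P)%E).-integrable setT (fun w => (h (N w) (G w) w.1)%:E).
  apply: (int_le _ _ _ fst) => // [|w]; last exact: h_bd.
  apply: (mcoded _ _ (A 0) (n.+1 * K ^ 0)%N (fun a w => h (inord a) (G w) w.1)) => //.
  by move=> a; apply: mcomp.
have fx_int m k : lambda.-integrable setT (fun z => (f m (code m k z) z)%:E).
  apply: (int_le _ _ _ id) => // [|z]; last exact: h_bd.
  exact: (mcoded _ _ (code m k) (n.+1 * K ^ m)%N (f m)).
have fG_int m : ((lambda \x P)%E).-integrable setT (fun w => (f m (A m w) w.1)%:E).
  apply: (int_le _ _ _ fst) => // [|w]; last exact: h_bd.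
  apply: (mcoded _ _ (A m) (n.+1 * K ^ m)%N (fun a w => f m a w.1)) => // a.
  mea.
pose IL := fine (\int[lambda]_z (L z)%:E)%E.
have ILE : (\int[lambda]_z (L z)%:E)%E = IL%:E.
  by rewrite fineK// ge0_fin_numE ?fin_le//; apply: integral_ge0 => z _; rewrite lee_fin.
have D0 : 0 <= D by apply: sumr_ge0 => i _; exact: ltW.
have hdist a (y y' : 'rV[R]_d) z m : (forall i, `|y 0 i| <= M + 1) -> (forall i, `|y' 0 i| <= M + 1) ->
    (forall i, `|y 0 i - y' 0 i| <= s * 2^-1 ^+ m) -> `|h a y z - h a y' z| <= D * 2^-1 ^+ m * L z.
  move=> yM y'M yy; apply: le_trans (hL a y y' z yM y'M) _.
  by rewrite mulrC ler_wpM2r// /D mulr_suml; exact: ler_sum.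
have gapx m k : `|fine (\int[lambda]_z (h (j k z) (x k z) z)%:E)%E -
    fine (\int[lambda]_z (f m (code m k z) z)%:E)%E| <= D * 2^-1 ^+ m * IL.
  apply: le_trans (fine_integral_gap (hx_int k) (fx_int m k) (l := fun z => D * 2^-1 ^+ m * L z) _ _) _.
  - rewrite (_ : EFin \o _ = (fun z => (D * 2^-1 ^+ m)%:E * (L z)%:E)%E); last by apply/funext => z; rewrite EFinM.
    exact: integrableZl.
  - move=> z; have E : f m (code m k z) z = h (j k z) (point m (code m k z)) z.
      by rewrite /f /code root_vcode inord_val.
    rewrite E; apply: (hdist _ _ _ _ _ _ (point_bound _ _) (point_code m k z)).
    by move=> i; apply: le_trans (xM k z i) _; rewrite lerDl.
  - under eq_integral do rewrite EFinM.
    by rewrite ge0_integralZl_EFin ?ILE ?mulr_ge0//; [move=> z _; rewrite lee_fin|mea].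
have gapG m : `|fine (\int[(lambda \x P)%E]_w (h (N w) (G w) w.1)%:E)%E -
    fine (\int[(lambda \x P)%E]_w (f m (A m w) w.1)%:E)%E| <= D * 2^-1 ^+ m * IL.
  have mDL : mble (fun z => D * 2^-1 ^+ m * L z) by exact: measurable_funM.
  have E : (\int[(lambda \x P)%E]_w (D * 2^-1 ^+ m * L w.1)%:E = (D * 2^-1 ^+ m * IL)%:E)%E.
    rewrite (integral_fst _ _ mDL); last by move=> z; rewrite !mulr_ge0.
    rewrite (eq_integral (fun z => (D * 2^-1 ^+ m)%:E * (L z)%:E)%E); last by move=> z _; rewrite EFinM.
    by rewrite ge0_integralZl_EFin ?ILE ?mulr_ge0//; [move=> z _; rewrite lee_fin|mea].
  apply: le_trans (fine_integral_gap hG_int (fG_int m) (l := fun w => D * 2^-1 ^+ m * L w.1) _ _) _.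
  - apply/integrableP; split.
      mea.
    rewrite (eq_integral (fun w => (D * 2^-1 ^+ m * L w.1)%:E)); first by rewrite E ltry.
    by move=> w _; rewrite /= ger0_norm// !mulr_ge0.
  - move=> w; have E' : f m (A m w) w.1 = h (N w) (point m (A m w)) w.1.
      by rewrite /f (root_nested (A := A ^~ w)).
    by rewrite E'; apply: (hdist _ _ _ _ _ (GM w) (point_bound _ _) (GP m w)).
  - by rewrite E.
have fcvg m : fine (\int[lambda]_z (f m (code m k z) z)%:E)%E @[k --> U] -->
    fine (\int[(lambda \x P)%E]_w (f m (A m w) w.1)%:E)%E.
  have ind0 d2 (W : measurableType d2) (c : W -> nat) a w : 0 <= \1_[set w | c w = a] w :> R by [].
  have mind d2 (W : measurableType d2) (c : W -> nat) :
     (forall a, measurable [set w | c w = a]) -> forall a, mble (\1_[set w | c w = a] : W -> R).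
    mea.
  rewrite (coded_integral (mA m) mfst (ind0 _ _ (A m)) (mind _ _ _ (mA m)) (A_lt m) (mf m)); last 2 first.
  - by move=> a z; exact: h0.
  - move=> a; apply: fin_le => [|w]; last exact: h0.
    apply: (int_le _ _ _ fst) => // [|w]; last exact: h_bd.
    mea.
  have -> : (fun k => fine (\int[lambda]_z (f m (code m k z) z)%:E)%E) = (fun k =>
     \sum_(a < n.+1 * K ^ m) fine (\int[wpush lambda (ind0 _ _ (code m k) a)
        (mind _ _ _ (mcode m k) a) (@measurable_id _ Z setT)]_z (f m a z)%:E)%E).
    apply/funext => k; apply: coded_integral => // [a z|a]; first exact: h0.
    apply: fin_le => [|w]; last exact: h0.
    by apply: (int_le _ _ _ id) => // w; exact: h_bd.
  apply: cvg_sum_seq => a; apply: (setwise_integral_cvg (lambda := lambda)).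
  - move=> k S mS; rewrite /= /wpush integral_indic//.
    by rewrite preimage_id; apply: le_measure; rewrite ?inE//; mea.
  - move=> S mS; rewrite /= /wpush integral_indic//; last exact: mble_preimage.
    apply: (@le_trans _ _ ((lambda \x P)%E (S `*` setT))).
      apply: le_measure; rewrite ?inE//.
      - mea.
      - exact: measurableX.
      - by move=> w /= [_ ?]; split.
    by rewrite product_measure1E// [X in (_ * X)%E]probability_setT mule1.
  - move=> S mS; rewrite /= /wpush integral_indic//; last exact: mble_preimage.
    rewrite setIC; have := A_cvg m a S mS (ltn_ord a); apply: cvg_trans.
    apply: near_eq_cvg; apply: nearW => k.
    by rewrite /wpush integral_indic// preimage_id// setIC.
  - by move=> z; exact: h0.
  - by apply: (int_le _ _ _ id) => // w; exact: h_bd.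
apply/cvgrPdist_le => e e0.
have [m hm] : exists m, D * 2^-1 ^+ m * IL <= e / 3.
  have c0 : D * IL * (2^-1 ^+ m) @[m --> \oo] --> 0.
    rewrite -[X in _ --> X](mulr0 (D * IL)); apply: cvgM; first exact: cvg_cst.
    by apply: cvg_expr; rewrite ger0_norm// invf_lt1 ?ltr1n.
  have e3 : 0 < e / 3 by rewrite divr_gt0.
  have /cvgrPdist_le/(_ _ e3)[m _ /(_ _ (leqnn m))] := c0.
  rewrite sub0r normrN => /(le_trans (ler_norm _)) hm; exists m.
  by rewrite mulrAC.
have e3 : 0 < e / 3 by rewrite divr_gt0.
have /cvgrPdist_le/(_ _ e3) := fcvg m; apply: filterS => k hk.
exact: dist_third (le_trans (gapG m) hm) (le_trans (gapx m k) hm) hk.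
Qed.
End stability.

(** Finer ultrafilters replace subsequences: if P failed along F, the failures together with F would
    generate a proper filter, and an ultrafilter above it would contain both P and its failure. *)
Lemma ultra_near (F : set_system nat) (P : nat -> Prop) : Filter F ->
  (forall U : set_system nat, UltraFilter U -> F `<=` U -> \forall k \near U, P k) ->
  \forall k \near F, P k.
Proof.
move=> FF h; apply: contrapT => nP.
pose G : set_system nat := fun A => F [set k | ~ P k -> A k].
have GE (A B : set nat) : (forall k, A k -> ~ P k -> B k) -> F A -> G B.
  by move=> AB; exact: filterS.
have GF : ProperFilter G.
  split=> [G0|].
    have G0' : F [set k | ~ P k -> False] := G0.
    by apply: nP; apply: filterS G0' => k h0; apply: contrapT.
  split=> [|A B GA GB|A B AB GA].
  - by apply: (GE setT) => //; exact: filterT.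
  - have GA' : F [set k | ~ P k -> A k] := GA.
    have GB' : F [set k | ~ P k -> B k] := GB.
    apply: (GE _ _ _ (filterI GA' GB')) => k [a b] nPk.
    by split; [exact: a|exact: b].
  - by apply: (GE [set k | ~ P k -> A k] _ _ GA) => k a nPk; exact/AB/a.
have [U [UU GU]] := ultraFilterLemma GF.
have U1 : U [set k | P k].
  by apply: h => // A FA; apply: GU; move: FA; apply: GE.
have U2 : U [set k | ~ P k] by apply: GU; apply: (GE setT) => //; exact: filterT.
have PU := @ultra_proper _ _ UU.
by have [k []] := @filter_ex _ _ PU _ (filterI U1 U2).
Qed.

Section hat_integrals.
Context (R : realType) (d : nat).
Variable M : R.
Hypothesis M0 : 0 <= M.
Local Notation cube := [set x : 'rV[R]_d | forall k, `|x 0 k| <= M].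

Lemma measurable_cube : measurable cube.
Proof.
rewrite (_ : cube = \bigcap_(k in [set: 'I_d]) [set x : 'rV[R]_d | `|x 0 k| <= M]).
  apply: fin_bigcap_measurable => // k _; rewrite -[X in measurable X]setTI.
  have mk : mble (fun x : 'rV[R]_d => `|x 0 k|).
    by apply: measurableT_comp => //; mea.
  exact: (measurable_fun_ler mk (measurable_cst M) measurableT (Y := [set true])).
by apply/seteqP; split=> [x h k _|x h k]; [exact: h|exact: (h k Logic.I)].
Qed.

Lemma hat_near N b (x y : 'rV[R]_d) : 0 < N -> hat_prod N b x != 0 -> hat_prod N b y != 0 ->
  forall k, `|x 0 k - y 0 k| <= 2 / N :> R.
Proof.
move=> N0 /hat_prod_supp hx /hat_prod_supp hy k.
rewrite ler_pdivlMr// -[X in _ * X](gtr0_norm N0) -normrM mulrBl.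
rewrite (_ : _ - _ = (N * x 0 k + b k) - (N * y 0 k + b k)); last by ring.
by apply: (le_trans (ler_normB _ _)); have := hx k; have := hy k; lra.
Qed.

(** For O open, the sum of the hats of scale N + 1 supported in O tends to the indicator of O on the
    cube. Hence the measures agree on open sets, which are closed under intersection and generate
    the Borel sets. *)
Lemma hat_integrals_unique (m1 m2 : {finite_measure set 'rV[R]_d -> \bar R}) :
  (m1 (~` cube) = 0)%E -> (m2 (~` cube) = 0)%E ->
  (forall N b, 0 < N -> (\int[m1]_x (hat_prod N b x)%:E = \int[m2]_x (hat_prod N b x)%:E)%E) ->
  measure_eq m1 m2.
Proof.
move=> m10 m20 m12.
pose PK N := [set K : nat | forall x : 'rV[R]_d, (forall k, `|x 0 k| <= M) ->
  \sum_(a : {ffun 'I_d -> 'I_K.+1}) hat_prod N%:R (fun k => N%:R * M - (a k)%:R) x = 1].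
pose K N := xget 0%N (PK N).
have KP N : forall x : 'rV[R]_d, (forall k, `|x 0 k| <= M) ->
  \sum_(a : {ffun 'I_d -> 'I_(K N).+1}) hat_prod N%:R (fun k => N%:R * M - (a k)%:R) x = 1.
  have : PK N (K N) by have [k hk] := hat_prod_sum d N M0; apply: xgetPex; exists k.
  by [].
pose b_ N (c : {ffun 'I_d -> 'I_(K N).+1}) k := N%:R * M - (c k)%:R.
have mhat N b : mble (@hat_prod R d N b) by exact: measurable_hat_prod.
have opens O : open O -> m1 O = m2 O.
  move=> oO; have mO : measurable O by exact: open_measurable_mx.
  pose ins N c := `[< forall y, hat_prod N.+1%:R (b_ N.+1 c) y != 0 -> O y >].
  pose f N x := \sum_c (ins N c)%:R * hat_prod N.+1%:R (b_ N.+1 c) x.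
  have mf N : mble (f N).
    apply: measurable_sum => c; apply: measurable_funM; first mea.
    exact: mhat.
  have f0 N x : 0 <= f N x by apply: sumr_ge0 => c _; rewrite mulr_ge0 ?hat_prod_ge0.
  have f1 N x : cube x -> f N x <= 1.
    move=> cx; rewrite -(KP N.+1 x cx); apply: ler_sum => c _.
    by rewrite ler_piMl ?hat_prod_ge0//; case: (ins N c).
  have fout N x : ~ O x -> f N x = 0.
    move=> nO; apply: big1 => c _; rewrite /ins; case: asboolP => [h|]; last by rewrite mul0r.
    by rewrite mul1r; apply: contrapT => /eqP /h; exact: nO.
  have fin x : cube x -> O x -> \forall N \near \oo, f N x = 1.
    move=> cx Ox; have /nbhs_ballP[e /= e0 he] := open_nbhs_nbhs (conj oO Ox).
    exists (Num.bound (2 / e)) => // N /= hN.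
    have N0 : 0 < N.+1%:R :> R by [].
    rewrite -(KP N.+1 x cx); apply: eq_bigr => c _; rewrite -/(b_ N.+1 c).
    have [->|hx] := eqVneq (hat_prod N.+1%:R (b_ N.+1 c) x) 0; first by rewrite mulr0.
    suff -> : ins N c by rewrite mul1r.
    apply/asboolP => y hy; apply: he; split=> // i k; rewrite ord1 /ball/=.
    apply: le_lt_trans (hat_near N0 hx hy k) _.
    rewrite ltr_pdivrMr// mulrC -ltr_pdivrMr//.
    apply: (@lt_le_trans _ _ (Num.bound (2 / e))%:R); last by rewrite ler_nat ltnW.
    by apply: archi_boundP; rewrite divr_ge0// ltW.
  have conv (m : {finite_measure set 'rV[R]_d -> \bar R}) : m (~` cube) = 0%E ->
      (\int[m]_x (f N x)%:E @[N --> \oo] --> m O)%E.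
    move=> m0; have mC := measurable_cube.
    have ae_cube (P : 'rV[R]_d -> Prop) : (forall x, cube x -> P x) -> {ae m, forall x, P x}.
      move=> h; exists (~` cube); split=> //; first mea.
      by move=> x nPx cx; exact/nPx/h.
    have [] := @dominated_convergence _ _ _ m setT measurableT (fun N x => (f N x)%:E)
      (fun x => (\1_O x)%:E) (cst 1%E).
    - mea.
    - mea.
    - apply: ae_cube => x cx _; have [Ox|nOx] := pselect (O x).
        rewrite indicE mem_set//; apply: cvg_near_cst.
        by apply: filterS (fin x cx Ox) => N ->.
      rewrite indicE memNset// (_ : (fun N => _) = cst 0%E); first exact: cvg_cst.
      by apply/funext => N; rewrite fout.
    - exact: finite_measure_integrable_cst.
    - by apply: ae_cube => x cx N _; rewrite /= lee_fin ger0_norm// f1.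
    move=> _ _; rewrite integral_indic// setIT; exact.
  have E : (fun N => \int[m1]_x (f N x)%:E)%E = (fun N => \int[m2]_x (f N x)%:E)%E.
    apply/funext => N.
    have S (m : {finite_measure set 'rV[R]_d -> \bar R}) : (\int[m]_x (f N x)%:E =
       \sum_c (ins N c)%:R%:E * \int[m]_x (hat_prod N.+1%:R (b_ N.+1 c) x)%:E)%E.
      transitivity (\int[m]_x \sum_c ((ins N c)%:R * hat_prod N.+1%:R (b_ N.+1 c) x)%:E)%E.
        by apply: eq_integral => x _; rewrite sumEFin.
      rewrite ge0_integral_sum//.
      - apply: eq_bigr => c _; under eq_integral do rewrite EFinM.
        rewrite ge0_integralZl_EFin//.
        - nonneg.
        - mea.
      - mea.
      - nonneg.
    by rewrite !S; apply: eq_bigr => c _; rewrite m12.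
  by apply: (cvg_unique _ (conv _ m10)) => //; rewrite E; exact: conv.
have mE : @measurable _ 'rV[R]_d = <<s @open 'rV[R]_d >> by [].
have cover : \bigcup_(k in [set: nat]) [set: 'rV[R]_d] = setT by rewrite bigcup_const//; exists 0%N.
have fin (k : nat) : (m1 setT < +oo)%E by rewrite -ge0_fin_numE// fin_num_measure.
have oI : setI_closed (@open 'rV[R]_d) by move=> B C; exact: openI.
have oT (k : nat) : open [set: 'rV[R]_d] by exact: openT.
move=> A mA.
have := (@measure_unique _ R _ _ (fun=> setT) mE oI oT cover m1 m2).
move=> /(_ opens fin A mA).
by [].
Qed.

End hat_integrals.

(** * Stability of the optimal maps *)

Lemma ge0_integral_image d1 d2 (X : measurableType d1) (Y : measurableType d2) (R : realType)
    (m : {measure set X -> \bar R}) (m' : {measure set Y -> \bar R}) (phi : X -> Y) (g : Y -> \bar R) :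
  mble phi -> measure_eq m' (pushforward m phi) ->
  (forall y, 0 <= g y)%E -> mble g ->
  (\int[m']_y g y = \int[m]_x g (phi x))%E.
Proof.
move=> mphi PE g0 mg.
pose W := wpush m (fun=> ler01) (@measurable_cst _ _ _ _ setT (1%R : R)) mphi.
rewrite (_ : \int[m']_y g y = \int[W]_y g y)%E; last first.
  apply: eq_measure_integral => A mA _.
  rewrite [LHS]PE//; have mB : measurable (phi @^-1` A).
    mea.
  by rewrite -[RHS]/(\int[m]_(z in phi @^-1` A) (1%R)%:E)%E integral_cst ?mul1e.
by rewrite ge0_integral_wpush//; under eq_integral do rewrite mul1e.
Qed.

Lemma sqnorm_lipschitz (R : realType) d (B : R) (a y y' : 'rV[R]_d) :
  (forall i, `|y 0 i| <= B) -> (forall i, `|y' 0 i| <= B) ->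
  `|sqnorm (a - y) - sqnorm (a - y')| <= (sqnorm a + (2 * B + 1)) * \sum_i `|y 0 i - y' 0 i|.
Proof.
move=> yB y'B; rewrite /sqnorm -sumrB; apply: le_trans (ler_norm_sum _ _ _) _.
rewrite mulr_sumr; apply: ler_sum => i _; rewrite !mxE.
have -> : (a 0 i - y 0 i) ^+ 2 - (a 0 i - y' 0 i) ^+ 2 =
  (2 * a 0 i - y 0 i - y' 0 i) * - (y 0 i - y' 0 i) by ring.
rewrite normrM normrN ler_wpM2r//.
have h : `|a 0 i| *+ 2 <= a 0 i ^+ 2 + 1.
  have := sqr_ge0 (`|a 0 i| - 1); rewrite sqrrB1 (real_normK (num_real _)); lra.
have h2 : a 0 i ^+ 2 <= \sum_(k < d) a 0 k ^+ 2.
  by rewrite (bigD1 i)//= lerDl sumr_ge0// => k _; exact: sqr_ge0.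
apply: le_trans (ler_normB _ _) _.
have := ler_normB (2 * a 0 i) (y 0 i); rewrite normrM (ger0_norm (ler0n _ 2)) mulr_natl.
by have := yB i; have := y'B i; lra.
Qed.

Section nearest_vertex.
Context (R : realType) (d n : nat) (M : R).
Hypothesis M0 : 0 <= M.
Local Notation L := (lifted R d n).

(** Points that are at no vertex receive the arbitrary node [ord0]. *)
Definition node_of (z : L) : 'I_n.+1 := odflt ord0 [pick j | node_weights z.2 0 j == 1].

Lemma node_of_vertex (z : L) j : z.2 = vertex R j -> node_of z = j.
Proof.
move=> zj; rewrite /node_of; case: pickP => [i|/(_ j)]; rewrite zj node_weights_vertexE.
  by case: (eqVneq i j) => [->//|_]; rewrite eq_sym oner_eq0.
by rewrite eqxx eqxx.
Qed.

Lemma measurable_node_of j : measurable [set z | node_of z = j].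
Proof.
have mw i : measurable [set z : L | node_weights z.2 0 i = 1].
  rewrite (_ : [set _ | _] = (fun z : L => node_weights z.2 0%R i) @^-1` [set 1%R])//.
  rewrite -[X in measurable X]setTI.
  by apply: (measurableT_comp (measurable_node_weights i)).
rewrite (_ : [set _ | _] = [set z | node_weights z.2 0 j = 1] `|`
   (if j == ord0 then ~` (\bigcup_(i in [set: 'I_n.+1]) [set z | node_weights z.2 0 i = 1]) else set0)).
  apply: measurableU => //; case: ifP => // _.
  by apply: measurableC; apply: fin_bigcup_measurable.
apply/seteqP; split=> z /=.
  rewrite /node_of; case: pickP => [i /eqP wi /= <-|w0 /= <-]; first by left.
  by right; rewrite eqxx => -[i _ /= wi]; have := w0 i; rewrite wi eqxx.
case=> [/vertex_weights/node_of_vertex//|]; case: eqVneq => // -> h.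
rewrite /node_of; case: pickP => [i /eqP wi /=|//].
by exfalso; apply: h; exists i.
Qed.

Definition clip (y : R) : R := Num.max (- M) (Num.min M y).

Lemma clip_bound y : `|clip y| <= M.
Proof.
rewrite ler_norml /clip le_max lexx/= ge_max ge_min lexx andbT.
by rewrite lerNl (le_trans _ M0)// oppr_le0.
Qed.

Lemma clip_id y : `|y| <= M -> clip y = y.
Proof. by rewrite ler_norml => /andP[h1 h2]; rewrite /clip (min_idPr h2); apply/max_idPr. Qed.

Lemma sqnorm_clip (x : 'rV[R]_d) : sqnorm (\row_i clip (x 0 i)) <= d%:R * M ^+ 2.
Proof.
have -> : d%:R * M ^+ 2 = \sum_(k < d) M ^+ 2 by rewrite sumr_const card_ord mulr_natl.
apply: ler_sum => i _; rewrite mxE -[leLHS]real_normK ?num_real//.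
by rewrite ler_pXn2r// clip_bound.
Qed.

(** The identity on vertices over the cube, and measurable with bounded places everywhere. Composed
    with it, maps that take values there almost everywhere get bounds that hold at every point. *)
Definition nearest (z : L) : L := (\row_i clip (z.1 0 i), vertex R (node_of z)).

Lemma nearest_id z : at_vertex z -> (forall i, `|z.1 0 i| <= M) -> nearest z = z.
Proof.
case: z => x r [j /= rj] xM; rewrite /nearest (@node_of_vertex (x, r) j)// rj; congr pair.
by apply/rowP => i; rewrite mxE clip_id.
Qed.

Lemma measurable_clip : mble clip.
Proof.
apply: measurable_maxr; first mea.
by apply: measurable_minr; [mea|mea].
Qed.

#[local] Hint Resolve measurable_clip measurable_node_of : mble_db.

Lemma measurable_vertex_of d' (T : measurableType d') (N : T -> 'I_n.+1) :
  (forall j, measurable [set t | N t = j]) -> mble (fun t => vertex R (N t) : simplex R n).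
Proof.
move=> mN _ B mB; rewrite setTI.
rewrite (_ : _ @^-1` B = \bigcup_(j in [set j | B (vertex R j)]) [set t | N t = j]).
  by apply: fin_bigcup_measurable => //; exact: finite_finset.
by apply/seteqP; split=> t /=; [move=> h; exists (N t)|move=> [j Bj /= ->]].
Qed.

End nearest_vertex.

Section linearization.
Context (R : realType) (d n : nat) (q : 'M[R]_n.+1) (theta : R -> R -> R).
Hypotheses (q_ge0 : forall i j, 0 <= q i j) (q_symmetric : symmetric_graph q) (q_connected : connected_graph q) (theta_interp : interpolation_function theta).
Local Notation L := (lifted R d n).
Variables (Omega : set 'rV[R]_d) (M : R).
Hypotheses (mO : measurable Omega) (M0 : 0 <= M)
  (OM : forall x, Omega x -> forall k, `|x 0 k| <= M).
Variable lambda : probability L R.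
Hypothesis ref_moment : finite_second_moment lambda.
Local Notation cube B := [set x : 'rV[R]_d | forall k, `|x 0 k| <= B].

Let sup : set L := [set z | at_vertex z /\ Omega z.1].

Let msup : measurable sup.
Proof. by apply: measurableI; [exact: measurable_at_vertex|exact: measurable_in_fst]. Qed.

Let nearest_sup z : sup z -> nearest M z = z.
Proof. by move=> [vz Oz]; apply: nearest_id => //; exact: OM. Qed.

Lemma sqnorm_fst_integrable : lambda.-integrable setT (fun z => (sqnorm z.1)%:E).
Proof.
apply/integrableP; split; first mea.
apply: le_lt_trans ref_moment; apply: le_integral_nonmeas => z; first nonneg.
by rewrite /= lee_fin ger0_norm ?sqnorm_ge0// lerDl sqnorm_ge0.
Qed.

Lemma lambda_integrable_le (f : L -> R) (c : R) : mble f ->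
  (forall z, 0 <= f z <= 2 * sqnorm z.1 + c) -> lambda.-integrable setT (EFin \o f).
Proof.
move=> mf fc; have ci : lambda.-integrable setT (fun z => (c%:E)).
  exact: finite_measure_integrable_cst.
apply: (le_integrable measurableT _ _ (integrableD measurableT (integrableZl measurableT 2 sqnorm_fst_integrable) ci)).
  mea.
move=> z _; have /andP[f0 fz] := fc z.
by rewrite /= lee_fin !ger0_norm//; apply: le_trans f0 fz.
Qed.

Definition represents (S : L -> L) (mu : vmeasure R d n.+1) : Prop :=
  mble S /\ measure_eq (canonical_lifting mu) (pushforward lambda S).

Section represented.
Variables (S : L -> L) (mu : vmeasure R d n.+1).
Hypotheses (Smu : represents S mu) (muO : vprob Omega mu).

Lemma represents_integral (f : L -> \bar R) : mble f -> (forall z, 0 <= f z)%E ->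
  (\int[lambda]_z f (S z) = \int[canonical_lifting mu]_z f z)%E.
Proof. by have [mS SE] := Smu => mf f0; rewrite (ge0_integral_image mS SE). Qed.

Lemma measurable_represented_sup : measurable (S @^-1` sup).
Proof. by rewrite -[X in measurable X]setTI; apply: (proj1 Smu). Qed.

Lemma represented_sup : (lambda (~` (S @^-1` sup)) = 0)%E.
Proof.
have [mS SE] := Smu; rewrite -[LHS](SE (~` sup)); last mea.
exact: canonical_support.
Qed.

Lemma represents_hat j N b :
  (\int[lambda]_z (node_weights (S z).2 0%R j * hat_prod N b (S z).1)%:E =
   \int[mu j]_x (hat_prod N b x)%:E)%E.
Proof.
have [w0 _] := node_weights_prob (vertex R j : simplex R n).
rewrite (represents_integral (f := fun z => (node_weights z.2 0 j * hat_prod N b z.1)%:E)%E).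
- rewrite ge0_integral_canonical.
  + rewrite (bigD1 j)//= big1 ?addr0.
      by apply: eq_integral => x _; rewrite node_weights_vertexE eqxx mul1r.
    move=> i /negPf ij; rewrite integral0_eq// => x _.
    by rewrite node_weights_vertexE eq_sym ij mul0r.
  + apply/measurable_EFinP; apply: measurable_funM.
      by apply: (measurableT_comp (measurable_node_weights j)); mea.
    mea.
  + move=> z; rewrite lee_fin mulr_ge0 ?hat_prod_ge0//.
    by have [p0 _] := node_weights_prob z.2.
- apply/measurable_EFinP; apply: measurable_funM.
    by apply: (measurableT_comp (measurable_node_weights j)); mea.
  mea.
- move=> z; rewrite lee_fin mulr_ge0 ?hat_prod_ge0//.
  by have [p0 _] := node_weights_prob z.2.
Qed.

Lemma measurable_nearest_fst : mble (fun z => (nearest M (S z)).1).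
Proof.
apply: (measurable_fun_mx measurableT) => a i; rewrite ord1.
rewrite (_ : (fun z => _) = (fun z => clip M ((S z).1 0 i))); last by apply/funext => z; rewrite mxE.
apply: (measurableT_comp (measurable_clip M)); apply: (measurableT_comp (measurable_coord _ _)).
by apply: (measurableT_comp measurable_fst); exact: (proj1 Smu).
Qed.

Lemma measurable_node_represented j : measurable [set z | node_of (S z) = j].
Proof.
rewrite (_ : [set _ | _] = S @^-1` [set z | node_of z = j])//.
by rewrite -[X in measurable X]setTI; apply: (proj1 Smu) => //; exact: measurable_node_of.
Qed.

(** S and its bounded version differ only on a null set; measurability is asked of the new integrand
    alone. *)
Lemma integral_nearest (f : L -> L -> R) : (forall z y, 0 <= f z y) ->
  mble (fun z => f z (nearest M (S z))) ->
  (\int[lambda]_z (f z (S z))%:E = \int[lambda]_z (f z (nearest M (S z)))%:E)%E.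
Proof.
move=> f0 mf; apply: (integral_nonmeas_ae_eq measurable_represented_sup represented_sup).
- nonneg.
- nonneg.
- mea.
- by move=> z Sz; rewrite nearest_sup.
Qed.

End represented.

Lemma measurable_nearest S mu : represents S mu -> mble (fun z => nearest M (S z)).
Proof.
move=> Smu; apply: measurable_fun_pair; first exact: measurable_nearest_fst Smu.
exact: (measurable_vertex_of (measurable_node_represented Smu)).
Qed.

Variable T : vmeasure R d n.+1 -> L -> L.
Hypothesis T_optimal : unique_optimal_maps q theta lambda T.

Lemma optimal_map_represents mu : vprob2 setT mu -> represents (T mu) mu.
Proof.
move=> mu2; have [G [[[c1 c2] _] _ mT GE]] := T_optimal mu2; split=> // A mA.
by rewrite -c2// [LHS]GE// -[X in measurable X]setTI; mea.
Qed.

Variables (mu : vmeasure R d n.+1) (mu_ : nat -> vmeasure R d n.+1).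
Hypotheses (mu2 : vprob2 setT mu) (mu_2 : forall k, vprob2 setT (mu_ k)).
Hypotheses (muO : vprob Omega mu) (mu_O : forall k, vprob Omega (mu_ k)).
Hypothesis mu_mu : hat_converge mu_ mu.

Let rep := optimal_map_represents mu2.
Let rep_ k := optimal_map_represents (mu_2 k).
Let S_ k z := nearest M (T (mu_ k) z).
Let S z := nearest M (T mu z).

(** Once the limit plan is identified with the plan of T mu, the integrand |y - S z|^2 can be
    tested: it is Lipschitz in y and measurable in z, and its limit is an integral over the graph of
    S, hence 0. *)
Lemma linearized_ultra_cvg (U : set_system nat) : UltraFilter U -> nbhs \oo `<=` U ->
  fine (\int[lambda]_z (lifted_sqdist (S_ k z) (S z))%:E)%E @[k --> U] --> 0.
Proof.
move=> UU ooU; have PU : ProperFilter U by exact: ultra_proper.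
pose x k z := (S_ k z).1; pose j k z := node_of (T (mu_ k) z).
have SE k z : S_ k z = (x k z, vertex R (j k z)) by [].
have mx k i : mble (fun z => x k z 0 i).
  by apply: (measurableT_comp (measurable_coord _ _)); exact: measurable_nearest_fst (rep_ k).
have mj k a : measurable [set z | j k z = a] by exact: measurable_node_represented (rep_ k) a.
have xM k z i : `|x k z 0 i| <= M by rewrite mxE clip_bound.
have [P [N [G [mN mG GM stab]]]] := subsequential_maps lambda UU M0 mx mj xM.
have M1 : M <= M + 1 by rewrite lerDl.
have mGG : mble G.
  by apply: (measurable_fun_mx measurableT) => a i; rewrite ord1; exact: mG.
(* The limit of the plans of [T (mu_ k)] along [U]. *)
pose phi w : L * L := (w.1, (G w, vertex R (N w))).
have mphi : mble phi.
  apply: measurable_fun_pair; first exact: measurable_fst.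
  by apply: measurable_fun_pair => //; exact: measurable_vertex_of.
have lP1 : (lambda \x P)%E setT = 1%E.
  by rewrite -setXTT product_measure1E// [X in (_ * X)%E]probability_setT mule1; exact: probability_setT.
have [Gam GamE] := @mk_probability _ _ _ (pushforward (lambda \x P)%E phi) lP1.
have Gamphi : measure_eq Gam (pushforward (lambda \x P)%E phi) by move=> A _; exact: GamE.
have lim_unique (f : nat -> R) (l l' : R) : f k @[k --> U] --> l -> f k @[k --> U] --> l' -> l = l'.
  by move=> h h'; apply: (cvg_unique _ h h'); exact: norm_hausdorff.
have int_lim (f : L * L -> R) : mble f -> (forall z, 0 <= f z) ->
    (\int[Gam]_z (f z)%:E = \int[(lambda \x P)%E]_w (f (phi w))%:E)%E.
  move=> mf f0; apply: (ge0_integral_image mphi Gamphi); last mea.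
  nonneg.
have hatE k a Nn b : fine (\int[lambda]_z ((j k z == a)%:R * hat_prod Nn b (x k z))%:E)%E = hat_mass (mu_ k) a Nn b.
  rewrite /hat_mass -(represents_hat (rep_ k)).
  rewrite (integral_nearest (rep_ k) (mu_O k) (f := fun _ y => node_weights y.2 0 a * hat_prod Nn b y.1)).
  - by congr fine; apply: eq_integral => z _; rewrite node_weights_vertexE eq_sym.
  - move=> _ y; rewrite mulr_ge0 ?hat_prod_ge0//.
    by have [p0 _] := node_weights_prob y.2.
  - have mS := measurable_nearest (rep_ k); apply: measurable_funM.
      by apply: (measurableT_comp (measurable_node_weights a)); mea.
    mea.
have w0 a w : 0 <= \1_[set w | N w = a] w :> R by [].
have mw a : mble (\1_[set w | N w = a] : _ -> R) by mea.
(* The target marginal of the limit is recognized by its hat integrals, which converge along U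
   because U contains the neighbourhoods of infinity. *)
have mu_eq a : measure_eq (wpush (lambda \x P)%E (w0 a) (mw a) mGG) (mu a).
  have fin : (wpush (lambda \x P)%E (w0 a) (mw a) mGG setT < +oo)%E.
    rewrite wpushT integral_indic// setIT.
    apply: (@le_lt_trans _ _ ((lambda \x P)%E setT)); last by rewrite lP1 ltry.
    by apply: le_measure; rewrite ?inE.
  have [m mE] := mk_finite_measure fin.
  have mW : measure_eq m (wpush (lambda \x P)%E (w0 a) (mw a) mGG) by [].
  suff h : measure_eq m (mu a) by move=> A mA; rewrite -mW// h.
  apply: (hat_integrals_unique (le_trans M0 M1)).
  - rewrite mE /= /wpush (_ : _ @^-1` _ = set0) ?integral_set0//.
    by apply/seteqP; split=> w //=; apply; exact: GM.
  - apply: (subset_measure0 (B := ~` Omega)).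
    + by apply: measurableC; exact: measurable_cube.
    + mea.
    + by move=> y ny Oy; apply: ny => i; apply: le_trans (OM Oy i) _.
    + by have [h _] := muO; exact: h.
  move=> Nn b Nn0; rewrite (ge0_integral_eq_measure _ mW) ge0_integral_wpush.
  - have [Lh Lh0 hL] := hat_prod_lipschitz R d.
    have gE : (\int[(lambda \x P)%E]_w ((\1_[set w | N w = a] w)%:E * (hat_prod Nn b (G w))%:E) =
      \int[(lambda \x P)%E]_w ((N w == a)%:R * hat_prod Nn b (G w))%:E)%E.
      apply: eq_integral => w _; rewrite -EFinM indicE; congr (_ * _)%:E.
      by case: eqVneq => [<-|/eqP h]; [rewrite mem_set|rewrite memNset].
    have := stab (fun a' y _ => (a' == a)%:R * hat_prod Nn b y) (fun=> Lh * Nn).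
    move=> /(_ _ _ _ _ _ _ _)/wrap[].
    + nonneg.
    + mea.
    + by move=> a'; exact: finite_measure_integrable_cst.
    + nonneg.
    + mea.
    + exact: finite_measure_integrable_cst.
    + move=> a' y y' _ _ _; case: eqVneq => _; first by rewrite !mul1r; exact: hL.
      by rewrite !mul0r subrr normr0 mulr_ge0 ?mulr_ge0 ?(ltW Lh0) ?(ltW Nn0)// sumr_ge0.
    under eq_fun do rewrite hatE; move=> c1.
    have c2 : hat_mass (mu_ k) a Nn b @[k --> U] --> hat_mass mu a Nn b.
      apply/cvgrPdist_le => e e0; apply: ooU; apply: filterS (mu_mu a b Nn0 e0) => k.
      by rewrite distrC.
    rewrite gE -hat_massE (lim_unique _ _ _ c2 c1) fineK//.
    rewrite ge0_fin_numE; last by apply: integral_ge0 => w _; rewrite lee_fin mulr_ge0 ?hat_prod_ge0.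
    apply: (@le_lt_trans _ _ (\int[(lambda \x P)%E]_w (cst 1%E w))%E).
      apply: ge0_le_integral => //.
      * nonneg.
      * apply/measurable_EFinP; apply: measurable_funM; last first.
          mea.
        rewrite (_ : (fun w => _) = \1_[set w | N w = a])//; apply/funext => w.
        by rewrite indicE; case: eqVneq => [<-|/eqP h]; [rewrite mem_set|rewrite memNset].
      * by move=> w _; rewrite lee_fin; apply: mulr_ile1; rewrite ?hat_prod_ge0 ?hat_prod_le1//; case: (_ == _).
    by rewrite integral_cst// mul1e; exact: (eq_ind_r (fun v => (v < +oo)%E) (ltry 1) lP1).
  - mea.
  - nonneg.
have cG : coupling lambda (canonical_lifting mu) Gam.
  split=> B mB.
    transitivity ((lambda \x P)%E (B `*` setT)).
      by rewrite /pushforward GamE; congr ((lambda \x P)%E _); apply/seteqP; split=> w //= [].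
    by rewrite product_measure1E// [X in (_ * X)%E]probability_setT mule1.
  rewrite canonical_liftingE//.
  transitivity ((lambda \x P)%E [set w | B (G w, vertex R (N w))]).
    by rewrite /pushforward; exact: GamE.
  have mB2 : measurable [set w | B (G w, vertex R (N w))].
    have mGN : mble (fun w => (G w, vertex R (N w)) : L).
      by apply: measurable_fun_pair => //; exact: measurable_vertex_of.
    exact: mble_preimage.
  have mBa a : measurable [set y | B (y, vertex R a)].
    exact: mble_preimage.
  transitivity (\int[(lambda \x P)%E]_w (\sum_a (\1_[set w | N w = a] w * \1_[set y | B (y, vertex R a)] (G w))%:E))%E.
    rewrite -[in LHS](setIT [set w | B _]) -integral_indic//.
    apply: eq_integral => w _; rewrite sumEFin; congr EFin.
    rewrite (bigD1 (N w))//= big1 ?addr0.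
      rewrite [\1_[set w0 | N w0 = N w] w]indicE mem_set// mul1r !indicE.
      by congr (_%:R); apply/idP/idP => /set_mem h; apply/mem_set.
    by move=> a /eqP aw; rewrite indicE memNset ?mul0r//= => e; apply: aw.
  rewrite ge0_integral_sum//.
  - apply: eq_bigr => a _; rewrite -mu_eq//.
    transitivity (\int[wpush (lambda \x P)%E (w0 a) (mw a) mGG]_y (\1_[set y | B (y, vertex R a)] y)%:E)%E; last first.
      by rewrite integral_indic// setIT.
    rewrite ge0_integral_wpush//.
    mea.
  - move=> a; apply/measurable_EFinP; apply: measurable_funM => //.
    by apply: measurableT_comp => //; mea.
have [C C0 hC] := node_cost_bounded q_ge0 q_symmetric q_connected theta_interp.
have nc0 a r : 0 <= node_cost q theta a r by exact: node_cost_ge0.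
have mnc a := measurable_node_cost q_ge0 q_symmetric q_connected theta_interp a.
have [G0 [[cG0 optG0] uniqG0 _ G0E]] := T_optimal mu2.
pose c := 2 * (d%:R * (M + 1) ^+ 2) + C.
have vc_le (z : L) (x' : 'rV[R]_d) a : (forall i, `|x' 0 i| <= M + 1) ->
    0 <= vertex_cost q theta z (x', vertex R a) <= 2 * sqnorm z.1 + c.
  move=> hx; rewrite vertex_cost_ge0//= vertex_costE /c addrA; apply: lerD => //.
  by apply: sqnorm_sub_le => //; rewrite addr_ge0.
pose cost S' := fine (\int[lambda]_z (vertex_cost q theta z (S' z))%:E)%E.
have costE S' m : represents S' m -> vprob Omega m ->
    (\int[lambda]_z (vertex_cost q theta z (S' z))%:E = (cost (fun z => nearest M (S' z)))%:E)%E.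
  move=> rS' mO'; have mS' := measurable_nearest rS'.
  have mV : mble (fun z => vertex_cost q theta z (nearest M (S' z))).
    by apply: measurable_vertex_cost => //; mea.
  rewrite (integral_nearest rS' mO' (f := vertex_cost q theta))//; last exact: vertex_cost_ge0.
  rewrite fineK//; apply: integrable_fin_num => //.
  apply: (lambda_integrable_le (c := c)) => // z; apply: vc_le => i.
  by rewrite mxE; apply: le_trans M1; exact: clip_bound.
have planE m (m2 : vprob2 setT m) (mO' : vprob Omega m) G' :
    coupling lambda (canonical_lifting m) G' -> measure_eq G' (pushforward lambda (fun z => (z, T m z))) ->
    (transport_cost q theta G' = (cost (fun z => nearest M (T m z)))%:E)%E.
  move=> cG' GE'; have [mT TE] := optimal_map_represents m2.
  rewrite (transport_costE q_ge0 q_symmetric q_connected theta_interp mO mO' cG').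
  have mz : mble (fun z => (z, T m z)) by apply: measurable_fun_pair.
  rewrite (ge0_integral_image mz GE').
  - exact: costE (optimal_map_represents m2) mO'.
  - by move=> z; rewrite lee_fin vertex_cost_ge0.
  - by apply/measurable_EFinP; exact: measurable_vertex_cost.
have GamcostE : transport_cost q theta Gam =
    (\int[(lambda \x P)%E]_w (vertex_cost q theta w.1 (G w, vertex R (N w)))%:E)%E.
  rewrite (transport_costE q_ge0 q_symmetric q_connected theta_interp mO muO cG).
  rewrite (int_lim (fun z => vertex_cost q theta z.1 z.2))//.
  - exact: measurable_vertex_cost.
  - by move=> z; exact: vertex_cost_ge0.
have Gamcost_fin : (transport_cost q theta Gam < +oo)%E.
  have mb : mble (fun z : L => 2 * sqnorm z.1 + c) by mea.
  have c0 : 0 <= c.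
    by rewrite addr_ge0//; apply: mulr_ge0 => //; apply: mulr_ge0 => //; rewrite exprn_ge0// addr_ge0.
  have b0 (z : L) : 0 <= 2 * sqnorm z.1 + c by nonneg.
  have bb z : 0 <= 2 * sqnorm (z : L).1 + c <= 2 * sqnorm z.1 + c by rewrite b0 lexx.
  have /integrableP[_] := lambda_integrable_le mb bb; rewrite GamcostE.
  rewrite (eq_integral (fun z => (2 * sqnorm z.1 + c)%:E)); last first.
    by move=> z _; rewrite /= ger0_norm.
  rewrite -(integral_fst lambda P mb b0); apply: le_lt_trans.
  apply: le_integral_nonmeas => w; first by rewrite lee_fin vertex_cost_ge0.
  by rewrite lee_fin; have /andP[] := vc_le w.1 (G w) (N w) (GM w).
(* The cost is Lipschitz in the place and integrable in z, so the optimal costs for [mu_ k] converge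
   to the cost of the limit plan. *)
have costlim : cost (S_ k) @[k --> U] --> fine (transport_cost q theta Gam).
  have := stab (fun a y z => sqnorm (z.1 - y) + node_cost q theta a z.2)
    (fun z => sqnorm z.1 + (2 * (M + 1) + 1)).
  move=> /(_ _ _ _ _ _ _ _)/wrap[].
  - nonneg.
  - move=> a; apply: measurable_funD.
      apply: (measurableT_comp (@measurable_sqnorm _ _)).
      by apply: measurable_mx_sub; [mea|exact: measurable_fst].
    mea.
  - move=> a; apply: (lambda_integrable_le (f := fun z => sqnorm (z.1 - 0) + node_cost q theta a z.2) (c := C)).
      apply: measurable_funD.
        rewrite (_ : (fun z => _) = (fun z : L => sqnorm z.1)); last by apply/funext => z; rewrite subr0.
        mea.
      mea.
    move=> z; rewrite addr_ge0 ?sqnorm_ge0//= subr0 lerD// mulr2n mulrDl mul1r lerDl.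
    nonneg.
  - nonneg.
  - mea.
  - apply: (lambda_integrable_le (c := 2 * (M + 1) + 1)).
      mea.
    move=> z; rewrite addr_ge0 ?sqnorm_ge0//=; last by rewrite addr_ge0// mulr_ge0// addr_ge0.
    by rewrite lerD// mulr2n mulrDl mul1r lerDl sqnorm_ge0.
  - move=> a y y' z yM y'M; rewrite opprD addrACA subrr addr0.
    exact: sqnorm_lipschitz.
  rewrite GamcostE; under [in X in _ --> X -> _]eq_integral do rewrite -vertex_costE.
  rewrite (_ : (fun k => _) = (fun k => cost (S_ k)))//.
  apply/funext => k; rewrite /cost; congr fine; apply: eq_integral => z _.
  by rewrite SE vertex_costE.
(* Recovery plans carry the optimal cost for mu, up to e, over to [mu_ k], where T (mu_ k) does no
   worse; in the limit [Gam] costs at most the optimum plus e. *)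
have optG : optimal_plan q theta lambda (canonical_lifting mu) Gam.
  split=> // G' cG'; apply: le_trans (optG0 _ cG').
  rewrite (planE _ mu2 muO _ cG0 G0E) -(@fineK _ (transport_cost q theta Gam)); last first.
    by rewrite ge0_fin_numE ?transport_cost_ge0.
  rewrite lee_fin; apply/ler_addgt0Pr => e e0.
  apply: (cvgr_to_le costlim); apply: ooU; have [mT TE] := rep.
  have SO : (lambda (~` [set z | Omega (T mu z).1]) = 0)%E.
    apply: (subset_measure0 (B := ~` (T mu @^-1` sup))).
    - apply: measurableC; rewrite -[X in measurable X]setTI; apply: (mT measurableT [set z | Omega z.1]).
      mea.
    - mea.
    - by move=> z nz [_ Oz]; exact: nz.
    - exact: represented_sup rep muO.
  have := recovery_plan q_ge0 q_symmetric q_connected theta_interp mO M0 OM ref_moment mT SO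
    (fun j0 N0 b _ => represents_hat rep j0 N0 b) muO mu_O mu_mu e0.
  apply: filterS => k [G'' cG'' hG''].
  have [Gk [[cGk optGk] _ _ GkE]] := T_optimal (mu_2 k).
  have := le_trans (optGk _ cG'') hG''.
  by rewrite (planE _ (mu_2 k) (mu_O k) _ cGk GkE) (costE _ _ rep muO) -EFinD lee_fin.
have GamE2 := uniqG0 _ optG.
pose D := d%:R * M ^+ 2 + (2 * (M + 1) + 1).
have D0 : 0 <= D by rewrite addr_ge0 ?mulr_ge0// addr_ge0// mulr_ge0// addr_ge0.
have SM z : sqnorm (S z).1 <= d%:R * M ^+ 2 by exact: sqnorm_clip.
have mS := measurable_nearest rep.
have := stab (fun a y z => lifted_sqdist (y, vertex R a) (S z)) (fun=> D).
have ls0 (z z' : L) : 0 <= lifted_sqdist z z' by rewrite addr_ge0// sqnorm_ge0.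
have sqC (a b : 'rV[R]_d) : sqnorm (a - b) = sqnorm (b - a).
  by apply: eq_bigr => i _; rewrite !mxE -sqrrN opprB.
move=> /(_ _ _ _ _ _ _ _)/wrap[].
- by move=> a y z.
- move=> a; apply: measurable_lifted_sqdist; last mea.
  mea.
- move=> a; apply: (@finite_bounded_integrable _ _ _ _ _
     (d%:R * M ^+ 2 + \sum_b sqnorm (coords (vertex R a) - coords (vertex R b)))).
    apply: measurable_lifted_sqdist => //; mea.
  move=> z; rewrite ger0_norm//; apply: lerD; first by rewrite /= sqC subr0; exact: SM.
  rewrite /=; by rewrite (bigD1 (node_of (T mu z)))//= lerDl sumr_ge0// => b _; exact: sqnorm_ge0.
- by [].
- mea.
- exact: finite_measure_integrable_cst.
- move=> a y y' z yM y'M; rewrite /lifted_sqdist/= opprD addrACA subrr addr0 !(sqC _ (S z).1).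
  apply: le_trans (sqnorm_lipschitz _ yM y'M) _.
  by rewrite ler_wpM2r ?sumr_ge0// /D lerD2r.
rewrite (_ : (\int[_]_w _)%E = 0%E)//.
(* By uniqueness [Gam] is the image of [lambda] on the graph of T mu, where the integrand vanishes
   almost everywhere. *)
transitivity (\int[Gam]_z (lifted_sqdist z.2 (S z.1))%:E)%E.
  rewrite (int_lim (fun z => lifted_sqdist z.2 (S z.1)))//.
  by apply: measurable_lifted_sqdist => //; mea.
rewrite (ge0_integral_eq_measure _ GamE2).
have mz : mble (fun z => (z, T mu z)) by apply: measurable_fun_pair => //; exact: (proj1 rep).
rewrite (ge0_integral_image mz G0E).
- rewrite (integral_nonmeas_ae_eq (g := cst 0%E) (measurable_represented_sup rep) (represented_sup rep muO))//.
  + by rewrite integral0.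
  + nonneg.
  + move=> z Tz; rewrite /S/= nearest_sup// /lifted_sqdist !subrr.
    by rewrite /sqnorm !big1 ?addr0// => i _; rewrite mxE expr0n.
- nonneg.
- apply/measurable_EFinP; apply: measurable_lifted_sqdist => //; mea.
Qed.

Lemma LOT_cvg0 (e : R) : 0 < e ->
  \forall k \near \oo, (\int[lambda]_z (lifted_sqdist (T (mu_ k) z) (T mu z))%:E <= e%:E)%E.
Proof.
move=> e0; apply: ultra_near => U UU ooU.
have ls0 (z z' : L) : 0 <= lifted_sqdist z z' by rewrite addr_ge0// sqnorm_ge0.
have /cvgrPdist_le/(_ _ e0) := linearized_ultra_cvg UU ooU; apply: filterS => k.
have mS := measurable_nearest rep; have mSk := measurable_nearest (rep_ k).
have mI : mble (fun z => lifted_sqdist (S_ k z) (S z)).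
  exact: measurable_lifted_sqdist.
rewrite sub0r normrN ger0_norm; last by rewrite fine_ge0// integral_ge0// => z _; rewrite lee_fin.
have -> : (\int[lambda]_z (lifted_sqdist (T (mu_ k) z) (T mu z))%:E =
    \int[lambda]_z (lifted_sqdist (S_ k z) (S z))%:E)%E.
  apply: (integral_nonmeas_ae_eq (D := (T (mu_ k) @^-1` sup) `&` (T mu @^-1` sup))).
  - apply: measurableI; [exact: measurable_represented_sup (rep_ k)|exact: measurable_represented_sup rep].
  - apply: measure_setCI_null.
    + exact: measurable_represented_sup (rep_ k).
    + exact: measurable_represented_sup rep.
    + exact: represented_sup (rep_ k) (mu_O k).
    + exact: represented_sup rep muO.
  - nonneg.
  - nonneg.
  - exact/measurable_EFinP.
  - by move=> z [Tk Tm]; rewrite /S_ /S !nearest_sup.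
rewrite -lee_fin fineK//; apply: integrable_fin_num => //.
pose c := 4 * (d%:R * M ^+ 2) + \sum_a \sum_b sqnorm (coords (vertex R a : simplex R n) - coords (vertex R b)).
apply: (@finite_bounded_integrable _ _ _ _ _ c) => // z; rewrite ger0_norm// /lifted_sqdist lerD//.
  have /sqnorm_sub_le h i : `|(S z).1 0 i| <= M by rewrite mxE clip_bound.
  have := h M0 (S_ k z).1; have := sqnorm_clip M0 (T (mu_ k) z).1.
  by rewrite -/(nearest M (T (mu_ k) z)).1 -/(S_ k z); lra.
rewrite (bigD1 (node_of (T (mu_ k) z)))//= (bigD1 (node_of (T mu z)))//= -addrA lerDl.
apply: addr_ge0; apply: sumr_ge0 => a _; first exact: sqnorm_ge0.
nonneg.
Qed.

End linearization.

(** * Lower bound for the dynamic distance *)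

Lemma measurable_fun_slice d1 d2 d3 (X : measurableType d1) (T : measurableType d2)
    (Y : measurableType d3) (f : X * T -> Y) (D : set T) t :
  measurable D -> D t -> measurable_fun (setT `*` D) f -> mble (fun x => f (x, t)).
Proof.
move=> mD Dt mf _ B mB; rewrite setTI.
have := measurable_ysection t (mf (measurableX measurableT mD) B mB).
congr measurable; apply/seteqP; split=> x; rewrite /ysection/=.
  by move=> /set_mem[].
by move=> Bx; apply/mem_set; split.
Qed.

Lemma integral_null_outside d (T : measurableType d) (R : realType) (m : {measure set T -> \bar R})
    (D : set T) (f : T -> \bar R) : measurable D -> (m (~` D) = 0)%E ->
  (forall x, 0 <= f x)%E -> mble f ->
  (\int[m]_x f x = \int[m]_(x in D) f x)%E.
Proof.
move=> mD D0 f0 mf; rewrite [RHS]integral_mkcond; apply/esym.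
apply: (integral_nonmeas_ae_eq mD D0) => // x; first by rewrite patchE; case: ifP.
by move=> Dx; rewrite patchE mem_set.
Qed.

Lemma young_square (R : realFieldType) (z delta : R) : 0 < delta ->
  2 * `|z| <= delta + delta^-1 * z ^+ 2.
Proof.
move=> d0; rewrite -subr_ge0 (_ : _ - _ = delta^-1 * (delta - `|z|) ^+ 2).
  nonneg.
by rewrite -[z ^+ 2](real_normK (num_real _)); field; rewrite gt_eqF.
Qed.

(** The speed of a curve is not known to be measurable in time, so the bound is stated for an
    arbitrary nonnegative f. *)
Lemma integral_nonmeas_affine01 (R : realType) (c k E : R) (f : R -> \bar R) : 0 <= c -> 0 < k ->
  (forall t, 0 <= f t)%E ->
  (\int[@lebesgue_measure R]_(t in `[0%R, 1%R]) f t <= E%:E)%E ->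
  (\int[@lebesgue_measure R]_(t in `[0%R, 1%R]) (c%:E + k%:E * f t) <= (c + k * E)%:E)%E.
Proof.
move=> c0 k0 f0 hE; rewrite integral_mkcond.
have kf t : (0 <= k%:E * f t)%E by rewrite mule_ge0// lee_fin ltW.
apply: (@le_trans _ _ (\int[@lebesgue_measure R]_t (c * \1_(`[0%R, 1%R]%classic : set R) t)%:E +
    k%:E * \int[@lebesgue_measure R]_t (f \_ `[0%R, 1%R]%classic) t)%E).
  apply: integral_nonmeas_affine => //.
  - nonneg.
  - by apply: measurable_funM => //; mea.
  - by move=> t; rewrite patchE; case: ifP.
  - by move=> t; rewrite patchE; case: ifP => // _; rewrite adde_ge0// lee_fin.
  - move=> t; rewrite !patchE indicE; case: ifP => _; first by rewrite mulr1.
    by rewrite mulr0 mule0 adde0.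
rewrite EFinD EFinM; apply: leeD; last first.
  by apply: lee_wpmul2l; rewrite ?lee_fin ?(ltW k0)// -integral_mkcond.
rewrite -[leRHS](@integral_cst01 R c) [leRHS]integral_mkcond; apply: le_integral_nonmeas => t.
  nonneg.
by rewrite patchE indicE; case: ifP => h; rewrite ?mulr1 ?mulr0.
Qed.

Section densities.
Context (R : realType) (d n : nat).
Implicit Types mu : vmeasure R d n.
Local Open Scope ereal_scope.
Local Notation RN := Radon_Nikodym_SigmaFinite.f.

Lemma dominated_total mu i : mu i `<< total_measure mu.
Proof.
apply/null_content_dominatesP => A mA; rewrite /= /sum_finite_measure /sum_measure => h.
by apply/eqP; rewrite -measure_le0 -h (bigD1 i)//= leeDl// sume_ge0.
Qed.

Lemma densityE mu i x : (density mu i x)%:E = RN (mu i) (total_measure mu) x.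
Proof. by rewrite fineK//; exact/Radon_Nikodym_SigmaFinite.f_fin_num/dominated_total. Qed.

Lemma density_ge0 mu i x : (0 <= density mu i x)%R.
Proof. by rewrite -lee_fin densityE; exact/Radon_Nikodym_SigmaFinite.f_ge0/dominated_total. Qed.

Lemma measurable_density mu i : mble (density mu i).
Proof.
apply/measurable_EFinP; rewrite (_ : _ \o _ = RN (mu i) (total_measure mu)).
  exact: (measurable_int _ (Radon_Nikodym_SigmaFinite.f_integrable (@dominated_total mu i))).
by apply/funext => x; exact: densityE.
Qed.

#[local] Hint Resolve measurable_density : mble_db.

Lemma density_measure mu i A : measurable A ->
  \int[total_measure mu]_(x in A) (density mu i x)%:E = mu i A.
Proof.
move=> mA; rewrite (Radon_Nikodym_SigmaFinite.f_integral (@dominated_total mu i) mA).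
by apply: eq_integral => x _; exact: densityE.
Qed.

Lemma vprob_mass_le1 (Omega : set 'rV[R]_d) mu i : vprob Omega mu -> mu i setT <= 1.
Proof. by move=> [_ <-]; rewrite (bigD1 i)//= leeDl// sume_ge0. Qed.

Lemma total_out (Omega : set 'rV[R]_d) mu : vprob Omega mu -> total_measure mu (~` Omega) = 0.
Proof. by move=> [h _]; rewrite /= /sum_finite_measure /sum_measure big1// => i _; exact: h. Qed.

End densities.

Section dynamic_lower_bound.
Context (R : realType) (d n : nat) (q : 'M[R]_n) (theta : R -> R -> R).
Hypotheses (q_ge0 : forall i j, 0 <= q i j) (q_symmetric : symmetric_graph q) (theta_interp : interpolation_function theta).
Variables (Omega : set 'rV[R]_d).
Hypotheses (Omega_compact : compact Omega).
Local Notation leb := (@lebesgue_measure R).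

Let mO : measurable Omega.
Proof. by apply: closed_measurable_mx; exact: compact_closed. Qed.

Lemma theta_density_ge0 (mu : vmeasure R d n) i j x : 0 <= theta_density theta mu i j x.
Proof. by apply: (theta_ge0 theta_interp); exact: density_ge0. Qed.

#[local] Hint Extern 0 (is_true _) => exact: theta_density_ge0 : mble_db.

Lemma measurable_theta_density (mu : vmeasure R d n) i j : mble (theta_density theta mu i j).
Proof.
by apply: (measurable_theta theta_interp) => //; first exact: measurable_density;
  [exact: measurable_density|move=> x _; exact: density_ge0|move=> x _; exact: density_ge0].
Qed.

Lemma theta_density_mass (mu : vmeasure R d n) i j : vprob Omega mu ->
  (\int[total_measure mu]_x (theta_density theta mu i j x)%:E <= 2%:E)%E.
Proof.
move=> muO; apply: (@le_trans _ _ (\int[total_measure mu]_x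
    ((density mu i x)%:E + (density mu j x)%:E))%E).
  apply: le_integral_nonmeas => x; first nonneg.
  by rewrite -EFinD lee_fin (theta_le_add theta_interp)// density_ge0.
rewrite ge0_integralD//; last 4 first.
- by move=> x _; rewrite lee_fin density_ge0.
- by apply/measurable_EFinP; exact: measurable_density.
- by move=> x _; rewrite lee_fin density_ge0.
- by apply/measurable_EFinP; exact: measurable_density.
rewrite !density_measure// (_ : 2%:E = 1 + 1)%E; last by rewrite -EFinD.
by apply: leeD; exact: (vprob_mass_le1 _ muO).
Qed.

Lemma young_pair (th x y phi c delta : R) : 0 < delta -> 0 <= th -> 0 <= c -> `|phi| <= 1 ->
  `|phi * th * (x - y) * c| <=
  delta * c * th + delta^-1 * (x ^+ 2 * th * c + y ^+ 2 * th * c).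
Proof.
move=> d0 th0 c0 phi1; rewrite !normrM (ger0_norm th0) (ger0_norm c0).
have xy : `|x - y| <= delta + delta^-1 * (x ^+ 2 + y ^+ 2).
  have h z := young_square z d0.
  have := h x; have := h y; have := ler_normB x y.
  have e : delta^-1 * (x ^+ 2 + y ^+ 2) = delta^-1 * x ^+ 2 + delta^-1 * y ^+ 2 by rewrite mulrDr.
  have p1 : 0 <= delta^-1 * x ^+ 2 by nonneg.
  have p2 : 0 <= delta^-1 * y ^+ 2 by nonneg.
  by rewrite e; lra.
rewrite (_ : _ + _ = 1 * th * (delta + delta^-1 * (x ^+ 2 + y ^+ 2)) * c); last by ring.
apply: ler_wpM2r => //; apply: ler_pM => //; first nonneg.
by apply: ler_wpM2r.
Qed.

Section one_curve.
Variables (rho : R -> vmeasure R d n) (u : 'I_n -> 'rV[R]_d * R -> 'rV[R]_d)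
    (v : 'I_n -> 'I_n -> 'rV[R]_d * R -> R).
Hypothesis ce : continuity_equation Omega q theta 0 1 rho u v.
Local Notation speed t := (tangent_sqnorm Omega q theta (rho t) (fun i x => u i (x, t))
                             (fun i j x => v i j (x, t))).

Lemma tangent_sqnorm_ge0 t : (0 <= speed t)%E.
Proof.
apply: adde_ge0.
  nonneg.
apply: mule_ge0; first nonneg.
apply: sume_ge0 => i _; apply: sume_ge0 => j _; apply: integral_ge0 => x _.
nonneg.
Qed.

Lemma speed_ge_space i t : (\int[rho t i]_(x in Omega) (sqnorm (u i (x, t)))%:E <= speed t)%E.
Proof.
rewrite /tangent_sqnorm (bigD1 i)//= -addeA leeDl// adde_ge0//.
  nonneg.
apply: mule_ge0; first nonneg.
apply: sume_ge0 => a _; apply: sume_ge0 => b _; apply: integral_ge0 => x _.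
nonneg.
Qed.

Lemma speed_ge_node i j t : (\int[total_measure (rho t)]_(x in Omega)
  (v i j (x, t) ^+ 2 * theta_density theta (rho t) i j x * q i j)%:E <= 2%:E * speed t)%E.
Proof.
have p a b : (0 <= \int[total_measure (rho t)]_(x in Omega)
    (`|v a b (x, t)| ^+ 2 * theta_density theta (rho t) a b x * q a b)%:E)%E.
  apply: integral_ge0 => x _.
  nonneg.
apply: (@le_trans _ _ (\sum_(a < n) \sum_(b < n) \int[total_measure (rho t)]_(x in Omega)
    (`|v a b (x, t)| ^+ 2 * theta_density theta (rho t) a b x * q a b)%:E)%E).
  rewrite (bigD1 i)//= (bigD1 j)//= -addeA.
  rewrite (eq_integral (fun x => (`|v i j (x, t)| ^+ 2 * theta_density theta (rho t) i j x * q i j)%:E)).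
    by rewrite leeDl// adde_ge0// sume_ge0// => a _; rewrite ?sume_ge0.
  by move=> x _; rewrite real_normK// num_real.
rewrite /tangent_sqnorm; set B := (X in (X <= _)%E).
apply: (@le_trans _ _ (2%:E * ((2^-1)%:E * B))%E).
  by rewrite muleA -EFinM mulfV// mul1e.
apply: lee_wpmul2l; rewrite// leeDr// sume_ge0// => a _.
nonneg.
Qed.

Variables (N : R) (b : 'I_d -> R) (G : R).
Hypotheses (N0 : 0 < N) (G0 : 0 < G).
Hypothesis hG : forall k x, Omega x -> `|'D_(delta_mx 0 k) (@hat_prod R d N b) x| <= G.

Lemma space_flux_bound i t e delta : t \in `[0, 1] -> 0 < delta ->
  (`|\int[rho t i]_x (\sum_(k < d) dspace (fun z => hat_prod N b z.1 * cutoff e z.2) k (x, t)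
      * u i (x, t) 0%R k)%:E| <=
   (delta * G * d%:R)%:E + (delta^-1 * G)%:E * speed t)%E.
Proof.
move=> t01 d0; have rO := ce_prob ce t01.
have mu_i : mble (fun x => u i (x, t)).
  by apply: (measurable_fun_slice _ _ (ce_u_measurable ce i)).
have out : (rho t i (~` Omega) = 0)%E by have [h _] := rO; exact: h.
have G0' := ltW G0.
apply: (@le_trans _ _ (\int[rho t i]_x (delta * G * d%:R + delta^-1 * G * sqnorm (u i (x, t)))%:E)%E).
  apply: le_trans (abse_integral_le _ (h := fun x => (\sum_(k < d) `|dspace (fun z => hat_prod N b z.1 * cutoff e z.2) k (x, t)
      * u i (x, t) 0%R k|)%:E) _) _.
    by move=> x _; rewrite lee_fin ler_norm_sum.
  apply: (integral_nonmeas_ae_le mO out) => [x|x||x Ox].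
  - nonneg.
  - nonneg.
  - mea.
  rewrite lee_fin (_ : _ + _ = \sum_(k < d) (delta * G + delta^-1 * G * u i (x, t) 0 k ^+ 2)); last first.
    by rewrite big_split/= sumr_const card_ord mulr_natr /sqnorm mulr_sumr.
  apply: ler_sum => k _; rewrite dspace_hat_cutoff normrM (normrM _ (cutoff e t)) (ger0_norm (cutoff_ge0 e t)).
  have h : `|u i (x, t) 0 k| <= delta + delta^-1 * u i (x, t) 0 k ^+ 2.
    by apply: le_trans (young_square _ d0); rewrite mulr_natl mulr2n lerDl.
  rewrite (_ : delta * G + _ = G * (delta + delta^-1 * u i (x, t) 0 k ^+ 2)); last by ring.
  apply: ler_pM => //; first by rewrite mulr_ge0 ?cutoff_ge0.
  by rewrite -[leRHS]mulr1; apply: ler_pM; rewrite ?cutoff_ge0 ?cutoff_le1 ?hG.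
have sE : (\int[rho t i]_x (sqnorm (u i (x, t)))%:E = \int[rho t i]_(x in Omega) (sqnorm (u i (x, t)))%:E)%E.
  apply: integral_null_outside => //; first nonneg.
  mea.
rewrite (_ : (\int[_]_x _)%E = ((delta * G * d%:R)%:E * rho t i setT + (delta^-1 * G)%:E * \int[rho t i]_x (sqnorm (u i (x, t)))%:E)%E).
  apply: leeD.
    rewrite -[leRHS]mule1; apply: lee_wpmul2l; last exact: (vprob_mass_le1 _ rO).
    nonneg.
  apply: lee_wpmul2l; last by rewrite sE; exact: speed_ge_space.
  nonneg.
under eq_integral do rewrite EFinD [(_ * sqnorm _)%:E]EFinM.
rewrite ge0_integralD//.
- rewrite integral_cst// ge0_integralZl_EFin//.
  + nonneg.
  + mea.
  + nonneg.
- nonneg.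
- by move=> x _; rewrite -EFinM lee_fin mulr_ge0 ?sqnorm_ge0// mulr_ge0// invr_ge0 ltW.
- by apply/measurable_EFinP; mea.
Qed.

(** Each of the two orientations of the edge contributes at most twice the energy, which carries the
    factor 1/2: hence 4. The factor 2 in front of q i j bounds the total mass of theta of the
    densities. *)
Lemma node_flux_bound i j t e delta : t \in `[0, 1] -> 0 < delta ->
  (`|\int[total_measure (rho t)]_x (hat_prod N b x * cutoff e t * theta_density theta (rho t) i j x
            * (v i j (x, t) - v j i (x, t)) * q i j)%:E| <=
   (delta * (2 * q i j))%:E + (delta^-1 * 4)%:E * speed t)%E.
Proof.
move=> t01 d0; have rO := ce_prob ce t01.
have mv a c : mble (fun x => v a c (x, t)).
  by apply: (measurable_fun_slice _ _ (ce_v_measurable ce a c)).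
have out := total_out rO.
set m := total_measure (rho t).
have th0 x : 0 <= theta_density theta (rho t) i j x by nonneg.
have thS x : theta_density theta (rho t) i j x = theta_density theta (rho t) j i x.
  by rewrite /theta_density (theta_sym theta_interp) ?density_ge0.
have mth := measurable_theta_density (rho t) i j.
have X0 a c x : 0 <= v a c (x, t) ^+ 2 * theta_density theta (rho t) i j x * q i j.
  nonneg.
have Xle : (\int[m]_x (v i j (x, t) ^+ 2 * theta_density theta (rho t) i j x * q i j)%:E <= 2%:E * speed t)%E.
  rewrite (integral_null_outside mO out) => [|x|]; first exact: speed_ge_node.
    nonneg.
  mea.
have Xle' : (\int[m]_x (v j i (x, t) ^+ 2 * theta_density theta (rho t) i j x * q i j)%:E <= 2%:E * speed t)%E.
  rewrite (integral_null_outside mO out) => [|x|]; last 2 first.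
  - nonneg.
  - mea.
  rewrite (eq_integral (fun x => (v j i (x, t) ^+ 2 * theta_density theta (rho t) j i x * q j i)%:E)).
    exact: speed_ge_node.
  by move=> x _; rewrite thS q_symmetric.
apply: (@le_trans _ _ (\int[m]_x (delta * q i j * theta_density theta (rho t) i j x +
   delta^-1 * (v i j (x, t) ^+ 2 * theta_density theta (rho t) i j x * q i j +
               v j i (x, t) ^+ 2 * theta_density theta (rho t) i j x * q i j))%:E)%E).
  apply: abse_integral_le => x _; rewrite lee_fin; apply: young_pair => //.
  have c0 := cutoff_ge0 e t; have c1 := cutoff_le1 e t.
  rewrite ger0_norm; first by apply: mulr_ile1; rewrite ?hat_prod_ge0 ?hat_prod_le1.
  nonneg.
have di0 : 0 <= delta^-1 by nonneg.
rewrite (_ : (\int[_]_x _)%E = ((delta * q i j)%:E * \int[m]_x (theta_density theta (rho t) i j x)%:E +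
  delta^-1%:E * (\int[m]_x (v i j (x, t) ^+ 2 * theta_density theta (rho t) i j x * q i j)%:E +
       \int[m]_x (v j i (x, t) ^+ 2 * theta_density theta (rho t) i j x * q i j)%:E))%E).
  apply: leeD.
    rewrite (_ : (delta * (2 * q i j))%:E = (delta * q i j)%:E * 2%:E)%E; last by rewrite -EFinM; congr EFin; ring.
    by apply: lee_wpmul2l; [rewrite lee_fin mulr_ge0// ltW|exact: theta_density_mass rO].
  rewrite [in leRHS]EFinM -muleA; apply: lee_wpmul2l; first nonneg.
  apply: le_trans (leeD Xle Xle') _.
  by rewrite -ge0_muleDl// -EFinD (_ : 2 + 2 = 4 :> R)//; ring.
under eq_integral do rewrite EFinD [(_ * theta_density _ _ _ _ _)%:E]EFinM [(delta^-1 * _)%:E]EFinM EFinD.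
rewrite ge0_integralD//.
- rewrite ge0_integralZl_EFin//.
  + rewrite ge0_integralZl_EFin//.
    * rewrite ge0_integralD//.
      nonneg.
      mea.
      nonneg.
      mea.
    * nonneg.
    * by apply: emeasurable_funD; mea.
  + nonneg.
  + mea.
  + nonneg.
- by move=> x _; rewrite -EFinM lee_fin !mulr_ge0// ltW.
- by apply: measurable_funeM; mea.
- by move=> x _; rewrite -EFinD -EFinM lee_fin mulr_ge0// addr_ge0.
- by apply: measurable_funeM; apply: emeasurable_funD; mea.
Qed.

(** A hat times a time cutoff is an admissible test function, and both flux bounds are uniform in
    the cutoff, so [endpoint_difference_le] applies to the integral of the hat along the curve. *)
Lemma hat_gap_dynamic a (E delta : R) : 0 < delta ->
  (\int[leb]_(t in `[0%R, 1%R]) speed t <= E%:E)%E ->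
  `|fine (\int[rho 1 a]_x (hat_prod N b x)%:E)%E - fine (\int[rho 0 a]_x (hat_prod N b x)%:E)%E| <=
  delta * (G * d%:R + \sum_j q a j) + delta^-1 * (G + n%:R * 2) * E.
Proof.
move=> d0 hE; have di0 : 0 < delta^-1 by rewrite invr_gt0.
pose m t := (\int[rho t a]_(x in Omega) hat_prod N b x)%R.
have mE t : t \in `[0, 1] -> (m t)%:E = (\int[rho t a]_x (hat_prod N b x)%:E)%E.
  move=> t01; have [out _] := ce_prob ce t01.
  rewrite /m /Rintegral -(integral_null_outside mO (out a)).
  - by rewrite fineK//; apply: integrable_fin_num => //; exact: hat_integrable.
  - nonneg.
  - mea.
have fE t : t \in `[0, 1] -> m t = fine (\int[rho t a]_x (hat_prod N b x)%:E)%E by move=> t01; rewrite -mE.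
rewrite -!fE ?in_itv/= ?lexx ?ler01//.
apply: endpoint_difference_le.
  apply: (ce_continuous ce); first by apply: continuous_subspaceT; exact: hat_prod_continuous.
  exists 1; split; first by rewrite num_real.
  move=> M M1 x _; apply: le_trans (ltW M1); rewrite patchE; case: ifP => _; last by rewrite normr0.
  by rewrite ger0_norm ?hat_prod_ge0 ?hat_prod_le1.
move=> e e0 e4.
have -> : (\int[leb]_(t in `[0%R, 1%R]) (m t * derive1 (cutoff e) t)%:E =
    \int[leb]_(t in `[0%R, 1%R]) \int[rho t a]_x (dtime (fun z => hat_prod N b z.1 * cutoff e z.2) (x, t))%:E)%E.
  apply: eq_integral => t /set_mem/= t01; rewrite EFinM mE// muleC.
  rewrite -(integralZl measurableT (hat_integrable _ _ _)); apply: eq_integral => x _.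
  by rewrite dtime_hat_cutoff -EFinM mulrC.
rewrite (ce_weak ce a (test_function_hat_cutoff _ N0 e0)).
set A := (\int[leb]_(t in _) _)%E; set B := (\sum_(j < n) _)%E.
have sp0 t : (0 <= speed t)%E by exact: tangent_sqnorm_ge0.
have hA : (`|A| <= (delta * G * d%:R + delta^-1 * G * E)%:E)%E.
  apply: le_trans (integral_nonmeas_affine01 (c := delta * G * d%:R) (k := delta^-1 * G) _ _ sp0 hE).
  - by apply: abse_integral_le => t t01; exact: space_flux_bound.
  - nonneg.
  - by rewrite mulr_gt0.
have hB : (`|B| <= (\sum_(j < n) (delta * (2 * q a j) + delta^-1 * 4 * E)%R)%:E)%E.
  apply: le_trans (lee_abs_sum _ _ _) _; rewrite -sumEFin; apply: lee_sum => j _.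
  apply: le_trans (integral_nonmeas_affine01 (c := delta * (2 * q a j)) (k := delta^-1 * 4) _ _ sp0 hE).
  - by apply: abse_integral_le => t t01; exact: node_flux_bound.
  - nonneg.
  - by rewrite mulr_gt0.
apply: le_trans (lee_abs_sub _ _) _; rewrite abseN abseM (gee0_abs (_ : 0 <= (2^-1)%:E)%E)//.
apply: le_trans (leeD hA (lee_wpmul2l _ hB)) _; first nonneg.
rewrite -EFinM -EFinD lee_fin big_split/= sumr_const card_ord -mulr_sumr -mulr_sumr.
by rewrite -mulr_natl le_eqVlt; apply/orP; left; apply/eqP; field; rewrite gt_eqF.
Qed.

End one_curve.
End dynamic_lower_bound.

Definition dynamic_costs (R : realType) (d n : nat) (Omega : set 'rV[R]_d) (q : 'M[R]_n)
    (theta : R -> R -> R) (mu nu : vmeasure R d n) : set (\bar R) :=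
  [set w | exists rho u v,
    [/\ continuity_equation Omega q theta 0 1 rho u v,
        vmeasure_eq (rho 0) mu, vmeasure_eq (rho 1) nu &
        w = (\int[@lebesgue_measure R]_(t in `[0%R, 1%R])
              tangent_sqnorm Omega q theta (rho t) (fun i x => u i (x, t))
                             (fun i j x => v i j (x, t)))%E]].

Section dynamic_convergence.
Context (R : realType) (d n : nat) (q : 'M[R]_n.+1) (theta : R -> R -> R).
Hypotheses (q_ge0 : forall i j, 0 <= q i j) (q_symmetric : symmetric_graph q) (theta_interp : interpolation_function theta).
Variables (Omega : set 'rV[R]_d).
Hypotheses (Omega_compact : compact Omega).

Lemma dynamic_costs_ge0 mu nu : lbound (dynamic_costs Omega q theta mu nu) 0%E.
Proof.
move=> _ [rho [u [v [_ _ _ ->]]]]; apply: integral_ge0 => t _.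
exact: tangent_sqnorm_ge0.
Qed.

Lemma dynamic_hat_converge (mu_ : nat -> vmeasure R d n.+1) mu :
  (forall e, 0 < e -> \forall k \near \oo,
     (ereal_inf (dynamic_costs Omega q theta (mu_ k) mu) <= e%:E)%E) ->
  hat_converge mu_ mu.
Proof.
move=> h j N b N0 e e0.
have [G G0 hG] := hat_prod_derive_bound N b Omega_compact.
pose K1 := G * d%:R + \sum_i q j i; pose K2 := G + n.+1%:R * 2.
have K10 : 0 <= K1 by rewrite addr_ge0 ?mulr_ge0 ?(ltW G0)// sumr_ge0.
have K20 : 0 < K2 by rewrite ltr_pwDl.
(* With this delta the first term of the gap is at most e / 2; E is then the energy for which the
   second term equals e / 2. *)
pose delta := e / 2 / (K1 + 1).
have d0 : 0 < delta by rewrite !divr_gt0// ltr_wpDl.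
pose E := e / 2 * delta / K2.
have E0 : 0 < E by rewrite divr_gt0// mulr_gt0// divr_gt0.
have E20 : 0 < E / 2 by rewrite divr_gt0.
apply: filterS (h _ E20) => k hk.
have /ereal_inf_lt[_ [rho [u [v [ce r0 r1 ->]]]] hw] :
    (ereal_inf (dynamic_costs Omega q theta (mu_ k) mu) < E%:E)%E.
  by apply: le_lt_trans hk _; rewrite lte_fin ltr_pdivrMr// mulr_natr mulr2n ltrDl.
have := hat_gap_dynamic q_ge0 q_symmetric theta_interp Omega_compact ce N0 G0 hG j d0 (ltW hw).
rewrite distrC /hat_mass -(ge0_integral_eq_measure _ (r0 j)) -(ge0_integral_eq_measure _ (r1 j)).
move=> /le_trans; apply; rewrite -/K1 -/K2.
have h1 : delta * K1 <= e / 2.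
  by rewrite /delta -mulrA ler_piMr ?divr_ge0 ?(ltW e0)// mulrC ler_pdivrMr ?ltr_wpDl// mul1r lerDl.
have -> : delta^-1 * K2 * E = e / 2 by rewrite /E; field; rewrite !gt_eqF.
by lra.
Qed.

End dynamic_convergence.

(** * Calculus along curves *)

Section directional_chain.
Context (R : realType) (V : normedModType R) (f : V -> R).

Lemma is_derive_line (b v : V) (s a : R) : is_derive (b + s *: v) v f a ->
  is_derive (s : R^o) 1 (fun s => f (b + s *: v)) a.
Proof.
move=> [df <-].
have E : (fun h : R => h^-1 *: (((fun s : R^o => f (b + s *: v)) \o shift s) (h *: 1) - f (b + s *: v))) =
  (fun h : R => h^-1 *: ((f \o shift (b + s *: v)) (h *: v) - f (b + s *: v))).
  by apply/funext => h /=; rewrite [h *: 1]mulr1 scalerDl addrCA.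
by split; rewrite /derivable /derive E.
Qed.

Lemma directional_mvt (v : V) (dv : V -> R) : (forall x, is_derive x v f (dv x)) ->
  forall b s, exists xi, `|xi| <= `|s| /\ f (b + s *: v) - f b = s * dv (b + xi *: v).
Proof.
move=> fv b s; pose g (s : R) := f (b + s *: v).
have dg s' : is_derive (s' : R^o) 1 g (dv (b + s' *: v)) by exact: is_derive_line.
have cg (A : set R) : {within A, continuous g}.
  apply: continuous_subspaceT => s'; apply: (@differentiable_continuous _ R^o R^o).
  by apply/derivable1_diffP.
have g0 : g 0 = f b by rewrite /g scale0r addr0.
have [s0|s0] := leP 0 s.
  have [c] := MVT_segment s0 (fun x _ => dg x) (cg _).
  rewrite in_itv/= g0 subr0 => /andP[c0 cs] ->; exists c; split; last by rewrite mulrC.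
  by rewrite !ger0_norm.
have [c] := MVT_segment (ltW s0) (fun x _ => dg x) (cg _).
rewrite in_itv/= g0 sub0r => /andP[sc c0] E; exists c; split.
  by rewrite !ler0_norm ?(ltW s0)// lerN2.
by rewrite -[LHS]opprB -/(g s) E; ring.
Qed.

Variables (I : Type) (phi : I -> R -> R) (dphi : I -> R) (v : I -> V) (dv : I -> V -> R) (t : R).
Hypotheses (fv : forall i x, is_derive x (v i) f (dv i x)) (cdv : forall i, continuous (dv i)).
Hypothesis dphiP : forall i, is_derive (t : R^o) 1 (phi i) (dphi i).

(** Smoothness is given by directional derivatives, so the chain rule is proved without a
    differential: the directions are added one at a time, each by the mean value theorem. The base
    point depends on h so that the induction can absorb the direction just treated. *)
Lemma directional_sum (r : seq I) (b : R -> V) (p : V) : b h @[h --> 0^'] --> p ->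
  h^-1 * (f (b h + \sum_(i <- r) (phi i (t + h) - phi i t) *: v i) - f (b h)) @[h --> 0^'] -->
  \sum_(i <- r) dphi i * dv i p.
Proof.
elim: r b => [|i r IH] b bp.
  rewrite big_nil (_ : (fun h => _) = cst 0); first exact: cvg_cst.
  by apply/funext => h; rewrite big_nil addr0 subrr mulr0.
pose D h := phi i (t + h) - phi i t.
have D0 : D h @[h --> 0^'] --> 0.
  have ct : {for t, continuous (phi i)}.
    by apply: (@differentiable_continuous _ R^o R^o); apply/derivable1_diffP.
  have th : (fun h : R => t + h) h @[h --> (0 : R)] --> t.
    by rewrite -[X in _ --> X]addr0; apply: cvgD; [exact: cvg_cst|exact: cvg_id].
  have pc : (fun h : R => phi i (t + h)) h @[h --> (0 : R)] --> phi i t.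
    exact: (cvg_comp _ _ th ct).
  have Dc : (fun h : R => phi i (t + h) - phi i t) h @[h --> (0 : R)] --> phi i t - phi i t.
    by apply: cvgB; [exact: pc|exact: cvg_cst].
  by rewrite subrr in Dc; exact: cvg_within_filter Dc.
have Dq : h^-1 * D h @[h --> 0^'] --> dphi i.
  have [dp <-] := dphiP i.
  rewrite (_ : (fun h => _) = (fun h : R => h^-1 *: ((phi i \o shift t) (h *: 1) - phi i t))); first exact: dp.
  by apply/funext => h; rewrite /D/= [h%:A]mulr1 [h + t]addrC.
pose b' h := b h + D h *: v i.
have b'p : b' h @[h --> 0^'] --> p.
  rewrite -[p]addr0 -(scale0r (v i)); apply: cvgD => //.
  by apply: cvgZl.
have [xi xiP] := choice (fun h => directional_mvt (fv i) (b h) (D h)).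
have xi0 : xi h @[h --> 0^'] --> 0.
  apply/norm_cvg0P; apply: (squeeze_cvgr _ (cvg_cst 0)); last exact/norm_cvg0P/D0.
  by apply: nearW => h; rewrite normr_ge0 (xiP h).1.
have dvp : dv i (b h + xi h *: v i) @[h --> 0^'] --> dv i p.
  apply: continuous_cvg; first exact: cdv.
  rewrite -[p]addr0 -(scale0r (v i)); apply: cvgD => //.
  by apply: cvgZl.
rewrite big_cons addrC.
rewrite (_ : (fun h => _) = (fun h => h^-1 * (f (b' h + \sum_(i <- r) (phi i (t + h) - phi i t) *: v i) - f (b' h)) +
   (h^-1 * D h) * dv i (b h + xi h *: v i))).
  by apply: cvgD; [exact: IH|exact: cvgM].
apply/funext => h; rewrite big_cons -/(D h) addrA -/(b' h) -mulrA -(xiP h).2 -mulrDr.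
by congr (_ * _); rewrite -/(b' h); ring.
Qed.

Lemma is_derive_curve (r : seq I) (c0 : V) :
  is_derive (t : R^o) 1 (fun s => f (c0 + \sum_(i <- r) phi i s *: v i))
   (\sum_(i <- r) dphi i * dv i (c0 + \sum_(i <- r) phi i t *: v i)).
Proof.
set p := c0 + \sum_(i <- r) phi i t *: v i.
have bp : (fun _ : R => p) h @[h --> 0^'] --> p by exact: cvg_cst.
have := @directional_sum r _ _ bp.
set l := \sum_(i <- r) _; set F := (X in X @ _ --> _); move=> Fl.
have E : (fun h : R => h^-1 *: (((fun s : R^o => f (c0 + \sum_(i <- r) phi i s *: v i)) \o shift t) (h *: 1)
    - f p)) = F.
  apply/funext => h; rewrite /F/= [h *: 1]mulr1 [h + t]addrC; congr (_ * (f _ - _)).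
  rewrite /p -addrA -big_split/=; congr (_ + _); apply: eq_bigr => i _.
  by rewrite -scalerDl subrKC.
split; first by rewrite /derivable E; apply/cvg_ex; exists l.
by rewrite /derive E; exact/cvg_lim.
Qed.

End directional_chain.

(** * Bounded densities and conditional means *)

Section bounded_densities.
Context (R : realType).

(** The Radon-Nikodym derivative is at most c almost everywhere only; truncating it at c keeps the
    integrals and makes the bound hold everywhere. *)
Lemma bounded_density d (T : measurableType d) (m1 m2 : {finite_measure set T -> \bar R}) (c : R) :
  0 <= c -> (forall A, measurable A -> (m1 A <= c%:E * m2 A)%E) ->
  exists s : T -> R, [/\ mble s, forall x, 0 <= s x <= c &
    forall A, measurable A -> (m1 A = \int[m2]_(x in A) (s x)%:E)%E].
Proof.
move=> c0 m12.
have dom : m1 `<< m2.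
  apply/null_content_dominatesP => A mA A0.
  by apply/eqP; rewrite -measure_le0 (le_trans (m12 _ mA))// A0 mule0.
pose f := fine \o Radon_Nikodym_SigmaFinite.f m1 m2.
have fE x : ((f x)%:E = Radon_Nikodym_SigmaFinite.f m1 m2 x)%E.
  by rewrite fineK//; exact: Radon_Nikodym_SigmaFinite.f_fin_num.
have f0 x : 0 <= f x by apply: fine_ge0; exact: Radon_Nikodym_SigmaFinite.f_ge0.
have mf : mble f.
  apply/measurable_EFinP; rewrite (_ : _ \o _ = Radon_Nikodym_SigmaFinite.f m1 m2).
    exact: (measurable_int _ (Radon_Nikodym_SigmaFinite.f_integrable dom)).
  by apply/funext => x; exact: fE.
have fI A : measurable A -> (m1 A = \int[m2]_(x in A) (f x)%:E)%E.
  move=> mA; rewrite (Radon_Nikodym_SigmaFinite.f_integral dom mA).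
  by apply: eq_integral => x _; rewrite fE.
pose s x := Num.min (f x) c.
have ms : mble s by apply: measurable_minr; [exact: mf|mea].
have s0 x : 0 <= s x by rewrite le_min f0.
exists s; split=> // [x|A mA]; first by rewrite s0/= ge_min lexx orbT.
pose B := [set x | c < f x].
have mB : measurable B.
  rewrite -[X in measurable X]setTI.
  exact: (measurable_fun_ltr (measurable_cst c) mf measurableT (Y := [set true])).
have mAB : measurable (A `&` B) by exact: measurableI.
have mAD : measurable (A `\` B) by exact: measurableD.
have split_int (g : T -> R) : mble g -> (forall x, 0 <= g x) ->
    (\int[m2]_(x in A) (g x)%:E = \int[m2]_(x in A `&` B) (g x)%:E + \int[m2]_(x in A `\` B) (g x)%:E)%E.
  move=> mg g0.
  have -> : (\int[m2]_(x in A) (g x)%:E = \int[m2]_(x in (A `&` B) `|` (A `\` B)) (g x)%:E)%E by rewrite setUIDK.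
  rewrite ge0_integral_setU//.
  - mea.
  - nonneg.
  - by apply/disj_setPS => x [[_ Bx] [_ nBx]].
rewrite fI// !split_int//; congr (_ + _)%E.
  apply/eqP; rewrite eq_le; apply/andP; split; last first.
    apply: le_integral_nonmeas_in => x _; rewrite lee_fin// /s ge_min lexx//.
  rewrite -fI//; apply: le_trans (m12 _ mAB) _; rewrite -integral_cst//.
  apply: le_integral_nonmeas_in => x [_ Bx]; rewrite /= lee_fin// /s.
  by rewrite le_min lexx (ltW Bx).
apply: eq_integral => x /set_mem[_ nB]; congr EFin; apply/esym/min_idPl.
by rewrite leNgt; apply/negP.
Qed.

(** V is the conditional expectation of h given phi: h + c is the density of a measure whose image
    has a density s against the image of m, and V = s - c. The last clause holds because h - V o phi
    is orthogonal to V o phi. *)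
Lemma conditional_mean d1 d2 (W : measurableType d1) (Y : measurableType d2)
    (m : {finite_measure set W -> \bar R}) (phi : W -> Y) (h : W -> R) (c : R) :
  mble phi -> mble h -> (forall w, `|h w| <= c) -> 0 <= c ->
  exists V : Y -> R, [/\ mble V, forall y, `|V y| <= c,
    forall (f : Y -> R) (B : R), mble f -> (forall y, `|f y| <= B) ->
      (\int[m]_w (f (phi w) * h w)%:E = \int[m]_w (f (phi w) * V (phi w))%:E)%E &
    (\int[m]_w (V (phi w) ^+ 2)%:E <= \int[m]_w (h w ^+ 2)%:E)%E].
Proof.
move=> mphi mh hc c0.
pose g w := h w + c.
have g0 w : 0 <= g w by have := hc w; rewrite /g ler_norml => /andP[]; lra.
have mg : mble g by exact: measurable_funD.
have gc w : `|g w| <= c + c by rewrite ger0_norm// /g lerD2r; exact: le_trans (ler_norm _) (hc w).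
pose W1 := wpush m g0 mg mphi.
pose W2 := wpush m (fun=> ler01) (@measurable_cst _ _ _ _ setT (1 : R)) mphi.
have mA A : measurable A -> measurable (phi @^-1` A) by mea.
have W2E A : measurable A -> W2 A = m (phi @^-1` A).
  by move=> mA'; rewrite /W2 /wpush integral_cst ?mul1e//; exact: mA.
have W12 A : measurable A -> (W1 A <= (c + c)%:E * W2 A)%E.
  move=> mA'; rewrite W2E// /W1 /wpush -integral_cst; last exact: mA.
  apply: le_integral_nonmeas_in => w _; rewrite lee_fin//.
  by apply: le_trans (ler_norm _) _.
have fin2 : (W2 setT < +oo)%E by rewrite W2E// -ge0_fin_numE// fin_num_measure//; exact: mA.
have fin1 : (W1 setT < +oo)%E.
  by apply: le_lt_trans (W12 _ measurableT) _; apply: lte_mul_pinfty; rewrite ?lee_fin ?addr_ge0.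
have [m1 m1E] := mk_finite_measure fin1; have [m2 m2E] := mk_finite_measure fin2.
have [s [ms sc sI]] : exists s : Y -> R, [/\ mble s, forall x, 0 <= s x <= c + c &
    forall A, measurable A -> (m1 A = \int[m2]_(x in A) (s x)%:E)%E].
  apply: bounded_density; first nonneg.
  by move=> A mA'; rewrite m1E m2E; exact: W12.
have s0 y : 0 <= s y by have /andP[] := sc y.
have ge0 (f : Y -> R) : mble f -> (forall y, 0 <= f y) ->
    (\int[m]_w (f (phi w) * g w)%:E = \int[m]_w (f (phi w) * s (phi w))%:E)%E.
  move=> mf f0.
  have mfE : mble (fun y => (f y)%:E) by exact/measurable_EFinP.
  transitivity (\int[m1]_y (f y)%:E)%E.
    rewrite (ge0_integral_eq_measure _ (m2 := W1)); last by move=> A _; exact: m1E.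
    rewrite ge0_integral_wpush//.
    by apply: eq_integral => w _; rewrite -EFinM mulrC.
  transitivity (\int[wpush m2 s0 ms (@measurable_id _ Y setT)]_y (f y)%:E)%E.
    by apply: ge0_integral_eq_measure => A mA'; exact: sI.
  rewrite ge0_integral_wpush//.
  rewrite (ge0_integral_eq_measure _ (m2 := W2)); last by move=> A _; exact: m2E.
  rewrite ge0_integral_wpush//.
  - by apply: eq_integral => w _; rewrite mul1e -EFinM mulrC.
  - by apply/measurable_EFinP; mea.
  - by move=> y; rewrite lee_fin mulr_ge0.
pose V y := s y - c.
have mV : mble V by exact: measurable_funB.
have Vc y : `|V y| <= c by have /andP[h1 h2] := sc y; rewrite /V ler_norml; apply/andP; split; lra.
have bI (F : W -> R) (B : R) : mble F -> (forall w, `|F w| <= B) ->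
    m.-integrable setT (EFin \o F) by exact: finite_bounded_integrable.
have bM (F F' : W -> R) (B B' : R) : (forall w, `|F w| <= B) -> (forall w, `|F' w| <= B') ->
    forall w, `|F w * F' w| <= B * B'.
  by move=> h1 h2 w; rewrite normrM; apply: ler_pM.
have mc (f : Y -> R) : mble f -> mble (fun w => f (phi w)) by mea.
have sc' y : `|s y| <= c + c by rewrite ger0_norm//; have /andP[] := sc y.
have main (f : Y -> R) (B : R) : mble f -> (forall y, `|f y| <= B) ->
      (\int[m]_w (f (phi w) * h w)%:E = \int[m]_w (f (phi w) * V (phi w))%:E)%E.
  move=> mf fB.
  have B0 y : 0 <= f y + B by have := fB y; rewrite ler_norml => /andP[]; lra.
  have B00 (y : Y) : 0 <= B by apply: le_trans (fB y).
  have L (k : W -> R) : mble k -> (forall w, `|k w| <= c + c) ->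
      (\int[m]_w (f (phi w) * (k w - c))%:E =
       (1 * fine (\int[m]_w ((f (phi w) + B) * k w)%:E) +
        (- 1) * fine (\int[m]_w (1 * (B * k w) + c * f (phi w))%:E))%:E)%E.
    move=> mk kc; rewrite -integral_lincomb//.
    - by apply: eq_integral => w _; congr EFin; ring.
    - apply: (bI _ ((B + B) * (c + c))).
        mea.
      apply: bM => // w; apply: le_trans (ler_normD _ _) _; rewrite lerD// ger0_norm//.
      exact: (B00 (phi w)).
    - apply: (bI _ (B * (c + c) + c * B)).
        mea.
      move=> w; apply: le_trans (ler_normD _ _) _; rewrite mul1r lerD//.
        by apply: (bM (fun=> B)) => // w'; rewrite ger0_norm//; exact: (B00 (phi w)).
      by apply: (bM (fun=> c) (fun w => f (phi w))) => // w'; rewrite ger0_norm.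
  have eg : (\int[m]_w (f (phi w) * h w)%:E = \int[m]_w (f (phi w) * (g w - c))%:E)%E.
    by apply: eq_integral => w _; rewrite /g addrK.
  have ms' : mble (fun w => s (phi w)) by mea.
  rewrite eg (L _ mg gc) [RHS](L _ ms' (fun w => sc' (phi w))); congr (1 * fine _ + -1 * fine _)%:E.
    by apply: (ge0 (fun y => f y + B)) => //; mea.
  have gI (k : W -> R) : mble k -> (forall w, `|k w| <= c + c) ->
      (\int[m]_w (1 * (B * k w) + c * f (phi w))%:E =
       (1 * fine (\int[m]_w (B * k w)%:E) + c * fine (\int[m]_w (f (phi w))%:E))%:E)%E.
    move=> mk kc; rewrite -integral_lincomb//.
      apply: (bI _ (B * (c + c))); first mea.
      by move=> w; apply: (bM (fun=> B)) => // w'; rewrite ger0_norm//; exact: (B00 (phi w)).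
    by apply: (bI _ B) => //; exact: mc.
  rewrite (gI _ mg gc) (gI _ ms' (fun w => sc' (phi w))); congr (1 * fine _ + _)%:E.
  by apply: (ge0 (fun=> B)).
exists V; split=> //.
have hV := main V c mV Vc.
have I1 : m.-integrable setT (fun w => (h w ^+ 2)%:E).
  apply: (bI _ (c * c)); first mea.
  by move=> w; rewrite expr2; exact: bM.
have I2 : m.-integrable setT (fun w => (V (phi w) * h w)%:E).
  by apply: (bI _ (c * c)); [mea|exact: bM].
have I3 : m.-integrable setT (fun w => (V (phi w) ^+ 2)%:E).
  apply: (bI _ (c * c)); first mea.
  move=> w; rewrite expr2.
  exact: (bM _ _ c c (fun w => Vc (phi w)) (fun w => Vc (phi w))).
have E : (\int[m]_w ((h w - V (phi w)) ^+ 2)%:E = (1 * fine (\int[m]_w (h w ^+ 2)%:E) +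
    1 * fine (\int[m]_w (- 2 * (V (phi w) * h w) + 1 * V (phi w) ^+ 2)%:E))%:E)%E.
  rewrite -integral_lincomb//; first by apply: eq_integral => w _; congr EFin; ring.
  rewrite (_ : EFin \o _ = (fun w => (- 2)%:E * (V (phi w) * h w)%:E + 1%:E * (V (phi w) ^+ 2)%:E)%E); last first.
    by apply/funext => w; rewrite /= EFinD !EFinM.
  by apply: integrableD => //; exact: integrableZl.
have E' : (\int[m]_w (- 2 * (V (phi w) * h w) + 1 * V (phi w) ^+ 2)%:E =
   (- fine (\int[m]_w (V (phi w) ^+ 2)%:E))%:E)%E.
  rewrite integral_lincomb// hV (_ : (\int[m]_w (V (phi w) * V (phi w))%:E)%E = (\int[m]_w (V (phi w) ^+ 2)%:E)%E).
    by congr EFin; ring.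
  by apply: eq_integral => w _; rewrite expr2.
have : (0 <= \int[m]_w ((h w - V (phi w)) ^+ 2)%:E)%E by nonneg.
rewrite E E' lee_fin/= !mul1r subr_ge0 => hle.
by rewrite -(fineK (integrable_fin_num measurableT I3)) -(fineK (integrable_fin_num measurableT I1)) lee_fin.
Qed.

Lemma unit_interval_probability : exists P : probability (measurableTypeR R) R,
  forall f : R -> \bar R, mble f ->
  (\int[P]_t f t = \int[@lebesgue_measure R]_(t in `[0%R, 1%R]) f t)%E.
Proof.
have i0 t : 0 <= \1_(`[0, 1]%classic : set R) t :> R by [].
have mi : mble (\1_(`[0, 1]%classic : set R) : measurableTypeR R -> R) by [].
pose W := wpush (@lebesgue_measure R) i0 mi (@measurable_id _ (measurableTypeR R) setT).
have WT : W setT = 1%E.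
  transitivity (\int[@lebesgue_measure R]_t (\1_(`[0, 1]%classic : set R) t)%:E)%E; first exact: wpushT.
  by rewrite integral_indic// setIT; exact: lebesgue_itv01.
have [P PE] := mk_probability WT; exists P => f mf.
rewrite (ge0_integral_eq_measure _ (m2 := W)); last by move=> A _; exact: PE.
rewrite integral_wpush// [RHS]integral_mkcond; apply: eq_integral => t _.
by rewrite patchE indicE; case: ifP => _; rewrite ?mul1e ?mul0e.
Qed.

End bounded_densities.

Section space_time_functions.
Context (R : realType) (d : nat).
Local Notation V := ('rV[R]_d * R^o)%type.

(** Measurability refers to the product sigma-algebra; the function is factored through row vectors
    of length d + 1, where continuity suffices and the coordinates are measurable. *)
Lemma continuous_measurable_space_time (f : V -> R) : continuous f ->
  mble (f : 'rV[R]_d * measurableTypeR R -> R).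
Proof.
move=> cf.
pose g (w : 'rV[R]_(d + 1)) : R := f (lsubmx w, rsubmx w 0 0).
have cg : continuous g.
  move=> w; apply: (@continuous_comp _ V _ (fun w : 'rV[R]_(d + 1) => (lsubmx w, rsubmx w 0 0) : V) f); last exact: cf.
  have c1 : {for w, continuous (lsubmx : 'rV[R]_(d + 1) -> 'rV[R]_d)} by exact: continuous_lsubmx.
  have c2 : {for w, continuous (fun w : 'rV[R]_(d + 1) => rsubmx w 0 0 : R^o)}.
    apply: (@continuous_comp _ _ _ (rsubmx : 'rV[R]_(d + 1) -> _) (fun w : 'rV[R]_1 => w 0 0)).
      exact: continuous_rsubmx.
    exact: coord_continuous.
  exact: (cvg_pair c1 c2).
rewrite (_ : f = g \o (fun w : 'rV[R]_d * measurableTypeR R => row_mx w.1 (w.2)%:M)); last first.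
  by apply/funext => -[v t]; rewrite /g/= row_mxKl row_mxKr mxE eqxx mulr1n.
apply: (measurableT_comp (continuous_measurable_mx cg)).
apply: (measurable_fun_mx measurableT) => a k; rewrite ord1.
under eq_fun do rewrite mxE.
case: (fintype.split k) => j.
  by apply: (measurableT_comp (measurable_coord _ _)); exact: measurable_fst.
rewrite ord1 (_ : (fun w => _) = snd); first exact: measurable_snd.
by apply/funext => w; rewrite mxE eqxx mulr1n.
Qed.

Lemma compact_support_bounded (f : V -> R) (K : set V) : compact K -> continuous f ->
  (forall w, ~ K w -> f w = 0) -> exists B, forall w, `|f w| <= B.
Proof.
move=> cK cf f0.
have [B [_ hB]] := compact_bounded (continuous_compact (continuous_subspaceT cf) cK).
exists (Num.max 0 (B + 1)) => w; rewrite le_max; case: (pselect (K w)) => [Kw|nK].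
  by apply/orP; right; apply: hB; [rewrite ltrDl|exists w].
by rewrite f0// normr0 lexx.
Qed.

Lemma test_functionP (a b : R) (eta : V -> R) : test_function (setT `*` `]a, b[) eta ->
  [/\ forall v w, is_derive w v (eta : V -> R^o) ('D_v (eta : V -> R^o) w),
      forall v, continuous ('D_v (eta : V -> R^o)) & continuous eta] /\
  [/\ exists B, forall w, `|eta w| <= B,
      forall v, exists B, forall w, `|'D_v (eta : V -> R^o) w| <= B &
      forall w, w.2 <= a \/ b <= w.2 -> eta w = 0].
Proof.
move=> [/(_ 1%N)/Ck_succE[ce de Ce] cK KU].
pose K := closure [set w | eta w != 0].
have e0 w : ~ K w -> eta w = 0.
  by move=> nK; apply/eqP; apply: contrapT => /negP h; apply: nK; exact: subset_closure.
have cD v : continuous ('D_v (eta : V -> R^o)) by exact: Ck_continuous (Ce v).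
have De v w : is_derive w v (eta : V -> R^o) ('D_v (eta : V -> R^o) w) by exact/derivableP/de.
split; split=> //.
- exact: compact_support_bounded cK ce e0.
- move=> v; apply: compact_support_bounded cK (cD v) _ => w nK.
  suff : is_derive w v (eta : V -> R^o) 0 by case.
  apply: (@near_eq_is_derive _ V R^o (cst 0)).
  have oK : open (~` K) by apply: closed_openC; exact: closed_closure.
  by have := open_nbhs_nbhs (conj oK nK); apply: filterS => u /e0 ->.
- move=> w h; apply: e0 => /KU [_] /=; rewrite in_itv/= => /andP[h1 h2].
  by case: h; rewrite leNgt ?h1 ?h2.
Qed.

End space_time_functions.

(** * Upper bound for the dynamic distance *)

Section interpolating_curve.
Context d' (Z : measurableType d') (R : realType) (d n : nat).
Variables (q : 'M[R]_n) (theta : R -> R -> R).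
Hypotheses (q_ge0 : forall i j, 0 <= q i j) (q_symmetric : symmetric_graph q) (theta_interp : interpolation_function theta).
Variables (C : R) (P : 'I_n -> 'I_n -> R -> 'I_n -> R) (J : 'I_n -> 'I_n -> R -> 'I_n -> 'I_n -> R).
Hypotheses (C0 : 0 <= C) (fs : flow_system q C P J).
Variables (pi : probability Z R) (x y : Z -> 'rV[R]_d) (i0 i1 : Z -> 'I_n) (M : R).
Hypotheses (mx : mble x) (my : mble y)
  (mi0 : forall a, measurable [set z | i0 z = a]) (mi1 : forall a, measurable [set z | i1 z = a])
  (M0 : 0 <= M) (xM : forall z k, `|x z 0 k| <= M) (yM : forall z k, `|y z 0 k| <= M).
Variables (Omega : set 'rV[R]_d) (good : set Z).
Hypotheses (Omega_convex : convex_set Omega) (Omega_compact : compact Omega)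
  (mgood : measurable good) (good1 : (pi (~` good) = 0)%E)
  (xgood : forall z, good z -> Omega (x z)) (ygood : forall z, good z -> Omega (y z)).
Local Notation leb := (@lebesgue_measure R).

Let mO : measurable Omega.
Proof. by apply: closed_measurable_mx; exact: compact_closed. Qed.

(* The nodes react during [0, 1/2], the mass moves in space during [1/2, 1]. *)
Definition moved (t : R) : R := ramp (2 * t + - 1) ^+ 2.
Definition speed (t : R) : R := 4 * ramp (2 * t + - 1).
(** With times clamped to [0, 1] the curve consists of probability vectors at every real time, and
    its continuity can be proved on the whole line. *)
Definition clock (t : R) : R := Num.max 0 (Num.min 1 t).

Lemma clock01 t : 0 <= clock t <= 1.
Proof. by rewrite le_max lexx/= ge_max ler01 ge_min lexx. Qed.

Lemma clock_id t : 0 <= t <= 1 -> clock t = t.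
Proof. by move=> /andP[h1 h2]; rewrite /clock (min_idPr h2); apply/max_idPr. Qed.

Lemma clock_continuous : continuous clock.
Proof.
move=> t; apply: (@continuous_max R R (cst 0) (fun t => Num.min 1 t)); first exact: cst_continuous.
by apply: (@continuous_min R R (cst 1) id); [exact: cst_continuous|].
Qed.

Lemma moved01 t : 0 <= t <= 1 -> 0 <= moved t <= 1.
Proof.
move=> /andP[h1 h2]; rewrite sqr_ge0/= exprn_ile1 ?ramp_ge0//.
by rewrite /ramp ge_max ler01/=; lra.
Qed.

Lemma speed_bound t : 0 <= t <= 1 -> 0 <= speed t <= 4.
Proof.
move=> /andP[h1 h2]; rewrite mulr_ge0 ?ramp_ge0//= -[leRHS]mulr1 ler_pM2l//.
by rewrite /ramp ge_max ler01/=; lra.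
Qed.

Lemma speed_rest t : t <= 2^-1 -> speed t = 0.
Proof. by move=> h; rewrite /speed ramp_le0 ?mulr0//; lra. Qed.

Lemma moved_rest t : t <= 2^-1 -> moved t = 0.
Proof. by move=> h; rewrite /moved ramp_le0 ?expr0n//; lra. Qed.

Lemma moved_end : moved 1 = 1.
Proof. by rewrite /moved /ramp (max_idPr _); [ring|lra]. Qed.

Lemma is_derive_moved t : is_derive (t : R^o) 1 moved (speed t).
Proof.
have h := @is_derive1_comp R (fun t => ramp t ^+ 2) (fun t => 2 * t + - 1) t _ _
  (is_derive_ramp2 (2 * t + - 1)) (is_derive_affine 2 (- 1) t).
rewrite (_ : speed t = 2 * ramp (2 * t + - 1) * 2); first exact: h.
by rewrite /speed; ring.
Qed.

Lemma moved_continuous : continuous moved.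
Proof.
move=> t; apply: (@differentiable_continuous _ R^o R^o).
by apply/derivable1_diffP; have [] := is_derive_moved t.
Qed.

Lemma measurable_moved : mble moved.
Proof. exact: continuous_measurable_fun moved_continuous. Qed.

Lemma measurable_speed : mble speed.
Proof.
have ca : continuous (fun t : R => 2 * t + - 1).
  by move=> t; apply: cvgD; [apply: cvgM; [exact: cvg_cst|exact: cvg_id]|exact: cvg_cst].
apply: continuous_measurable_fun => t; apply: cvgM; first exact: cvg_cst.
exact: (cvg_comp _ _ (ca t) (@ramp_continuous R _)).
Qed.

Lemma measurable_select d2 (T : measurableType d2) (a b : T -> 'I_n) (F : 'I_n -> 'I_n -> T -> R) :
  (forall i, measurable [set w | a w = i]) -> (forall i, measurable [set w | b w = i]) ->
  (forall i j, mble (F i j)) -> mble (fun w => F (a w) (b w) w).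
Proof.
move=> ma mb mF.
rewrite (_ : (fun w => _) = (fun w => \sum_i \sum_j (\1_[set w | a w = i] w * \1_[set w | b w = j] w * F i j w))).
  mea.
apply/funext => w; rewrite (bigD1 (a w))//= (bigD1 (b w))//= !indicE !mem_set// !mul1r.
rewrite big1; last first.
  by move=> j /eqP jb; rewrite !indicE [_ \in [set w | b w = j]]memNset ?mulr0 ?mul0r//= => e; exact/jb.
rewrite big1 ?addr0// => i /eqP ia; rewrite big1// => j _.
by rewrite indicE memNset ?mul0r//= => e; exact/ia.
Qed.

Definition position (t : R) (z : Z) : 'rV[R]_d := x z + moved t *: (y z - x z).

Lemma position_coord t z k : position t z 0 k = x z 0 k + moved t * (y z 0 k - x z 0 k).
Proof. by rewrite !mxE. Qed.

Lemma position_Omega t z : 0 <= t <= 1 -> good z -> Omega (position t z).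
Proof.
move=> /moved01 /andP[h0 h1] gz.
have := Omega_convex (Itv01 h0 h1) (mem_set (ygood gz)) (mem_set (xgood gz)).
move=> /set_mem; congr Omega; apply/rowP => k; rewrite /conv/= !mxE/=.
by rewrite /unstable.onem; ring.
Qed.

Lemma measurable_position t : mble (position t).
Proof.
apply: (measurable_fun_mx measurableT) => a k; rewrite ord1.
under eq_fun do rewrite position_coord.
mea.
Qed.

Definition weight (t : R) (a : 'I_n) (z : Z) : R := P (i0 z) (i1 z) t a.

Lemma weight_ge0 t a z : 0 <= t -> 0 <= weight t a z.
Proof. exact: (fs_ge0 fs). Qed.

Lemma weight_sum t z : \sum_a weight t a z = 1.
Proof. exact: (fs_sum fs). Qed.

Lemma weight_le1 t a z : 0 <= t -> weight t a z <= 1.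
Proof.
move=> t0; rewrite -(weight_sum t z) (bigD1 a)//= lerDl.
by apply: sumr_ge0 => b _; exact: weight_ge0.
Qed.

Lemma weight_end t a z : 2^-1 <= t -> weight t a z = (a == i1 z)%:R.
Proof. by move=> ht; rewrite /weight (fs_end fs). Qed.

Lemma measurable_weight t a : mble (weight t a).
Proof. by apply: (measurable_select (F := fun i j _ => P i j t a)). Qed.

Lemma P_continuous i j a : continuous (fun t => P i j t a).
Proof.
move=> t; apply: (@differentiable_continuous _ R^o R^o).
by apply/derivable1_diffP; have [] := fs_derive fs i j a t.
Qed.

Let cw0 t a z : 0 <= weight (clock t) a z.
Proof. by apply: weight_ge0; have /andP[] := clock01 t. Qed.

Lemma curve_exists t a : exists m : {finite_measure set 'rV[R]_d -> \bar R},
  forall A, m A = wpush pi (cw0 t a) (measurable_weight (clock t) a) (measurable_position (clock t)) A.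
Proof.
apply: mk_finite_measure; apply: le_lt_trans (_ : (\int[pi]_z (weight (clock t) a z)%:E < +oo)%E).
  by rewrite [leLHS]wpushT.
apply: (@le_lt_trans _ _ (\int[pi]_z (cst 1%E z))%E); last first.
  rewrite integral_cst// mul1e.
  exact: (eq_ind_r (fun v => (v < +oo)%E) (ltry 1) (probability_setT pi)).
apply: le_integral_nonmeas => z; rewrite lee_fin//.
by apply: weight_le1; have /andP[] := clock01 t.
Qed.

(** The weighted image has to be bundled as a finite measure, hence the choice; only its values,
    given by [curveE], are used. *)
Definition curve (t : R) : vmeasure R d n := fun a => sval (cid (curve_exists t a)).

Lemma curveE t a A : curve t a A =
  wpush pi (cw0 t a) (measurable_weight (clock t) a) (measurable_position (clock t)) A.
Proof. exact: (svalP (cid (curve_exists t a))). Qed.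

Lemma curve_integral_clock t a (f : 'rV[R]_d -> R) : mble f ->
  (\int[curve t a]_v (f v)%:E = \int[pi]_z (weight (clock t) a z * f (position (clock t) z))%:E)%E.
Proof.
move=> mf; have cE : measure_eq (curve t a)
    (wpush pi (cw0 t a) (measurable_weight (clock t) a) (measurable_position (clock t))).
  by move=> A _; exact: curveE.
rewrite (ge0_integral_eq_measure _ cE).
by rewrite integral_wpush//; mea.
Qed.

Lemma curve_integral t a (f : 'rV[R]_d -> R) : 0 <= t <= 1 -> mble f ->
  (\int[curve t a]_v (f v)%:E = \int[pi]_z (weight t a z * f (position t z))%:E)%E.
Proof. by move=> t01 mf; rewrite curve_integral_clock// clock_id. Qed.

Lemma curve_out t a : curve t a (~` Omega) = 0%E.
Proof.
rewrite curveE; apply/eqP; rewrite eq_le measure_ge0 andbT /wpush.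
apply: (@le_trans _ _ (\int[pi]_(z in ~` good) (cst 1%E z))%E); last first.
  rewrite (integral_cst _ (measurableC mgood)) mul1e.
  exact: (eq_ind_r (fun v => (v <= 0)%E) (lexx 0%E) good1).
rewrite integral_mkcond [leRHS]integral_mkcond; apply: le_integral_nonmeas => z.
  by rewrite patchE; case: ifP => // _; rewrite lee_fin.
rewrite !patchE; case: ifPn => [/set_mem nO|_]; last by case: ifP.
have ng : (~` good) z by move=> gz; apply: nO; exact: position_Omega (clock01 t) gz.
by rewrite mem_set// lee_fin; apply: weight_le1; have /andP[] := clock01 t.
Qed.

Lemma curve_prob t : vprob Omega (curve t).
Proof.
split=> [a|]; first exact: curve_out.
under eq_bigr => a _ do rewrite curveE wpushT.
rewrite -ge0_integral_sum//.
- rewrite -[RHS](probability_setT pi) -[RHS]mul1e -integral_cst//; apply: eq_integral => z _.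
  by rewrite sumEFin weight_sum.
- by move=> a; apply/measurable_EFinP; exact: measurable_weight.
- nonneg.
Qed.

Lemma continuous_along (f : 'rV[R]_d -> R) (g : R -> 'rV[R]_d) : {within Omega, continuous f} ->
  continuous g -> (forall t, Omega (g t)) -> continuous (fun t => (f \_ Omega) (g t)).
Proof.
move=> cf cg gO t; rewrite (_ : (fun t => _) = (fun t => f (g t))); last first.
  by apply/funext => s; rewrite patchE mem_set.
have /subspace_continuousP/(_ _ (gO t)) := cf; apply: cvg_comp => A wA.
have H : nbhs t [set s | Omega (g s) -> A (g s)] := cg t _ wA.
by apply: filterS H => s hs; exact: hs (gO s).
Qed.

Lemma measurable_within (f : 'rV[R]_d -> R) : {within Omega, continuous f} ->
  mble (f \_ Omega).
Proof.
move=> cf; apply/(measurable_restrictT _ _).1 => //.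
apply: (measurability _ (RGenOpens.measurableE R)) => _ [_ [a [b ->] <-]].
have oab : open (`]a, b[%classic : set R) by [].
have oU : open (f @^-1` `]a, b[%classic : set (subspace Omega)).
  by move/continuousP : cf => /(_ _ oab).
have [V oV VE] := (open_subspaceP Omega _).1 oU.
by rewrite setIC -VE; apply: measurableI => //; exact: open_measurable_mx.
Qed.

Lemma curve_continuous t0 t1 : narrowly_continuous Omega t0 t1 curve.
Proof.
move=> a f cf [B [Br hB]].
have mf := measurable_within cf.
pose B1 := Num.max 0 (B + 1).
have fB v : `|(f \_ Omega) v| <= B1 by apply: (le_trans (hB (B + 1) _ v I)); rewrite ?ltrDl// le_max lexx orbT.
pose G t z := weight (clock t) a z * (f \_ Omega) (position (clock t) z).
have mG t : mble (G t).
  by apply: measurable_funM; [exact: measurable_weight|apply: (measurableT_comp mf); exact: measurable_position].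
have GB t z : `|G t z| <= B1.
  rewrite normrM -[leRHS]mul1r; apply: ler_pM => //; rewrite ger0_norm//.
  by apply: weight_le1; have /andP[] := clock01 t.
have E t : (\int[curve t a]_(v in Omega) f v)%R = (\int[pi]_(z in setT) G t z)%R.
  rewrite /Rintegral; congr fine; rewrite integral_mkcond -curve_integral_clock//.
  by apply: eq_integral => v _; rewrite !patchE; case: ifP.
under [X in continuous X]eq_fun do rewrite E.
apply: continuous_subspaceT => t.
have := @continuity_under_integral R _ _ pi G setT measurableT (t - 1) (t + 1) _ _ (cst B1) _ _.
move=> /(_ _ _ _ _)/wrap[].
- by move=> s _; apply: (@finite_bounded_integrable _ _ _ _ _ B1).
- exists (~` good); split=> //; first mea.
  move=> z nz gz; apply: nz => _ s _; apply: cvgM.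
    apply: (@continuous_comp _ _ _ clock (fun s => P (i0 z) (i1 z) s a)); first exact: clock_continuous.
    exact: P_continuous.
  apply: continuous_along => //; last by move=> r; exact: position_Omega (clock01 r) gz.
  move=> r; apply: cvgD; first exact: cvg_cst.
  apply: cvgZl; apply: (@continuous_comp _ _ _ clock moved); first exact: clock_continuous.
  exact: moved_continuous.
- exact: finite_measure_integrable_cst.
- by move=> s _; apply: aeW => z _.
by apply; rewrite inE/= in_itv/= ltrBlDr !ltrDl ltr01.
Qed.

Definition pick (ij : 'I_n * 'I_n) (z : Z) : R :=
  \1_[set z | i0 z = ij.1] z * \1_[set z | i1 z = ij.2] z.

Lemma pick_sum (F : 'I_n -> 'I_n -> R) z : \sum_ij pick ij z * F ij.1 ij.2 = F (i0 z) (i1 z).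
Proof.
rewrite (bigD1 (i0 z, i1 z))//= /pick !indicE !mem_set// !mul1r big1 ?addr0// => -[i j].
rewrite xpair_eqE negb_and => /orP[/eqP h|/eqP h]; rewrite /= !indicE.
  by rewrite memNset ?mul0r//= => e; exact/h.
by rewrite [_ \in [set z | i1 z = j]]memNset ?mulr0 ?mul0r//= => e; exact/h.
Qed.

Lemma pick_ge0 ij z : 0 <= pick ij z. Proof. exact: mulr_ge0. Qed.

Lemma pick_le1 ij z : pick ij z <= 1.
Proof. by rewrite /pick !indicE; case: (_ \in _); case: (_ \in _); rewrite ?mulr1 ?mulr0. Qed.

Lemma measurable_pick ij : mble (pick ij).
Proof. by apply: measurable_funM; exact: measurable_indic. Qed.

(** m is the law of the initial place and s ij v the conditional probability of the pair of nodes
    given the place v. During the first half, the curve is over each v the graph flow mixed with the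
    weights s ij v. *)
Lemma pair_densities : exists (m : {finite_measure set 'rV[R]_d -> \bar R})
    (s : 'I_n * 'I_n -> 'rV[R]_d -> R),
  [/\ forall A, measurable A -> m A = pi (x @^-1` A),
      forall ij, mble (s ij), forall ij v, 0 <= s ij v <= 1 &
      forall ij (f : 'rV[R]_d -> R), mble f ->
        (\int[m]_v (s ij v * f v)%:E = \int[pi]_z (pick ij z * f (x z))%:E)%E].
Proof.
pose W ij := wpush pi (pick_ge0 ij) (measurable_pick ij) mx.
pose W1 := wpush pi (fun=> ler01) (@measurable_cst _ _ _ _ setT (1 : R)) mx.
have mA A : measurable A -> measurable (x @^-1` A) by mea.
have W1E A : measurable A -> W1 A = pi (x @^-1` A).
  by move=> mA'; rewrite /W1 /wpush integral_cst ?mul1e//; exact: mA.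
have WW1 ij A : measurable A -> (W ij A <= W1 A)%E.
  by move=> mA'; apply: le_integral_nonmeas_in => z _; rewrite lee_fin ?pick_ge0 ?pick_le1.
have fin1 : (W1 setT < +oo)%E.
  by rewrite W1E// -ge0_fin_numE// fin_num_measure//; exact: mA.
have fin ij : (W ij setT < +oo)%E by apply: le_lt_trans (WW1 ij _ measurableT) fin1.
have [m mE] := mk_finite_measure fin1.
have [w wE] := choice (fun ij => mk_finite_measure (fin ij)).
have /choice[s hs] (ij : 'I_n * 'I_n) : exists s : 'rV[R]_d -> R, [/\ mble s, forall v, 0 <= s v <= 1 &
    forall A, measurable A -> (w ij A = \int[m]_(v in A) (s v)%:E)%E].
  by apply: bounded_density => // A mA'; rewrite mul1e wE mE; exact: WW1.
exists m, s; split=> [A mA'|ij|ij v|ij f mf].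
- by rewrite mE; exact: W1E.
- by have [] := hs ij.
- by have [_ h _] := hs ij; exact: h.
have [ms s01 sI] := hs ij; have s0 v : 0 <= s ij v by have /andP[] := s01 v.
have mfE : mble (fun v => (f v)%:E) by exact/measurable_EFinP.
transitivity (\int[wpush m s0 ms (@measurable_id _ 'rV[R]_d setT)]_v (f v)%:E)%E.
  by rewrite integral_wpush.
transitivity (\int[w ij]_v (f v)%:E)%E.
  by apply/esym; apply: ge0_integral_eq_measure => A mA'; exact: sI.
rewrite (ge0_integral_eq_measure _ (_ : measure_eq _ (W ij))); last by move=> A _; exact: wE.
by rewrite integral_wpush.
Qed.

Section densities.
Variables (m : {finite_measure set 'rV[R]_d -> \bar R}) (s : 'I_n * 'I_n -> 'rV[R]_d -> R).
Hypotheses (mE : forall A, measurable A -> m A = pi (x @^-1` A))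
  (ms : forall ij, mble (s ij)) (s01 : forall ij v, 0 <= s ij v <= 1)
  (s_int : forall ij (f : 'rV[R]_d -> R), mble f ->
        (\int[m]_v (s ij v * f v)%:E = \int[pi]_z (pick ij z * f (x z))%:E)%E).

Let s0 ij v : 0 <= s ij v. Proof. by have /andP[] := s01 ij v. Qed.

Lemma mixture_integral (f : 'I_n -> 'I_n -> 'rV[R]_d -> R) (B : R) :
  (forall i j, mble (f i j)) -> (forall i j v, `|f i j v| <= B) ->
  (\int[m]_v (\sum_ij s ij v * f ij.1 ij.2 v)%:E = \int[pi]_z (f (i0 z) (i1 z) (x z))%:E)%E.
Proof.
move=> mf fB; have mfx ij : mble (fun z => pick ij z * f ij.1 ij.2 (x z)).
  by apply: measurable_funM; [exact: measurable_pick|mea].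
transitivity (\int[m]_v (\sum_ij (s ij v * f ij.1 ij.2 v)%:E))%E.
  by apply: eq_integral => v _; rewrite sumEFin.
rewrite integral_sum//; last first.
  move=> ij; apply: (@finite_bounded_integrable _ _ _ _ _ B).
    mea.
  move=> v; rewrite normrM -[leRHS]mul1r; apply: ler_pM => //.
  by rewrite ger0_norm//; have /andP[] := s01 ij v.
transitivity (\int[pi]_z (\sum_ij (pick ij z * f ij.1 ij.2 (x z))%:E))%E.
  rewrite integral_sum//; last first.
    move=> ij; apply: (@finite_bounded_integrable _ _ _ _ _ B) => // z.
    rewrite normrM -[leRHS]mul1r; apply: ler_pM => //.
    by rewrite ger0_norm ?pick_ge0 ?pick_le1.
  by apply: eq_bigr => ij _; exact: s_int.
by apply: eq_integral => z _; rewrite sumEFin (pick_sum (fun i j => f i j (x z))).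
Qed.

Definition dens (t : R) (a : 'I_n) (v : 'rV[R]_d) : R := mix_dens P (s ^~ v) t a.

Lemma dens_ge0 t a v : 0 <= t -> 0 <= dens t a v.
Proof. by move=> t0; apply: (mix_dens_ge0 fs). Qed.

Lemma measurable_dens t a : mble (dens t a).
Proof. by apply: measurable_sum => ij; exact: measurable_funM. Qed.

Lemma position_start t z : t <= 2^-1 -> position t z = x z.
Proof. by move=> h; rewrite /position moved_rest// scale0r addr0. Qed.

Lemma curve_start t a A : 0 <= t -> t <= 2^-1 -> measurable A ->
  (\int[m]_(v in A) (dens t a v)%:E = curve t a A)%E.
Proof.
move=> t0 t2 mA; have t01 : 0 <= t <= 1 by rewrite t0/=; lra.
have mI : mble (\1_A : 'rV[R]_d -> R) by mea.
have PB i j v : `|P i j t a * \1_A v| <= 1.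
  have P0 b : 0 <= P i j t b by exact: (fs_ge0 fs).
  have P1 : P i j t a <= 1 by rewrite -(fs_sum fs i j t) (bigD1 a)//= lerDl; exact: sumr_ge0.
  by rewrite ger0_norm ?mulr_ge0//; exact: mulr_ile1.
transitivity (\int[m]_v (\sum_ij s ij v * (P ij.1 ij.2 t a * \1_A v))%:E)%E.
  rewrite integral_mkcond; apply: eq_integral => v _; rewrite patchE indicE; case: ifP => _.
    by congr EFin; apply: eq_bigr => ij _; rewrite mulr1.
  by rewrite big1// => ij _; rewrite !mulr0.
rewrite (mixture_integral (f := fun i j v => P i j t a * \1_A v) (B := 1))//; last first.
  mea.
rewrite -[in RHS](setIT A) -integral_indic// (curve_integral a t01 mI).
by apply: eq_integral => z _; rewrite position_start.
Qed.

Lemma total_start t A : 0 <= t -> t <= 2^-1 -> measurable A -> total_measure (curve t) A = m A.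
Proof.
move=> t0 t2 mA; rewrite /= /sum_finite_measure /sum_measure.
have t01 : 0 <= t <= 1 by rewrite t0/=; lra.
have mI : mble (\1_A : 'rV[R]_d -> R) by mea.
have w0 a z : 0 <= weight t a z by exact: weight_ge0.
have mw a := measurable_weight t a.
transitivity (\sum_(a < n) \int[pi]_z (weight t a z * \1_A (x z))%:E)%E.
  apply: eq_bigr => a _; rewrite -[in LHS](setIT A) -integral_indic// (curve_integral a t01 mI).
  by apply: eq_integral => z _; rewrite position_start.
rewrite -ge0_integral_sum//; last 2 first.
- by move=> a; apply/measurable_EFinP; apply: measurable_funM => //; exact: measurableT_comp.
- nonneg.
have mA' : measurable (x @^-1` A) by rewrite -[X in measurable X]setTI; exact: (mx).
rewrite mE// -[in RHS](setIT (x @^-1` A)) -integral_indic//; apply: eq_integral => z _.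
by rewrite sumEFin -mulr_suml weight_sum mul1r.
Qed.

(** The equation involves a fixed Radon-Nikodym version of the densities, which agrees with [dens]
    only off a null set; the bounds below are proved outside that set. *)
Lemma density_start t : 0 <= t -> t <= 2^-1 -> exists E, [/\ measurable E,
  total_measure (curve t) (~` E) = 0%E & forall v a, E v -> density (curve t) a v = dens t a v].
Proof.
move=> t0 t2; set tot := total_measure (curve t).
have totm : measure_eq tot m by move=> A mA; exact: total_start.
have ae_a a : {ae tot, forall v, density (curve t) a v = dens t a v}.
  have di : tot.-integrable setT (fun v => (density (curve t) a v)%:E).
    apply/integrableP; split; first by apply/measurable_EFinP; exact: measurable_density.
    rewrite (eq_integral (fun v => (density (curve t) a v)%:E)); last first.
      by move=> v _; rewrite /= ger0_norm// density_ge0.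
    by rewrite density_measure// -ge0_fin_numE// fin_num_measure.
  have mdE : mble (fun v => (dens t a v)%:E) by apply/measurable_EFinP; exact: measurable_dens.
  have : ae_eq tot setT (fun v => (density (curve t) a v)%:E) (fun v => (dens t a v)%:E).
    apply: integral_ae_eq => // A _ mA.
    rewrite density_measure// -(curve_start a t0 t2 mA); apply: eq_measure_integral => B mB _.
    exact/esym/totm.
  by apply: filterS => v /(_ Logic.I) [].
have [N [mN N0 NE]] : {ae tot, forall v a, density (curve t) a v = dens t a v}.
  by apply: filter_forall; exact: ae_a.
exists (~` N); split; [mea|by rewrite setCK|].
move=> v a nN; apply: contrapT => h; apply: nN; apply: NE => /= h'; exact: h.
Qed.

Lemma curve_ae_le t (f g : 'rV[R]_d -> R) : 0 <= t -> t <= 2^-1 ->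
  (forall v, 0 <= f v) -> (forall v, 0 <= g v) -> mble g ->
  (forall v, (forall a, density (curve t) a v = dens t a v) -> f v <= g v) ->
  (\int[total_measure (curve t)]_(v in Omega) (f v)%:E <= \int[m]_v (g v)%:E)%E.
Proof.
move=> t0 t2 f0 g0 mg fg; have [E [mEE E0 hE]] := density_start t0 t2.
have totm : measure_eq (total_measure (curve t)) m by move=> A mA; exact: total_start.
rewrite -(ge0_integral_eq_measure _ totm).
apply: (@le_trans _ _ (\int[total_measure (curve t)]_v (f v)%:E)%E).
  rewrite integral_mkcond; apply: le_integral_nonmeas => v; rewrite patchE; case: ifP => // _; rewrite lee_fin//.
apply: (integral_nonmeas_ae_le mEE E0) => // [|v Ev]; first mea.
nonneg.
Qed.

Definition rate (a b : 'I_n) (w : 'rV[R]_d * R) : R := mix_velocity q theta P J (s ^~ w.1) w.2 a b.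

Lemma measurable_rate a b : measurable_fun (setT `*` `[0 : R, 1 : R]%classic) (rate a b).
Proof.
have mD : measurable (setT `*` `[0 : R, 1 : R]%classic : set ('rV[R]_d * R)) by exact: measurableX.
have msf ij : mble (fun w : 'rV[R]_d * R => s ij w.1) by mea.
have mt (f : R -> R) : continuous f -> mble (fun w : 'rV[R]_d * R => f w.2).
  move=> cf; apply: (measurableT_comp (continuous_measurable_fun cf)); mea.
have mdw c : measurable_fun (setT `*` `[0 : R, 1 : R]%classic) (fun w : 'rV[R]_d * R => dens w.2 c w.1).
  apply: measurable_funTS; apply: measurable_sum => ij; apply: measurable_funM => //.
  by apply: (mt (fun t => P ij.1 ij.2 t c)); exact: P_continuous.
have d0 c (w : 'rV[R]_d * R) : (setT `*` `[0 : R, 1 : R]%classic) w -> 0 <= dens w.2 c w.1.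
  by move=> [_ /=]; rewrite in_itv/= => /andP[h _]; exact: dens_ge0.
rewrite (_ : rate a b = (fun w => mix_flux J (s ^~ w.1) w.2 a b * (theta (dens w.2 a w.1) (dens w.2 b w.1) * q a b)^-1)); last first.
  by apply/funext => w; rewrite /rate mxE.
apply: measurable_funM.
  apply: measurable_funTS; apply: measurable_sum => ij; apply: measurable_funM => //.
  by apply: (mt (fun t => J ij.1 ij.2 t a b)); exact: (fs_continuous fs).
apply: measurable_invr => //; apply: measurable_funM => //.
exact: (measurable_theta theta_interp mD (mdw a) (mdw b) (d0 a) (d0 b)).
Qed.

Lemma rate_flux t v a b : 0 <= t ->
  theta (dens t a v) (dens t b v) * rate a b (v, t) * q a b = mix_flux J (s ^~ v) t a b.
Proof. by move=> t0; apply: (mix_velocity_flux q_ge0 theta_interp C0 fs). Qed.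

Lemma rate_stop t v a b : 2^-1 <= t -> rate a b (v, t) = 0.
Proof. by move=> t2; rewrite /rate mxE (mix_flux_stop fs)// mul0r. Qed.

Lemma J_bound i j t a b : 0 <= t -> `|J i j t a b| <= C + 1.
Proof.
move=> t0; have h := fs_bound fs i j a b t0.
have P1 : Num.min (P i j t a) (P i j t b) <= 1.
  rewrite ge_min; apply/orP; left; rewrite -(fs_sum fs i j t) (bigD1 a)//= lerDl.
  by apply: sumr_ge0 => c _; exact: (fs_ge0 fs).
have JC : J i j t a b ^+ 2 <= C by apply: le_trans h _; rewrite ler_piMr.
have := sqr_ge0 (`|J i j t a b| - 1); rewrite sqrrB1 (real_normK (num_real _)) => h2.
have C1 := C0; rewrite -(ler_pM2l (ltr0n R 2)); rewrite mulr_natl.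
by lra.
Qed.

Definition flux_bound : R := \sum_(ij : 'I_n * 'I_n) (C + 1).

Lemma mix_flux_le t v a b : 0 <= t -> `|mix_flux J (s ^~ v) t a b| <= flux_bound.
Proof.
move=> t0; apply: le_trans (ler_norm_sum _ _ _) _; apply: ler_sum => ij _.
rewrite normrM -[leRHS]mul1r; apply: ler_pM => //; last exact: J_bound.
by rewrite ger0_norm//; have /andP[] := s01 ij v.
Qed.

Lemma flux_bound_ge0 : 0 <= flux_bound.
Proof. by apply: sumr_ge0 => ij _; rewrite addr_ge0. Qed.

Lemma m_mass : m setT = 1%E.
Proof. by rewrite mE// preimage_setT probability_setT. Qed.

Lemma rate_integral t a b : 0 <= t <= 1 ->
  (\int[total_measure (curve t)]_(v in Omega) (`|rate a b (v, t)| * theta_density theta (curve t) a b v)%:E <=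
   (flux_bound * (q a b)^-1)%:E)%E.
Proof.
move=> /andP[t0 t1]; have K0 : 0 <= flux_bound * (q a b)^-1 by rewrite mulr_ge0 ?flux_bound_ge0 ?invr_ge0.
have [t2|t2] := leP t 2^-1; last first.
  by rewrite integral0_eq// => v _; rewrite rate_stop ?normr0 ?mul0r// ltW.
have th0 v : 0 <= theta_density theta (curve t) a b v by exact: theta_density_ge0.
apply: le_trans (curve_ae_le (g := fun=> flux_bound * (q a b)^-1) t0 t2 _ _ _ _) _ => //.
- nonneg.
- move=> v hv; rewrite /theta_density !hv.
  have [q0|q0] := eqVneq (q a b) 0.
    by rewrite /rate mxE q0 mulr0 invr0 mulr0 normr0 mul0r mulr0.
  have qp : 0 < q a b by rewrite lt_neqAle eq_sym q0 q_ge0.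
  rewrite ler_pdivlMr//; apply: le_trans (mix_flux_le v a b t0); rewrite -rate_flux// !normrM.
  rewrite (ger0_norm (q_ge0 a b)) (ger0_norm (theta_ge0 theta_interp (dens_ge0 a v t0) (dens_ge0 b v t0))).
  by rewrite [_ * theta _ _]mulrC.
- rewrite integral_cst//.
  by apply: (eq_ind_r (fun e => ((flux_bound * (q a b)^-1)%:E * e <= _)%E) _ m_mass); rewrite mule1.
Qed.

Definition switch (z : Z) : R := (i0 z != i1 z)%:R.

Lemma measurable_switch : mble switch.
Proof. by apply: (measurable_select (F := fun i j _ => (i != j)%:R)). Qed.

(** [mix_velocity_energy] bounds the integrand at v by a multiple of the conditional probability at
    v that the two nodes differ, and integrating gives the mean of [switch]. *)
Lemma rate_energy t a b : 0 <= t <= 1 ->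
  (\int[total_measure (curve t)]_(v in Omega) (`|rate a b (v, t)| ^+ 2 * theta_density theta (curve t) a b v * q a b)%:E <=
   (C * (q a b)^-1)%:E * \int[pi]_z (switch z)%:E)%E.
Proof.
move=> /andP[t0 t1]; have K0 : 0 <= C * (q a b)^-1 by rewrite mulr_ge0 ?invr_ge0.
have [t2|t2] := leP t 2^-1; last first.
  rewrite integral0_eq; last first.
    by move=> v _; rewrite rate_stop ?normr0 ?expr0n ?mul0r// ltW.
  by apply: mule_ge0; [rewrite lee_fin|nonneg].
have th0 v : 0 <= theta_density theta (curve t) a b v by exact: theta_density_ge0.
have mo : mble (fun v => C * off_diag (s ^~ v) * (q a b)^-1).
  apply: measurable_funM => //; apply: measurable_funM => //.
  rewrite (_ : (fun v => _) = (fun v => \sum_ij (ij.1 != ij.2)%:R * s ij v)); last first.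
    apply/funext => v; rewrite /off_diag big_mkcond; apply: eq_bigr => ij _.
    by case: (_ != _); rewrite ?mul1r ?mul0r.
  mea.
apply: le_trans (curve_ae_le (g := fun v => C * off_diag (s ^~ v) * (q a b)^-1) t0 t2 _ _ mo _) _.
- nonneg.
- by move=> v; rewrite !mulr_ge0 ?invr_ge0// off_diag_ge0.
- move=> v hv; rewrite /theta_density !hv real_normK ?num_real//.
  exact: (mix_velocity_energy q_ge0 theta_interp C0 fs).
rewrite -ge0_integralZl_EFin//; [|nonneg|by apply/measurable_EFinP; exact: measurable_switch].
have := mixture_integral (f := fun i j _ => C * (q a b)^-1 * (i != j)%:R) (B := C * (q a b)^-1).
move=> /(_ _ _)/wrap[] //.
  by move=> i j _; rewrite normrM (ger0_norm K0) ler_piMr//; case: (_ != _); rewrite ?normr1 ?normr0.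
move=> hm; rewrite le_eqVlt; apply/orP; left; apply/eqP; apply: eq_trans (eq_trans hm _).
  apply: eq_integral => v _; congr EFin; rewrite /off_diag mulrAC mulr_sumr big_mkcond.
  by apply: eq_bigr => ij _; case: eqVneq => _; rewrite /= ?mulr0// mulr1 mulrC.
by apply: eq_integral => z _; rewrite EFinM.
Qed.

Lemma node_integral t a b (eta : 'rV[R]_d -> R) (B : R) : 0 <= t <= 1 -> mble eta ->
  (forall v, `|eta v| <= B) ->
  (\int[total_measure (curve t)]_v (eta v * theta_density theta (curve t) a b v *
      (rate a b (v, t) - rate b a (v, t)) * q a b)%:E =
   \int[pi]_z (2 * (eta (position t z) * J (i0 z) (i1 z) t a b))%:E)%E.
Proof.
move=> t01 meta etaB; have /andP[t0 t1] := t01.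
have [t2|t2] := leP t 2^-1; last first.
  rewrite integral0_eq; last by move=> v _; rewrite !rate_stop ?(ltW t2)// subrr mulr0 mul0r.
  by rewrite integral0_eq// => z _; rewrite (fs_stop fs) ?(ltW t2)// !mulr0.
have mr c e : mble (fun v => rate c e (v, t)).
  by apply: (measurable_fun_slice _ _ (measurable_rate c e)).
have [E [mEE E0 hE]] := density_start t0 t2.
have totm : measure_eq (total_measure (curve t)) m by move=> A mA; exact: total_start.
transitivity (\int[total_measure (curve t)]_v (2 * (eta v * mix_flux J (s ^~ v) t a b))%:E)%E.
  have mth := measurable_theta_density theta_interp (curve t) a b.
  apply: ae_eq_integral => //.
  - mea.
  - apply/measurable_EFinP; apply: measurable_funM => //; apply: measurable_funM => //.
    by apply: measurable_sum => ij; mea.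
  exists (~` E); split; [mea|exact: E0|].
  move=> v nv Ev; apply: nv => _; congr EFin.
  have h1 := rate_flux v a b t0; have h2 := rate_flux v b a t0.
  rewrite /theta_density !hE//; move: h1 h2.
  rewrite (theta_sym theta_interp (dens_ge0 a v t0) (dens_ge0 b v t0)) (q_symmetric b a) (mix_flux_anti fs _ _ b a).
  move: (theta _ _) (rate a b _) (rate b a _) (mix_flux _ _ _ _ _) => th r1 r2 F h1 h2.
  rewrite (_ : eta v * th * (r1 - r2) * q a b = eta v * (th * r1 * q a b - th * r2 * q a b)); last by ring.
  by rewrite h1 h2; ring.
rewrite (ge0_integral_eq_measure _ totm).
have JC i j v : `|2 * (eta v * J i j t a b)| <= 2 * (B * (C + 1)).
  rewrite normrM ger0_norm// ler_pM2l// normrM; apply: ler_pM => //; exact: J_bound.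
have := mixture_integral (f := fun i j v => 2 * (eta v * J i j t a b)) (B := 2 * (B * (C + 1))).
move=> /(_ _ JC)/wrap[].
  mea.
move=> hm; apply: eq_trans (eq_trans hm _).
  apply: eq_integral => v _; congr EFin; rewrite /mix_flux mulr_sumr mulr_sumr.
  by apply: eq_bigr => ij _; ring.
by apply: eq_integral => z _; rewrite position_start.
Qed.

(** * Exchanging the integrals over trajectories and time *)

Variable U : probability (measurableTypeR R) R.
Hypothesis U_int : forall f : R -> \bar R, mble f ->
  (\int[U]_t f t = \int[leb]_(t in `[0%R, 1%R]) f t)%E.
Local Notation T := (Z * measurableTypeR R)%type.

Lemma piU_mass : (pi \x U)%E setT = 1%E.
Proof. by rewrite -setXTT product_measure1E// [X in (_ * X)%E]probability_setT mule1; exact: probability_setT. Qed.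

Lemma piU_bounded_integrable (f : T -> R) (B : R) : mble f -> (forall w, `|f w| <= B) ->
  ((pi \x U)%E).-integrable setT (EFin \o f).
Proof.
move=> mf fB; apply: measurable_bounded_integrable => //.
  exact: (eq_ind_r (fun v => (v < +oo)%E) (ltry 1) piU_mass).
exists B; split; first by rewrite num_real.
by move=> N BN w _ /=; apply: le_trans (fB w) _; exact: ltW.
Qed.

(** The available bounds hold for times in [0, 1] only. This factor makes the integrands bounded
    everywhere and does not affect integrals against U, which represents Lebesgue measure on that
    interval. *)
Definition in_time (w : T) : R := \1_(`[0, 1]%classic : set R) w.2.

Lemma measurable_in_time : mble in_time.
Proof.
have mi : mble (\1_(`[0, 1]%classic : set R) : measurableTypeR R -> R) by [].
by apply: (measurableT_comp mi); mea.
Qed.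

Section exchange.
Variables (H : T -> R) (B : R).
Hypotheses (mH : mble H) (HB : forall z t, 0 <= t <= 1 -> `|H (z, t)| <= B).

Let H1 w := in_time w * H w.

Let H1i : ((pi \x U)%E).-integrable setT (EFin \o H1).
Proof.
apply: (@piU_bounded_integrable _ `|B|).
  by apply: measurable_funM => //; exact: measurable_in_time.
move=> [z t]; rewrite /H1 /in_time indicE/=; case: (boolP (t \in _)) => [/set_mem|_]; last by rewrite mul0r normr0.
by rewrite /= in_itv/= mul1r => /HB h; apply: le_trans (h z) (ler_norm B).
Qed.

Let H1E z t : 0 <= t <= 1 -> H1 (z, t) = H (z, t).
Proof. by move=> t01; rewrite /H1 /in_time indicE mem_set ?mul1r//= in_itv. Qed.

Lemma time_space_integral :
  (\int[leb]_(t in `[0%R, 1%R]) \int[pi]_z (H (z, t))%:E = \int[(pi \x U)%E]_w (in_time w * H w)%:E)%E.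
Proof.
rewrite -(integral21_prod_meas1 H1i) U_int; last exact: measurable_fubini_G H1i.
apply: eq_integral => t /set_mem/=; rewrite in_itv/= => t01.
by rewrite /fubini_G; apply: eq_integral => z _ /=; rewrite H1E.
Qed.

Lemma space_time_integral :
  (\int[pi]_z \int[leb]_(t in `[0%R, 1%R]) (H (z, t))%:E = \int[(pi \x U)%E]_w (in_time w * H w)%:E)%E.
Proof.
rewrite -(integral12_prod_meas1 H1i); apply: eq_integral => z _.
rewrite /fubini_F U_int; last first.
  have mp : mble (pair z : measurableTypeR R -> T) by [].
  by apply: (measurableT_comp (measurable_int _ H1i) mp).
by apply: eq_integral => t /set_mem/=; rewrite in_itv/= => t01; rewrite H1E.
Qed.

End exchange.

(** Motion in space takes place after the nodes have settled, so conditioning on the current node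
    means conditioning on the final one. *)
Definition last_at (a : 'I_n) (w : T) : R := \1_[set z | i1 z = a] w.1.

Lemma last_at_ge0 a w : 0 <= last_at a w. Proof. by []. Qed.

Lemma measurable_last_at a : mble (last_at a).
Proof.
have mi : mble (\1_[set z | i1 z = a] : Z -> R) by mea.
by apply: (measurableT_comp mi); mea.
Qed.

Definition space_time (w : T) : 'rV[R]_d * measurableTypeR R := (position w.2 w.1, w.2).

Lemma measurable_time (f : R -> R) : mble f -> mble (fun w : T => f w.2).
Proof. by move=> mf; apply: (measurableT_comp (mf : mble (f : measurableTypeR R -> R))); exact: measurable_snd. Qed.

Lemma measurable_coord_diff k : mble (fun w : T => y w.1 0 k - x w.1 0 k).
Proof.
mea.
Qed.

Lemma measurable_space_time : mble space_time.
Proof.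
apply: measurable_fun_pair; last mea.
apply: (measurable_fun_mx measurableT) => a k; rewrite ord1.
under eq_fun do rewrite position_coord.
have mc (f : Z -> 'rV[R]_d) : mble f -> mble (fun w : T => f w.1 0 k) by mea.
apply: measurable_funD; first exact: mc.
by apply: measurable_funM; [exact: measurable_time measurable_moved|mea].
Qed.

#[local] Hint Resolve measurable_moved measurable_speed measurable_position measurable_weight measurable_switch
  measurable_in_time measurable_last_at measurable_coord_diff measurable_space_time measurable_dens : mble_db.
#[local] Hint Extern 0 (is_true _) => first [apply: weight_ge0 | exact: theta_density_ge0] : mble_db.

Lemma coord_diff_bound (w : T) k : `|y w.1 0 k - x w.1 0 k| <= M + M.
Proof. by apply: le_trans (ler_normB _ _) _; exact: lerD. Qed.

(* The velocity of the mass is its conditional expectation given the position,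
   the time and the node. *)
Lemma drift_exists : exists V : 'I_n -> 'I_d -> 'rV[R]_d * measurableTypeR R -> R,
  [/\ forall a k, mble (V a k), forall a k v, `|V a k v| <= M + M,
    forall a k (f : 'rV[R]_d * measurableTypeR R -> R) (B : R), mble f ->
      (forall v, `|f v| <= B) ->
      (\int[(pi \x U)%E]_w (last_at a w * (f (space_time w) * (y w.1 0%R k - x w.1 0%R k)))%:E =
       \int[(pi \x U)%E]_w (last_at a w * (f (space_time w) * V a k (space_time w)))%:E)%E &
    forall a k, (\int[(pi \x U)%E]_w (last_at a w * V a k (space_time w) ^+ 2)%:E <=
       \int[(pi \x U)%E]_w (last_at a w * (y w.1 0%R k - x w.1 0%R k) ^+ 2)%:E)%E].
Proof.
pose W a := wpush (pi \x U)%E (@last_at_ge0 a) (measurable_last_at a) (@measurable_id _ T setT).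
have WT a : (W a setT < +oo)%E.
  apply: le_lt_trans (_ : (\int[(pi \x U)%E]_w (last_at a w)%:E < +oo)%E); first by rewrite [leLHS]wpushT.
  apply: (@le_lt_trans _ _ (\int[(pi \x U)%E]_w (cst 1%E w))%E).
    by apply: le_integral_nonmeas => w; rewrite lee_fin// /last_at indicE; case: (_ \in _).
  rewrite integral_cst// mul1e.
  exact: (eq_ind_r (fun v => (v < +oo)%E) (ltry 1) piU_mass).
have [ma maE] := choice (fun a => mk_finite_measure (WT a)).
have maI a (f : T -> R) : mble f ->
    (\int[ma a]_w (f w)%:E = \int[(pi \x U)%E]_w (last_at a w * f w)%:E)%E.
  move=> mf; have E : measure_eq (ma a) (W a) by move=> A _; exact: maE.
  by rewrite (ge0_integral_eq_measure _ E) integral_wpush//; mea.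
have M20 : 0 <= M + M by nonneg.
have /choice[V hV] (ak : 'I_n * 'I_d) := conditional_mean (ma ak.1) measurable_space_time
  (measurable_coord_diff ak.2) (fun w => coord_diff_bound w ak.2) M20.
exists (fun a k => V (a, k)); split=> [a k|a k v|a k f B mf fB|a k]; have [mV VM VE Vle] := hV (a, k) => //.
  have := VE f B mf fB; rewrite !maI//.
  - mea.
  - mea.
move: Vle; rewrite !maI//.
- mea.
- mea.
Qed.

Definition nice (F : T -> R) : Prop := mble F /\
  exists B, forall z t, 0 <= t <= 1 -> `|F (z, t)| <= B.

Definition IQ (F : T -> R) : R := fine (\int[(pi \x U)%E]_w (in_time w * F w)%:E)%E.

Lemma nice_integrable F : nice F -> ((pi \x U)%E).-integrable setT (fun w => (in_time w * F w)%:E).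
Proof.
move=> [mF [B FB]]; apply: (@piU_bounded_integrable _ `|B|).
  mea.
move=> [z t]; rewrite /in_time indicE/=; case: (boolP (t \in _)) => [/set_mem|_]; last by rewrite mul0r normr0.
by rewrite /= in_itv/= mul1r => /FB h; apply: le_trans (h z) (ler_norm B).
Qed.

Lemma IQE F : nice F -> (\int[(pi \x U)%E]_w (in_time w * F w)%:E = (IQ F)%:E)%E.
Proof. by move=> nF; rewrite fineK//; apply: integrable_fin_num => //; exact: nice_integrable. Qed.

Lemma niceD F G : nice F -> nice G -> nice (fun w => F w + G w).
Proof.
move=> [mF [B FB]] [mG [B' GB]]; split; first mea.
by exists (B + B') => z t t01; apply: le_trans (ler_normD _ _) _; apply: lerD; [exact: FB|exact: GB].
Qed.

Lemma niceM F G : nice F -> nice G -> nice (fun w => F w * G w).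
Proof.
move=> [mF [B FB]] [mG [B' GB]]; split; first mea.
by exists (B * B') => z t t01; rewrite normrM; apply: ler_pM => //; [exact: FB|exact: GB].
Qed.

Lemma nice_cst c : nice (fun=> c).
Proof. by split; [exact: measurable_cst|exists `|c|]. Qed.

Lemma nice_sum (I : Type) (r : seq I) (F : I -> T -> R) : (forall i, nice (F i)) ->
  nice (fun w => \sum_(i <- r) F i w).
Proof.
move=> nF; elim: r => [|i r IH].
  by rewrite (_ : (fun w => _) = (fun=> 0)); [exact: nice_cst|apply/funext => w; rewrite big_nil].
rewrite (_ : (fun w => _) = (fun w => F i w + \sum_(i <- r) F i w)); first exact: niceD.
by apply/funext => w; rewrite big_cons.
Qed.

Lemma IQD F G : nice F -> nice G -> IQ (fun w => F w + G w) = IQ F + IQ G.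
Proof.
move=> nF nG; apply: EFin_inj; rewrite -IQE; last exact: niceD.
rewrite EFinD -!IQE// -integralD//; try exact: nice_integrable.
by apply: eq_integral => w _; rewrite mulrDr EFinD.
Qed.

Lemma IQZ c F : nice F -> IQ (fun w => c * F w) = c * IQ F.
Proof.
move=> nF; apply: EFin_inj; rewrite -IQE; last by apply: niceM => //; exact: nice_cst.
rewrite EFinM -IQE// -integralZl//; last exact: nice_integrable.
by apply: eq_integral => w _; rewrite mulrCA EFinM.
Qed.

Lemma IQ_sum (I : Type) (r : seq I) (F : I -> T -> R) : (forall i, nice (F i)) ->
  IQ (fun w => \sum_(i <- r) F i w) = \sum_(i <- r) IQ (F i).
Proof.
move=> nF; elim: r => [|i r IH].
  rewrite big_nil /IQ integral0_eq// => w _.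
  by rewrite big_nil mulr0.
rewrite big_cons -IH -IQD//; last exact: nice_sum.
by congr IQ; apply/funext => w; rewrite big_cons.
Qed.

Lemma nice_weight a : nice (fun w => weight w.2 a w.1).
Proof.
split; last first.
  exists 1 => z t /andP[t0 _]; rewrite ger0_norm; first exact: weight_le1.
  nonneg.
have mf : mble (fst : T -> Z) by mea.
apply: (measurable_select (a := fun w : T => i0 w.1) (b := fun w : T => i1 w.1) (F := fun i j w => P i j w.2 a)).
- by move=> i; rewrite -[X in measurable X]setTI; exact: (mf measurableT _ (mi0 i)).
- by move=> i; rewrite -[X in measurable X]setTI; exact: (mf measurableT _ (mi1 i)).
- by move=> i j; apply: (@measurable_time (fun t => P i j t a)); apply: continuous_measurable_fun; exact: P_continuous.
Qed.

Lemma nice_J a b : nice (fun w => J (i0 w.1) (i1 w.1) w.2 a b).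
Proof.
split; last by exists (C + 1) => z t /andP[t0 _]; exact: J_bound.
have mf : mble (fst : T -> Z) by mea.
apply: (measurable_select (a := fun w : T => i0 w.1) (b := fun w : T => i1 w.1) (F := fun i j w => J i j w.2 a b)).
- by move=> i; rewrite -[X in measurable X]setTI; exact: (mf measurableT _ (mi0 i)).
- by move=> i; rewrite -[X in measurable X]setTI; exact: (mf measurableT _ (mi1 i)).
- by move=> i j; apply: (@measurable_time (fun t => J i j t a b)); apply: continuous_measurable_fun; exact: (fs_continuous fs).
Qed.

Lemma nice_speed : nice (fun w => speed w.2).
Proof.
split; first mea.
by exists 4 => z t /speed_bound /andP[h1 h2]; rewrite ger0_norm.
Qed.

Lemma nice_coord_diff k : nice (fun w => y w.1 0 k - x w.1 0 k).
Proof. by split; [exact: measurable_coord_diff|exists (M + M) => z t _; exact: (coord_diff_bound (z, t))]. Qed.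

Lemma nice_along (f : 'rV[R]_d * R -> R) (B : R) : mble f -> (forall v, `|f v| <= B) ->
  nice (fun w => f (space_time w)).
Proof.
move=> mf fB; split; last by exists B => z t _; exact: fB.
mea.
Qed.

(** Before time 1/2 the speed is zero; afterwards the weight is the indicator of the final node. *)
Lemma weight_speed a z t : weight t a z * speed t = last_at a (z, t) * speed t.
Proof.
have [t2|t2] := leP t 2^-1; first by rewrite speed_rest// !mulr0.
rewrite weight_end ?ltW// /last_at indicE; congr (_ * _).
by case: eqVneq => [->|/eqP h]; [rewrite mem_set|rewrite memNset//= => e; exact/h].
Qed.

Variable V : 'I_n -> 'I_d -> 'rV[R]_d * measurableTypeR R -> R.
Hypotheses (mV : forall a k, mble (V a k)) (VM : forall a k v, `|V a k v| <= M + M).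
Hypothesis VE : forall a k (f : 'rV[R]_d * measurableTypeR R -> R) (B : R), mble f ->
      (forall v, `|f v| <= B) ->
      (\int[(pi \x U)%E]_w (last_at a w * (f (space_time w) * (y w.1 0%R k - x w.1 0%R k)))%:E =
       \int[(pi \x U)%E]_w (last_at a w * (f (space_time w) * V a k (space_time w)))%:E)%E.
Hypothesis Vle : forall a k, (\int[(pi \x U)%E]_w (last_at a w * V a k (space_time w) ^+ 2)%:E <=
       \int[(pi \x U)%E]_w (last_at a w * (y w.1 0%R k - x w.1 0%R k) ^+ 2)%:E)%E.

Definition drift (a : 'I_n) (w : 'rV[R]_d * R) : 'rV[R]_d := \row_k (speed w.2 * V a k w).

Lemma measurable_drift a : mble (drift a).
Proof.
apply: (measurable_fun_mx measurableT) => i k; rewrite ord1.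
under eq_fun do rewrite mxE.
apply: measurable_funM; last exact: (mV a k).
mea.
Qed.

Lemma IQ_drift a k (f : 'rV[R]_d * R -> R) (B : R) : mble f -> (forall v, `|f v| <= B) ->
  IQ (fun w => weight w.2 a w.1 * (f (space_time w) * (speed w.2 * V a k (space_time w)))) =
  IQ (fun w => weight w.2 a w.1 * (f (space_time w) * (speed w.2 * (y w.1 0 k - x w.1 0 k)))).
Proof.
move=> mf fB; rewrite /IQ; congr fine.
pose f' (v : 'rV[R]_d * measurableTypeR R) : R := \1_(`[0, 1]%classic : set R) v.2 * speed v.2 * f v.
have mi : mble (\1_(`[0, 1]%classic : set R) : measurableTypeR R -> R) by [].
have mf' : mble f'.
  apply: measurable_funM => //; apply: measurable_funM.
    by apply: (measurableT_comp mi); mea.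
  mea.
have f'B v : `|f' v| <= 4 * B.
  rewrite normrM; apply: ler_pM => //; rewrite indicE; case: (boolP (v.2 \in _)) => [/set_mem|_].
    by rewrite /= in_itv/= mul1r => /speed_bound/andP[h1 h2]; rewrite ger0_norm.
  by rewrite mul0r normr0.
have E (g : T -> R) w : in_time w * (weight w.2 a w.1 * (f (space_time w) * (speed w.2 * g w))) =
    last_at a w * (f' (space_time w) * g w).
  case: w => z t; rewrite /f' /space_time /in_time/=.
  transitivity (\1_(`[0, 1]%classic : set R) t * f (position t z, t) * g (z, t) * (weight t a z * speed t)); first by ring.
  by rewrite weight_speed; ring.
rewrite (eq_integral (fun w => (last_at a w * (f' (space_time w) * V a k (space_time w)))%:E)); last first.
  by move=> w _; rewrite -(E (fun w => V a k (space_time w))).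
rewrite -(VE a k mf' f'B).
by apply: eq_integral => w _; rewrite -(E (fun w => y w.1 0 k - x w.1 0 k)).
Qed.

Lemma drift_integrable a : (\int[leb]_(t in `[0%R, 1%R]) \int[curve t a]_(v in Omega) (enorm (drift a (v, t)))%:E < +oo)%E.
Proof.
pose K := Num.sqrt (\sum_(k < d) (4 * (M + M)) ^+ 2).
have K0 : 0 <= K by exact: sqrtr_ge0.
apply: (@le_lt_trans _ _ (\int[leb]_(t in `[0%R, 1%R]) K%:E)%E); last by rewrite integral_cst01 ltry.
apply: le_integral_nonmeas_in => t; rewrite /= in_itv/= => t01.
  by apply: integral_ge0 => v _; rewrite lee_fin sqrtr_ge0.
apply: (@le_trans _ _ (\int[curve t a]_(v in Omega) K%:E)%E).
  apply: le_integral_nonmeas_in => v _; rewrite lee_fin ?sqrtr_ge0// ler_sqrt; last first.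
    nonneg.
  apply: ler_sum => k _; rewrite mxE -[leLHS]real_normK ?num_real// ler_pXn2r// ?nnegrE//; last first.
    nonneg.
  have /andP[h1 h2] := speed_bound t01.
  by rewrite normrM; apply: ler_pM => //; rewrite ger0_norm.
rewrite integral_cst// -[leRHS]mule1; apply: lee_wpmul2l; first nonneg.
apply: le_trans (vprob_mass_le1 a (curve_prob t)).
by apply: le_measure; rewrite ?inE.
Qed.

Definition displacement : \bar R := (\int[pi]_z (sqnorm (y z - x z))%:E)%E.

(** 16 is the square of the maximal speed 4; replacing the conditional mean by the displacement
    itself is [Vle], and summing over the final node removes the indicator. *)
Lemma drift_energy : (\int[leb]_(t in `[0%R, 1%R]) \sum_a \int[pi]_z (weight t a z * sqnorm (drift a (position t z, t)))%:E <=
  16%:E * displacement)%E.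
Proof.
pose Hs (w : T) := \sum_a \sum_k 16 * (last_at a w * V a k (space_time w) ^+ 2).
have mVs a k : mble (fun w => V a k (space_time w)) by mea.
have nHs : nice Hs.
  apply: nice_sum => a; apply: nice_sum => k; apply: niceM; first exact: nice_cst.
  apply: niceM; first by split; [mea|exists 1 => z t _; rewrite ger0_norm// /last_at indicE; case: (_ \in _)].
  have nV : nice (fun w => V a k (space_time w)) by split=> //; exists (M + M) => z t _.
  by have h := niceM nV nV; rewrite (_ : (fun w => _) = (fun w => V a k (space_time w) * V a k (space_time w))).
have Hs0 w : 0 <= Hs w by apply: sumr_ge0 => a _; apply: sumr_ge0 => k _; rewrite mulr_ge0// mulr_ge0// sqr_ge0.
have [mHs [B HsB]] := nHs.
apply: (@le_trans _ _ (\int[leb]_(t in `[0%R, 1%R]) \int[pi]_z (Hs (z, t))%:E)%E).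
  apply: le_integral_nonmeas_in => t; rewrite /= in_itv/= => t01; have /andP[t0 t1] := t01.
    nonneg.
  rewrite -ge0_integral_sum//; last 2 first.
  - move=> a; apply/measurable_EFinP; apply: measurable_funM; first mea.
    apply: (measurableT_comp (@measurable_sqnorm _ _)).
    apply: (measurableT_comp (measurable_drift a)).
    mea.
  - nonneg.
  apply: le_integral_nonmeas => z.
    nonneg.
  rewrite sumEFin lee_fin; apply: ler_sum => a _; rewrite /sqnorm mulr_sumr; apply: ler_sum => k _.
  have /andP[s0' s4] := speed_bound t01.
  rewrite mxE /= (_ : _ * _ = (weight t a z * speed t) * speed t * V a k (position t z, t) ^+ 2); last by ring.
  rewrite weight_speed (_ : 16 * _ = last_at a (z, t) * 16 * V a k (space_time (z, t)) ^+ 2); last by ring.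
  apply: ler_wpM2r; first exact: sqr_ge0.
  rewrite -mulrA; apply: ler_wpM2l => //.
  by rewrite (_ : 16 = 4 * 4 :> R); [exact: ler_pM|ring].
rewrite (time_space_integral mHs HsB).
apply: (@le_trans _ _ (\int[(pi \x U)%E]_w (Hs w)%:E)%E).
  apply: le_integral_nonmeas => w; rewrite lee_fin; first nonneg.
  by rewrite ler_piMl// /in_time indicE; case: (_ \in _).
have sumI (G : 'I_n -> 'I_d -> T -> R) : (forall a k, mble (G a k)) -> (forall a k w, 0 <= G a k w) ->
    (\int[(pi \x U)%E]_w (\sum_a \sum_k 16 * (last_at a w * G a k w))%:E =
     16%:E * \sum_a \sum_k \int[(pi \x U)%E]_w (last_at a w * G a k w)%:E)%E.
  move=> mG G0; have mlG a k : mble (fun w => last_at a w * G a k w).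
    mea.
  transitivity (\int[(pi \x U)%E]_w (\sum_a \sum_k (16 * (last_at a w * G a k w))%:E))%E.
    by apply: eq_integral => w _; rewrite -sumEFin; apply: eq_bigr => a _; rewrite sumEFin.
  rewrite ge0_integral_sum//.
  - rewrite ge0_sume_distrr; last by move=> a _; apply: sume_ge0 => k _; apply: integral_ge0 => w _; rewrite lee_fin mulr_ge0.
    apply: eq_bigr => a _; rewrite ge0_integral_sum//.
    + rewrite ge0_sume_distrr; last by move=> k _; apply: integral_ge0 => w _; rewrite lee_fin mulr_ge0.
      apply: eq_bigr => k _; under eq_integral do rewrite EFinM.
      rewrite ge0_integralZl_EFin//; first nonneg.
      mea.
    + mea.
    + nonneg.
  - move=> a; under eq_fun do rewrite sumEFin.
    mea.
  - nonneg.
rewrite (sumI (fun a k w => V a k (space_time w) ^+ 2)); last 2 first.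
- mea.
- nonneg.
apply: (@le_trans _ _ (16%:E * \sum_a \sum_k \int[(pi \x U)%E]_w (last_at a w * (y w.1 0%R k - x w.1 0%R k) ^+ 2)%:E)%E).
  by apply: lee_wpmul2l; rewrite//; apply: lee_sum => a _; apply: lee_sum => k _; exact: Vle.
rewrite -(sumI (fun a k w => (y w.1 0%R k - x w.1 0%R k) ^+ 2)); last 2 first.
- mea.
- nonneg.
have msq : mble (fun z => 16 * sqnorm (y z - x z)) by mea.
rewrite (_ : (\int[_]_w _)%E = (\int[(pi \x U)%E]_w (16 * sqnorm (y w.1 - x w.1))%:E)%E).
  rewrite (integral_fst pi U msq); last by move=> z; rewrite mulr_ge0// sqnorm_ge0.
  under eq_integral do rewrite EFinM.
  rewrite ge0_integralZl_EFin//; first nonneg.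
  mea.
apply: eq_integral => -[z t] _; congr EFin; rewrite (bigD1 (i1 z))//= [X in _ + X]big1 ?addr0; last first.
  move=> a /eqP h; rewrite big1// => k _; rewrite /last_at indicE memNset ?mul0r ?mulr0//= => e; exact/h.
rewrite /sqnorm mulr_sumr; apply: eq_bigr => k _.
by rewrite /last_at indicE mem_set// mul1r !mxE.
Qed.

Lemma time_IQ F : nice F -> (\int[leb]_(t in `[0%R, 1%R]) \int[pi]_z (F (z, t))%:E = (IQ F)%:E)%E.
Proof. by move=> nF; have [mF [B FB]] := nF; rewrite (time_space_integral mF FB) IQE. Qed.

Lemma nice_last_at_bound a k : nice (fun w => speed w.2 * V a k (space_time w)).
Proof.
apply: niceM; first exact: nice_speed.
split; last by exists (M + M) => z t _.
mea.
Qed.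

(** * The weak equation along trajectories *)

Section weak_formulation.
Variable eta : 'rV[R]_d * R -> R.
Hypothesis eta_test : @test_function R ('rV[R]_d * R^o)%type (setT `*` `]0, 1[) eta.
Local Notation W := ('rV[R]_d * R^o)%type.

Definition mass_term (a : 'I_n) (w : T) : R := weight w.2 a w.1 * dtime eta (space_time w).
Definition motion_term (a : 'I_n) (k : 'I_d) (w : T) : R :=
  weight w.2 a w.1 * (dspace eta k (space_time w) * (speed w.2 * (y w.1 0 k - x w.1 0 k))).
Definition node_term (a b : 'I_n) (w : T) : R :=
  eta (space_time w) * J (i0 w.1) (i1 w.1) w.2 a b.

Let eta' v w : is_derive w v (eta : W -> R^o) ('D_v (eta : W -> R^o) w).
Proof. by have [[h _ _] _] := test_functionP eta_test. Qed.

Let ceta' v : continuous ('D_v (eta : W -> R^o)).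
Proof. by have [[_ h _] _] := test_functionP eta_test. Qed.

Let ceta : continuous (eta : W -> R).
Proof. by have [[_ _ h] _] := test_functionP eta_test. Qed.

Let nice_eta : nice (fun w => eta (space_time w)).
Proof.
have [_ [[B eB] _ _]] := test_functionP eta_test; apply: nice_along eB.
exact: (continuous_measurable_space_time ceta).
Qed.

Let nice_eta' (v : W) : nice (fun w => 'D_v (eta : W -> R^o) (space_time w)).
Proof.
have [_ [_ /(_ v)[B eB] _]] := test_functionP eta_test; apply: nice_along eB.
exact: (continuous_measurable_space_time (@ceta' v)).
Qed.

Lemma nice_mass a : nice (mass_term a).
Proof. by apply: niceM; [exact: nice_weight|exact: nice_eta']. Qed.

Lemma nice_motion a k : nice (motion_term a k).
Proof.
apply: niceM; first exact: nice_weight.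
apply: niceM; first exact: nice_eta'.
by apply: niceM; [exact: nice_speed|exact: nice_coord_diff].
Qed.

Lemma nice_node a b : nice (node_term a b).
Proof. by apply: niceM; [exact: nice_eta|exact: nice_J]. Qed.

Definition along_term (a : 'I_n) (w : T) : R :=
  mass_term a w + \sum_k motion_term a k w + \sum_b node_term a b w.

Lemma nice_along_term a : nice (along_term a).
Proof.
apply: niceD; last by apply: nice_sum => b; exact: nice_node.
by apply: niceD; [exact: nice_mass|apply: nice_sum => k; exact: nice_motion].
Qed.

(** The trajectory in space-time as a sum of scalar functions times fixed directions, [None] being
    the time direction: this is the form that [is_derive_curve] asks for. *)
Let line_dir (i : option 'I_d) : W := if i is Some k then (delta_mx 0 k, 0) else (0, 1).
Let line_coef (z : Z) (i : option 'I_d) (t : R) : R :=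
  if i is Some k then (y z 0 k - x z 0 k) * moved t else t.
Let line_speed (z : Z) (t : R) (i : option 'I_d) : R :=
  if i is Some k then (y z 0 k - x z 0 k) * speed t else 1.
Let line_ind : seq (option 'I_d) := None :: [seq Some k | k <- enum 'I_d].

Let lineE z t : (position t z, t) = (x z, 0) + \sum_(i <- line_ind) line_coef z i t *: line_dir i :> W.
Proof.
rewrite /line_ind big_cons big_map big_enum/=.
have f1 : {morph (fst : W -> 'rV[R]_d) : u v / u + v} by [].
have f2 : {morph (snd : W -> R^o) : u v / u + v} by [].
apply: injective_projections; rewrite /= ?scaler0 ?add0r.
  rewrite (big_morph _ f1 (erefl _)) /position [y z - x z]row_sum_delta scaler_sumr; congr (_ + _).
  by apply: eq_bigr => k _; rewrite /= scalerA !mxE mulrC.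
rewrite (big_morph _ f2 (erefl _)) big1 ?addr0 ?[t%:A]mulr1// => k _.
by rewrite /= scaler0.
Qed.

Let eta_along z t : is_derive (t : R^o) 1 (fun t => eta (position t z, t))
  (dtime eta (position t z, t) + \sum_k (y z 0 k - x z 0 k) * speed t * dspace eta k (position t z, t)).
Proof.
have h := @is_derive_curve R W eta (option 'I_d) (line_coef z) (line_speed z t) line_dir
  (fun i => 'D_(line_dir i) (eta : W -> R^o)) t (fun i w => eta' (line_dir i) w)
  (fun i => @ceta' (line_dir i)).
have {}h := h _ line_ind (x z, 0).
rewrite (_ : (fun t => eta _) = (fun s => eta ((x z, 0) + \sum_(i <- line_ind) line_coef z i s *: line_dir i))); last first.
  by apply/funext => r; rewrite -lineE.
apply: is_derive_eq (h _) _.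
  move=> [k|]; rewrite /line_coef /line_speed; last exact: is_derive_id.
  exact: (is_deriveZ _ (is_derive_moved t)).
by rewrite -lineE /line_ind big_cons big_map big_enum/= mul1r.
Qed.

Lemma is_derive_along a z t : is_derive (t : R^o) 1 (fun t => weight t a z * eta (position t z, t))
  (along_term a (z, t)).
Proof.
apply: is_derive_eq (is_deriveM (fs_derive fs (i0 z) (i1 z) a t) (eta_along z t)) _.
rewrite /along_term /mass_term /motion_term /node_term /space_time/=.
rewrite /GRing.scale/= mulrDr mulr_sumr -/(weight t a z); congr (_ + _ + _).
  by apply: eq_bigr => k _; ring.
by rewrite mulr_sumr.
Qed.

Lemma along_continuous a z : continuous (fun t : R => along_term a (z, t)).
Proof.
have cpos : continuous (fun t : R => (position t z, t) : W).
  move=> t; have c1 : {for t, continuous (fun t => position t z)}.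
    apply: cvgD; first exact: cvg_cst.
    by apply: cvgZl; exact: moved_continuous.
  have c2 : {for t, continuous (fun t : R => t : R^o)} by [].
  exact: (cvg_pair c1 c2).
have ce v t : {for t, continuous (fun t => 'D_v (eta : W -> R^o) (position t z, t))}.
  by apply: (@continuous_comp _ W _ (fun t : R => (position t z, t) : W) ('D_v (eta : W -> R^o))); [exact: cpos|exact: ceta'].
have cw t b : {for t, continuous (fun t => weight t b z)} by exact: P_continuous.
have cs t : {for t, continuous speed}.
  apply: cvgM; first exact: cvg_cst.
  have ca : {for t, continuous (fun t : R => 2 * t + - 1)}.
    by apply: cvgD; [apply: cvgM; [exact: cvg_cst|exact: cvg_id]|exact: cvg_cst].
  exact: (cvg_comp _ _ ca (@ramp_continuous R _)).
move=> t; apply: cvgD; [apply: cvgD|].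
- by apply: cvgM; [exact: cw|exact: ce].
- apply: cvg_sum_seq => k; apply: cvgM; first exact: cw.
  apply: cvgM; first exact: ce.
  exact: (cvgM (cs t) (cvg_cst (y z 0 k - x z 0 k))).
- apply: cvg_sum_seq => b; apply: cvgM; last exact: (fs_continuous fs).
  by apply: (@continuous_comp _ W _ (fun t : R => (position t z, t) : W) (eta : W -> R)); [exact: cpos|exact: ceta].
Qed.

(** On each trajectory the time integral of [along_term] is a difference of boundary values, where
    the test function vanishes; averaging over z gives the weak equation before the displacement is
    replaced by its conditional mean. *)
Lemma IQ_along a : IQ (mass_term a) + \sum_k IQ (motion_term a k) + \sum_b IQ (node_term a b) = 0.
Proof.
have nm := nice_mass a.
have nms : nice (fun w => \sum_k motion_term a k w) by apply: nice_sum => k; exact: nice_motion.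
have nns : nice (fun w => \sum_b node_term a b w) by apply: nice_sum => b; exact: nice_node.
rewrite -IQ_sum; last by move=> k; exact: nice_motion.
rewrite -IQ_sum; last by move=> b; exact: nice_node.
rewrite -IQD// -IQD//; last exact: niceD.
have nA := nice_along_term a; have [mA [B AB]] := nA.
apply: EFin_inj; rewrite -(IQE nA) -(space_time_integral mA AB) integral0_eq// => z _.
rewrite (@FTC_is_derive _ (fun t => weight t a z * eta (position t z, t)) _ _ _ (@ltr01 R) (is_derive_along a z)); last first.
  by apply: continuous_subspaceT; exact: along_continuous.
have [_ [_ _ e0]] := test_functionP eta_test.
by rewrite !e0 ?mulr0 ?subee//=; [left|right].
Qed.

Lemma weak_formulation a :
  (\int[leb]_(t in `[0%R, 1%R]) \int[curve t a]_v (dtime eta (v, t))%:E =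
    - (\int[leb]_(t in `[0%R, 1%R]) \int[curve t a]_v
        (\sum_(k < d) dspace eta k (v, t) * drift a (v, t) 0%R k)%:E)
    - (2^-1)%:E * \sum_(b < n)
        \int[leb]_(t in `[0%R, 1%R]) \int[total_measure (curve t)]_v
          (eta (v, t) * theta_density theta (curve t) a b v
            * (rate a b (v, t) - rate b a (v, t)) * q a b)%:E)%E.
Proof.
have mslice (f : W -> R) t : continuous f -> mble (fun v => f (v, t)).
  move=> cf; have mf := continuous_measurable_space_time cf.
  mea.
have [_ [[Be eB] eB' _]] := test_functionP eta_test.
have E1 : (\int[leb]_(t in `[0%R, 1%R]) \int[curve t a]_v (dtime eta (v, t))%:E = (IQ (mass_term a))%:E)%E.
  rewrite -(time_IQ (nice_mass a)); apply: eq_integral => t /set_mem; rewrite /= in_itv/= => t01.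
  by rewrite (curve_integral a t01 (mslice _ t (@ceta' (0, 1)))).
have E2 : (\int[leb]_(t in `[0%R, 1%R]) \int[curve t a]_v
        (\sum_(k < d) dspace eta k (v, t) * drift a (v, t) 0%R k)%:E = (\sum_k IQ (motion_term a k))%:E)%E.
  have nD k : nice (fun w => weight w.2 a w.1 * (dspace eta k (space_time w) * (speed w.2 * V a k (space_time w)))).
    apply: niceM; first exact: nice_weight.
    by apply: niceM; [exact: nice_eta'|exact: nice_last_at_bound].
  rewrite (_ : \sum_k _ = IQ (fun w => \sum_k weight w.2 a w.1 * (dspace eta k (space_time w) * (speed w.2 * V a k (space_time w))))); last first.
    rewrite IQ_sum//; apply: eq_bigr => k _; have [B hB] := eB' (delta_mx 0 k, 0).
    by rewrite (IQ_drift a k (continuous_measurable_space_time (@ceta' (delta_mx 0 k, 0))) hB).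
  rewrite -time_IQ; last by apply: nice_sum.
  apply: eq_integral => t /set_mem; rewrite /= in_itv/= => t01.
  rewrite curve_integral//; last first.
    apply: measurable_sum => k; apply: measurable_funM; first exact: (mslice _ t (@ceta' (delta_mx 0 k, 0))).
    apply: (measurableT_comp (measurable_coord _ _)).
    by apply: (measurableT_comp (measurable_drift a)); apply: measurable_fun_pair => //; mea.
  apply: eq_integral => z _; congr EFin; rewrite mulr_sumr; apply: eq_bigr => k _.
  by rewrite mxE.
have E3 b : (\int[leb]_(t in `[0%R, 1%R]) \int[total_measure (curve t)]_v
          (eta (v, t) * theta_density theta (curve t) a b v
            * (rate a b (v, t) - rate b a (v, t)) * q a b)%:E = (2 * IQ (node_term a b))%:E)%E.
  rewrite -IQZ; last exact: nice_node.
  rewrite -time_IQ; last by apply: niceM; [exact: nice_cst|exact: nice_node].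
  apply: eq_integral => t /set_mem; rewrite /= in_itv/= => t01.
  by rewrite (node_integral a b t01 (mslice _ t ceta) (fun v => eB (v, t))).
rewrite E1 E2 (eq_bigr _ (fun b _ => E3 b)) sumEFin -EFinM -!EFinN -EFinD; congr EFin.
have := IQ_along a; rewrite -mulr_sumr mulKf//.
by move: (IQ _) (\sum_k _) (\sum_b _) => A1 A2 A3 h; lra.
Qed.

End weak_formulation.

Lemma curve_ce : continuity_equation Omega q theta 0 1 curve drift rate.
Proof.
split.
- by move=> t _; exact: curve_prob.
- exact: curve_continuous.
- by move=> a; apply: measurable_funTS; exact: measurable_drift.
- exact: drift_integrable.
- exact: measurable_rate.
- move=> a b; apply: (@le_lt_trans _ _ (\int[leb]_(t in `[0%R, 1%R]) (flux_bound * (q a b)^-1)%:E)%E).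
    apply: le_integral_nonmeas_in => t; rewrite /= in_itv/= => t01; last exact: rate_integral.
    nonneg.
  by rewrite integral_cst01 ltry.
- by move=> eta a ht; exact: weak_formulation.
Qed.

Lemma curve_energy : (\int[leb]_(t in `[0%R, 1%R])
    tangent_sqnorm Omega q theta (curve t) (fun i x => drift i (x, t)) (fun i j x => rate i j (x, t)) <=
  16%:E * displacement + (2^-1 * \sum_a \sum_b C * (q a b)^-1)%:E * \int[pi]_z (switch z)%:E)%E.
Proof.
pose K := 2^-1 * \sum_a \sum_b C * (q a b)^-1.
have K0 : 0 <= K.
  by rewrite mulr_ge0//; apply: sumr_ge0 => a _; apply: sumr_ge0 => b _; rewrite mulr_ge0 ?invr_ge0.
have Sw0 : (0 <= \int[pi]_z (switch z)%:E)%E by nonneg.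
have [S SE] : exists S, (\int[pi]_z (switch z)%:E = S%:E)%E.
  exists (fine (\int[pi]_z (switch z)%:E)%E); rewrite fineK// integrable_fin_num//.
  apply: (@finite_bounded_integrable _ _ _ _ _ 1); first mea.
  by move=> z; rewrite ger0_norm// /switch; case: (_ != _).
have msq a t : mble (fun v => sqnorm (drift a (v, t))).
  apply: (measurableT_comp (@measurable_sqnorm _ _)); apply: (measurableT_comp (measurable_drift a)).
  mea.
pose D (t : R) := (\sum_a \int[pi]_z (weight t a z * sqnorm (drift a (position t z, t)))%:E)%E.
have S0 : 0 <= S by rewrite -lee_fin -SE.
apply: (@le_trans _ _ (\int[leb]_(t in `[0%R, 1%R]) (D t + (K * S)%:E))%E).
  apply: le_integral_nonmeas_in => t; rewrite /= in_itv/= => t01.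
    apply: adde_ge0; first by apply: sume_ge0 => a _; apply: integral_ge0 => v _; rewrite lee_fin sqnorm_ge0.
    apply: mule_ge0; first nonneg.
    apply: sume_ge0 => a _; apply: sume_ge0 => b _; apply: integral_ge0 => v _.
    nonneg.
  apply: leeD.
    apply: lee_sum => a _; rewrite -(curve_integral a t01 (msq a t)) integral_mkcond.
    by apply: le_integral_nonmeas => v; rewrite patchE; case: ifP => // _; rewrite lee_fin sqnorm_ge0.
  rewrite /K -mulrA EFinM mulr_suml -sumEFin; apply: lee_wpmul2l; first nonneg.
  apply: lee_sum => a _; rewrite mulr_suml -sumEFin; apply: lee_sum => b _.
  by rewrite EFinM -SE; exact: rate_energy.
have [Dp DpE] : exists Dp, displacement = Dp%:E.
  exists (fine displacement); rewrite fineK// integrable_fin_num//.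
  apply: (@finite_bounded_integrable _ _ _ _ _ (\sum_(k < d) (M + M) ^+ 2)).
    mea.
  move=> z; rewrite ger0_norm ?sqnorm_ge0//; apply: ler_sum => k _.
  rewrite -[leLHS]real_normK ?num_real// ler_pXn2r// ?nnegrE ?addr_ge0// !mxE.
  by apply: le_trans (ler_normB _ _) _; exact: lerD.
have hE := drift_energy; rewrite DpE -EFinM in hE.
rewrite DpE SE -!EFinM -EFinD [leRHS](_ : _ = (K * S + 1 * (16 * Dp))%:E); last by rewrite mul1r addrC.
(* [integral_nonmeas_affine01] wants a function that is nonnegative at all times, while the weights
   are controlled for t >= 0 only; hence the absolute value. *)
have D0 (t : R) : (0 <= D `|t|%R)%E.
  by apply: sume_ge0 => a _; apply: integral_ge0 => z _; rewrite lee_fin mulr_ge0 ?weight_ge0 ?sqnorm_ge0.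
have DE (t : R) : `[0, 1]%classic t -> D `|t|%R = D t.
  by rewrite /= in_itv/= => /andP[t0 _]; rewrite ger0_norm.
have hE' : (\int[leb]_(t in `[0%R, 1%R]) D `|t|%R <= (16 * Dp)%:E)%E.
  apply: le_trans hE; rewrite le_eqVlt; apply/orP; left; apply/eqP; apply: eq_integral => t /set_mem h.
  exact: DE.
have h := integral_nonmeas_affine01 (mulr_ge0 K0 S0) (@ltr01 R) D0 hE'.
apply: le_trans h; rewrite le_eqVlt; apply/orP; left; apply/eqP; apply: eq_integral => t /set_mem ht.
by rewrite -(DE _ ht) mul1e addeC.
Qed.

Lemma dynamic_costs_le (mu nu : vmeasure R d n) :
  vmeasure_eq (curve 0) mu -> vmeasure_eq (curve 1) nu ->
  (ereal_inf (dynamic_costs Omega q theta mu nu) <=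
   16%:E * displacement + (2^-1 * \sum_a \sum_b C * (q a b)^-1)%:E * \int[pi]_z (switch z)%:E)%E.
Proof.
move=> c0 c1; apply: le_trans curve_energy.
apply: ereal_inf_lbound; exists curve, drift, rate; split=> //.
exact: curve_ce.
Qed.

End densities.

Lemma curve_at0 a A : measurable A -> curve 0 a A = pi ([set z | i0 z = a] `&` x @^-1` A).
Proof.
move=> mA; have t01 : 0 <= (0 : R) <= 1 by rewrite lexx ler01.
have mI : mble (\1_A : 'rV[R]_d -> R) by mea.
rewrite -[in LHS](setIT A) -integral_indic// (curve_integral a t01 mI).
rewrite -[in RHS](setIT (_ `&` _)) -integral_indic//; last mea.
apply: eq_integral => z _; congr EFin; rewrite /weight (fs_start fs) position_start//.
rewrite !indicE in_setI; case: (boolP (z \in [set z | i0 z = a])) => [/set_mem/= ->|h].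
  by rewrite eqxx mul1r.
by case: eqVneq => [e|_]; [case/negP: h; exact/mem_set|rewrite mul0r].
Qed.

Lemma curve_at1 a A : measurable A -> curve 1 a A = pi ([set z | i1 z = a] `&` y @^-1` A).
Proof.
move=> mA; have t01 : 0 <= (1 : R) <= 1 by rewrite lexx ler01.
have mI : mble (\1_A : 'rV[R]_d -> R) by mea.
rewrite -[in LHS](setIT A) -integral_indic// (curve_integral a t01 mI).
rewrite -[in RHS](setIT (_ `&` _)) -integral_indic//; last mea.
apply: eq_integral => z _; congr EFin; rewrite weight_end ?invf_le1 ?ler1n//.
rewrite /position moved_end scale1r subrKC.
rewrite !indicE in_setI; case: (boolP (z \in [set z | i1 z = a])) => [/set_mem/= ->|h].
  by rewrite eqxx mul1r.
by case: eqVneq => [e|_]; [case/negP: h; exact/mem_set|rewrite mul0r].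
Qed.

Theorem interpolation_energy (mu nu : vmeasure R d n) :
  (forall a A, measurable A -> pi ([set z | i0 z = a] `&` x @^-1` A) = mu a A) ->
  (forall a A, measurable A -> pi ([set z | i1 z = a] `&` y @^-1` A) = nu a A) ->
  (ereal_inf (dynamic_costs Omega q theta mu nu) <=
   16%:E * displacement + (2^-1 * \sum_a \sum_b C * (q a b)^-1)%:E * \int[pi]_z (switch z)%:E)%E.
Proof.
move=> hmu hnu.
have [m [s [mE ms s01 sI]]] := pair_densities.
have [U U_int] := @unit_interval_probability R.
have [V [mV VM VE Vle]] := drift_exists U.
apply: (dynamic_costs_le mE ms s01 sI U_int mV VM VE Vle) => a A mA.
  by rewrite curve_at0// hmu.
by rewrite curve_at1// hnu.
Qed.

End interpolating_curve.

(** * Curves from couplings of canonical liftings *)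

Section dynamic_upper_bound.
Context (R : realType) (d n : nat) (q : 'M[R]_n.+1) (theta : R -> R -> R).
Hypotheses (q_ge0 : forall i j, 0 <= q i j) (q_symmetric : symmetric_graph q) (q_connected : connected_graph q) (theta_interp : interpolation_function theta).
Local Notation L := (lifted R d n).
Variables (Omega : set 'rV[R]_d) (M : R).
Hypotheses (Omega_convex : convex_set Omega) (Omega_compact : compact Omega).
Hypotheses (M0 : 0 <= M) (OM : forall x, Omega x -> forall k, `|x 0 k| <= M).

Let mO : measurable Omega.
Proof. by apply: closed_measurable_mx; exact: compact_closed. Qed.

Let sup : set L := [set z | at_vertex z /\ Omega z.1].

Let msup : measurable sup.
Proof. by apply: measurableI; [exact: measurable_at_vertex|exact: measurable_in_fst]. Qed.

Let measurable_place : mble (fun z : L => (nearest M z).1).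
Proof.
apply: (measurable_fun_mx measurableT) => a i; rewrite ord1.
rewrite (_ : (fun z => _) = (fun z : L => clip M (z.1 0 i))); last by apply/funext => z; rewrite mxE.
apply: (measurableT_comp (measurable_clip M)); apply: (measurableT_comp (measurable_coord _ _)).
mea.
Qed.

Lemma canonical_node_place (mu : vmeasure R d n.+1) a A : vprob Omega mu -> measurable A ->
  canonical_lifting mu [set z | node_of z = a /\ A (nearest M z).1] = mu a A.
Proof.
move=> [muO _] mA.
have mB : measurable ((fun z : L => (nearest M z).1) @^-1` A) by mea.
rewrite canonical_liftingE; last by apply: measurableI => //; exact: measurable_node_of.
rewrite (bigD1 a)//= big1 ?adde0; last first.
  move=> j /eqP ja; rewrite (_ : [set _ | _] = set0)// -subset0 => v [h _].
  by apply: ja; rewrite -h (@node_of_vertex _ _ _ (v, vertex R j) j).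
set B := [set v | _].
have clipO v : Omega v -> \row_i clip M (v 0 i) = v.
  by move=> Ov; apply/rowP => i; rewrite mxE clip_id//; exact: OM.
have BE : B `&` Omega = A `&` Omega.
  apply/seteqP; split=> v [].
    by move=> [_ Av] Ov; split=> //; move: Av; rewrite /= clipO.
  move=> Av Ov; split=> //; split; first exact: node_of_vertex.
  by rewrite /= clipO.
have mBv : measurable B.
  rewrite (_ : B = (fun v : 'rV[R]_d => (v, vertex R a) : L) @^-1` [set z | node_of z = a /\ A (nearest M z).1])//.
  rewrite -[X in measurable X]setTI; apply: (@measurable_pair_vertex R d n a) => //.
  by apply: measurableI => //; exact: measurable_node_of.
have inO X : measurable X -> mu a X = mu a (X `&` Omega).
  move=> mX; rewrite -(setUIDK X Omega) measureU ?setUIDK//; first last.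
  - by rewrite -subset0 => v [[_ ?] []].
  - exact: measurableD.
  - mea.
  rewrite [X in (_ + X)%E](_ : _ = 0%E) ?adde0//; apply/eqP; rewrite -measure_le0 -(muO a).
  by apply: le_measure; rewrite ?inE; [exact: measurableD|mea|move=> v []].
by rewrite inO// BE -inO.
Qed.

(** A coupling is carried by pairs of vertices over Omega. There both |x - y|^2 and c times the
    indicator of a change of node are at most the ground cost, so the energy bound 16 |x - y|^2 + Q
    times that indicator gives the constant 16 + Q / c. *)
Lemma dynamic_le_transport : exists2 K : R, 0 < K &
  forall (mu nu : vmeasure R d n.+1), vprob Omega mu -> vprob Omega nu ->
  (ereal_inf (dynamic_costs Omega q theta mu nu) <=
   K%:E * ereal_inf (coupling_costs q theta (canonical_lifting mu) (canonical_lifting nu)))%E.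
Proof.
have [C [P [J [C0 fs]]]] := flow_systemP q_connected q_symmetric.
have [c c0 hc] := ground_vertex_lower d q_ge0 q_symmetric theta_interp.
pose Q := 2^-1 * \sum_a \sum_b C * (q a b)^-1.
have Q0 : 0 <= Q.
  by rewrite mulr_ge0//; apply: sumr_ge0 => a _; apply: sumr_ge0 => b _; rewrite mulr_ge0 ?invr_ge0.
exists (16 + Q * c^-1); first by rewrite ltr_pwDl// mulr_ge0// invr_ge0 ltW.
move=> mu nu muO nuO; have K0 : 0 < 16 + Q * c^-1 by rewrite ltr_pwDl// mulr_ge0// invr_ge0 ltW.
rewrite -lee_pdivrMl//; apply: le_ereal_inf_tmp => _ [G cG <-]; rewrite lee_pdivrMl//.
pose good := (fst @^-1` sup) `&` (snd @^-1` sup) : set (L * L).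
have mf : measurable (fst @^-1` sup : set (L * L)) by rewrite -[X in measurable X]setTI; mea.
have ms : measurable (snd @^-1` sup : set (L * L)) by rewrite -[X in measurable X]setTI; mea.
have mgood : measurable good by exact: measurableI.
have good1 : (G (~` good) = 0)%E.
  apply: measure_setCI_null => //.
    by apply: (coupling_fst_null msup cG); exact: canonical_support.
  by apply: (coupling_snd_null msup cG); exact: canonical_support.
pose x (z : L * L) := (nearest M z.1).1; pose y (z : L * L) := (nearest M z.2).1.
pose i0 (z : L * L) := node_of z.1; pose i1 (z : L * L) := node_of z.2.
have mx : mble x by apply: (measurableT_comp measurable_place); mea.
have my : mble y by apply: (measurableT_comp measurable_place); mea.
have mi0 a : measurable [set z | i0 z = a].
  rewrite (_ : [set _ | _] = fst @^-1` [set z : L | node_of z = a])//.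
  by rewrite -[X in measurable X]setTI; apply: measurable_fst => //; exact: measurable_node_of.
have mi1 a : measurable [set z | i1 z = a].
  rewrite (_ : [set _ | _] = snd @^-1` [set z : L | node_of z = a])//.
  by rewrite -[X in measurable X]setTI; apply: measurable_snd => //; exact: measurable_node_of.
have place_bound (z : L) k : `|(nearest M z).1 0 k| <= M by rewrite mxE; exact: clip_bound.
have near1 (z : L) : sup z -> nearest M z = z by move=> [vz Oz]; apply: nearest_id => //; exact: OM.
have mset a A : measurable A -> measurable [set z : L | node_of z = a /\ A (nearest M z).1].
  move=> mA; apply: measurableI; first exact: measurable_node_of.
  exact: mble_preimage.
have ground0 (z : L * L) : (0 <= ground_sqdist q theta z.1 z.2)%E by nonneg.
have below (f : L * L -> R) : mble f -> (forall z, 0 <= f z) ->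
    (forall z, good z -> ((f z)%:E <= ground_sqdist q theta z.1 z.2)%E) ->
    (\int[G]_z (f z)%:E <= transport_cost q theta G)%E.
  move=> mf' f0 fg; have mI : mble (fun z => (f z * \1_good z)%:E).
    mea.
  apply: (@le_trans _ _ (\int[G]_z (f z * \1_good z)%:E)%E).
    apply: (integral_nonmeas_ae_le mgood good1) => //.
    - nonneg.
    - by move=> z gz; rewrite indicE mem_set// mulr1.
  apply: le_integral_nonmeas => z; first nonneg.
  rewrite indicE; case: (boolP (z \in good)) => [/set_mem gz|_]; first by rewrite mulr1 fg.
  by rewrite mulr0.
have [c1 c2] := cG.
have h := interpolation_energy q_ge0 q_symmetric theta_interp C0 fs (pi := G) mx my mi0 mi1 M0
  (fun z k => place_bound z.1 k) (fun z k => place_bound z.2 k) Omega_convex Omega_compact mgood good1.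
have xO z : good z -> Omega (x z) by move=> [z1 _]; rewrite /x near1//; case: z1.
have yO z : good z -> Omega (y z) by move=> [_ z2]; rewrite /y near1//; case: z2.
apply: le_trans (h xO yO mu nu _ _) _.
- move=> a A mA; rewrite -(canonical_node_place a muO mA) -c1//; exact: mset.
- move=> a A mA; rewrite -(canonical_node_place a nuO mA) -c2//; exact: mset.
have hd : (displacement G x y <= transport_cost q theta G)%E.
  apply: below.
  - mea.
  - nonneg.
  - move=> z [z1 z2]; rewrite /x /y !near1// /ground_sqdist.
    rewrite (_ : sqnorm _ = sqnorm (z.1.1 - z.2.1)); last first.
      by apply: eq_bigr => k _; rewrite !mxE -sqrrN opprB.
    by rewrite leeDl// W_graph_sq_ge0.
have hs : (c%:E * \int[G]_z (switch R i0 i1 z)%:E <= transport_cost q theta G)%E.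
  have msw : mble (switch R i0 i1).
    exact: (measurable_switch mi0 mi1).
  rewrite -ge0_integralZl_EFin//; last 3 first.
  - nonneg.
  - mea.
  - exact: ltW.
  under eq_integral do rewrite -EFinM.
  apply: below; first mea.
    nonneg.
  move=> z [[[i zi] _] [[j zj] _]]; rewrite /switch /i0 /i1 (node_of_vertex zi) (node_of_vertex zj).
  by case: eqVneq => [_|ij]; rewrite ?mulr0// mulr1; exact: hc zi zj ij.
have c1' : (0 <= (Q * c^-1)%:E)%E by nonneg.
have h16 : (0 <= (16 : R)%:E)%E by [].
rewrite (EFinD 16 (Q * c^-1)) (ge0_muleDl _ h16 c1'); apply: leeD.
  exact: lee_wpmul2l.
rewrite (EFinM Q c^-1) -muleA; apply: lee_wpmul2l; first nonneg.
by rewrite lee_pdivlMl.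
Qed.

End dynamic_upper_bound.

(** * Equivalence of the four convergences *)

Lemma vprob2_setT (R : realType) (d n : nat) (Omega : set 'rV[R]_d) (mu : vmeasure R d n) :
  measurable Omega -> vprob2 Omega mu -> vprob2 setT mu.
Proof.
move=> mO [[mu0 mu1] mu2]; split.
  by split=> // i; rewrite setCT measure0.
move=> i; apply: le_lt_trans (mu2 i).
rewrite [leRHS]integral_mkcond; apply: (integral_nonmeas_ae_le mO (mu0 i)).
- nonneg.
- by move=> x; rewrite patchE; case: ifP => // _; rewrite lee_fin sqnorm_ge0.
- apply/(measurable_restrictT _ mO)/measurable_funTS; apply/measurable_EFinP.
  mea.
- by move=> x Ox; rewrite patchE mem_set.
Qed.

Theorem proposition1p8 (R : realType) (d n : nat)
  (Omega : set 'rV[R]_d) (q : 'M[R]_n.+1) (theta : R -> R -> R)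
  (lambda_ref : probability (lifted R d n) R)
  (T : vmeasure R d n.+1 -> lifted R d n -> lifted R d n)
  (Omega_convex : convex_set Omega) (Omega_compact : compact Omega)
  (q_ge0 : forall i j, 0 <= q i j)
  (q_connected : connected_graph q) (q_symmetric : symmetric_graph q)
  (theta_interp : interpolation_function theta)
  (ref_moment : finite_second_moment lambda_ref)
  (T_optimal : unique_optimal_maps q theta lambda_ref T)
  (mu_ : nat -> vmeasure R d n.+1) (mu : vmeasure R d n.+1)
  (mu_P2 : forall k, vprob2 Omega (mu_ k)) (mu_P2_lim : vprob2 Omega mu) :
  [/\ (d_LOT lambda_ref T (mu_ k) mu @[k --> \oo] --> 0%E <->
       W2W q theta (mu_ k) mu @[k --> \oo] --> 0%E),
      (d_LOT lambda_ref T (mu_ k) mu @[k --> \oo] --> 0%E <->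
       W_dynamic Omega q theta (mu_ k) mu @[k --> \oo] --> 0%E) &
      (d_LOT lambda_ref T (mu_ k) mu @[k --> \oo] --> 0%E <->
       D_static q theta (mu_ k) mu @[k --> \oo] --> 0%E)].
Proof.
have mO : measurable Omega by apply: closed_measurable_mx; exact: compact_closed.
have [M M0 OM] : exists2 M : R, 0 <= M & forall x, Omega x -> forall k, `|x 0 k| <= M.
  have [B [_ hB]] := compact_bounded Omega_compact.
  exists (Num.max 0 (B + 1)); first by rewrite le_max lexx.
  move=> x Ox k; rewrite le_max; apply/orP; right.
  apply: le_trans (hB (B + 1) _ x Ox); last by rewrite ltrDl.
  rewrite [leRHS](mx_normrE x).
  exact: (le_bigmax 0 (fun ij => `|x ij.1 ij.2|) (0, k)).
have muO : vprob Omega mu by case: mu_P2_lim.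
have mukO k : vprob Omega (mu_ k) by case: (mu_P2 k).
have mu2 : vprob2 setT mu by exact: vprob2_setT mu_P2_lim.
have muk2 k : vprob2 setT (mu_ k) by exact: vprob2_setT (mu_P2 k).
have LOT_ge0 k : (0 <= \int[lambda_ref]_z (lifted_sqdist (T (mu_ k) z) (T mu z))%:E)%E.
  by apply: integral_ge0 => z _; rewrite lee_fin addr_ge0 ?sqnorm_ge0.
have W2W_ge0 k : (0 <= ereal_inf (coupling_costs q theta (canonical_lifting (mu_ k)) (canonical_lifting mu)))%E.
  exact: coupling_costs_ge0.
have dyn_ge0 k : (0 <= ereal_inf (dynamic_costs Omega q theta (mu_ k) mu))%E.
  by apply: le_ereal_inf_tmp => w; exact: dynamic_costs_ge0.
have scale (K : R) (a b : nat -> \bar R) : 0 <= K -> (forall k, (a k <= K%:E * b k)%E) ->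
    (forall e, 0 < e -> \forall k \near \oo, (b k <= e%:E)%E) ->
    forall e, 0 < e -> \forall k \near \oo, (a k <= e%:E)%E.
  move=> K0 ab hb e e0; have K1 : 0 < K + 1 by rewrite ltr_wpDl.
  have eK : 0 < e / (K + 1) by rewrite divr_gt0.
  apply: filterS (hb _ eK) => k bk; apply: le_trans (ab k) _.
  apply: (@le_trans _ _ (K%:E * (e / (K + 1))%:E)%E); first by apply: lee_wpmul2l; rewrite ?lee_fin.
  by rewrite -EFinM lee_fin mulrA ler_pdivrMr// mulrC ler_pM2l// lerDl.
have [C C0 hC] := W2W_le_LOT q_ge0 q_symmetric q_connected theta_interp mO T_optimal.
have [K K0 hK] := dynamic_le_transport q_ge0 q_symmetric q_connected theta_interp
  Omega_convex Omega_compact M0 OM.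
pose LOT0 := d_LOT lambda_ref T (mu_ k) mu @[k --> \oo] --> 0%E.
pose W0 := W2W q theta (mu_ k) mu @[k --> \oo] --> 0%E.
pose dyn0 := W_dynamic Omega q theta (mu_ k) mu @[k --> \oo] --> 0%E.
pose D0 := D_static q theta (mu_ k) mu @[k --> \oo] --> 0%E.
(* The implications below form two cycles through [hat_converge]: one passes from [W2W] to
   [D_static], the other from [W2W] to the dynamic distance. *)
have LOT_W : LOT0 -> W0.
  move=> /(sqrte_cvg0P LOT_ge0) h; apply/(sqrte_cvg0P W2W_ge0).
  by apply: scale C0 _ h => k; exact: hC.
have W_D : W0 -> D0.
  move=> h; apply/cvg0P => [k|e e0]; first exact: D_static_ge0.
  have /cvg0P h' := h; apply: filterS (h' (fun k => sqrte_ge0 _) e e0) => k.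
  by apply: le_trans; exact: D_static_le_W2W (mukO k) muO.
have D_hat : D0 -> hat_converge mu_ mu.
  exact: D_static_hat_converge.
have hat_LOT : hat_converge mu_ mu -> LOT0.
  move=> h; apply/(sqrte_cvg0P LOT_ge0) => e e0.
  exact: (LOT_cvg0 q_ge0 q_symmetric q_connected theta_interp mO M0 OM ref_moment T_optimal mu2 muk2 muO mukO h).
have W_dyn : W0 -> dyn0.
  move=> /(sqrte_cvg0P W2W_ge0) h; apply/(sqrte_cvg0P dyn_ge0).
  by apply: scale (ltW K0) _ h => k; exact: hK.
have dyn_hat : dyn0 -> hat_converge mu_ mu.
  move=> /(sqrte_cvg0P dyn_ge0); exact: dynamic_hat_converge.
split; split; [exact: LOT_W|by move=> /W_D/D_hat/hat_LOT|by move=> /LOT_W/W_dyn|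
  by move=> /dyn_hat/hat_LOT|by move=> /LOT_W/W_D|by move=> /D_hat/hat_LOT].
Qed.
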